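(* Let $K$ be a post-critically finite fractal such that $(K,\mathcal E_K,\mu,V_0)$ is symmetric, with approximating weighted graphs $(G_m,\mu_m,\gamma_m)$. Let $\Lambda\in(0,1)$, $\ell_{0,0}>0$, let $M_m$ be the metric graph with underlying graph $G_m$ and edge lengths $\ell_{m,e}=\frac{\ell_{0,0}}{\gamma_{0,e_0}}\Lambda^m$ (where $e=F_w(e_0)$, $w\in W_m$, $e_0\in E_0$), and let $\widetilde{\mathcal E}_m=\tau_m\mathcal E_{M_m}$ with $$\tau_m=\frac{\ell_{0,0}^2\,C_0N_0}{2}\Bigl(\frac{N\Lambda^2}{r}\Bigr)^m$$ be the rescaled metric graph energy form. Then there are $\hat\delta_m\ge0$ with $\hat\delta_m\to0$ as $m\to\infty$ such that $\widetilde{\mathcal E}_m$ and the fractal energy form $\mathcal E_K$ are $\hat\delta_m$-quasi-unitarily equivalent for every $m$.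
   Context: **Quasi-unitary equivalence.** An energy form in a Hilbert space $\mathcal H$ is a non-negative, densely defined, closed quadratic form $\mathcal E$; its domain $\mathcal H^1=\operatorname{dom}\mathcal E$ carries the norm $\|f\|_1^2=\|f\|^2+\mathcal E(f)$. For $\delta\ge0$, energy forms $\mathcal E$ in $\mathcal H$ and $\widetilde{\mathcal E}$ in $\widetilde{\mathcal H}$ are $\delta$-quasi-unitarily equivalent if there are bounded linear operators $J\colon\mathcal H\to\widetilde{\mathcal H}$, $J'\colon\widetilde{\mathcal H}\to\mathcal H$, $J^1\colon\mathcal H^1\to\widetilde{\mathcal H}^1$, $J'^1\colon\widetilde{\mathcal H}^1\to\mathcal H^1$ such that $\|Jf\|\le(1+\delta)\|f\|$, $|\langle Jf,u\rangle-\langle f,J'u\rangle|\le\delta\|f\|\|u\|$ for all $f\in\mathcal H$, $u\in\widetilde{\mathcal H}$, and for all $f\in\mathcal H^1$, $u\in\widetilde{\mathcal H}^1$: $\|f-J'Jf\|\le\delta\|f\|_1$, $\|u-JJ'u\|\le\delta\|u\|_1$, $\|J^1f-Jf\|\le\delta\|f\|_1$, $\|J'^1u-J'u\|\le\delta\|u\|_1$, $|\widetilde{\mathcal E}(J^1f,u)-\mathcal E(f,J'^1u)|\le\delta\|f\|_1\|u\|_1$. **Symmetric p.c.f. fractal.** $K\subset\mathbb R^d$ is compact, non-empty, $K=\bigcup_{j=1}^NF_j(K)$, $N\ge2$, where each $F_j\colon\mathbb R^d\to\mathbb R^d$ satisfies $|F_j(x)-F_j(y)|=\theta|x-y|$ with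 a common $\theta\in(0,1)$. $V_0$ is a non-empty subset of the set of fixed points of the $F_j$ (the boundary), $N_0=|V_0|$, and $F_j(K)\cap F_{j'}(K)\subset F_j(V_0)\cap F_{j'}(V_0)$ for $j\ne j'$ (post-critically finite). $W_m=\{1,\dots,N\}^m$, $F_w=F_{w_1}\circ\dots\circ F_{w_m}$. $G_0=(V_0,E_0)$ is the complete graph on $V_0$; $G_{m+1}=(V_{m+1},E_{m+1})$ with $V_{m+1}=\bigcup_jF_j(V_m)$ and edges $\{F_j(x'),F_j(y')\}$ for $\{x',y'\}\in E_m$; these graphs are simple and $V_m\subset V_{m+1}$. Edge weights: $\gamma_0\colon E_0\to(0,\infty)$ and $\gamma_{m,e}=r^{-m}\gamma_{0,e_0}$ if $e=F_w(e_0)$, $w\in W_m$, with $r\in(0,1)$ the energy renormalisation parameter. $\mathcal E_m(f)=\sum_{\{x,y\}\in E_m}\gamma_{m,\{x,y\}}|f(x)-f(y)|^2$; the sequence is assumed compatible: $\mathcal E_m(\phi)=\min\{\mathcal E_{m+1}(f): f|_{V_m}=\phi\}$ for all $\phi\colon V_m\to\mathbb C$. $\mathcal E_K(u)=\lim_m\mathcal E_m(u|_{V_m})$ is the resulting self-similar energy form on $K$, with domain the $u\in C(K)$ for which the limit is finite; it satisfies $\mathcal E_K(u)=\sum_jr^{-1}\mathcal E_K(u\circ F_j)$. $\mu$ is a Borel measure on $K$ with $\mu(K)=1$ and $\mu(F_w(K))=N^{-m}$ for all $w\in W_m$; $\mathcal E_K$ is considered in $L_2(K,\mu)$. For $v\in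 V_m$, $\psi_{m,v}\in\operatorname{dom}\mathcal E_K$ is the $m$-harmonic function: $\psi_{m,v}(v')=\delta_{v,v'}$ for $v'\in V_m$ with minimal $\mathcal E_K$-energy. Vertex weights: $\mu_m(v)=\int_K\psi_{m,v}\,d\mu$. ''$(K,\mathcal E_K,\mu,V_0)$ is symmetric'' means: (i) all $F_j$ have the same similitude factor $\theta$; (ii) $\mathcal E_K(u)=\sum_{j=1}^Nr^{-1}\mathcal E_K(u\circ F_j)$ with the same $r$ for all $j$; (iii) $\mu(F_w(K))=N^{-m}$ for all $w\in W_m$ and all $m$, i.e. the measure factor is the same for all $j$; and (iv) symmetry of the boundary: $\mu_0(v_0)=1/N_0$ for all $v_0\in V_0$ and there is $C_0>0$ with $\sum_{e_0\in E_0,\,e_0\ni v_0}1/\gamma_{0,e_0}=C_0$ for all $v_0\in V_0$. **Metric graph.** $M_m$ is obtained from intervals $[0,\ell_{m,e}]$, $e\in E_m$, by identifying end points according to $G_m$, with the sum of Lebesgue measures; $\mathcal E_{M_m}(u)=\sum_e\int_0^{\ell_{m,e}}|u_e'(x)|^2\,dx$ on $L_2(M_m)$, with domain the continuous functions $u=(u_e)_e$ on $M_m$ with $u_e\in H^1([0,\ell_{m,e}])$. *)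

(* Defs.v *)
From HB Require Import structures.
From mathcomp Require Import all_boot all_order all_algebra finmap.
From mathcomp Require Import complex ring lra.
From mathcomp Require Import all_classical all_reals all_analysis.
From mathcomp Require Import measurable_realfun.
Import Order.TTheory GRing.Theory Num.Theory numFieldNormedType.Exports.

Set Implicit Arguments.
Unset Strict Implicit.
Unset Printing Implicit Defensive.

Local Open Scope classical_set_scope.
Local Open Scope ring_scope.
Local Open Scope complex_scope.

(* [complex] and [Num] both define Re and Im; these are the R-valued ones. *)
Notation Re := complex.Re.
Notation Im := complex.Im.
Notation cmod := Normc.normc.

Definition cmod2 (R : rcfType) (z : R[i]) : R := Re z ^+ 2 + Im z ^+ 2.

Section ComplexIntegral.
Context d (T : measurableType d) (R : realType).
Variable mu : {measure set T -> \bar R}.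

Definition cmeasurable (f : T -> R[i]) : Prop :=
  measurable_fun setT (fun x => Re (f x)) /\
  measurable_fun setT (fun x => Im (f x)).

Definition cintegral (D : set T) (f : T -> R[i]) : R[i] :=
  (\int[mu]_(x in D) Re (f x))%R +i* (\int[mu]_(x in D) Im (f x))%R.

End ComplexIntegral.

Section L2.
Context d (T : measurableType d) (R : realType).
Variable mu : {measure set T -> \bar R}.

Definition sq_integrable (f : T -> R[i]) : Prop :=
  cmeasurable f /\ (\int[mu]_x (cmod2 (f x))%:E < +oo)%E.

Record L2fun := MkL2fun {
  L2fun_val :> T -> R[i];
  L2funP : sq_integrable L2fun_val }.

HB.instance Definition _ := gen_eqMixin L2fun.
HB.instance Definition _ := gen_choiceMixin L2fun.

Definition L2rel (f g : L2fun) : bool := `[< {ae mu, forall x, f x = g x} >].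

Local Open Scope quotient_scope.

Lemma L2rel_refl : reflexive L2rel.
Proof. by move=> f; apply/asboolP; near=> x. Unshelve. all: by end_near. Qed.

Lemma L2rel_sym : symmetric L2rel.
Proof.
suff S f g : L2rel f g -> L2rel g f by move=> f g; apply/idP/idP; exact: S.
by move=> /asboolP h; apply/asboolP; apply: filterS h => x ->.
Qed.

Lemma L2rel_trans : transitive L2rel.
Proof.
move=> g f h /asboolP fg /asboolP gh; apply/asboolP.
by apply: filterS2 fg gh => x -> ->.
Qed.

Canonical L2rel_equiv := EquivRel L2rel L2rel_refl L2rel_sym L2rel_trans.

Definition L2 : Type := {eq_quot L2rel}.
HB.instance Definition _ := Choice.on L2.
HB.instance Definition _ := EqQuotient.on L2.

Definition L2_repr (f : L2) : L2fun := repr f.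
Definition L2_to_fun (f : L2) : T -> R[i] := L2_repr f.
Coercion L2_to_fun : L2 >-> Funclass.

Lemma L2P (f g : L2) : f = g <-> {ae mu, forall x, f x = g x}.
Proof.
split=> [->|fg]; first by near=> x.
rewrite -[f]reprK -[g]reprK; apply/eqP; rewrite eqmodE; exact/asboolP.
Unshelve. all: by end_near. Qed.

Lemma cmeasurable_cmod2 (f : T -> R[i]) : cmeasurable f ->
  measurable_fun [set: T] (fun x => cmod2 (f x)).
Proof.
by move=> [rf jf]; apply: measurable_funD; apply: measurable_funX.
Qed.

Lemma cmod2_ge0 (z : R[i]) : 0 <= cmod2 z.
Proof. by rewrite addr_ge0 ?sqr_ge0. Qed.

Lemma cmod2D_le (z w : R[i]) : cmod2 (z + w) <= 2 * cmod2 z + 2 * cmod2 w.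
Proof.
case: z w => [a b] [a' b']; rewrite /cmod2 /=.
rewrite -subr_ge0; set D := (X in 0 <= X).
suff -> : D = (a - a') ^+ 2 + (b - b') ^+ 2 by rewrite addr_ge0 ?sqr_ge0.
by rewrite /D; ring.
Qed.

Lemma cmod2M (z w : R[i]) : cmod2 (z * w) = cmod2 z * cmod2 w.
Proof. by case: z w => [a b] [a' b']; rewrite /cmod2 /=; ring. Qed.

Lemma cmeasurableD (f g : T -> R[i]) : cmeasurable f -> cmeasurable g ->
  cmeasurable (fun x => f x + g x).
Proof.
move=> [rf jf] [rg jg]; split.
  rewrite (_ : (fun x => _) = (fun x => Re (f x) + Re (g x))).
    exact: measurable_funD.
  by apply/funext => x; case: (f x) (g x) => ? ? [].
rewrite (_ : (fun x => _) = (fun x => Im (f x) + Im (g x))).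
  exact: measurable_funD.
by apply/funext => x; case: (f x) (g x) => ? ? [].
Qed.

Lemma cmeasurableM (f g : T -> R[i]) : cmeasurable f -> cmeasurable g ->
  cmeasurable (fun x => f x * g x).
Proof.
move=> [rf jf] [rg jg]; split.
  rewrite (_ : (fun x => _) =
      (fun x => Re (f x) * Re (g x) - Im (f x) * Im (g x))).
    by apply: measurable_funB; exact: measurable_funM.
  by apply/funext => x; case: (f x) (g x) => ? ? [].
rewrite (_ : (fun x => _) =
    (fun x => Re (f x) * Im (g x) + Im (f x) * Re (g x))).
  by apply: measurable_funD; exact: measurable_funM.
by apply/funext => x; case: (f x) (g x) => ? ? [].
Qed.

Lemma cmeasurable_cst (a : R[i]) : cmeasurable (fun _ : T => a).
Proof. by split; exact: measurable_cst. Qed.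

Lemma cmeasurableJ (f : T -> R[i]) : cmeasurable f ->
  cmeasurable (fun x => (f x)^*).
Proof.
move=> [rf jf]; split.
  by rewrite (_ : (fun x => _) = (fun x => Re (f x)))//;
    apply/funext => x; case: (f x).
rewrite (_ : (fun x => _) = (fun x => - Im (f x))).
  exact: measurableT_comp.
by apply/funext => x; case: (f x).
Qed.

Lemma sq_integrableD (f g : T -> R[i]) : sq_integrable f -> sq_integrable g ->
  sq_integrable (fun x => f x + g x).
Proof.
move=> [mf fi] [mg gi]; split; first exact: cmeasurableD.
have M (h : T -> R[i]) : cmeasurable h ->
    measurable_fun [set: T] (fun x => (2 * cmod2 (h x))%:E).
  move=> mh; apply/measurable_EFinP; apply: measurable_funM => //.
  exact: cmeasurable_cmod2.
apply: (@le_lt_trans _ _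
  (\int[mu]_x ((2 * cmod2 (f x))%:E + (2 * cmod2 (g x))%:E))%E).
  apply: ge0_le_integral => //.
  - by move=> x _; rewrite lee_fin cmod2_ge0.
  - exact/measurable_EFinP/cmeasurable_cmod2/cmeasurableD.
  - by apply: emeasurable_funD; exact: M.
  - by move=> x _; rewrite -EFinD lee_fin cmod2D_le.
rewrite ge0_integralD//; last 4 first.
- by move=> x _; rewrite lee_fin mulr_ge0 ?cmod2_ge0.
- exact: M.
- by move=> x _; rewrite lee_fin mulr_ge0 ?cmod2_ge0.
- exact: M.
have Z (h : T -> R[i]) : cmeasurable h ->
    (\int[mu]_x (cmod2 (h x))%:E < +oo)%E ->
    (\int[mu]_x (2 * cmod2 (h x))%:E < +oo)%E.
  move=> mh hi; rewrite [ltLHS](_ : _ = (2%:E * \int[mu]_x (cmod2 (h x))%:E)%E).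
    by rewrite lte_mul_pinfty.
  rewrite -ge0_integralZl_EFin//; last 2 first.
  - by move=> x _; rewrite lee_fin cmod2_ge0.
  - exact/measurable_EFinP/cmeasurable_cmod2.
by rewrite lte_add_pinfty// Z.
Qed.

Lemma sq_integrableZ (a : R[i]) (f : T -> R[i]) : sq_integrable f ->
  sq_integrable (fun x => a * f x).
Proof.
move=> [mf fi]; split; first exact: (cmeasurableM (cmeasurable_cst a) mf).
rewrite [ltLHS](_ : _ = ((cmod2 a)%:E * \int[mu]_x (cmod2 (f x))%:E)%E).
  by rewrite lte_mul_pinfty ?lee_fin ?cmod2_ge0.
rewrite -ge0_integralZl_EFin ?cmod2_ge0//.
- by apply: eq_integral => x _; rewrite cmod2M EFinM.
- by move=> x _; rewrite lee_fin cmod2_ge0.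
- exact/measurable_EFinP/cmeasurable_cmod2.
Qed.

Lemma sq_integrable0 : sq_integrable (fun=> 0).
Proof.
split; first exact: cmeasurable_cst.
by under eq_integral do rewrite /cmod2 /= expr0n /= addr0; rewrite integral0.
Qed.

Definition L2fun0 := MkL2fun sq_integrable0.
Definition L2fun_add (f g : L2fun) :=
  MkL2fun (sq_integrableD (L2funP f) (L2funP g)).
Definition L2fun_scale (a : R[i]) (f : L2fun) :=
  MkL2fun (sq_integrableZ a (L2funP f)).

Definition L2zero : L2 := \pi_L2 L2fun0.
Definition L2add (f g : L2) : L2 := \pi_L2 (L2fun_add (repr f) (repr g)).
Definition L2scale (a : R[i]) (f : L2) : L2 := \pi_L2 (L2fun_scale a (repr f)).

Lemma L2piE (f : L2fun) : {ae mu, forall x, (\pi_L2 f : L2) x = f x}.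
Proof.
by apply/asboolP; rewrite -[X in is_true X]/(L2rel _ _) -eqmodE reprK.
Qed.

Lemma L2zeroE : {ae mu, forall x, L2zero x = 0}.
Proof. exact: (L2piE L2fun0). Qed.

Lemma L2addE f g : {ae mu, forall x, L2add f g x = f x + g x}.
Proof. exact: (L2piE (L2fun_add _ _)). Qed.

Lemma L2scaleE a f : {ae mu, forall x, L2scale a f x = a * f x}.
Proof. exact: (L2piE (L2fun_scale _ _)). Qed.

Lemma L2addA : associative L2add.
Proof.
move=> f g h; apply/L2P; near=> x.
rewrite (near (L2addE f (L2add g h)) x)// (near (L2addE g h) x)//.
by rewrite (near (L2addE (L2add f g) h) x)// (near (L2addE f g) x)// addrA.
Unshelve. all: by end_near. Qed.

Lemma L2addC : commutative L2add.
Proof.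
move=> f g; apply/L2P; near=> x.
by rewrite (near (L2addE f g) x)// (near (L2addE g f) x)// addrC.
Unshelve. all: by end_near. Qed.

Lemma L2add0 : left_id L2zero L2add.
Proof.
move=> f; apply/L2P; near=> x.
by rewrite (near (L2addE L2zero f) x)// (near L2zeroE x)// add0r.
Unshelve. all: by end_near. Qed.

Lemma L2addN : left_inverse L2zero (L2scale (-1)) L2add.
Proof.
move=> f; apply/L2P; near=> x.
rewrite (near (L2addE (L2scale (-1) f) f) x)// (near (L2scaleE (-1) f) x)//.
by rewrite (near L2zeroE x)// mulN1r addNr.
Unshelve. all: by end_near. Qed.

HB.instance Definition _ :=
  GRing.isZmodule.Build L2 L2addA L2addC L2add0 L2addN.

Lemma L2scaleA a b f : L2scale a (L2scale b f) = L2scale (a * b) f.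
Proof.
apply/L2P; near=> x.
rewrite (near (L2scaleE a (L2scale b f)) x)// (near (L2scaleE b f) x)//.
by rewrite (near (L2scaleE (a * b) f) x)// mulrA.
Unshelve. all: by end_near. Qed.

Lemma L2scale1 : left_id 1 L2scale.
Proof.
move=> f; apply/L2P; near=> x.
by rewrite (near (L2scaleE 1 f) x)// mul1r.
Unshelve. all: by end_near. Qed.

Lemma L2scaleDr : right_distributive L2scale +%R.
Proof.
move=> a f g; apply/L2P; near=> x.
rewrite (near (L2scaleE a (f + g)) x)// (near (L2addE f g) x)//.
rewrite (near (L2addE (L2scale a f) (L2scale a g)) x)//.
by rewrite (near (L2scaleE a f) x)// (near (L2scaleE a g) x)// mulrDr.
Unshelve. all: by end_near. Qed.

Lemma L2scaleDl f : {morph L2scale^~ f : a b / a + b}.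
Proof.
move=> a b; apply/L2P; near=> x.
rewrite (near (L2scaleE (a + b) f) x)//.
rewrite (near (L2addE (L2scale a f) (L2scale b f)) x)//.
by rewrite (near (L2scaleE a f) x)// (near (L2scaleE b f) x)// mulrDl.
Unshelve. all: by end_near. Qed.

HB.instance Definition _ := GRing.Zmodule_isLmodule.Build R[i] L2
  L2scaleA L2scale1 L2scaleDr L2scaleDl.

Lemma L2DE (f g : L2) : {ae mu, forall x, (f + g : L2) x = f x + g x}.
Proof. exact: L2addE. Qed.

Lemma L2ZE (a : R[i]) (f : L2) : {ae mu, forall x, (a *: f : L2) x = a * f x}.
Proof. exact: L2scaleE. Qed.

Definition L2ip (f g : L2) : R[i] :=
  cintegral mu setT (fun x => f x * (g x)^*).

Lemma L2_sqint (f : L2) : sq_integrable f.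
Proof. exact: L2funP. Qed.

Definition cintegrable (f : T -> R[i]) : Prop :=
  mu.-integrable setT (EFin \o (fun x => Re (f x))) /\
  mu.-integrable setT (EFin \o (fun x => Im (f x))).

Lemma cmod2_integrable (f : T -> R[i]) : sq_integrable f ->
  mu.-integrable setT (EFin \o (fun x => cmod2 (f x))).
Proof.
move=> [mf fi]; apply/integrableP; split.
  exact/measurable_EFinP/cmeasurable_cmod2.
apply: le_lt_trans fi; rewrite le_eqVlt; apply/orP; left; apply/eqP.
by apply: eq_integral => x _ /=; rewrite ger0_norm ?cmod2_ge0.
Qed.

Lemma cintegrableM (f g : T -> R[i]) : sq_integrable f -> sq_integrable g ->
  cintegrable (fun x => f x * (g x)^*).
Proof.
move=> hf hg; have [mf _] := hf; have [mg _] := hg.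
have [mr mi] := cmeasurableM mf (cmeasurableJ mg).
have I := integrableD measurableT (cmod2_integrable hf) (cmod2_integrable hg).
have B (a b a' b' : R) :
    `|a * a' - b * - b'| <= cmod2 (a +i* b) + cmod2 (a' +i* b') /\
    `|a * - b' + b * a'| <= cmod2 (a +i* b) + cmod2 (a' +i* b').
  have [] := (sqr_ge0 (a + a'), sqr_ge0 (a - a')).
  have [] := (sqr_ge0 (b + b'), sqr_ge0 (b - b')).
  have [] := (sqr_ge0 (a + b'), sqr_ge0 (a - b')).
  have [] := (sqr_ge0 (b + a'), sqr_ge0 (b - a')).
  have [] := (sqr_ge0 a, sqr_ge0 a'); have [] := (sqr_ge0 b, sqr_ge0 b').
  by rewrite /cmod2 /=; split; rewrite ler_norml; apply/andP; split; nra.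
split; apply: le_integrable I => //; try exact/measurable_EFinP.
- move=> x _ /=; rewrite lee_fin [leRHS]ger0_norm; last first.
    by apply: addr_ge0; exact: cmod2_ge0.
  by case: (f x) (g x) => a b [a' b']; exact: (B a b a' b').1.
- move=> x _ /=; rewrite lee_fin [leRHS]ger0_norm; last first.
    by apply: addr_ge0; exact: cmod2_ge0.
  by case: (f x) (g x) => a b [a' b'] ; exact: (B a b a' b').2.
Qed.

Lemma cintegral_ae (f g : T -> R[i]) : cmeasurable f -> cmeasurable g ->
  {ae mu, forall x, f x = g x} -> cintegral mu setT f = cintegral mu setT g.
Proof.
move=> [rf jf] [rg jg] fg; congr (_ +i* _); congr fine;
  apply: ae_eq_integral => //; try exact/measurable_EFinP.
- by apply: filterS fg => x -> _.
- by apply: filterS fg => x -> _.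
Qed.

Lemma cintegralDZ (a : R[i]) (f g : T -> R[i]) :
  cintegrable f -> cintegrable g ->
  cintegral mu setT (fun x => a * f x + g x) =
  a * cintegral mu setT f + cintegral mu setT g.
Proof.
move=> [rf jf] [rg jg]; case: a => a b; rewrite /cintegral.
have Z c h : mu.-integrable setT (EFin \o h) ->
    mu.-integrable setT (EFin \o (fun x => c * h x)).
  by move=> hi; exact: (integrableZl measurableT c hi).
rewrite [LHS](_ : _ =
  (\int[mu]_(x in setT) ((a * Re (f x) + - b * Im (f x)) + Re (g x)))%R +i*
  (\int[mu]_(x in setT) ((a * Im (f x) + b * Re (f x)) + Im (g x)))%R).
  rewrite !RintegralD ?RintegralZl//; try exact: Z.
  - by simpc.
  - by apply: (integrableD measurableT (Z _ _ _) (Z _ _ _)).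
  - by apply: (integrableD measurableT (Z _ _ _) (Z _ _ _)).
by congr (_ +i* _); apply: eq_Rintegral => x _;
  case: (f x) (g x) => ? ? [? ?] /=; rewrite ?mulNr.
Qed.

Lemma L2ip_cmeas (f g : L2) : cmeasurable (fun x => f x * (g x)^*).
Proof.
by apply: cmeasurableM; [|apply: cmeasurableJ]; exact: (L2_sqint _).1.
Qed.

Lemma L2ipDZ a f g h : L2ip (a *: f + g) h = a * L2ip f h + L2ip g h.
Proof.
rewrite -cintegralDZ; try by apply: cintegrableM; exact: L2_sqint.
apply: cintegral_ae.
- exact: L2ip_cmeas.
- apply: cmeasurableD; last exact: L2ip_cmeas.
  by apply: cmeasurableM; [exact: cmeasurable_cst|exact: L2ip_cmeas].
- near=> x; rewrite (near (L2DE (a *: f) g) x)// (near (L2ZE a f) x)//.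
  by rewrite mulrDl mulrA.
Unshelve. all: by end_near. Qed.

Lemma L2ipC f g : L2ip g f = (L2ip f g)^*.
Proof.
have [_ I] := cintegrableM (L2_sqint f) (L2_sqint g).
rewrite /L2ip /cintegral /=; congr (_ +i* _).
  by apply: eq_Rintegral => x _; case: (f x) (g x) => ? ? [? ?] /=; ring.
rewrite -mulN1r -RintegralZl//.
by apply: eq_Rintegral => x _; case: (f x) (g x) => ? ? [? ?] /=; ring.
Qed.

Lemma L2ipE f : L2ip f f = (\int[mu]_(x in setT) cmod2 (f x))%R%:C.
Proof.
rewrite /L2ip /cintegral -complexr0; congr (_ +i* _).
  apply: eq_Rintegral => x _; rewrite /cmod2; case: (f x) => ? ? /=; ring.
rewrite /Rintegral [X in fine X](_ : _ = 0%E)//.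
rewrite -(integral0 mu setT); apply: eq_integral => x _; congr EFin.
by case: (f x) => ? ? /=; ring.
Qed.

Lemma L2ip_ge0 f : 0 <= L2ip f f.
Proof.
by rewrite L2ipE ler0c; apply: Rintegral_ge0 => x _; exact: cmod2_ge0.
Qed.

Lemma L2ip_eq0 f : L2ip f f = 0 -> f = 0.
Proof.
rewrite L2ipE => -[f0]; apply/L2P.
have If := cmod2_integrable (L2_sqint f).
have : (\int[mu]_x `|(cmod2 (f x))%:E| = 0)%E.
  rewrite -[RHS]/(0%:E) -f0 /Rintegral fineK.
    by apply: eq_integral => x _; rewrite /= ger0_norm ?cmod2_ge0.
  exact: integrable_fin_num If.
move/(ae_eq_integral_abs mu measurableT (measurable_int _ If)) => h.
apply: filterS2 h L2zeroE => x /(_ I) [] fx0 ->; move: fx0 => /eqP.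
case: (f x) => a b; rewrite /cmod2 paddr_eq0 ?sqr_ge0// !sqrf_eq0 /=.
by move=> /andP[/eqP -> /eqP ->].
Qed.

End L2.

Section Hilbert.
Variable R : realType.

(* Linear in the first argument; [0 <= _] is the order of R[i], so [ip_ge0]
   also says that ip f f is real. Completeness is part of [energy_form]. *)
Record ipSpace := IpSpace {
  ip_sort :> lmodType R[i];
  ip : ip_sort -> ip_sort -> R[i];
  ipDZ : forall a f g h, ip (a *: f + g) h = a * ip f h + ip g h;
  ipC : forall f g, ip g f = (ip f g)^*;
  ip_ge0 : forall f, 0 <= ip f f;
  ip_eq0 : forall f, ip f f = 0 -> f = 0 }.

Definition hnorm (H : ipSpace) (f : H) : R := Num.sqrt (Re (ip f f)).

Definition complete_for (H : ipSpace) (D : set H) (nu : H -> R) : Prop :=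
  forall u : nat -> H, (forall n, D (u n)) ->
  (forall e, 0 < e -> exists n0, forall m n, (n0 <= m)%N -> (n0 <= n)%N ->
     nu (u m - u n) < e) ->
  exists2 f, D f & (fun n => nu (u n - f)) @ \oo --> (0 : R).

Record qform (H : ipSpace) := QForm { qdom : set H; qval : H -> R }.

(* The sesquilinear form of a quadratic form, linear in the first argument. *)
Definition polar (H : ipSpace) (a : qform H) (f g : H) : R[i] :=
  4%:R^-1 * \sum_(k < 4) 'i%C ^+ k * (qval a (f + 'i%C ^+ k *: g))%:C.

Definition norm1 (H : ipSpace) (a : qform H) (f : H) : R :=
  Num.sqrt (hnorm f ^+ 2 + qval a f).

Definition quadratic (H : ipSpace) (a : qform H) : Prop :=
  [/\ qdom a 0,
      forall c f g, qdom a f -> qdom a g -> qdom a (c *: f + g),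
      forall c f g h, qdom a f -> qdom a g -> qdom a h ->
        polar a (c *: f + g) h = c * polar a f h + polar a g h,
      forall f g, qdom a f -> qdom a g -> polar a g f = (polar a f g)^* &
      forall f, qdom a f -> polar a f f = (qval a f)%:C].

Definition energy_form (H : ipSpace) (a : qform H) : Prop :=
  [/\ complete_for setT (@hnorm H),
      quadratic a,
      forall f, qdom a f -> 0 <= qval a f,
      forall (f : H) e, 0 < e -> exists2 g, qdom a g & hnorm (f - g) < e &
      complete_for (qdom a) (norm1 a)].

(* An operator D -> D' is a total function used on D only. *)
Definition bounded_operator (H H' : ipSpace) (D : set H) (D' : set H')
    (nu : H -> R) (nu' : H' -> R) (J : H -> H') : Prop :=
  [/\ forall f, D f -> D' (J f),
      forall c f g, D f -> D g -> J (c *: f + g) = c *: J f + J g &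
      exists C : R, forall f, D f -> nu' (J f) <= C * nu f].

Definition quasi_unitarily_equivalent (H H' : ipSpace) (delta : R)
    (a : qform H) (a' : qform H') : Prop :=
  [/\ 0 <= delta, energy_form a, energy_form a' &
  exists (J : H -> H') (J' : H' -> H) (J1 : H -> H') (J1' : H' -> H),
  [/\ bounded_operator setT setT (@hnorm H) (@hnorm H') J,
      bounded_operator setT setT (@hnorm H') (@hnorm H) J',
      bounded_operator (qdom a) (qdom a') (norm1 a) (norm1 a') J1 &
      bounded_operator (qdom a') (qdom a) (norm1 a') (norm1 a) J1'] /\
  [/\ forall f, hnorm (J f) <= (1 + delta) * hnorm f,
      forall f u, cmod (ip (J f) u - ip f (J' u)) <= delta * hnorm f * hnorm u,
      (forall f, qdom a f -> hnorm (f - J' (J f)) <= delta * norm1 a f) /\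
      (forall u, qdom a' u -> hnorm (u - J (J' u)) <= delta * norm1 a' u),
      (forall f, qdom a f -> hnorm (J1 f - J f) <= delta * norm1 a f) /\
      (forall u, qdom a' u -> hnorm (J1' u - J' u) <= delta * norm1 a' u) &
      forall f u, qdom a f -> qdom a' u ->
        cmod (polar a' (J1 f) u - polar a f (J1' u)) <=
          delta * norm1 a f * norm1 a' u]].

Definition scale_form (H : ipSpace) (t : R) (a : qform H) : qform H :=
  QForm (qdom a) (fun f => t * qval a f).

Definition L2space d (T : measurableType d)
    (mu : {measure set T -> \bar R}) : ipSpace :=
  IpSpace (@L2ipDZ _ _ _ mu) (@L2ipC _ _ _ mu) (@L2ip_ge0 _ _ _ mu)
    (@L2ip_eq0 _ _ _ mu).

End Hilbert.

Section MetricGraph.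
Variable R : realType.

(* The edges are numbered by the i < mg_size; edge i is a copy of
   [0, mg_len i], running from mg_src i to mg_tgt i. *)
Record metric_graph (V : Type) := MetricGraph {
  mg_size : nat;
  mg_src : nat -> V;
  mg_tgt : nat -> V;
  mg_len : nat -> R }.

Definition interval_measure (l : R) :
    {measure set (measurableTypeR R) -> \bar R} :=
  mrestr (@lebesgue_measure R) (measurable_itv `[0, l]).

Section EdgeMeasure.
Variables (l : R) (i : nat).

Definition edge_measure (A : set (nat * measurableTypeR R)) : \bar R :=
  interval_measure l [set x | A (i, x)].

Let edge_measure0 : edge_measure set0 = 0%E.
Proof. exact: measure0. Qed.

Let edge_measure_ge0 A : (0 <= edge_measure A)%E.
Proof. exact: measure_ge0. Qed.

Let edge_measure_sigma_additive : semi_sigma_additive edge_measure.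
Proof.
move=> F mF tF mUF; rewrite /edge_measure.
have mp A : measurable A -> measurable [set x : measurableTypeR R | A (i, x)].
  by move=> mA; rewrite -[X in measurable X]setTI; exact: pair1_measurable.
rewrite [X in interval_measure l X](_ : _ =
  \bigcup_n [set x | F n (i, x)]); last by apply/seteqP; split.
apply: measure_semi_sigma_additive.
- by move=> n; exact: mp.
- by move=> m n _ _ [x [Fm Fn]]; apply: (tF m n) => //; exists (i, x).
- exact: (mp _ mUF).
Qed.

HB.instance Definition _ := isMeasure.Build _ _ _ edge_measure
  edge_measure0 edge_measure_ge0 edge_measure_sigma_additive.

End EdgeMeasure.

Definition mg_measure (V : Type) (M : metric_graph V) :
    {measure set (nat * measurableTypeR R) -> \bar R} :=
  msum (fun i => edge_measure (mg_len M i) i) (mg_size M).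

(* The test functions of the weak derivative: C^1 with compact support in
   the open interval ]0, l[. *)
Definition test_function (l : R) (phi : R -> R) : Prop :=
  [/\ forall x, derivable phi x 1, continuous (derive1 phi) &
      exists a b, [/\ 0 < a, b < l & forall x, x \notin `[a, b] -> phi x = 0]].

Definition weak_derivative (l : R) (v g : R -> R[i]) : Prop :=
  sq_integrable (interval_measure l) g /\
  forall phi, test_function l phi ->
    cintegral (@lebesgue_measure R) `[0, l]
      (fun x => v x * (derive1 phi x)%:C) =
    - cintegral (@lebesgue_measure R) `[0, l] (fun x => g x * (phi x)%:C).

Section MetricForm.
Variables (V : Type) (M : metric_graph V).

(* f has the representative (v i)_i, which is continuous on the metric graph
   and in H^1 of each edge, with derivative (v' i)_i. *)
Definition mg_H1 (f : L2 (mg_measure M)) (v v' : nat -> R -> R[i]) : Prop :=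
  [/\ {ae mg_measure M, forall p, f p = v p.1 p.2},
      forall i, (i < mg_size M)%N ->
        {within `[0, mg_len M i], continuous (v i : R -> R[i]^o)},
      exists phi : V -> R[i], forall i, (i < mg_size M)%N ->
        v i 0 = phi (mg_src M i) /\ v i (mg_len M i) = phi (mg_tgt M i) &
      forall i, (i < mg_size M)%N -> weak_derivative (mg_len M i) (v i) (v' i)].

(* A choice of the weak derivative, which is unique almost everywhere. *)
Definition mg_derivative (f : L2 (mg_measure M)) : nat -> R -> R[i] :=
  xget (fun _ _ => 0) [set v' | exists v, mg_H1 f v v'].

Definition mg_form : qform (L2space (mg_measure M)) :=
  @QForm R (L2space (mg_measure M)) [set f | exists v v', mg_H1 f v v']
    (fun f => \sum_(i < mg_size M)
      (\int[@lebesgue_measure R]_(x in `[0, mg_len M i])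
         cmod2 (mg_derivative f i x))%R).

End MetricForm.

End MetricGraph.

Section Fractal.
Variables (R : realType) (d : nat).

Notation point := 'rV[R]_d.

(* The norm of the library on 'rV[R]_d is the sup norm. *)
Definition euclid (x : point) : R := Num.sqrt (\sum_(i < d) x ord0 i ^+ 2).

Definition borel := g_sigma_algebraType (@open point).

(* mu is a measure on the Borel sets of R^d, made to vanish outside K by
   [borel_measure_on_K], so that L2 (mu) is L_2(K, mu). Edges are two-element sets of points. *)
Record fractal := Fractal {
  nmaps : nat;
  F : 'I_nmaps -> point -> point;
  K : set point;
  theta : R;
  V0 : {fset point};
  gamma0 : {fset point} -> R;
  renorm : R;
  mu : {measure set borel -> \bar R} }.

Section Graphs.
Variable D : fractal.

Definition Fword (w : seq 'I_(nmaps D)) (x : point) : point :=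
  foldr (fun j y => F j y) x w.

Fixpoint Vm (m : nat) : {fset point} :=
  if m is m'.+1
  then (\bigcup_(j <- enum 'I_(nmaps D)) [fset F j x | x in Vm m'])%fset
  else V0 D.

Fixpoint Em (m : nat) : {fset {fset point}} :=
  if m is m'.+1
  then (\bigcup_(j <- enum 'I_(nmaps D))
          [fset (F j @` (e : {fset point}))%fset | e in Em m'])%fset
  else [fset e in fpowerset (V0 D) | #|` e| == 2%N]%fset.

(* The two points of an edge, in the (arbitrary) order of its enumeration;
   [graph_energy] and the metric graph form do not depend on it. *)
Definition src (e : {fset point}) : point := nth 0 e 0.
Definition tgt (e : {fset point}) : point := nth 0 e 1.

(* The edges e0 in E_0 with e = F_w(e0) for some word w of length m; for
   e in E_m there is exactly one under [simple_graphs]. *)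
Definition base_edge_of (m : nat) (e e0 : {fset point}) : Prop :=
  e0 \in Em 0 /\ exists w : m.-tuple 'I_(nmaps D), e = (Fword w @` e0)%fset.

Definition base_edge (m : nat) (e : {fset point}) : {fset point} :=
  xget fset0 [set e0 | base_edge_of m e e0].

Definition gamma (m : nat) (e : {fset point}) : R :=
  (renorm D ^+ m)^-1 * gamma0 D (base_edge m e).

Definition graph_energy (m : nat) (u : point -> R[i]) : R :=
  \sum_(e <- Em m) gamma m e * cmod2 (u (src e) - u (tgt e)).

(* G_{m+1} is glued from the copies F_j(G_m) without parallel edges. *)
Definition simple_graphs : Prop :=
  forall m (w w' : m.-tuple 'I_(nmaps D)) e e', e \in Em 0 -> e' \in Em 0 ->
    (Fword w @` e)%fset = (Fword w' @` e')%fset -> w = w' /\ e = e'.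

Definition pcf_fractal : Prop :=
  [/\ (2 <= nmaps D)%N,
      compact (K D) /\ K D !=set0,
      K D = \bigcup_(j : 'I_(nmaps D)) (F j @` K D),
      0 < theta D < 1 /\
        forall j x y, euclid (@F D j x - F j y) = theta D * euclid (x - y) &
      [/\ V0 D != fset0,
          forall v, v \in V0 D -> exists j, @F D j v = v &
          forall j j' : 'I_(nmaps D), j != j' ->
            (F j @` K D) `&` (F j' @` K D) `<=`
            (F j @` [set x | x \in V0 D]) `&` (F j' @` [set x | x \in V0 D])]].

Definition compatible_energies : Prop :=
  forall m (phi : point -> R[i]),
    (forall f, {in Vm m, f =1 phi} ->
       graph_energy m phi <= graph_energy m.+1 f) /\
    exists2 f : point -> R[i], {in Vm m, f =1 phi} &
      graph_energy m.+1 f = graph_energy m phi.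

Definition weighted_graphs : Prop :=
  [/\ simple_graphs, forall e, e \in Em 0 -> 0 < gamma0 D e, 0 < renorm D < 1 &
      compatible_energies].

Definition dom_energy (u : point -> R[i]) : Prop :=
  {within K D, continuous (u : point -> R[i]^o)} /\
  cvgn (fun m => graph_energy m u).

Definition energy (u : point -> R[i]) : R :=
  limn (fun m => graph_energy m u).

Definition borel_measure_on_K : Prop :=
  mu D (~` K D) = 0%E /\ mu D (K D) = 1%E.

Definition m_harmonic (m : nat) (v : point) (psi : point -> R[i]) : Prop :=
  [/\ dom_energy psi,
      forall v', v' \in Vm m -> psi v' = (v' == v)%:R &
      forall u, dom_energy u ->
        (forall v', v' \in Vm m -> u v' = (v' == v)%:R) ->
        energy psi <= energy u].

(* The m-harmonic function of each vertex exists and, as a function on K, is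
   unique; [psi] is then well defined up to its values outside K. *)
Definition harmonic_functions : Prop :=
  forall m v, v \in Vm m ->
    exists2 psi, m_harmonic m v psi &
      forall psi', m_harmonic m v psi' -> forall x, K D x -> psi' x = psi x.

Definition psi (m : nat) (v : point) : point -> R[i] :=
  xget (fun=> 0) [set psi | m_harmonic m v psi].

Definition vertex_weight (m : nat) (v : point) : R[i] :=
  cintegral (mu D) (K D) (psi m v).

Definition symmetric_fractal (C0 : R) : Prop :=
  [/\ forall u, dom_energy u ->
        (forall j, dom_energy (u \o @F D j)) /\
        energy u = \sum_(j < nmaps D) (renorm D)^-1 * energy (u \o F j),
      forall m (w : m.-tuple 'I_(nmaps D)),
        mu D (Fword w @` K D) = (((nmaps D)%:R ^+ m)^-1)%:E,
      forall v, v \in V0 D -> vertex_weight 0 v = ((#|` V0 D|%:R : R)^-1)%:C &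
      0 < C0 /\ forall v, v \in V0 D ->
        \sum_(e <- Em 0 | v \in e) (gamma0 D e)^-1 = C0].

(* Membership in C(K) and the energy only involve the values on K. *)
Definition fractal_repr (f : L2 (mu D)) (u : point -> R[i]) : Prop :=
  dom_energy u /\ {ae mu D, forall x, f x = u x}.

Definition fractal_form : qform (L2space (mu D)) :=
  @QForm R (L2space (mu D)) [set f | exists u, fractal_repr f u]
    (fun f => energy (xget (fun=> 0) [set u | fractal_repr f u])).

Definition Em_nth (m i : nat) : {fset point} := nth fset0 (Em m) i.

Definition graph_Mm (l00 Lambda : R) (m : nat) : metric_graph R point :=
  MetricGraph #|` Em m| (fun i => src (Em_nth m i)) (fun i => tgt (Em_nth m i))
    (fun i => l00 / gamma0 D (base_edge m (Em_nth m i)) * Lambda ^+ m).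

Definition tau (C0 l00 Lambda : R) (m : nat) : R :=
  l00 ^+ 2 * C0 * #|` V0 D|%:R / 2%:R *
  ((nmaps D)%:R * Lambda ^+ 2 / renorm D) ^+ m.

End Graphs.

End Fractal.

(* Main.v *)
(** The cells of level m give a common coarse picture of the two spaces. On the
   fractal take the normalised indicators of the N^m cells of K, on the metric
   graph those of the copies of G_0, which all have length
   l_{0,0} Lambda^m N_0 C_0 / 2; J and J' identify the two orthonormal families.
   A function of finite energy is approximated in both spaces by the combination
   of the indicators with its values at the vertices F_w(v0), with an error of
   order (r/N)^(m/2) in terms of the energy: on the fractal by the self-similarity
   of the energy and a bound of the oscillation on K, on the graph by
   Cauchy-Schwarz along the edges.

   The maps on the form domains use the vertex values only: J^1 is m-harmonic
   extension and J'^1 affine interpolation on the edges, up to reciprocal factors.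
   Both forms reduce to the energy of G_m when one argument is harmonic or affine,
   so these maps intertwine the forms exactly once tau_m is as given, and they
   keep the vertex values. *)

Require Import Defs.
From HB Require Import structures.
From mathcomp Require Import all_boot all_order all_algebra finmap.
From mathcomp Require Import complex ring lra.
From mathcomp Require Import all_classical all_reals all_analysis.
From mathcomp Require Import measurable_realfun.
Import Order.TTheory GRing.Theory Num.Theory numFieldNormedType.Exports.

Set Implicit Arguments.
Unset Strict Implicit.
Unset Printing Implicit Defensive.

Local Open Scope classical_set_scope.
Local Open Scope ring_scope.
Local Open Scope complex_scope.

(** Connectedness of K is not assumed, yet every estimate rests on a bound of the oscillation by the
    energy. It comes from compatibility of E_0 with E_1 together with uniqueness of the 0-harmonic
    functions: both make G_1 connected, and r < 1 lets the bound of one level be summed over all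
    levels. The same bound extends functions of bounded energy from the union of the V_m to K, which
    identifies the energy of an m-harmonic function with its energy on G_m.

    J and J' are exact adjoints and the maps on the form domains intertwine the forms exactly, so
    the only errors are distances to the spans of the two families. They give the rate 2 sqrt(c
    (r/N)^m), where c depends neither on Lambda nor on l_{0,0}, and r < 1 < N.

    Both forms must also be shown closed and densely defined. In both spaces the form norm dominates
    the sup norm of the continuous representative, so Cauchy sequences converge uniformly. On an
    edge this needs a fundamental theorem of calculus for weak derivatives, proved with explicit C^1
    test functions. *)

Local Notation Re := complex.Re.
Local Notation Im := complex.Im.

(** * Complex modulus *)

Section Cmod.
Variable R : rcfType.
Implicit Types z w : R[i].

(* [ssrnum] and [complex] both denote conjugation by [^*]. *)
Lemma conjCE z : Num.conj z = conjc z.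
Proof. by []. Qed.

Lemma cmod_sqr z : cmod z ^+ 2 = cmod2 z.
Proof. by case: z => a b; rewrite /= sqr_sqrtr // addr_ge0 ?sqr_ge0. Qed.

Lemma cmod2_ge0' z : 0 <= cmod2 z.
Proof. by rewrite addr_ge0 ?sqr_ge0. Qed.

Lemma cmodE z : cmod z = Num.sqrt (cmod2 z).
Proof. by case: z. Qed.

Lemma cmod_ge0 z : 0 <= cmod z.
Proof. by rewrite cmodE sqrtr_ge0. Qed.

Lemma cmodN z : cmod (- z) = cmod z.
Proof. by rewrite !cmodE; case: z => a b; rewrite /cmod2 /= !sqrrN. Qed.

Lemma cmodB z w : cmod (z - w) = cmod (w - z).
Proof. by rewrite -cmodN opprB. Qed.

Lemma cmodD z w : cmod (z + w) <= cmod z + cmod w.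
Proof. exact: le_normcD. Qed.

Lemma cmod_triangle z w y : cmod (z - w) <= cmod (z - y) + cmod (y - w).
Proof. by rewrite (_ : z - w = (z - y) + (y - w)) ?cmodD // addrA subrK. Qed.

Lemma cmodM z w : cmod (z * w) = cmod z * cmod w.
Proof. exact: Normc.normcM. Qed.

Lemma cmod0 : cmod (0 : R[i]) = 0.
Proof. by rewrite /= expr0n /= addr0 sqrtr0. Qed.

Lemma cmod_eq0 z : cmod z = 0 -> z = 0.
Proof. exact: Normc.eq0_normc. Qed.

Lemma cmod_real (x : R) : cmod x%:C = `|x|.
Proof. by rewrite /= expr0n /= addr0 sqrtr_sqr. Qed.

Lemma normr_Re z : `|Re z| <= cmod z.
Proof.
by rewrite -ler_sqr ?nnegrE ?cmod_ge0 // cmod_sqr real_normK ?num_real // lerDl sqr_ge0.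
Qed.

Lemma normr_Im z : `|Im z| <= cmod z.
Proof.
by rewrite -ler_sqr ?nnegrE ?cmod_ge0 // cmod_sqr real_normK ?num_real // lerDr sqr_ge0.
Qed.

Lemma cmod_le_Re_Im z : cmod z <= `|Re z| + `|Im z|.
Proof.
rewrite -ler_sqr ?nnegrE ?cmod_ge0 ?addr_ge0 // cmod_sqr sqrrD !real_normK ?num_real //.
by rewrite /cmod2 lerD2r lerDl mulrn_wge0 // mulr_ge0.
Qed.

Lemma cmod_conjB z w : cmod (conjc z - conjc w) = cmod (z - w).
Proof.
case: z w => a b [a' b']; rewrite !cmodE /cmod2 /=; congr Num.sqrt; ring.
Qed.

Lemma mulcC_cmod2 z : z * z^* = (cmod2 z)%:C.
Proof. by case: z => a b; rewrite /cmod2; simpc; congr Complex; ring. Qed.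

Lemma cmod2N z : cmod2 (- z) = cmod2 z.
Proof. by case: z => a b; rewrite /cmod2 /= !sqrrN. Qed.

Lemma cmod2B z w : cmod2 (z - w) = cmod2 (w - z).
Proof. by rewrite -cmod2N opprB. Qed.

Lemma cmod2_real (x : R) : cmod2 x%:C = x ^+ 2.
Proof. by rewrite /cmod2 /= expr0n addr0. Qed.

Lemma cmod2Z (x : R) z : cmod2 (x%:C * z) = x ^+ 2 * cmod2 z.
Proof. by case: z => a b; rewrite /cmod2 /=; ring. Qed.

Lemma cmod2_0 : cmod2 (0 : R[i]) = 0.
Proof. by rewrite /cmod2 /= expr0n addr0. Qed.

Lemma ReD z w : Re (z + w) = Re z + Re w.
Proof. by case: z w => ? ? [? ?]. Qed.

Lemma ImD z w : Im (z + w) = Im z + Im w.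
Proof. by case: z w => ? ? [? ?]. Qed.

Lemma ReB z w : Re (z - w) = Re z - Re w.
Proof. by case: z w => ? ? [? ?]. Qed.

Lemma ImB z w : Im (z - w) = Im z - Im w.
Proof. by case: z w => ? ? [? ?]. Qed.

Lemma Re_sum (I : Type) (s : seq I) (P : pred I) (F : I -> R[i]) :
  Re (\sum_(i <- s | P i) F i) = \sum_(i <- s | P i) Re (F i).
Proof. by apply: (big_morph _ ReD). Qed.

Lemma Im_sum (I : Type) (s : seq I) (P : pred I) (F : I -> R[i]) :
  Im (\sum_(i <- s | P i) F i) = \sum_(i <- s | P i) Im (F i).
Proof. by apply: (big_morph _ ImD). Qed.

Lemma realC_sum (I : Type) (s : seq I) (P : pred I) (F : I -> R) :
  (\sum_(i <- s | P i) F i)%:C = \sum_(i <- s | P i) (F i)%:C.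
Proof. exact: rmorph_sum. Qed.

End Cmod.

(** * Quasi-unitary equivalence from orthonormal families *)

Section Sesquilinear.
Variables (R : rcfType) (V : lmodType R[i]).

Definition linear_subspace (D : set V) : Prop :=
  D 0 /\ forall c f g, D f -> D g -> D (c *: f + g).

(** Relative to a set, since the energy forms are sesquilinear only on their domains, and without
    positivity, so that differences of energies qualify as well. *)
Definition hermitian_on (D : set V) (B : V -> V -> R[i]) : Prop :=
  (forall c f g h, D f -> D g -> D h -> B (c *: f + g) h = c * B f h + B g h) /\
  (forall f g, D f -> D g -> B g f = (B f g)^*).

Lemma subspaceD (D : set V) f g : linear_subspace D -> D f -> D g -> D (f + g).
Proof. by move=> [_ h] Df Dg; have := h 1 f g Df Dg; rewrite scale1r. Qed.

Lemma subspaceZ (D : set V) c f : linear_subspace D -> D f -> D (c *: f).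
Proof. by move=> [h0 h] Df; have := h c f 0 Df h0; rewrite addr0. Qed.

Lemma subspaceB (D : set V) f g : linear_subspace D -> D f -> D g -> D (f - g).
Proof.
by move=> sD Df Dg; rewrite -scaleN1r; apply: subspaceD => //; apply: subspaceZ.
Qed.

Variables (D : set V) (B : V -> V -> R[i]).
Hypotheses (sD : linear_subspace D) (hB : hermitian_on D B).

Lemma hermitianDr c f g h : D f -> D g -> D h ->
  B h (c *: f + g) = c^* * B h f + B h g.
Proof.
move=> Df Dg Dh; rewrite hB.2 //; last exact: sD.2.
by rewrite hB.1 // rmorphD rmorphM /= -!hB.2.
Qed.

Lemma hermitian_expand c f g : D f -> D g ->
  B (f + c *: g) (f + c *: g) =
  B f f + c * B g f + c^* * B f g + (cmod2 c)%:C * B g g.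
Proof.
move=> Df Dg; have Dcg : D (c *: g + f) by exact: sD.2.
rewrite ![f + _]addrC hB.1 // !hermitianDr // -mulcC_cmod2; ring.
Qed.

(** Semidefiniteness is enough, which matters for the difference of two energies: a null vector is
    then orthogonal to the whole domain. *)
Lemma cauchy_schwarz_on f g : (forall h, D h -> 0 <= Re (B h h)) ->
  D f -> D g -> cmod2 (B f g) <= Re (B f f) * Re (B g g).
Proof.
move=> pos Df Dg.
set a := Re (B f f); set b := Re (B g g); set m := cmod2 (B f g).
have m0 : 0 <= m by exact: cmod2_ge0'.
have b0 : 0 <= b by exact: pos.
(* Positivity at f - t B(f, g) g for real t. *)
have key (t : R) : 0 <= a - 2 * t * m + t ^+ 2 * m * b.
  have Dh : D (f + ((- t)%:C * B f g) *: g).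
    by rewrite addrC; apply: sD.2.
  have := pos _ Dh; rewrite hermitian_expand // (hB.2 f g) //.
  congr (_ <= _); rewrite !ReD -/a /b /m.
  case: (B f g) (B g g) => [x y] [u v]; rewrite /cmod2 /=; ring.
case: (ltrgtP b 0) b0 => // [bp _|be _].
  have := key b^-1; rewrite -(ler_pM2r bp) mul0r.
  rewrite (_ : (a - _ + _) * b = a * b - m) ?subr_ge0 //.
  by field; exact: lt0r_neq0.
rewrite be mulr0; case: (ltrgtP m 0) m0 => // mp _.
(* For b = 0 the bound is linear in t, and this t turns it into a - 2 (a + 1) >= 0, which is
   impossible. *)
have := key ((a + 1) / m); rewrite be mulr0 addr0.
rewrite (_ : 2 * _ * m = 2 * (a + 1)); last by field; exact: lt0r_neq0.
have := pos _ Df; rewrite -/a; lra.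
Qed.

End Sesquilinear.

Section IpSpace.
Variables (R : realType) (H : ipSpace R).
Implicit Types f g h : H.

Lemma ip_hermitian : hermitian_on setT (@ip R H).
Proof. by split=> *; [exact: ipDZ | exact: ipC]. Qed.

Lemma subspaceT (V : lmodType R[i]) : linear_subspace [set: V].
Proof. by []. Qed.

Lemma ipDl f g h : ip (f + g) h = ip f h + ip g h.
Proof. by rewrite -[f]scale1r ipDZ mul1r scale1r. Qed.

Lemma ip0l h : ip 0 h = 0.
Proof. by apply: (addIr (ip 0 h)); rewrite -ipDl addr0 add0r. Qed.

Lemma ipZl c f h : ip (c *: f) h = c * ip f h.
Proof. by rewrite -[c *: f]addr0 ipDZ ip0l addr0. Qed.

Lemma ipBl f g h : ip (f - g) h = ip f h - ip g h.
Proof. by rewrite ipDl -scaleN1r ipZl mulN1r. Qed.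

Lemma ip_suml (I : Type) (s : seq I) (P : pred I) (F : I -> H) h :
  ip (\sum_(i <- s | P i) F i) h = \sum_(i <- s | P i) ip (F i) h.
Proof.
by apply: (big_morph (fun x => ip x h)); [move=> x y; exact: ipDl|exact: ip0l].
Qed.

Lemma ipDr f g h : ip h (f + g) = ip h f + ip h g.
Proof. by rewrite ipC ipDl rmorphD /= -!ipC. Qed.

Lemma ipZr c f h : ip h (c *: f) = c^* * ip h f.
Proof. by rewrite ipC ipZl rmorphM /= -ipC. Qed.

Lemma ip_sumr (I : Type) (s : seq I) (P : pred I) (F : I -> H) h :
  ip h (\sum_(i <- s | P i) F i) = \sum_(i <- s | P i) ip h (F i).
Proof. by rewrite ipC ip_suml rmorph_sum; apply: eq_bigr => i _ /=; rewrite -ipC. Qed.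

Lemma Re_ip_ge0 f : 0 <= Re (ip f f).
Proof. by have := ip_ge0 f; rewrite lecE /= => /andP[]. Qed.

Lemma hnorm_ge0 f : 0 <= hnorm f. Proof. exact: sqrtr_ge0. Qed.

Lemma hnorm_sqr f : hnorm f ^+ 2 = Re (ip f f).
Proof. by rewrite sqr_sqrtr // Re_ip_ge0. Qed.

Lemma hnormD f g : hnorm (f + g) <= hnorm f + hnorm g.
Proof.
rewrite -ler_sqr ?nnegrE ?addr_ge0 ?hnorm_ge0 // sqrrD !hnorm_sqr.
rewrite ipDl !ipDr !ReD.
have cs : cmod2 (ip f g) <= (hnorm f * hnorm g) ^+ 2.
  rewrite exprMn !hnorm_sqr.
  by apply: (cauchy_schwarz_on (@subspaceT H) ip_hermitian) => // h _; exact: Re_ip_ge0.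
have re : Re (ip f g) <= hnorm f * hnorm g.
  apply: le_trans (ler_norm _) _; apply: le_trans (normr_Re _) _.
  by rewrite -ler_sqr ?nnegrE ?cmod_ge0 ?mulr_ge0 ?hnorm_ge0 // cmod_sqr.
rewrite (ipC f g) (_ : Re (ip f g)^* = Re (ip f g)); last by case: (ip f g).
by move: re; set x := Re (ip f g); set y := hnorm f * _; rewrite mulr2n; lra.
Qed.

Lemma hnorm_triangle f g h : hnorm (f - g) <= hnorm (f - h) + hnorm (h - g).
Proof. by rewrite (_ : f - g = (f - h) + (h - g)) ?hnormD // addrA subrK. Qed.

End IpSpace.

Section Orthonormal.
Variables (R : realType) (H : ipSpace R) (I : finType) (e : I -> H).
Hypothesis on : forall i j, ip (e i) (e j) = (i == j)%:R.

Lemma ip_comb_e (c : I -> R[i]) j : ip (\sum_i c i *: e i) (e j) = c j.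
Proof.
rewrite ip_suml (bigD1 j) //= ipZl on eqxx mulr1 big1 ?addr0 // => i ij.
by rewrite ipZl on (negbTE ij) mulr0.
Qed.

Lemma hnorm_comb (c : I -> R[i]) :
  hnorm (\sum_i c i *: e i) ^+ 2 = \sum_i cmod2 (c i).
Proof.
rewrite hnorm_sqr ip_sumr Re_sum; apply: eq_bigr => i _.
by rewrite ipZr ip_comb_e mulrC mulcC_cmod2.
Qed.

(** The part of f orthogonal to the span separates from the error of the coefficients. The first
    summand shows that inner products are the best coefficients, the second is the norm of J applied
    to the error. *)
Lemma pythagoras f (c : I -> R[i]) :
  hnorm (f - \sum_i c i *: e i) ^+ 2 =
  hnorm (f - \sum_i ip f (e i) *: e i) ^+ 2 + \sum_i cmod2 (ip f (e i) - c i).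
Proof.
set g := f - \sum_i ip f (e i) *: e i.
set s := \sum_i (ip f (e i) - c i) *: e i.
have -> : f - \sum_i c i *: e i = g + s.
  have -> : s = \sum_i ip f (e i) *: e i - \sum_i c i *: e i.
    by rewrite -sumrB; apply: eq_bigr => i _; rewrite scalerBl.
  by rewrite /g addrA subrK.
have go i : ip g (e i) = 0 by rewrite /g ipBl ip_comb_e subrr.
have gs : ip g s = 0.
  by rewrite ip_sumr big1 // => i _; rewrite ipZr go mulr0.
have sg : ip s g = 0 by rewrite ipC gs conjc0.
rewrite !hnorm_sqr (ipDl g s) (ipDr g s g) (ipDr g s s) gs sg addr0 add0r ReD.
by rewrite -!hnorm_sqr hnorm_comb.
Qed.

Lemma bessel f : \sum_i cmod2 (ip f (e i)) <= hnorm f ^+ 2.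
Proof.
have := pythagoras f (fun=> 0).
rewrite big1 ?subr0 => [->|i _]; last by rewrite scale0r.
by under eq_bigr do rewrite -[ip f (e _)]subr0; rewrite lerDr sqr_ge0.
Qed.

End Orthonormal.

Section Polarisation.
Variables (R : realType) (H : ipSpace R) (a : qform H) (B : H -> H -> R[i]).
Hypotheses (sD : linear_subspace (qdom a)) (hB : hermitian_on (qdom a) B)
  (BE : forall f, qdom a f -> B f f = (qval a f)%:C).

(** In the polarisation sum the diagonal terms and one of the two mixed terms cancel, so any
    hermitian form with the right diagonal is the polar form. *)
Lemma polarE f g : qdom a f -> qdom a g -> polar a f g = B f g.
Proof.
move=> Df Dg; rewrite /polar !big_ord_recr big_ord0 /= add0r.
have E c : (qval a (f + c *: g))%:C =
    B f f + c * B g f + c^* * B f g + (cmod2 c)%:C * B g g.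
  rewrite -BE ?(hermitian_expand sD hB) // addrC; exact: sD.2.
rewrite !E.
have i2 : 'i%C ^+ 2 = -1 :> R[i] by exact: sqr_i.
have i3 : 'i%C ^+ 3 = - 'i%C :> R[i] by rewrite exprS i2 mulrN1.
rewrite i2 i3 expr0 expr1 rmorphN1 rmorph1.
have ci : conjc ('i%C : R[i]) = - 'i%C by simpc.
have cni : conjc (- 'i%C : R[i]) = 'i%C by apply/eqP; rewrite eq_complex /= oppr0 opprK !eqxx.
rewrite !conjCE cni ci.
have n1 : cmod2 (1 : R[i]) = 1 by rewrite /cmod2 /= expr1n expr0n addr0.
have ni : cmod2 ('i%C : R[i]) = 1 by rewrite /cmod2 /= expr1n expr0n add0r.
rewrite !cmod2N n1 ni.
apply: (canLR (mulKf _)); first by rewrite pnatr_eq0.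
set x := B f f; set y := B g g; set z := B f g; set w := B g f.
have ii : 'i%C * 'i%C = -1 :> R[i] by rewrite -expr2.
rewrite rmorph1.
(* [ring] does not know that i^2 = -1, so the identity is proved for an arbitrary scalar with i * i
   left standing. *)
have -> (i : R[i]) : 1 * (x + 1 * w + 1 * z + 1 * y) +
   i * (x + i * w + - i * z + 1 * y) + -1 * (x + -1 * w + -1 * z + 1 * y) +
   - i * (x + - i * w + i * z + 1 * y) =
   2 * (z + w) + 2 * (i * i) * (w - z) by ring.
by rewrite ii; ring.
Qed.

Lemma quadratic_of_hermitian : quadratic a.
Proof.
split.
- exact: sD.1.
- exact: sD.2.
- by move=> c f g h Df Dg Dh; rewrite !polarE ?hB.1 //; apply: sD.2.
- by move=> f g Df Dg; rewrite !polarE ?(hB.2 f g).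
- by move=> f Df; rewrite polarE ?BE.
Qed.

End Polarisation.

Section EnergyForm.
Variables (R : realType) (H : ipSpace R) (a : qform H).

Lemma polar_scale (t : R) f g : polar (scale_form t a) f g = t%:C * polar a f g.
Proof.
rewrite /polar mulrCA [in RHS]mulr_sumr; congr (_ * _); apply: eq_bigr => k _ /=.
by rewrite rmorphM /= mulrCA.
Qed.

Lemma quadratic_scale (t : R) : quadratic a -> quadratic (scale_form t a).
Proof.
case=> h0 h1 h2 h3 h4; split => //.
- by move=> c f g h Df Dg Dh; rewrite !polar_scale h2 //; ring.
- by move=> f g Df Dg; rewrite !polar_scale (h3 f g) // [RHS]rmorphM /= oppr0.
- by move=> f Df; rewrite polar_scale h4 //= rmorphM.
Qed.

Lemma norm1_sqr f : 0 <= qval a f -> norm1 a f ^+ 2 = hnorm f ^+ 2 + qval a f.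
Proof. by move=> q0; rewrite sqr_sqrtr // addr_ge0 // sqr_ge0. Qed.

Lemma hnorm_le_norm1 f : 0 <= qval a f -> hnorm f <= norm1 a f.
Proof.
by move=> q0; rewrite -ler_sqr ?nnegrE ?hnorm_ge0 ?sqrtr_ge0 // norm1_sqr // lerDl.
Qed.

Lemma sqrt_qval_le_norm1 f : 0 <= qval a f -> Num.sqrt (qval a f) <= norm1 a f.
Proof. by move=> q0; rewrite ler_sqrt ?lerDr ?sqr_ge0 // addr_ge0 ?sqr_ge0. Qed.

(** The form norm is split into its L2 part and its energy part: [scale_form] then affects only one
    of them, and each part can be estimated on its own. *)
Definition closed_form : Prop :=
  forall u : nat -> H, (forall n, qdom a (u n)) ->
  (forall e, 0 < e -> exists n0, forall m n, (n0 <= m)%N -> (n0 <= n)%N ->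
     hnorm (u m - u n) < e) ->
  (forall e, 0 < e -> exists n0, forall m n, (n0 <= m)%N -> (n0 <= n)%N ->
     qval a (u m - u n) < e) ->
  exists2 f, qdom a f & (forall e, 0 < e -> exists n0, forall n, (n0 <= n)%N ->
     hnorm (u n - f) < e /\ qval a (u n - f) < e).

Lemma complete_norm1 : linear_subspace (qdom a) ->
  (forall f, qdom a f -> 0 <= qval a f) -> closed_form ->
  complete_for (qdom a) (norm1 a).
Proof.
move=> sD q0 cl u Du Cu.
have DB m n : qdom a (u m - u n) by exact: subspaceB.
have [|e e0|f Df lim] := cl u Du.
- move=> e e0; have [n0 Hn] := Cu e e0; exists n0 => m n hm hn.
  by apply: le_lt_trans (Hn m n hm hn); apply: hnorm_le_norm1; exact: q0.
- have se : 0 < Num.sqrt e by rewrite sqrtr_gt0.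
  have [n0 Hn] := Cu _ se; exists n0 => m n hm hn.
  have := Hn m n hm hn; rewrite -[in X in X -> _]ltr_sqr ?nnegrE ?sqrtr_ge0 //.
  rewrite norm1_sqr ?q0 // [Num.sqrt e ^+ 2]sqr_sqrtr ?ltW // => lt_e.
  by apply: le_lt_trans lt_e; rewrite lerDr sqr_ge0.
exists f => //; apply/cvgrPdist_lt => e e0.
(* The squared form norm is then below e^2 / 4 + e^2 / 2 < e^2. *)
set e' := Num.min (e / 2) (e ^+ 2 / 2).
have e'0 : 0 < e' by rewrite lt_min !divr_gt0 ?exprn_gt0.
have [n0 Hn] := lim _ e'0.
exists n0 => // n /= hn; have [h1 h2] := Hn n hn.
rewrite sub0r normrN ger0_norm ?sqrtr_ge0 //.
have Df' : qdom a (u n - f) by exact: subspaceB.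
rewrite -ltr_sqr ?nnegrE ?sqrtr_ge0 ?ltW // norm1_sqr ?q0 //.
have h3 : qval a (u n - f) < e ^+ 2 / 2.
  by apply: lt_le_trans h2 _; rewrite ge_min lexx orbT.
have h4 : hnorm (u n - f) < e / 2 by apply: lt_le_trans h1 _; rewrite ge_min lexx.
have h5 := hnorm_ge0 (u n - f); nra.
Qed.

Lemma closed_form_scale (t : R) : 0 < t -> closed_form ->
  forall u : nat -> H, (forall n, qdom a (u n)) ->
  (forall e, 0 < e -> exists n0, forall m n, (n0 <= m)%N -> (n0 <= n)%N ->
     hnorm (u m - u n) < e) ->
  (forall e, 0 < e -> exists n0, forall m n, (n0 <= m)%N -> (n0 <= n)%N ->
     t * qval a (u m - u n) < e) ->
  exists2 f, qdom a f & (forall e, 0 < e -> exists n0, forall n, (n0 <= n)%N ->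
     hnorm (u n - f) < e /\ t * qval a (u n - f) < e).
Proof.
move=> t0 cl u Du C1 C2; have [//|e e0|f Df lim] := cl u Du.
  have [n0 Hn] := C2 (t * e) (mulr_gt0 t0 e0); exists n0 => m n hm hn.
  by have := Hn m n hm hn; rewrite ltr_pM2l.
exists f => // e e0.
have [|n0 Hn] := lim (Num.min e (e / t)); first by rewrite lt_min e0 divr_gt0.
exists n0 => n hn; have [] := Hn n hn; rewrite !lt_min => /andP[-> _] /andP[_].
by rewrite ltr_pdivlMr // mulrC.
Qed.

End EnergyForm.

Section QuasiUnitary.
Variables (R : realType) (H H' : ipSpace R) (I : finType).
Variables (e : I -> H) (e' : I -> H').
Hypothesis on : forall i j, ip (e i) (e j) = (i == j)%:R.
Hypothesis on' : forall i j, ip (e' i) (e' j) = (i == j)%:R.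

Let J (f : H) : H' := \sum_i ip f (e i) *: e' i.

Lemma hnormJ f : hnorm (J f) <= hnorm f.
Proof.
rewrite -ler_sqr ?nnegrE ?hnorm_ge0 // hnorm_comb //; exact: bessel.
Qed.

Lemma J_bounded : bounded_operator setT setT (@hnorm R H) (@hnorm R H') J.
Proof.
split=> // [c f g _ _|]; last by exists 1 => f _; rewrite mul1r hnormJ.
rewrite /J scaler_sumr -big_split; apply: eq_bigr => i _ /=.
by rewrite ipDZ scalerDl scalerA.
Qed.

Variables (a : qform H) (a' : qform H').
Hypothesis (q0 : forall f, qdom a f -> 0 <= qval a f).
Hypothesis (q0' : forall f, qdom a' f -> 0 <= qval a' f).
Variables (eta : R) (p : H -> I -> R[i]) (p' : H' -> I -> R[i]).
Hypothesis eta0 : 0 <= eta.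
Hypothesis approx : forall f, qdom a f ->
  hnorm (f - \sum_i p f i *: e i) <= eta * Num.sqrt (qval a f).
Hypothesis approx' : forall u, qdom a' u ->
  hnorm (u - \sum_i p' u i *: e' i) <= eta * Num.sqrt (qval a' u).
Variable J1 : H -> H'.
Hypothesis J1dom : forall f, qdom a f -> qdom a' (J1 f).
Hypothesis J1lin : forall c f g, qdom a f -> qdom a g ->
  J1 (c *: f + g) = c *: J1 f + J1 g.
Hypothesis J1q : forall f, qdom a f -> qval a' (J1 f) <= qval a f.
Hypothesis J1p : forall f, qdom a f -> p' (J1 f) =1 p f.

(** The orthogonal projection is at least as good as any other element of the span, in particular
    the one with coefficients [p f]. *)
Lemma projection_error f : qdom a f ->
  hnorm (f - \sum_i ip f (e i) *: e i) <= eta * Num.sqrt (qval a f).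
Proof.
move=> Df; apply: le_trans (approx Df).
rewrite -ler_sqr ?nnegrE ?hnorm_ge0 // (pythagoras on f (p f)) lerDl.
by apply: sumr_ge0 => i _; exact: cmod2_ge0'.
Qed.

(** The triangle inequality passes through the combination of the [e' i] with coefficients [p f]. It
    approximates [J1 f], which has the same coefficients, and it is close to [J f] because J does
    not increase the error of the corresponding combination in the first space. *)
Lemma J1_error f : qdom a f ->
  hnorm (J1 f - J f) <= 2 * eta * Num.sqrt (qval a f).
Proof.
move=> Df; apply: le_trans (hnorm_triangle _ _ (\sum_i p f i *: e' i)) _.
rewrite -mulrA mulr2n mulrDl mul1r; apply: lerD.
  apply: (@le_trans _ _ (eta * Num.sqrt (qval a' (J1 f)))).
    by under eq_bigr do rewrite -(J1p Df); apply: approx'; exact: J1dom.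
  by rewrite ler_wpM2l // ler_sqrt ?q0 // J1q.
apply: le_trans (approx Df); rewrite -ler_sqr ?nnegrE ?hnorm_ge0 //.
rewrite (pythagoras on f (p f)) /J -sumrB.
under eq_bigr do rewrite -scalerBl.
rewrite hnorm_comb // ; under eq_bigr do rewrite cmod2B.
by rewrite lerDr sqr_ge0.
Qed.

Lemma J1_bounded : bounded_operator (qdom a) (qdom a') (norm1 a) (norm1 a') J1.
Proof.
(* Relative to the form norm of f, the norm of [J1 f] is at most 2 eta + 1 and the root of its
   energy at most 1, and (2 eta + 1)^2 + 1 <= (2 eta + 2)^2. *)
split=> //; exists (2 * eta + 2) => f Df.
have n1 := norm1_sqr (q0 Df); have n2 := norm1_sqr (q0' (J1dom Df)).
have m0 : 0 <= norm1 a f by exact: sqrtr_ge0.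
have h1 : hnorm (J1 f) <= (2 * eta + 1) * norm1 a f.
  rewrite -[J1 f](subrK (J f)); apply: le_trans (hnormD _ _) _.
  rewrite mulrDl mul1r; apply: lerD.
    apply: le_trans (J1_error Df) _; rewrite ler_wpM2l ?mulr_ge0 //.
    exact: sqrt_qval_le_norm1 (q0 Df).
  exact: le_trans (hnormJ _) (hnorm_le_norm1 (q0 Df)).
rewrite -ler_sqr ?nnegrE ?sqrtr_ge0 //; last by rewrite mulr_ge0 ?addr_ge0 ?mulr_ge0.
rewrite n2; have h2 := J1q Df; have h3 := hnorm_ge0 (J1 f).
apply: (@le_trans _ _ (((2 * eta + 1) * norm1 a f) ^+ 2 + norm1 a f ^+ 2)).
  apply: lerD; first by rewrite ler_sqr ?nnegrE ?mulr_ge0 ?addr_ge0 ?mulr_ge0.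
  by rewrite n1; apply: le_trans h2 _; rewrite lerDr sqr_ge0.
rewrite !exprMn -[X in _ + X]mul1r -mulrDl ler_wpM2r ?sqr_ge0 //.
by have := eta0; nra.
Qed.

End QuasiUnitary.

(* With [J f = sum_i <f, e i> e' i] and [J' u = sum_i <u, e' i> e i] the
   adjointness and energy errors vanish; the other errors are distances to the
   spans of the two orthonormal families. *)
Lemma quasi_unitary_of_cells (R : realType) (H H' : ipSpace R) (I : finType)
    (e : I -> H) (e' : I -> H') (a : qform H) (a' : qform H') (eta : R)
    (p : H -> I -> R[i]) (p' : H' -> I -> R[i]) (J1 : H -> H') (J1' : H' -> H) :
  (forall i j, ip (e i) (e j) = (i == j)%:R) ->
  (forall i j, ip (e' i) (e' j) = (i == j)%:R) ->
  energy_form a -> energy_form a' -> 0 <= eta ->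
  (forall f, qdom a f ->
    hnorm (f - \sum_i p f i *: e i) <= eta * Num.sqrt (qval a f)) ->
  (forall u, qdom a' u ->
    hnorm (u - \sum_i p' u i *: e' i) <= eta * Num.sqrt (qval a' u)) ->
  (forall f, qdom a f ->
    [/\ qdom a' (J1 f), qval a' (J1 f) <= qval a f & p' (J1 f) =1 p f]) ->
  (forall c f g, qdom a f -> qdom a g -> J1 (c *: f + g) = c *: J1 f + J1 g) ->
  (forall u, qdom a' u ->
    [/\ qdom a (J1' u), qval a (J1' u) <= qval a' u & p (J1' u) =1 p' u]) ->
  (forall c u v, qdom a' u -> qdom a' v ->
    J1' (c *: u + v) = c *: J1' u + J1' v) ->
  (forall f u, qdom a f -> qdom a' u -> polar a' (J1 f) u = polar a f (J1' u)) ->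
  quasi_unitarily_equivalent (2 * eta) a a'.
Proof.
move=> on on' ea ea' eta0 ap ap' hJ1 J1lin hJ1' J1lin' pol.
have q0 : forall f, qdom a f -> 0 <= qval a f by case: ea.
have q0' : forall f, qdom a' f -> 0 <= qval a' f by case: ea'.
have d0 : 0 <= 2 * eta by rewrite mulr_ge0.
have sq f : qdom a f -> 2 * eta * Num.sqrt (qval a f) <= 2 * eta * norm1 a f.
  by move=> Df; rewrite ler_wpM2l // sqrt_qval_le_norm1 // q0.
have sq' f : qdom a' f -> 2 * eta * Num.sqrt (qval a' f) <= 2 * eta * norm1 a' f.
  by move=> Df; rewrite ler_wpM2l // sqrt_qval_le_norm1 // q0'.
have half (x : R) : 0 <= x -> eta * x <= 2 * eta * x.
  by move=> x0; rewrite -mulrA ler_peMl ?mulr_ge0 // ler1n.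
split=> //; exists (fun f => \sum_i ip f (e i) *: e' i).
exists (fun u => \sum_i ip u (e' i) *: e i), J1, J1'; split; split.
- exact: J_bounded.
- exact: J_bounded.
- by apply: (J1_bounded on on' q0 q0' eta0 ap ap') => // f /hJ1[].
- by apply: (J1_bounded on' on q0' q0 eta0 ap' ap) => // f /hJ1'[].
- move=> f; apply: le_trans (hnormJ on on' f) _.
  by rewrite ler_peMl ?hnorm_ge0 // lerDl.
- move=> f u; rewrite ip_suml ip_sumr.
  have -> : \sum_i ip f (ip u (e' i) *: e i) = \sum_i ip (ip f (e i) *: e' i) u.
    by apply: eq_bigr => i _; rewrite ipZr ipZl (ipC u (e' i)) conjCE mulrC.
  by rewrite subrr cmod0 !mulr_ge0 ?hnorm_ge0.
- split.
  (* J' J is the orthogonal projection onto the span of the [e i], because [ip_comb_e] reads the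
     coefficients back. *)
  + move=> f Df; apply: le_trans (sq _ Df).
    apply: le_trans (half _ (sqrtr_ge0 _)).
    apply: le_trans (projection_error on ap Df); rewrite le_eqVlt; apply/orP; left.
    by apply/eqP; congr (hnorm (_ - _)); apply: eq_bigr => i _; rewrite ip_comb_e.
  + move=> f Df; apply: le_trans (sq' _ Df).
    apply: le_trans (half _ (sqrtr_ge0 _)).
    apply: le_trans (projection_error on' ap' Df); rewrite le_eqVlt; apply/orP; left.
    by apply/eqP; congr (hnorm (_ - _)); apply: eq_bigr => i _; rewrite ip_comb_e.
- split.
  + move=> f Df; apply: le_trans (sq _ Df).
    by apply: (J1_error on on' q0 eta0 ap ap') => // g /hJ1[].
  + move=> f Df; apply: le_trans (sq' _ Df).
    by apply: (J1_error on' on q0' eta0 ap' ap) => // g /hJ1'[].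
- move=> f u Df Du; rewrite pol // subrr cmod0 !mulr_ge0 ?sqrtr_ge0 //.
Qed.

(** * Completeness and density in L2 *)

Section ComplexLimits.
Variable R : realType.

Lemma cauchy_cvgn (u : nat -> R) :
  (forall e, 0 < e -> exists n0, forall m n, (n0 <= m)%N -> (n0 <= n)%N ->
     `|u m - u n| < e) -> cvgn u.
Proof.
move=> h; apply/cauchy_cvgP/cauchy_ballP => e e0.
have [n0 hn] := h e e0.
exists (u @` [set k | (n0 <= k)%N], u @` [set k | (n0 <= k)%N]) => /=.
  by split; exists n0 => // k /= hk; exists k.
by move=> [x y] /= [[m hm <-] [n hn' <-]]; rewrite /ball /=; exact: hn.
Qed.

(** The norm of the normed module [R[i]^o] is itself complex-valued; with the real modulus all
    tolerances stay in [R]. *)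
Definition ccvg (u : nat -> R[i]) (l : R[i]) : Prop :=
  forall e : R, 0 < e -> exists n0, forall n, (n0 <= n)%N -> cmod (u n - l) < e.

Lemma cauchy_ccvg (u : nat -> R[i]) :
  (forall e : R, 0 < e -> exists n0, forall m n, (n0 <= m)%N -> (n0 <= n)%N ->
     cmod (u m - u n) < e) -> exists l, ccvg u l.
Proof.
move=> h.
have cr : cvgn (fun n => Re (u n)).
  apply: cauchy_cvgn => e e0; have [n0 hn] := h e e0; exists n0 => m n hm hn'.
  by rewrite -ReB; apply: le_lt_trans (normr_Re _) (hn _ _ hm hn').
have ci : cvgn (fun n => Im (u n)).
  apply: cauchy_cvgn => e e0; have [n0 hn] := h e e0; exists n0 => m n hm hn'.
  by rewrite -ImB; apply: le_lt_trans (normr_Im _) (hn _ _ hm hn').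
exists (limn (fun n => Re (u n)) +i* limn (fun n => Im (u n))) => e e0.
have e2 : 0 < e / 2 by rewrite divr_gt0.
have [n1 _ h1] := (cvgrPdist_lt _ _).1 cr _ e2.
have [n2 _ h2] := (cvgrPdist_lt _ _).1 ci _ e2.
exists (maxn n1 n2) => n; rewrite geq_max => /andP[/h1 /= k1 /h2 /= k2].
apply: le_lt_trans (cmod_le_Re_Im _) _; rewrite ReB ImB /= distrC.
by rewrite [X in _ + X]distrC (splitr e) ltrD.
Qed.

Lemma ccvg_unique (u : nat -> R[i]) l l' : ccvg u l -> ccvg u l' -> l = l'.
Proof.
move=> h h'; apply/eqP; rewrite -subr_eq0; apply/eqP/cmod_eq0/eqP.
rewrite eq_le cmod_ge0 andbT; apply/ler_addgt0Pl => e e0; rewrite addr0.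
have e2 : 0 < e / 2 by rewrite divr_gt0.
have [n1 h1] := h _ e2; have [n2 h2] := h' _ e2.
have k1 := h1 _ (leq_maxl n1 n2); have k2 := h2 _ (leq_maxr n1 n2).
apply: le_trans (cmod_triangle _ _ (u (maxn n1 n2))) _.
by rewrite cmodB (splitr e) lerD // ltW.
Qed.

Lemma ccvg_le (u : nat -> R[i]) l z (c : R) n0 : ccvg u l ->
  (forall n, (n0 <= n)%N -> cmod (u n - z) <= c) -> cmod (l - z) <= c.
Proof.
move=> h hc; apply/ler_addgt0Pl => e e0.
have [n1 h1] := h _ e0.
have k1 := h1 _ (leq_maxr n0 n1); have k2 := hc _ (leq_maxl n0 n1).
apply: le_trans (cmod_triangle _ _ (u (maxn n0 n1))) _.
by rewrite cmodB lerD // ltW.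
Qed.

Lemma ccvg_shift (u : nat -> R[i]) l k : ccvg u l -> ccvg (fun n => u (n + k)%N) l.
Proof.
by move=> h e /h[n0 hn]; exists n0 => n hn0; apply: hn; rewrite (leq_trans hn0) ?leq_addr.
Qed.

Lemma ccvgDZ (u v : nat -> R[i]) l l' c :
  ccvg u l -> ccvg v l' -> ccvg (fun n => c * u n + v n) (c * l + l').
Proof.
move=> h h' e e0.
have c0 : 0 < cmod c + 1 by rewrite ltr_wpDl ?cmod_ge0.
have e1 : 0 < e / 2 / (cmod c + 1) by rewrite !divr_gt0.
have e2 : 0 < e / 2 by rewrite divr_gt0.
have [n1 h1] := h _ e1; have [n2 h2] := h' _ e2.
exists (maxn n1 n2) => n; rewrite geq_max => /andP[/h1 k1 /h2 k2].
rewrite (_ : _ - _ = c * (u n - l) + (v n - l')); last by ring.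
apply: le_lt_trans (cmodD _ _) _; rewrite (splitr e) cmodM; apply: ler_ltD => //.
apply: (@le_trans _ _ ((cmod c + 1) * cmod (u n - l))).
  by rewrite ler_wpM2r ?cmod_ge0 // lerDl.
by move: k1; rewrite ltr_pdivlMr // mulrC => /ltW.
Qed.

Lemma ccvg_Re (u : nat -> R[i]) l : ccvg u l -> (fun n => Re (u n)) @ \oo --> Re l.
Proof.
move=> h; apply/cvgrPdist_lt => e /h[n0 hn]; exists n0 => // n /= /hn.
by apply: le_lt_trans; rewrite distrC -ReB normr_Re.
Qed.

Lemma ccvg_Im (u : nat -> R[i]) l : ccvg u l -> (fun n => Im (u n)) @ \oo --> Im l.
Proof.
move=> h; apply/cvgrPdist_lt => e /h[n0 hn]; exists n0 => // n /= /hn.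
by apply: le_lt_trans; rewrite distrC -ImB normr_Im.
Qed.

Lemma ccvg_cmod2 (u : nat -> R[i]) l z : ccvg u l ->
  (fun n => cmod2 (z - u n)) @ \oo --> cmod2 (z - l).
Proof.
move=> h; rewrite /cmod2 ReB ImB; under eq_fun do rewrite ReB ImB.
apply: cvgD; rewrite !expr2; apply: cvgM; apply: cvgB; try exact: cvg_cst.
all: try exact: ccvg_Re; exact: ccvg_Im.
Qed.

Lemma geometric_dist (u : nat -> R[i]) (M q : R) : 0 <= q < 1 -> 0 <= M ->
  (forall n, cmod (u n.+1 - u n) <= M * q ^+ n) ->
  forall n k, cmod (u (n + k)%N - u n) <= M / (1 - q) * q ^+ n.
Proof.
move=> /andP[q0 q1] M0 h n k.
have p : 0 < 1 - q by rewrite subr_gt0.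
(* The partial geometric sum is kept, since the bound without the factor 1 - q^k is not
   inductive. *)
suff : cmod (u (n + k)%N - u n) <= M / (1 - q) * q ^+ n * (1 - q ^+ k).
  move/le_trans; apply; apply: ler_piMr; last by rewrite gerBl exprn_ge0.
  by rewrite !mulr_ge0 ?exprn_ge0 // invr_ge0 ltW.
elim: k => [|k IH]; first by rewrite addn0 subrr cmod0 expr0 subrr mulr0.
apply: le_trans (cmod_triangle _ _ (u (n + k)%N)) _.
rewrite addnS; apply: le_trans (lerD (h _) IH) _.
rewrite le_eqVlt; apply/orP; left; apply/eqP; rewrite exprD exprS; field.
exact: lt0r_neq0.
Qed.

Lemma geometric_small (M q e : R) : 0 <= q < 1 -> 0 < e ->
  exists n0, forall n, (n0 <= n)%N -> M * q ^+ n < e.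
Proof.
move=> /andP[q0 q1] e0.
have : (fun n => M * q ^+ n) @ \oo --> (0 : R).
  rewrite -[X in _ --> X](mulr0 M); apply: cvgM; first exact: cvg_cst.
  by apply: cvg_expr; rewrite ger0_norm.
move/cvgrPdist_lt => /(_ _ e0)[n0 _ hn]; exists n0 => n /hn /=.
by rewrite sub0r normrN; apply: le_lt_trans; exact: ler_norm.
Qed.

Lemma geometric_ccvg (u : nat -> R[i]) (M q : R) : 0 <= q < 1 -> 0 <= M ->
  (forall n, cmod (u n.+1 - u n) <= M * q ^+ n) ->
  exists2 l, ccvg u l & forall n, cmod (l - u n) <= M / (1 - q) * q ^+ n.
Proof.
move=> q01 M0 h; have G := geometric_dist q01 M0 h.
have [l cl] : exists l, ccvg u l.
  apply: cauchy_ccvg => e e0.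
  have e2 : 0 < e / 2 by rewrite divr_gt0.
  have [n0 hn] := geometric_small (M / (1 - q)) q01 e2.
  exists n0 => m n hm hn'; have k := hn _ (leqnn n0).
  apply: le_lt_trans (cmod_triangle _ _ (u n0)) _.
  rewrite (splitr e) [X in _ + X]cmodB -(subnKC hm) -(subnKC hn').
  by apply: ltrD; apply: le_lt_trans (G _ _) k.
exists l => // n; apply: (ccvg_le (n0 := n)) cl _ => m /subnKC <-; exact: G.
Qed.

End ComplexLimits.

Section SqNorm.
Context d (T : measurableType d) (R : realType).
Variable mu : {measure set T -> \bar R}.
Implicit Types f g : T -> R[i].
Local Open Scope ereal_scope.
Local Open Scope quotient_scope.

(** Extended-real, so that the theorems on integrals of nonnegative functions apply before
    finiteness is known. *)
Definition sqn f : \bar R := \int[mu]_x (cmod2 (f x))%:E.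

Lemma sqn_ge0 f : 0 <= sqn f.
Proof. by apply: integral_ge0 => x _; rewrite lee_fin cmod2_ge0. Qed.

Lemma measurable_cmod2E f : cmeasurable f ->
  measurable_fun setT (fun x => (cmod2 (f x))%:E).
Proof. by move=> mf; exact/measurable_EFinP/cmeasurable_cmod2. Qed.

Lemma cmeasurableB f g : cmeasurable f -> cmeasurable g ->
  cmeasurable (fun x => f x - g x)%R.
Proof.
move=> mf mg; rewrite (_ : (fun x => _) = (fun x => f x + (-1) * g x)%R).
  by apply: cmeasurableD => //; apply: cmeasurableM => //; exact: cmeasurable_cst.
by apply/funext => x; rewrite mulN1r.
Qed.

Lemma sqn_ae f g : cmeasurable f -> cmeasurable g ->
  {ae mu, forall x, f x = g x} -> sqn f = sqn g.
Proof.
move=> mf mg fg; apply: ge0_ae_eq_integral => //.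
- exact: measurable_cmod2E.
- exact: measurable_cmod2E.
- by move=> x _; rewrite lee_fin cmod2_ge0.
- by move=> x _; rewrite lee_fin cmod2_ge0.
- by apply: filterS fg => x /= -> _.
Qed.

Lemma sq_integrableB f g : sq_integrable mu f -> sq_integrable mu g ->
  sq_integrable mu (fun x => f x - g x)%R.
Proof.
move=> mf mg; rewrite (_ : (fun x => _) = (fun x => f x + (-1) * g x)%R).
  by apply: sq_integrableD => //; exact: sq_integrableZ.
by apply/funext => x; rewrite mulN1r.
Qed.

Lemma cintegrable_ae f g : sq_integrable mu f -> cmeasurable g ->
  {ae mu, forall x, f x = g x} -> sq_integrable mu g.
Proof.
move=> [mf fi] mg fg; split=> //; rewrite -/(sqn g) -(sqn_ae mf mg fg) //.
Qed.

Definition L2mk f (hf : sq_integrable mu f) : L2 mu := \pi_(L2 mu) (MkL2fun hf).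

Lemma L2mkE f (hf : sq_integrable mu f) : {ae mu, forall x, L2mk hf x = f x}.
Proof. exact: (L2piE (MkL2fun hf)). Qed.

Lemma hnorm_sqn (F : L2space mu) f : cmeasurable f ->
  {ae mu, forall x, (F : L2 mu) x = f x} -> ((hnorm F) ^+ 2)%:E = sqn f.
Proof.
move=> mf Ff; rewrite hnorm_sqr (L2ipE F : ip F F = _).
rewrite /= /Rintegral fineK.
  exact: (sqn_ae (L2_sqint F).1 mf Ff).
rewrite ge0_fin_numE; first exact: (L2_sqint F).2.
by apply: integral_ge0 => x _; rewrite lee_fin cmod2_ge0.
Qed.

Lemma L2BE (F G : L2 mu) : {ae mu, forall x, (F - G : L2 mu)%R x = (F x - G x)%R}.
Proof.
near=> x; rewrite (near (L2DE F (- G)%R) x)//; congr +%R.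
rewrite -scaleN1r (near (L2ZE (-1)%R G) x)//; exact: mulN1r.
Unshelve. all: by end_near. Qed.

Lemma L2sumE (I : Type) (s : seq I) (c : I -> R[i]) (F : I -> L2 mu) :
  {ae mu, forall x, (\sum_(i <- s) c i *: F i : L2 mu)%R x = (\sum_(i <- s) c i * F i x)%R}.
Proof.
elim: s => [|i s IH].
  by apply: filterS (L2zeroE mu) => x h; rewrite !big_nil.
near=> x; rewrite !big_cons.
rewrite (near (L2DE (c i *: F i) (\sum_(j <- s) c j *: F j)%R) x)//.
by rewrite (near (L2ZE (c i) (F i)) x)// (near IH x).
Unshelve. all: by end_near. Qed.

Lemma hnormB_sqn (F G : L2space mu) f g : cmeasurable f -> cmeasurable g ->
  {ae mu, forall x, (F : L2 mu) x = f x} -> {ae mu, forall x, (G : L2 mu) x = g x} ->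
  ((hnorm (F - G)%R) ^+ 2)%:E = sqn (fun x => f x - g x)%R.
Proof.
move=> mf mg hf hg; apply: hnorm_sqn; first exact: cmeasurableB.
by apply: filterS3 (L2BE F G) hf hg => x /= -> -> ->.
Qed.

Lemma ip_cintegral (F G : L2space mu) f g : cmeasurable f -> cmeasurable g ->
  {ae mu, forall x, (F : L2 mu) x = f x} -> {ae mu, forall x, (G : L2 mu) x = g x} ->
  ip F G = cintegral mu setT (fun x => f x * (g x)^*)%R.
Proof.
move=> mf mg hf hg; apply: cintegral_ae; first exact: L2ip_cmeas.
  by apply: cmeasurableM => //; exact: cmeasurableJ.
by apply: filterS2 hf hg => x /= -> ->.
Qed.

Lemma hnorm_lt (F : L2space mu) (e : R) : (0 < e)%R ->
  ((hnorm F ^+ 2)%:E < (e ^+ 2)%:E) = (hnorm F < e)%R.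
Proof. by move=> e0; rewrite lte_fin ltr_sqr ?nnegrE ?hnorm_ge0 // ltW. Qed.

Lemma sqnD_le f g : cmeasurable f -> cmeasurable g ->
  sqn (fun x => f x + g x)%R <= 2%:E * sqn f + 2%:E * sqn g.
Proof.
move=> mf mg.
have m2 h : cmeasurable h -> measurable_fun setT (fun x : T => (2 * cmod2 (h x))%:E).
  by move=> mh; apply/measurable_EFinP; apply: measurable_funM => //; exact: cmeasurable_cmod2.
apply: (@le_trans _ _ (\int[mu]_x ((2 * cmod2 (f x))%:E + (2 * cmod2 (g x))%:E))).
  apply: ge0_le_integral => //.
  - by move=> x _; rewrite lee_fin cmod2_ge0.
  - exact/measurable_cmod2E/cmeasurableD.
  - by apply: emeasurable_funD; exact: m2.
  - by move=> x _; rewrite -EFinD lee_fin cmod2D_le.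
rewrite ge0_integralD//; last 4 first.
- by move=> x _; rewrite lee_fin mulr_ge0 ?cmod2_ge0.
- exact: m2.
- by move=> x _; rewrite lee_fin mulr_ge0 ?cmod2_ge0.
- exact: m2.
have E h : cmeasurable h -> \int[mu]_x (2 * cmod2 (h x))%:E = 2%:E * sqn h.
  move=> mh; rewrite -ge0_integralZl_EFin //.
    by move=> x _; rewrite lee_fin cmod2_ge0.
  exact: measurable_cmod2E.
by rewrite !E.
Qed.

Lemma sqnZ c f : cmeasurable f -> sqn (fun x => c * f x)%R = (cmod2 c)%:E * sqn f.
Proof.
move=> mf; rewrite -ge0_integralZl_EFin ?cmod2_ge0 //.
- by apply: eq_integral => x _; rewrite cmod2M EFinM.
- by move=> x _; rewrite lee_fin cmod2_ge0.
- exact: measurable_cmod2E.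
Qed.

End SqNorm.

Lemma cvg_EFinr (R : realType) (u : nat -> R) l :
  u @ \oo --> l -> (fun n => (u n)%:E) @ \oo --> l%:E.
Proof. by move=> h; apply/cvg_EFin => //; near=> n. Unshelve. all: by end_near. Qed.

Section RieszFischer.
Context d (T : measurableType d) (R : realType).
Variable mu : {measure set T -> \bar R}.
Local Open Scope ereal_scope.

(* Fast Cauchy sequences converge almost everywhere: [sum_k 4^k |g_{k+1} - g_k|^2]
   has a finite integral, hence is finite almost everywhere. *)
Lemma fast_cauchy_ae (g : nat -> T -> R[i]) :
  (forall k, cmeasurable (g k)) ->
  (forall k, sqn mu (fun x => g k.+1 x - g k x)%R <= ((16^-1) ^+ k)%:E) ->
  {ae mu, forall x, exists l, ccvg (fun k => g k x) l}.
Proof.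
move=> mg hg.
pose dk k x := ((4 ^+ k) * cmod2 (g k.+1 x - g k x))%R.
have dk0 k x : 0 <= (dk k x)%:E by rewrite lee_fin mulr_ge0 ?exprn_ge0 ?cmod2_ge0.
have mdk k : measurable_fun setT (fun x => (dk k x)%:E).
  apply/measurable_EFinP; apply: measurable_funM => //.
  by apply: cmeasurable_cmod2; exact: cmeasurableB.
have fin : \int[mu]_x (\sum_(0 <= k <oo) (dk k x)%:E) < +oo.
  rewrite integral_nneseries //.
  apply: (@le_lt_trans _ _ (\sum_(0 <= k <oo) ((4^-1) ^+ k)%:E)).
    apply: lee_nneseries => k _; first by move=> _; apply: integral_ge0 => x _.
    rewrite /dk; under eq_integral do rewrite EFinM.
    rewrite ge0_integralZl_EFin ?exprn_ge0 //; last 2 first.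
    - by move=> x _; rewrite lee_fin cmod2_ge0.
    - by apply: measurable_cmod2E; exact: cmeasurableB.
    apply: (@le_trans _ _ ((4 ^+ k)%:E * ((16^-1) ^+ k)%:E)).
      by apply: lee_wpmul2l (hg k); rewrite lee_fin exprn_ge0.
    rewrite -EFinM lee_fin -exprMn le_eqVlt; apply/orP; left; apply/eqP.
    by congr (_ ^+ _)%R; field.
  have : cvgn (series (geometric (1 : R) 4^-1))%R.
    apply: is_cvg_geometric_series.
    by rewrite ger0_norm ?invr_ge0 // invf_lt1 // ltr1n.
  move=> cg; rewrite (_ : \sum_(0 <= k <oo) _ =
      (limn (series (geometric (1 : R) 4^-1)%R))%:E).
    by rewrite ltry.
  rewrite -EFin_lim //; congr (limn _); apply/funext => n /=.
  rewrite /series /= sumEFin; congr EFin; apply: eq_bigr => k _.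
  by rewrite mul1r.
have ms : measurable_fun setT (fun x => \sum_(0 <= k <oo) (dk k x)%:E).
  by apply: ge0_emeasurable_sum => //.
have int : mu.-integrable setT (fun x => \sum_(0 <= k <oo) (dk k x)%:E).
  apply/integrableP; split => //.
  rewrite (eq_integral (fun x => \sum_(0 <= k <oo) (dk k x)%:E)) // => x _.
  by rewrite gee0_abs //; apply: nneseries_ge0.
have := integrable_ae measurableT int.
apply: filterS => x /(_ I).
set S := \sum_(0 <= k <oo) _ => Sfin.
have Sle k : (dk k x)%:E <= S.
  apply: (@le_trans _ _ (\sum_(0 <= j < k.+1) (dk j x)%:E)).
    by rewrite big_nat_recr //= leeDr // sume_ge0.
  exact: nneseries_lim_ge.
have S0 : 0 <= S by apply: nneseries_ge0.
pose M := fine S.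
have M0 : (0 <= M)%R by exact: fine_ge0.
have hM k : (dk k x <= M)%R by rewrite -lee_fin /M fineK.
(* Each term 4^k |g_{k+1} - g_k|^2 is at most the finite sum M, so the k-th step is at most sqrt(M)
   2^-k. *)
have [] := @geometric_ccvg R (fun k => g k x) (Num.sqrt M) (2^-1) _ _ _.
- by rewrite invr_ge0 ler0n /= invf_lt1 // ltr1n.
- exact: sqrtr_ge0.
- move=> k; rewrite -ler_sqr ?nnegrE ?cmod_ge0 ?mulr_ge0 ?exprn_ge0 ?sqrtr_ge0 //.
  rewrite cmod_sqr exprMn sqr_sqrtr // -exprM mulnC exprM.
  rewrite (_ : 2^-1 ^+ 2 = 4^-1 :> R)%R; last by field.
  by rewrite exprVn ler_pdivlMr ?exprn_gt0 // mulrC; exact: hM.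
by move=> l cl _; exists l.
Qed.

(** The upper limits of the real and imaginary parts are defined and measurable everywhere, and they
    equal the limit wherever it exists; [fine] replaces infinite values off that set. *)
Lemma ae_limit_measurable (g : nat -> T -> R[i]) :
  (forall k, cmeasurable (g k)) ->
  {ae mu, forall x, exists l, ccvg (fun k => g k x) l} ->
  exists2 f, cmeasurable f & {ae mu, forall x, ccvg (fun k => g k x) (f x)}.
Proof.
move=> mg cg.
pose lm (p : R[i] -> R) x := fine (limn_esup (fun k => (p (g k x))%:E)).
exists (fun x => Complex (lm (@complex.Re R) x) (lm (@complex.Im R) x)).
  have mlm (p : R[i] -> R) : (forall k, measurable_fun setT (fun x => p (g k x))) ->
      measurable_fun setT (lm p).
    move=> mp; apply: (@measurableT_comp _ _ _ _ _ _ (@fine R)) => //.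
    by apply: (@measurable_fun_limn_esup _ _ _ _ (fun k x => (p (g k x))%:E)) => k;
      apply/measurable_EFinP.
  by split; apply: mlm => k; [exact: (mg k).1|exact: (mg k).2].
apply: filterS cg => x [l cl].
have cr := ccvg_Re cl; have ci := ccvg_Im cl.
rewrite (_ : Complex _ _ = l) // (_ : l = Complex (Re l) (Im l)); last by case: (l).
congr Complex.
  by have e := (cvg_limn_einf_sup (cvg_EFinr cr)).2; rewrite /lm e.
by have e := (cvg_limn_einf_sup (cvg_EFinr ci)).2; rewrite /lm e.
Unshelve. all: by end_near. Qed.

(** Fatou's lemma, applied to the tail from [n0] because the bound is assumed only there. *)
Lemma sqn_lim_le (f g : T -> R[i]) (h : nat -> T -> R[i]) (c : \bar R) n0 :
  (forall k, cmeasurable (h k)) -> cmeasurable g -> cmeasurable f ->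
  {ae mu, forall x, ccvg (fun k => h k x) (f x)} ->
  (forall k, (n0 <= k)%N -> sqn mu (fun x => g x - h k x)%R <= c) ->
  sqn mu (fun x => g x - f x)%R <= c.
Proof.
move=> mh mg mf hf hc.
pose h' k := h (k + n0)%N.
have mgh k : measurable_fun setT (fun x => (cmod2 (g x - h' k x))%:E).
  by apply: measurable_cmod2E; apply: cmeasurableB => //; exact: mh.
have ge0 k x : setT x -> 0 <= (cmod2 (g x - h' k x))%:E.
  by move=> _; rewrite lee_fin cmod2_ge0.
apply: (@le_trans _ _ (\int[mu]_x limn_einf (fun k => (cmod2 (g x - h' k x))%:E))).
  rewrite le_eqVlt; apply/orP; left; apply/eqP.
  apply: ge0_ae_eq_integral => //.
  - by apply: measurable_cmod2E; exact: cmeasurableB.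
  - rewrite (_ : (fun x => _) =
        fun x => - limn_esup (fun k => - (cmod2 (g x - h' k x))%:E)).
      apply: (measurableT_comp (f := -%E)) => //.
      apply: (@measurable_fun_limn_esup _ _ _ _
        (fun k x => - (cmod2 (g x - h' k x))%:E)) => k.
      exact: (measurableT_comp (f := -%E)).
    by apply/funext => x; rewrite -[LHS]oppeK -limn_esupN.
  - by move=> x _; rewrite lee_fin cmod2_ge0.
  - move=> x _; rewrite limn_einf_lim; apply: lime_ge; first exact: is_cvg_einfs.
    by near=> n; apply: le_ereal_inf_tmp => _ [k _ <-]; exact: ge0.
  - apply: filterS hf => x hx _; apply/esym.
    have c1 := ccvg_cmod2 (z := g x) (@ccvg_shift R (h^~ x) (f x) n0 hx).
    exact: (cvg_limn_einf_sup (cvg_EFinr c1)).1.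
apply: le_trans (fatou mu measurableT mgh ge0) _.
have le_c k : \int[mu]_x (cmod2 (g x - h' k x))%:E <= c.
  by apply: hc; rewrite leq_addl.
rewrite limn_einf_lim; apply: lime_le; first exact: is_cvg_einfs.
near=> n; apply: le_trans (le_c n).
by apply: ereal_inf_lbound; exists n => //=.
Unshelve. all: by end_near. Qed.

Lemma L2_complete : complete_for setT (@hnorm R (L2space mu)).
Proof.
move=> u _ Cu.
have /choice[N HN] : forall k, exists n0, forall m n, (n0 <= m)%N -> (n0 <= n)%N ->
    (hnorm (u m - u n) < (4^-1) ^+ k)%R.
  move=> k.
  by apply: Cu; rewrite exprn_gt0 // invr_gt0.
(* Summing the thresholds gives a monotone sequence of indices that still dominates each of them. *)
pose M k := (\sum_(j < k.+1) N j)%N.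
have NM k : (N k <= M k)%N by rewrite /M big_ord_recr leq_addl.
have MM k : (M k <= M k.+1)%N by rewrite /M [leqRHS]big_ord_recr leq_addr.
pose g k : T -> R[i] := (u (M k) : L2 mu).
have mg k : cmeasurable (g k) by exact: (L2_sqint _).1.
have dist m k : sqn mu (fun x => (u m : L2 mu) x - g k x)%R =
    (hnorm (u m - u (M k)) ^+ 2)%:E.
  apply/esym; apply: hnormB_sqn; [exact: (L2_sqint _).1|exact: mg|near=> x|near=> x] => //.
have [|f mf gf] := @ae_limit_measurable g mg _.
  apply: fast_cauchy_ae => // k; rewrite dist lee_fin.
  rewrite (_ : 16^-1 = (4^-1) ^+ 2 :> R)%R; last by field.
  rewrite -exprM mulnC exprM ler_sqr ?nnegrE ?hnorm_ge0 ?exprn_ge0 //.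
  by apply/ltW/HN; rewrite ?(leq_trans (NM k)).
have lim k m : (N k <= m)%N ->
    sqn mu (fun x => (u m : L2 mu) x - f x)%R <= (((4^-1) ^+ k) ^+ 2)%:E.
  move=> km; apply: (@sqn_lim_le f _ g _ k) => //; first exact: (L2_sqint _).1.
  move=> j kj; rewrite dist lee_fin ler_sqr ?nnegrE ?hnorm_ge0 ?exprn_ge0 //.
  apply/ltW/HN => //; apply: leq_trans (NM k) _.
  by apply: (@homo_leq _ M leq) kj => // a b c; exact: leq_trans.
(* f differs from a member of the sequence by a function of finite norm. *)
have sf : sq_integrable mu f.
  have h0 := lim 0%N _ (leqnn _).
  have i0 : sq_integrable mu (fun x => (u (N 0%N) : L2 mu) x - f x)%R.
    split; first by apply: cmeasurableB => //; exact: (L2_sqint _).1.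
    by apply: le_lt_trans h0 _; rewrite ltry.
  rewrite (_ : f = fun x => (u (N 0%N) : L2 mu) x - ((u (N 0%N) : L2 mu) x - f x))%R.
    by apply: sq_integrableB => //; exact: L2_sqint.
  by apply/funext => x; rewrite opprB addrC subrK.
exists (L2mk sf) => //; apply/cvgrPdist_lt => e e0.
have [|k0 hk] := @geometric_small R 1 (4^-1) e _ e0.
  by rewrite invr_ge0 ler0n /= invf_lt1 // ltr1n.
exists (N k0) => // n /= hn; rewrite sub0r normrN ger0_norm ?hnorm_ge0 //.
apply: le_lt_trans (hk k0 (leqnn _)); rewrite mul1r.
rewrite -ler_sqr ?nnegrE ?hnorm_ge0 ?exprn_ge0 // -lee_fin.
rewrite (@hnormB_sqn _ _ _ mu _ _ (u n : L2 mu) f) //.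
- exact: lim.
- exact: (L2_sqint _).1.
- by near=> x.
- exact: L2mkE.
Unshelve. all: by end_near. Qed.

End RieszFischer.

Import HBNNSimple.

(** * Density of a linear space of functions in L2 of a finite measure *)

Section Density.
Context d (T : measurableType d) (R : realType).
Variable mu : {measure set T -> \bar R}.
Variable P : set (T -> R[i]).
Hypothesis muT : (mu setT < +oo)%E.
Hypothesis Pm : forall f, P f -> cmeasurable f.
Hypothesis P0 : P (fun=> 0).
Hypothesis PDZ : forall c f g, P f -> P g -> P (fun x => c * f x + g x).
Local Open Scope ereal_scope.

Definition approximable (f : T -> R[i]) : Prop :=
  cmeasurable f /\
  forall e : R, (0 < e)%R -> exists2 g, P g & sqn mu (fun x => f x - g x)%R < e%:E.

Lemma approximable_lim f : cmeasurable f ->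
  (forall e : R, (0 < e)%R -> exists2 g, approximable g &
     sqn mu (fun x => f x - g x)%R < e%:E) -> approximable f.
Proof.
move=> mf h; split=> // e e0.
have e8 : (0 < e / 8)%R by rewrite divr_gt0.
have [g [mg hg] fg] := h _ e8; have [k Pk gk] := hg _ e8; exists k => //.
have mk := Pm Pk.
rewrite (_ : (fun x => _) = fun x => (f x - g x) + (g x - k x))%R; last first.
  by apply/funext => x; rewrite addrA subrK.
apply: le_lt_trans (sqnD_le _ _ _) _; try exact: cmeasurableB.
apply: (@le_lt_trans _ _ (2%:E * (e / 8)%:E + 2%:E * (e / 8)%:E)).
  by apply: leeD; apply: lee_wpmul2l => //; exact: ltW.
by rewrite -!EFinM -EFinD lte_fin; lra.
Qed.

Lemma approximable_P f : P f -> approximable f.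
Proof.
move=> Pf; split; first exact: Pm.
move=> e e0; exists f => //; rewrite /sqn.
under eq_integral do rewrite subrr cmod2_0.
by rewrite integral0 lte_fin.
Qed.

Lemma approximableDZ c f g : approximable f -> approximable g ->
  approximable (fun x => c * f x + g x)%R.
Proof.
move=> [mf hf] [mg hg].
have mcf : cmeasurable (fun x => c * f x)%R.
  by apply: cmeasurableM => //; exact: cmeasurable_cst.
split; first exact: cmeasurableD.
move=> e e0.
have c0 := cmod2_ge0' c.
have c1 : (0 < cmod2 c + 1)%R by rewrite ltr_wpDl.
have e1 : (0 < e / 4 / (cmod2 c + 1))%R by rewrite !divr_gt0.
have e8 : (0 < e / 8)%R by rewrite divr_gt0.
have [f' Pf ff] := hf _ e1; have [g' Pg gg] := hg _ e8.
exists (fun x => c * f' x + g' x)%R; first exact: PDZ.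
have mf' := Pm Pf; have mg' := Pm Pg.
rewrite (_ : (fun x => _) = fun x => c * (f x - f' x) + (g x - g' x))%R; last first.
  by apply/funext => x; ring.
have mff : cmeasurable (fun x => f x - f' x)%R by exact: cmeasurableB.
apply: le_lt_trans (sqnD_le _ _ _) _.
- by apply: cmeasurableM => //; exact: cmeasurable_cst.
- exact: cmeasurableB.
rewrite sqnZ //.
apply: (@le_lt_trans _ _ (2%:E * ((cmod2 c)%:E * (e / 4 / (cmod2 c + 1))%:E) + 2%:E * (e / 8)%:E)).
  apply: leeD; apply: lee_wpmul2l => //; last exact: ltW.
  by apply: lee_wpmul2l; rewrite ?lee_fin //; exact: ltW.
rewrite -!EFinM -EFinD lte_fin.
have : (cmod2 c * (e / 4 / (cmod2 c + 1)) <= e / 4)%R.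
  rewrite mulrA ler_pdivrMr // mulrC ler_wpM2l ?lerDl // divr_ge0 // ltW //.
lra.
Qed.

Lemma approximable0 : approximable (fun=> 0%R).
Proof. exact: approximable_P. Qed.

Lemma approximable_sum (I : Type) (s : seq I) (c : I -> R[i]) (F : I -> T -> R[i]) :
  (forall i, approximable (F i)) -> approximable (fun x => \sum_(i <- s) c i * F i x)%R.
Proof.
move=> hF; elim: s => [|i s IH].
  by under [X in approximable X]funext do rewrite big_nil; exact: approximable0.
under [X in approximable X]funext do rewrite big_cons.
exact: approximableDZ.
Qed.

(** Dominated convergence for |f - f_n|^2 provides one f_n within any prescribed distance of f. *)
Lemma approximable_dominated f (f_ : nat -> T -> R[i]) (h : T -> R) :
  (forall n, approximable (f_ n)) -> cmeasurable f ->
  (forall x, ccvg (fun n => f_ n x) (f x)) ->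
  (forall n x, cmod2 (f x - f_ n x) <= h x)%R ->
  mu.-integrable setT (EFin \o h) -> approximable f.
Proof.
move=> hf mf cf bd hi; apply: approximable_lim => // e e0.
have mfn n : cmeasurable (fun x => f x - f_ n x)%R.
  by apply: cmeasurableB => //; exact: (hf n).1.
have c1 : {ae mu, forall x, setT x ->
    (fun n => (cmod2 (f x - f_ n x))%:E) @ \oo --> (cst 0 x : \bar R)}.
  apply/aeW => x _ /=; rewrite -[X in _ --> X]/(0%:E) -(cmod2_0 R) -(subrr (f x)).
  by apply: cvg_EFinr; exact: ccvg_cmod2.
have c2 : {ae mu, forall x n, setT x ->
    `|(cmod2 (f x - f_ n x))%:E| <= (EFin \o h) x}.
  by apply/aeW => x n _; rewrite gee0_abs ?lee_fin ?cmod2_ge0 //; exact: bd.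
have [_ _] := @dominated_convergence _ _ _ mu setT measurableT
  (fun n x => (cmod2 (f x - f_ n x))%:E) (cst 0) (EFin \o h)
  (fun n => measurable_cmod2E (mfn n)) (measurable_cst _) c1 hi c2.
rewrite integral0.
have e0' : 0 < e%:E by rewrite lte_fin.
move=> /(_ [set y | y < e%:E]) [].
  by apply: open_nbhs_nbhs; split => //; exact: open_ereal_lt_ereal.
by move=> n _ /(_ n (leqnn n)) /= hn; exists (f_ n).
Qed.

Definition cindic (A : set T) (x : T) : R[i] := (\1_A x)%:C%C.

Lemma cmeasurable_indic A : measurable A -> cmeasurable (cindic A).
Proof. by move=> mA; split => /=; [exact: measurable_indic|exact: measurable_cst]. Qed.

Lemma integrable_cst1 (c : R) : mu.-integrable setT (EFin \o cst c).
Proof.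
apply/integrableP; split; first exact: (@measurable_cst _ _ _ _ _ (c%:E)).
by rewrite /= integral_cst // lte_mul_pinfty.
Qed.

(** The sets with approximable indicator form a Dynkin system, so it suffices to treat a generating
    family closed under intersection: open sets for the fractal, open intervals for an edge. *)
Lemma approximable_measurable (G : set (set T)) :
  d.-measurable = <<s G >> -> setI_closed G ->
  approximable (cindic setT) -> (forall A, G A -> approximable (cindic A)) ->
  forall A, measurable A -> approximable (cindic A).
Proof.
move=> mG GI GT hG A mA.
have sA : <<s G >> A by rewrite -mG.
apply: (@dynkin_induction _ T G (fun A => approximable (cindic A)) mG GI GT hG _ _ _ sA).
- move=> S mS hS.
  rewrite (_ : cindic (~` S) = fun x => (-1) * cindic S x + cindic setT x)%R.
    exact: approximableDZ.
  apply/funext => x; rewrite /cindic mulN1r -rmorphN -rmorphD; congr (_%:C)%C.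
  by rewrite indicT !indicE in_setC; case: (x \in S); rewrite /= ?addNr // oppr0 add0r.
- move=> F mF tF hF.
  pose U n := \big[setU/set0]_(i < n) F i.
  have mU n : measurable (U n) by exact: bigsetU_measurable.
  have aU n : approximable (cindic (U n)).
    elim: n => [|n IH].
      rewrite /U big_ord0 (_ : cindic set0 = fun=> 0%R); first exact: approximable0.
      by apply/funext => x; rewrite /cindic indic0.
    rewrite (_ : cindic _ = fun x => 1 * cindic (U n) x + cindic (F n) x)%R.
      exact: approximableDZ.
    apply/funext => x; rewrite mul1r /cindic !indicE /U big_ord_recr /= in_setU.
    case: (boolP (x \in F n)) => /= xF; last by rewrite orbF addr0.
    rewrite orbT (_ : (x \in _) = false) ?add0r //.
    apply/negbTE/negP; rewrite !inE -bigcup_mkord => -[k /= kn Fk].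
    have kE : k = n by apply: tF => //; exists x; split => //; exact/set_mem.
    by rewrite kE ltnn in kn.
  (* Partial unions are finite sums of disjoint indicators; the constant 1, integrable for a finite
     measure, dominates the passage to the countable union. *)
  apply: (@approximable_dominated _ (fun n => cindic (U n)) (cst 1%R)) => //.
  + by apply: cmeasurable_indic; exact: bigcup_measurable.
  + move=> x e e0; case: (pselect ((\bigcup_k F k) x)) => [[k _ Fk]|nF].
      exists k.+1 => n kn.
      rewrite (_ : cindic (U n) x = cindic (\bigcup_k F k) x) ?subrr ?cmod0 //.
      rewrite /cindic !indicE !mem_set //; first by exists k.
      by rewrite /U -bigcup_mkord; exists k.
    exists 0%N => n _.
    rewrite (_ : cindic (U n) x = cindic (\bigcup_k F k) x) ?subrr ?cmod0 //.
    rewrite /cindic !indicE !memNset //.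
    by rewrite /U -bigcup_mkord => -[k _ Fk]; apply: nF; exists k.
  + move=> n x; rewrite /cindic -rmorphB /= cmod2_real !indicE.
    by do 2 case: (_ \in _); rewrite /= ?subrr ?subr0 ?sub0r ?sqrrN ?expr1n ?expr0n.
  + exact: integrable_cst1.
Qed.

Hypothesis ind_approx : forall A, measurable A -> approximable (cindic A).

(** Simple functions increase to h, so 0 <= h - phi_n <= h and h^2 dominates the squared errors. *)
Lemma approximable_ge0 (h : T -> R) : measurable_fun setT h ->
  (forall x, 0 <= h x)%R -> \int[mu]_x ((h x) ^+ 2)%:E < +oo ->
  approximable (fun x => (h x)%:C%C).
Proof.
move=> mh h0 hi.
have mEh : measurable_fun setT (EFin \o h) by exact/measurable_EFinP.
pose phi := nnsfun_approx measurableT mEh.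
have cphi x : (fun n => (phi n x)%:E) @ \oo --> (h x)%:E.
  by apply: cvg_nnsfun_approx => // y _; rewrite /= lee_fin.
have lphi n x : (phi n x <= h x)%R.
  have cr : (fun k => phi k x) @ \oo --> h x by case/fine_cvgP: (cphi x).
  rewrite -(cvg_lim (@Rhausdorff R) cr); apply: nondecreasing_cvgn_le.
    by move=> a b ab; have /lefP := nd_nnsfun_approx measurableT mEh ab; exact.
  by apply/cvg_ex; exists (h x).
apply: (@approximable_dominated _ (fun n x => (phi n x)%:C%C) (fun x => h x ^+ 2)%R).
- move=> n; rewrite (_ : (fun x => _) = fun x =>
     \sum_(y <- fset_set (range (phi n))) y%:C%C * cindic (phi n @^-1` [set y]) x)%R.
    apply: approximable_sum => y; apply: ind_approx; exact: measurable_funPTI.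
  apply/funext => x; rewrite fimfunE fsbig_finite //= realC_sum.
  by apply: eq_bigr => y _; rewrite rmorphM.
- by split => //=; exact: measurable_cst.
- move=> x e e0.
  have := cphi x; move/fine_cvgP => [_] /cvgrPdist_lt /(_ e e0)[n0 _ hn].
  exists n0 => n /hn lt_e; rewrite -rmorphB cmod_real distrC //.
- move=> n x; rewrite -rmorphB /= cmod2_real ler_sqr ?nnegrE ?subr_ge0 //.
  by rewrite gerBl.
- apply/integrableP; split; first by apply/measurable_EFinP; exact: measurable_funX.
  rewrite (eq_integral (fun x => (h x ^+ 2)%:E)) // => x _ /=.
  by rewrite ger0_norm // sqr_ge0.
Qed.

Lemma approximable_all f : sq_integrable mu f -> approximable f.
Proof.
move=> [[mr mi] fi].
have A (h : T -> R) : measurable_fun setT h -> (forall x, h x ^+ 2 <= cmod2 (f x))%R ->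
    approximable (fun x => (h x)%:C%C).
  move=> mh hf.
  have B (k : T -> R) : measurable_fun setT k -> (forall x, 0 <= k x)%R ->
      (forall x, `|k x| <= `|h x|)%R -> approximable (fun x => (k x)%:C%C).
    move=> mk k0 kh; apply: approximable_ge0 => //; apply: le_lt_trans fi.
    apply: ge0_le_integral => //.
    - by move=> x _; rewrite lee_fin sqr_ge0.
    - by apply/measurable_EFinP; exact: measurable_funX.
    - by apply: measurable_cmod2E; split.
    - move=> x _; rewrite lee_fin; apply: le_trans (hf x).
      by rewrite -[leLHS]real_normK ?num_real // -[leRHS]real_normK ?num_real // ler_sqr ?nnegrE.
  rewrite (_ : (fun x => _) = fun x => (-1) * (Num.max (- h x) 0)%:C%C + (Num.max (h x) 0)%:C%C)%R.
    apply: approximableDZ; apply: B.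
    - by apply: measurable_maxr => //; exact: measurableT_comp.
    - by move=> x; rewrite le_max lexx orbT.
    - by move=> x; rewrite maxElt; case: ifP => _; rewrite ?normr0 ?normrN.
    - by apply: measurable_maxr => //; exact: measurableT_comp.
    - by move=> x; rewrite le_max lexx orbT.
    - by move=> x; rewrite maxElt; case: ifP => _; rewrite ?normr0.
  apply/funext => x; rewrite mulN1r -rmorphN -rmorphD; congr (_%:C)%C.
  rewrite !maxElt oppr_lt0.
  by case: (ltrgtP (h x) 0) => [||->]; rewrite ?opprK ?oppr0 ?addr0 ?add0r.
rewrite (_ : f = fun x => 'i%C * (Im (f x))%:C%C + (Re (f x))%:C%C)%R.
  apply: approximableDZ; apply: A => // x; rewrite /cmod2 ?lerDl ?lerDr sqr_ge0 //.
by apply/funext => x; rewrite addrC -complexE.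
Qed.

End Density.

(** * Words, cells and graph energies *)

Section Euclid.
Variables (R : realType) (d : nat).
Implicit Types x y : 'rV[R]_d.

Lemma euclid_ge0 x : 0 <= euclid x. Proof. exact: sqrtr_ge0. Qed.

Lemma coord_le_euclid x i : `|x ord0 i| <= euclid x.
Proof.
rewrite -sqrtr_sqr ler_sqrt ?sqr_ge0 //; last first.
  by apply: sumr_ge0 => j _; exact: sqr_ge0.
by rewrite (bigD1 i) //= lerDl sumr_ge0 // => j _; exact: sqr_ge0.
Qed.

Lemma norm_le_euclid x : `|x| <= euclid x.
Proof.
rewrite -[ `|x| ]/(mx_norm x); have [->|/mx_norm_neq0[[i j] ->]] := eqVneq (mx_norm x) 0.
  exact: euclid_ge0.
by rewrite ord1; exact: coord_le_euclid.
Qed.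

(** The factor is generous; it is positive for d = 0 as well and can therefore be divided by. *)
Lemma euclid_le_norm x : euclid x <= (d%:R + 1) * `|x|.
Proof.
have n0 : 0 <= `|x| by [].
rewrite -[leRHS]ger0_norm ?mulr_ge0 ?addr_ge0 // -sqrtr_sqr.
rewrite ler_sqrt ?sqr_ge0 //.
apply: (@le_trans _ _ (\sum_(i < d) `|x| ^+ 2)).
  apply: ler_sum => i _; rewrite -[leLHS]real_normK ?num_real //.
  rewrite ler_sqr ?nnegrE //; rewrite [leRHS]mx_normrE.
  exact: (le_bigmax _ (fun p : 'I_1 * 'I_d => `|x p.1 p.2|) (ord0, i)).
rewrite sumr_const card_ord -[leLHS]mulr_natl.
rewrite [leRHS]exprMn ler_wpM2r ?sqr_ge0 //.
by have : 0 <= d%:R :> R by []; nra.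
Qed.

Lemma euclid_eq0 x : euclid x = 0 -> x = 0.
Proof.
by move=> h; apply/eqP; rewrite -normr_eq0 eq_le normr_ge0 andbT -h norm_le_euclid.
Qed.

End Euclid.

Section Words.
Variables (R : realType) (d : nat) (D : fractal R d).
Implicit Types (x y : 'rV[R]_d) (e : {fset 'rV[R]_d}).
Notation N := (nmaps D).
Notation word m := (m.-tuple 'I_N).

Lemma Fword_cat (w w' : seq 'I_N) x : Fword (w ++ w') x = Fword w (Fword w' x).
Proof. by rewrite /Fword foldr_cat. Qed.

Lemma Fword_rcons (w : seq 'I_N) j x : Fword (rcons w j) x = Fword w (F j x).
Proof. by rewrite -cats1 Fword_cat. Qed.

Lemma sum_word_cons (W : nmodType) m (G : seq 'I_N -> W) :
  \sum_(w : word m.+1) G w = \sum_(j : 'I_N) \sum_(w : word m) G (j :: w).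
Proof.
rewrite pair_bigA (reindex (fun p : 'I_N * word m => cons_tuple p.1 p.2)) //=.
exists (fun w : word m.+1 => (thead w, [tuple of behead w])).
  by move=> [j w] _ /=; congr pair; apply/val_inj.
by move=> w _ /=; case/tupleP: w => j w; apply/val_inj.
Qed.

Lemma sum_word0 (W : nmodType) (G : seq 'I_N -> W) : \sum_(w : word 0) G w = G [::].
Proof.
rewrite (big_pred1 [tuple]) //= => w.
by apply/esym/eqP; rewrite tuple0.
Qed.

Lemma Em0P e : reflect (exists a b, [/\ a \in V0 D, b \in V0 D, a != b & e = [fset a; b]%fset])
  (e \in Em D 0).
Proof.
rewrite /= !inE /=; apply: (iffP andP).
  rewrite -[e \in _]/(e \in fpowerset _) fpowersetE => -[/fsubsetP sub /eqP c2].
  have /fset0Pn[a ae] : e != fset0 by rewrite -cardfs_gt0 c2.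
  have /cardfs1P[b eb] : #|` (e `\ a)%fset| == 1%N.
    by have := cardfsD1 a e; rewrite ae c2 add1n => -[<-].
  have be : b \in (e `\ a)%fset by rewrite eb inE.
  move: (be); rewrite !inE => /andP[ba be'].
  exists a, b; split; [exact: sub|exact: sub|by rewrite eq_sym|].
  by rewrite -(fsetD1K ae) eb fsetUC.
move=> [a [b [aV bV ab ->]]]; rewrite cardfs2 ab -[_ \in _]/(_ \in fpowerset _) fpowersetE; split => //.
by apply/fsubsetP => x; rewrite !inE => /orP[] /eqP ->.
Qed.

Lemma EmP m e : reflect (exists (w : word m) e0, e0 \in Em D 0 /\ e = (Fword w @` e0)%fset)
  (e \in Em D m).
Proof.
elim: m e => [|m IH] e.
  apply: (iffP idP) => [he|[w [e0 [he0 ->]]]].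
    exists [tuple], e; split => //; rewrite /= (_ : Fword _ = id) ?imfset_id //.
  by rewrite tuple0 /= (_ : Fword _ = id) ?imfset_id.
apply: (iffP (bigfcupP _ _ _ _)) => [[j _ /imfsetP[e' /= /IH[w [e0 [he0 ->]]] ->]]|[w [e0 [he0 ->]]]].
  exists (cons_tuple j w), e0; split=> //; rewrite -imfset_comp; exact: eq_imfset.
case/tupleP: w => j w; exists j; first by rewrite mem_enum.
apply/imfsetP; exists (Fword w @` e0)%fset; first by apply/IH; exists w, e0.
by rewrite -imfset_comp; exact: eq_imfset.
Qed.

Lemma VmP m x : reflect (exists (w : word m) v, v \in V0 D /\ x = Fword w v) (x \in Vm D m).
Proof.
elim: m x => [|m IH] x.
  apply: (iffP idP) => [he|[w [e0 [he0 ->]]]]; last by rewrite tuple0.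
  by exists [tuple], x.
apply: (iffP (bigfcupP _ _ _ _)) => [[j _ /imfsetP[y /= /IH[w [v [hv ->]]] ->]]|[w [v [hv ->]]]].
  by exists (cons_tuple j w), v.
case/tupleP: w => j w; exists j; first by rewrite mem_enum.
by apply/imfsetP; exists (Fword w v) => //; apply/IH; exists w, v.
Qed.

Lemma Vm_F m j x : x \in Vm D m -> F (f := D) j x \in Vm D m.+1.
Proof. by move=> h; apply/bigfcupP; exists j; rewrite ?mem_enum //; apply/imfsetP; exists x. Qed.

Lemma Vm_Fword m (w : seq 'I_N) x : x \in Vm D m -> Fword w x \in Vm D (size w + m).
Proof. by move=> h; elim: w => //= j w IH; exact: Vm_F. Qed.

Lemma src_tgt (a b : 'rV[R]_d) : a != b ->
  (src [fset a; b]%fset = a /\ tgt [fset a; b]%fset = b) \/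
  (src [fset a; b]%fset = b /\ tgt [fset a; b]%fset = a).
Proof.
move=> ab; set e := [fset a; b]%fset.
have c2 : #|` e| = 2%N by rewrite cardfs2 ab.
have s0 : src e \in e by rewrite /src mem_nth // c2.
have s1 : tgt e \in e by rewrite /tgt mem_nth // c2.
have ne : src e != tgt e by rewrite /src /tgt nth_uniq ?c2 // fset_uniq.
move: s0 s1 ne; rewrite !inE => /orP[] /eqP -> /orP[] /eqP ->; rewrite ?eqxx //; by [left|right].
Qed.

Lemma src_tgt_V0 e : e \in Em D 0 ->
  [/\ src e \in V0 D, tgt e \in V0 D, src e != tgt e & e = [fset src e; tgt e]%fset].
Proof.
move=> /Em0P[a [b [aV bV ab ->]]]; case: (src_tgt ab) => -[-> ->] //.
by split => //; [rewrite eq_sym|rewrite fsetUC].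
Qed.

Lemma edge_V0 a b : a \in V0 D -> b \in V0 D -> a != b -> [fset a; b]%fset \in Em D 0.
Proof. by move=> *; apply/Em0P; exists a, b. Qed.

Definition gform (m : nat) (u v : 'rV[R]_d -> R[i]) : R[i] :=
  \sum_(e <- Em D m) (gamma D m e)%:C * ((u (src e) - u (tgt e)) * (v (src e) - v (tgt e))^*).

Lemma gform_energy m u : gform m u u = (graph_energy D m u)%:C.
Proof.
by rewrite realC_sum; apply: eq_bigr => e _; rewrite [in RHS]rmorphM /= -mulcC_cmod2.
Qed.

Lemma gform_linear m c u u' v :
  gform m (fun x => c * u x + u' x) v = c * gform m u v + gform m u' v.
Proof.
by rewrite mulr_sumr -big_split; apply: eq_bigr => e _ /=; ring.
Qed.

Lemma gformC m u v : gform m v u = (gform m u v)^*.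
Proof.
rewrite rmorph_sum; apply: eq_bigr => e _ /=.
case: (u _ - u _) => a b; case: (v _ - v _) => a' b'; simpc.
by congr Complex; ring.
Qed.

(** The enumeration of the image edge may list its two points in the opposite order, so only
    symmetric expressions are transported along f. *)
Lemma src_tgt_sym (W : Type) (S : 'rV[R]_d -> 'rV[R]_d -> W) (f : 'rV[R]_d -> 'rV[R]_d) e :
  injective f -> (forall x y, S x y = S y x) -> e \in Em D 0 ->
  S (src (f @` e)%fset) (tgt (f @` e)%fset) = S (f (src e)) (f (tgt e)).
Proof.
move=> fI symS /src_tgt_V0[_ _ ne eE].
have -> : (f @` e)%fset = [fset f (src e); f (tgt e)]%fset.
  rewrite [in LHS]eE; apply/fsetP => x; apply/imfsetP/idP => /=.
    by move=> [y]; rewrite !inE => /orP[] /eqP -> ->; rewrite eqxx ?orbT.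
  by rewrite !inE => /orP[] /eqP ->; [exists (src e)|exists (tgt e)];
    rewrite // !inE eqxx ?orbT.
have fne : f (src e) != f (tgt e) by rewrite (inj_eq fI).
by case: (src_tgt fne) => -[-> ->].
Qed.

End Words.

Section Fractal.
Variables (R : realType) (d : nat) (D : fractal R d).
Implicit Types (x y : 'rV[R]_d) (e : {fset 'rV[R]_d}) (u : 'rV[R]_d -> R[i]).
Notation N := (nmaps D).
Notation word m := (m.-tuple 'I_N).
Hypothesis pcfD : pcf_fractal D.
Hypothesis graphsD : weighted_graphs D.

Lemma theta01 : 0 < theta D < 1. Proof. by case: pcfD => _ _ _ []. Qed.

Lemma F_similar (j : 'I_N) x y : euclid (F j x - F j y) = theta D * euclid (x - y).
Proof. by case: pcfD => _ _ _ [_ h] _; exact: h. Qed.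

Lemma Fword_similar (w : seq 'I_N) x y :
  euclid (Fword w x - Fword w y) = theta D ^+ size w * euclid (x - y).
Proof.
by elim: w => [|j w IH]; rewrite ?mul1r // /= F_similar IH exprS mulrA.
Qed.

Lemma Fword_inj (w : seq 'I_N) : injective (Fword w).
Proof.
move=> x y h; apply/eqP; rewrite -subr_eq0; apply/eqP/euclid_eq0.
have := Fword_similar w x y; rewrite h subrr.
have -> : euclid (0 : 'rV[R]_d) = 0.
  by rewrite /euclid big1 ?sqrtr0 // => i _; rewrite mxE expr0n.
move/esym/eqP; rewrite mulf_eq0 expf_eq0 => /orP[/andP[_ /eqP t0]|/eqP //].
by have := theta01; rewrite t0 ltxx.
Qed.

Lemma F_inj (j : 'I_N) : injective (F j).
Proof. exact: (@Fword_inj [:: j]). Qed.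

Lemma K_Fword (w : seq 'I_N) x : K D x -> K D (Fword w x).
Proof.
move=> Kx; elim: w => //= j w IH.
have -> : K D = \bigcup_(j : 'I_N) (F j @` K D) by case: pcfD.
by exists j => //; exact: imageP.
Qed.

Lemma K_F (j : 'I_N) x : K D x -> K D (F j x).
Proof. exact: (@K_Fword [:: j]). Qed.

Lemma K_cover m x : K D x -> exists w : word m, (Fword w @` K D) x.
Proof.
elim: m x => [|m IH] x Kx; first by exists [tuple]; exists x.
have KE : K D = \bigcup_(j : 'I_N) (F j @` K D) by case: pcfD.
move: Kx; rewrite {1}KE => -[j _ [y /IH[w [z Kz <-]] <-]].
by exists (cons_tuple j w); exists z.
Qed.

Lemma closedK : closed (K D).
Proof. by apply: compact_closed; [exact: norm_hausdorff|case: pcfD => _ []]. Qed.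

Lemma euclid_near_ball x (e : R) : 0 < e ->
  exists2 dl : R, 0 < dl & forall y, euclid (x - y) < dl -> ball x e y.
Proof.
by move=> e0; exists e => // y; rewrite -ball_normE /=; apply: le_lt_trans (norm_le_euclid _).
Qed.

Lemma ball_near_euclid x (e : R) : 0 < e -> \forall y \near x, euclid (x - y) < e.
Proof.
move=> e0; have d0 : 0 < d%:R + 1 :> R by rewrite ltr_wpDl.
have e1 : 0 < e / (d%:R + 1) by rewrite divr_gt0.
near=> y; apply: le_lt_trans (euclid_le_norm _) _.
rewrite mulrC -ltr_pdivlMr //; near: y; exact: (cvgr_dist_lt _ e1).
Unshelve. all: by end_near. Qed.

Lemma V0_fixed v : v \in V0 D -> exists j : 'I_N, F j v = v.
Proof. by case: pcfD => _ _ _ _ [_ h _]; exact: h. Qed.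

(** If F_j fixes v, then v is the limit of the iterates of F_j at any point of K, and K is
    closed. *)
Lemma V0_K v : v \in V0 D -> K D v.
Proof.
move=> /V0_fixed[j Fv]; have [x0 Kx0] : K D !=set0 by case: pcfD => _ [].
apply: closedK => B /nbhs_ballP[e e0 Be].
have [dl dl0 hdl] := euclid_near_ball v e0.
have [th0 th1] := andP theta01.
have [|n0 hn] := @geometric_small R (euclid (v - x0)) (theta D) dl _ dl0.
  by rewrite ltW.
pose w := nseq n0 j.
exists (Fword w x0); split; first exact: K_Fword.
apply: Be; apply: hdl.
have wv : Fword w v = v by rewrite /w; elim: (n0) => //= k ->.
by rewrite -{1}wv Fword_similar size_nseq mulrC; exact: hn.
Qed.

Lemma Vm_K m v : v \in Vm D m -> K D v.
Proof. by move=> /VmP[w [v0 [hv ->]]]; apply/K_Fword/V0_K. Qed.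

Lemma Vm_S m v : v \in Vm D m -> v \in Vm D m.+1.
Proof.
move=> /VmP[w [v0 [hv ->]]]; have [j <-] := V0_fixed hv.
rewrite -Fword_rcons; apply/VmP.
by exists [tuple of rcons w j], v0.
Qed.

Lemma Vm_leq m n v : (m <= n)%N -> v \in Vm D m -> v \in Vm D n.
Proof. by move=> /subnKC <-; elim: (n - m)%N => [|k IH] h; rewrite ?addn0 ?addnS //; apply/Vm_S/IH. Qed.

Lemma V0_neq0 : exists v, v \in V0 D.
Proof. by case: pcfD => _ _ _ _ [/fset0Pn[v hv] _ _]; exists v. Qed.

Lemma N_gt0 : (0 < N)%N. Proof. by case: pcfD => h _ _ _ _; exact: ltnW. Qed.

Lemma simpleD : simple_graphs D. Proof. by case: graphsD. Qed.
Lemma gamma0_gt0 e : e \in Em D 0 -> 0 < gamma0 D e.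
Proof. by case: graphsD => _ h _ _; exact: h. Qed.
Lemma renorm01 : 0 < renorm D < 1. Proof. by case: graphsD. Qed.
Lemma renorm_gt0 : 0 < renorm D. Proof. by case/andP: renorm01. Qed.
Lemma compatD : compatible_energies D. Proof. by case: graphsD. Qed.

(** Simplicity of the graphs makes (w, e) determined by F_w(e), so the edges of level m are listed
    without repetition by words and base edges. *)
Lemma sum_Em (W : nmodType) m (G : {fset 'rV[R]_d} -> W) :
  \sum_(e <- Em D m) G e = \sum_(w : word m) \sum_(e <- Em D 0) G (Fword w @` e)%fset.
Proof.
rewrite (perm_big [seq (Fword (t : word m) @` e)%fset | t <- enum {: word m}, e <- Em D 0]).
  by rewrite big_allpairs_dep big_enum.
apply: uniq_perm; first exact: fset_uniq.
  apply: allpairs_uniq; [exact: enum_uniq|exact: fset_uniq|].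
  move=> [w e] [w' e'] /allpairsP[[? ?] /= [_ he [-> ->]]] /allpairsP[[? ?] /= [_ he' [-> ->]]] h.
  by have [-> ->] := simpleD he he' h.
move=> e; apply/EmP/allpairsP => [[w [e0 [he ->]]]|[[w e0] /= [_ he ->]]].
  by exists (w, e0); rewrite mem_enum.
by exists w, e0.
Qed.

Lemma base_edgeE m (w : word m) e0 : e0 \in Em D 0 ->
  base_edge D m (Fword w @` e0)%fset = e0.
Proof.
move=> he; rewrite /base_edge; case: xgetP => [e _ [he' [w' h]]|].
  by have [_ ->] := simpleD he he' h.
by move=> /(_ e0)[]; split => //; exists w.
Qed.

Lemma base_edge_Em0 m e : e \in Em D m -> base_edge D m e \in Em D 0.
Proof. by move=> /EmP[w [e0 [he ->]]]; rewrite base_edgeE. Qed.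

Lemma gammaE m (w : word m) e0 : e0 \in Em D 0 ->
  gamma D m (Fword w @` e0)%fset = (renorm D ^+ m)^-1 * gamma0 D e0.
Proof. by move=> he; rewrite /gamma base_edgeE. Qed.

Lemma gamma_gt0 m e : e \in Em D m -> 0 < gamma D m e.
Proof.
move=> he; rewrite mulr_gt0 ?invr_gt0 ?exprn_gt0 ?renorm_gt0 //.
by apply/gamma0_gt0/base_edge_Em0.
Qed.

Lemma gform_words m u v : gform D m u v =
  \sum_(w : word m) ((renorm D ^+ m)^-1)%:C * gform D 0 (u \o Fword w) (v \o Fword w).
Proof.
rewrite /gform sum_Em; apply: eq_bigr => w _; rewrite mulr_sumr.
apply: eq_big_seq => e he.
pose S x y := (u x - u y) * (v x - v y)^*.
have symS x y : S x y = S y x.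
  by rewrite /S -(opprB (u y)) -(opprB (v y)) rmorphN mulrNN.
transitivity ((gamma D m (Fword w @` e)%fset)%:C *
   S (src (Fword w @` e)%fset) (tgt (Fword w @` e)%fset)); first by [].
rewrite (src_tgt_sym (@Fword_inj w) symS he) gammaE // (_ : gamma D 0 e = (renorm D ^+ 0)^-1 * gamma0 D (base_edge D 0 e)) //.
have -> : base_edge D 0 e = e.
  have := @base_edgeE 0 [tuple] e he.
  by rewrite (_ : Fword _ = id) ?imfset_id.
by rewrite expr0 invr1 mul1r rmorphM /= mulrA.
Qed.

Lemma gform_S m u v : gform D m.+1 u v =
  \sum_(j < N) ((renorm D)^-1)%:C * gform D m (u \o F j) (v \o F j).
Proof.
rewrite gform_words (sum_word_cons m (fun w =>
  ((renorm D ^+ m.+1)^-1)%:C * gform D 0 (u \o Fword w) (v \o Fword w))).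
apply: eq_bigr => j _; rewrite gform_words mulr_sumr; apply: eq_bigr => w _.
by rewrite mulrA exprS invfM rmorphM.
Qed.

(** Every edge of level m + n belongs to exactly one cell of level m, which contributes the factor
    r^-m to its weight. This is the self-similarity of the discrete forms. *)
Lemma gform_cat m n u v : gform D (m + n) u v =
  \sum_(w : word m) ((renorm D ^+ m)^-1)%:C * gform D n (u \o Fword w) (v \o Fword w).
Proof.
elim: m u v => [|m IH] u v.
  rewrite (sum_word0 (fun w => ((renorm D ^+ 0)^-1)%:C * gform D n (u \o Fword w) (v \o Fword w))).
  by rewrite expr0 invr1 rmorph1 mul1r.
rewrite addSn gform_S (sum_word_cons m (fun w =>
  ((renorm D ^+ m.+1)^-1)%:C * gform D n (u \o Fword w) (v \o Fword w))).
apply: eq_bigr => j _; rewrite IH mulr_sumr; apply: eq_bigr => w _.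
by rewrite mulrA exprS invfM rmorphM.
Qed.

Lemma graph_energy_cat m n u : graph_energy D (m + n) u =
  \sum_(w : word m) (renorm D ^+ m)^-1 * graph_energy D n (u \o Fword w).
Proof.
apply: (@complexI R); rewrite -gform_energy gform_cat realC_sum.
by apply: eq_bigr => w _; rewrite gform_energy rmorphM.
Qed.

Lemma graph_energy_ge0 m u : 0 <= graph_energy D m u.
Proof.
rewrite /graph_energy big_seq_cond sumr_ge0 // => e /andP[he _].
by rewrite mulr_ge0 ?cmod2_ge0' // ltW // gamma_gt0.
Qed.

Lemma graph_energy_word m n (w : word m) u :
  graph_energy D n (u \o Fword w) <= renorm D ^+ m * graph_energy D (m + n) u.
Proof.
have r0 : 0 < renorm D ^+ m by rewrite exprn_gt0 ?renorm_gt0.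
rewrite graph_energy_cat (bigD1 w) //= mulrDr mulVKf ?lt0r_neq0 // lerDl.
apply: mulr_ge0; [exact: ltW|apply: sumr_ge0 => w' _].
by rewrite mulr_ge0 ?invr_ge0 ?graph_energy_ge0 // ltW.
Qed.

Lemma graph_energy_mono m u : graph_energy D m u <= graph_energy D m.+1 u.
Proof. by case: (compatD m u) => h _; apply: h. Qed.

Lemma graph_energy_leq m n u : (m <= n)%N -> graph_energy D m u <= graph_energy D n u.
Proof.
move=> /subnKC <-; elim: (n - m)%N => [|k IH]; first by rewrite addn0.
by rewrite addnS; apply: le_trans IH (graph_energy_mono _ _).
Qed.

Lemma edge_Vm m e : e \in Em D m -> src e \in Vm D m /\ tgt e \in Vm D m.
Proof.
move=> /EmP[w [e0 [he ->]]].
pose S x y := (x \in Vm D m) && (y \in Vm D m).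
suff : S (src (Fword w @` e0)%fset) (tgt (Fword w @` e0)%fset) by move=> /andP[].
have symS x y : S x y = S y x by rewrite /S andbC.
rewrite (src_tgt_sym (@Fword_inj w) symS he).
have [s1 s2 _ _] := src_tgt_V0 he.
by apply/andP; split; apply/VmP; [exists w, (src e0)|exists w, (tgt e0)].
Qed.

Lemma eq_gform m u u' v v' : {in Vm D m, u =1 u'} -> {in Vm D m, v =1 v'} ->
  gform D m u v = gform D m u' v'.
Proof.
move=> hu hv; apply: eq_big_seq => e /edge_Vm[s t].
by rewrite !hu ?hv.
Qed.

Lemma eq_graph_energy m u u' : {in Vm D m, u =1 u'} ->
  graph_energy D m u = graph_energy D m u'.
Proof. by move=> h; apply: (@complexI R); rewrite -!gform_energy; exact: eq_gform. Qed.

(* [edge_resistance] bounds every effective resistance of the complete graph G_0. *)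
Definition edge_resistance : R := \sum_(e <- Em D 0) (gamma0 D e)^-1.

Lemma edge_resistance_ge0 : 0 <= edge_resistance.
Proof.
rewrite /edge_resistance big_seq_cond sumr_ge0 // => e /andP[he _].
by rewrite invr_ge0 ltW // gamma0_gt0.
Qed.

Lemma le_edge_resistance e : e \in Em D 0 -> (gamma0 D e)^-1 <= edge_resistance.
Proof.
move=> he; rewrite /edge_resistance (big_rem e) //= lerDl.
rewrite big_seq_cond sumr_ge0 // => e' /andP[/mem_rem he' _].
by rewrite invr_ge0 ltW // gamma0_gt0.
Qed.

(** G_0 is complete: a single edge joins a and b, and its own share of the energy bounds the
    difference. *)
Lemma osc_V0 u a b : a \in V0 D -> b \in V0 D ->
  cmod2 (u a - u b) <= edge_resistance * graph_energy D 0 u.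
Proof.
move=> aV bV; have [->|ab] := eqVneq a b.
  by rewrite subrr cmod2_0 mulr_ge0 ?graph_energy_ge0 ?edge_resistance_ge0.
have he := edge_V0 aV bV ab; set e := [fset a; b]%fset in he.
have E : cmod2 (u (src e) - u (tgt e)) = cmod2 (u a - u b).
  by case: (src_tgt ab) => -[-> ->]; rewrite // cmod2B.
have g0 := gamma0_gt0 he.
have h1 : gamma0 D e * cmod2 (u a - u b) <= graph_energy D 0 u.
  rewrite /graph_energy (big_rem e) //= -E.
  have -> : gamma D 0 e = gamma0 D e.
    have := @gammaE 0 [tuple] e he.
    by rewrite (_ : Fword _ = id) ?imfset_id // expr0 invr1 mul1r.
  rewrite lerDl big_seq_cond sumr_ge0 // => e' /andP[/mem_rem he' _].
  by rewrite mulr_ge0 ?cmod2_ge0' // ltW // gamma_gt0.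
apply: (@le_trans _ _ ((gamma0 D e)^-1 * graph_energy D 0 u)).
  by rewrite -ler_pdivrMl ?invr_gt0 // invrK.
by rewrite ler_wpM2r ?graph_energy_ge0 // le_edge_resistance.
Qed.

Lemma osc_cell m (w : word m) u a b : a \in V0 D -> b \in V0 D ->
  cmod2 (u (Fword w a) - u (Fword w b)) <=
    edge_resistance * (renorm D ^+ m * graph_energy D m u).
Proof.
move=> aV bV; apply: le_trans (osc_V0 (u \o Fword w) aV bV) _.
rewrite ler_wpM2l ?edge_resistance_ge0 //.
by have := graph_energy_word 0 w u; rewrite addn0.
Qed.

End Fractal.

(** * Continuity of complex functions on a subset *)

Section ComplexContinuity.
Variables (R : realType) (T : topologicalType) (A : set T).

(** A positive tolerance for the complex-valued norm is a complex number with zero imaginary part;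
    this reduces continuity to real tolerances. *)
Lemma within_continuousP (u : T -> R[i]) :
  {within A, continuous (u : T -> R[i]^o)} <->
  (forall x, A x -> forall e : R, 0 < e -> \forall y \near x, A y -> cmod (u x - u y) < e).
Proof.
split.
  move=> /subspace_continuousP h x Ax e e0.
  have /cvgrPdist_lt /(_ e%:C) H := h x Ax.
  have {}H : \forall y \near x, A y -> `|(u x : R[i]^o) - u y| < e%:C.
    by apply: H; rewrite (ltcR 0 e).
  apply: filterS H => y hy Ay; have := hy Ay.
  by rewrite normc_def -/(cmod2 _) -cmodE ltcR.
move=> h; apply/subspace_continuousP => x Ax; apply/cvgrPdist_lt => e e0.
have eE : e = (Re e)%:C by move: e0; rewrite ltcE /= => /andP[/eqP h0 _]; case: (e) h0 => a b /= ->.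
have re : 0 < Re e by move: e0; rewrite ltcE /= => /andP[].
apply: filterS (h x Ax _ re) => y hy Ay.
by rewrite normc_def -/(cmod2 _) -cmodE eE ltcR; exact: hy.
Qed.

Lemma within_continuousDZ (c : R[i]) (u v : T -> R[i]) :
  {within A, continuous (u : T -> R[i]^o)} ->
  {within A, continuous (v : T -> R[i]^o)} ->
  {within A, continuous ((fun x => c * u x + v x) : T -> R[i]^o)}.
Proof.
move=> /within_continuousP hu /within_continuousP hv; apply/within_continuousP => x Ax e e0.
have c0 : 0 < cmod c + 1 by rewrite ltr_wpDl ?cmod_ge0.
have e1 : 0 < e / 2 / (cmod c + 1) by rewrite !divr_gt0.
have e2 : 0 < e / 2 by rewrite divr_gt0.
apply: filterS2 (hu x Ax _ e1) (hv x Ax _ e2) => y k1 k2 Ay.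
have {}k1 := k1 Ay; have {}k2 := k2 Ay.
rewrite (_ : _ - _ = c * (u x - u y) + (v x - v y)); last by ring.
apply: le_lt_trans (cmodD _ _) _; rewrite (splitr e) cmodM; apply: ler_ltD => //.
apply: (@le_trans _ _ ((cmod c + 1) * cmod (u x - u y))).
  by rewrite ler_wpM2r ?cmod_ge0 // lerDl.
by move: k1; rewrite ltr_pdivlMr // mulrC => /ltW.
Qed.

Lemma within_uniform_limit (u_ : nat -> T -> R[i]) (u : T -> R[i]) :
  (forall n, {within A, continuous (u_ n : T -> R[i]^o)}) ->
  (forall e : R, 0 < e -> exists n, forall x, A x -> cmod (u_ n x - u x) < e) ->
  {within A, continuous (u : T -> R[i]^o)}.
Proof.
move=> hu lim; apply/within_continuousP => x Ax e e0.
have e3 : 0 < e / 3 by rewrite divr_gt0.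
have [n hn] := lim _ e3.
have /within_continuousP /(_ x Ax _ e3) := hu n; apply: filterS => y hy Ay.
have := hn x Ax; have := hn y Ay; have {}hy := hy Ay.
have := cmod_triangle (u x) (u y) (u_ n x); have := cmod_triangle (u_ n x) (u y) (u_ n y).
rewrite (cmodB (u x) (u_ n x)); lra.
Qed.

Lemma within_continuous_cst (c : R[i]) : {within A, continuous ((fun=> c) : T -> R[i]^o)}.
Proof.
by apply/within_continuousP => x Ax e e0; near=> y => _; rewrite subrr cmod0.
Unshelve. all: by end_near. Qed.

End ComplexContinuity.

(** * Cells and the topology of K *)

Section FractalTopology.
Variables (R : realType) (d : nat) (D : fractal R d).
Implicit Types (x y : 'rV[R]_d) (u : 'rV[R]_d -> R[i]).
Notation N := (nmaps D).
Notation word m := (m.-tuple 'I_N).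
Hypothesis pcfD : pcf_fractal D.

Lemma K_bounded : exists2 M : R, 0 < M & forall x y, K D x -> K D y -> euclid (x - y) <= M.
Proof.
have cK : compact (K D) by case: pcfD => _ [].
have [M0 [_ hM]] := compact_bounded cK.
pose M := Num.max 1 (M0 + 1).
have M0M : M0 < M by rewrite lt_max ltrDl ltr01 orbT.
have {}hM := hM M M0M.
have Mp : 0 < M by rewrite lt_max ltr01.
have dp : 0 < d%:R + 1 :> R by rewrite ltr_wpDl.
exists ((d%:R + 1) * (M + M)); first by rewrite mulr_gt0 // addr_gt0.
move=> x y Kx Ky; apply: le_trans (euclid_le_norm _) _.
rewrite ler_wpM2l ?(ltW dp) //; apply: le_trans (ler_normB _ _) _.
by apply: lerD; apply: hM.
Qed.

Lemma Fword_continuous (w : seq 'I_N) : continuous (Fword w : 'rV[R]_d -> 'rV[R]_d).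
Proof.
move=> x; apply/(@cvgrPdist_lt R 'rV[R]_d 'rV[R]_d (nbhs x) (nbhs_filter x)) => e e0.
have [th0 th1] := andP (theta01 pcfD).
apply: filterS (ball_near_euclid x e0) => y hy.
apply: le_lt_trans (norm_le_euclid _) _; apply: le_lt_trans hy.
rewrite (Fword_similar pcfD) ler_piMl ?euclid_ge0 //.
by rewrite exprn_ile1 ?ltW.
Qed.

Lemma closed_cell (w : seq 'I_N) : closed (Fword w @` K D).
Proof.
apply: compact_closed; first exact: norm_hausdorff.
apply: continuous_compact; last by case: pcfD => _ [].
exact/continuous_subspaceT/Fword_continuous.
Qed.

(** The cells of one level are finitely many closed sets, so x has a neighbourhood that avoids all
    cells not containing x. *)
Lemma near_cells m x : \forall y \near x, forall w : word m,
  (Fword w @` K D) y -> (Fword w @` K D) x.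
Proof.
have H (w : word m) : \forall y \near x, (Fword w @` K D) y -> (Fword w @` K D) x.
  2: exact: (@filter_forall _ {: word m} _ (nbhs x) (nbhs_filter x) H).
case: (pselect ((Fword w @` K D) x)) => [h|h].
  by near=> y.
have : nbhs x (~` (Fword w @` K D)).
  by apply: open_nbhs_nbhs; split => //; apply: closed_openC; exact: closed_cell.
by apply: filterS => y hy /hy.
Unshelve. all: by end_near. Qed.

(** A point of K close to x lies in some cell of the given level, and by [near_cells] that cell
    contains x too. A small oscillation on cells therefore gives continuity. *)
Lemma continuous_on_K u :
  (forall e : R, 0 < e -> exists m, forall (w : word m) x y,
    (Fword w @` K D) x -> (Fword w @` K D) y -> cmod (u x - u y) < e) ->
  {within K D, continuous (u : 'rV[R]_d -> R[i]^o)}.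
Proof.
move=> h; apply/within_continuousP => x Kx e e0.
have [m hm] := h e e0.
apply: filterS (near_cells m x) => y hy Ky.
by have [w yw] := K_cover pcfD m Ky; apply: (hm w) => //; exact: hy.
Qed.

(** Induction on the level. A common first letter is cancelled by injectivity. If the first letters
    differ, the overlap condition puts x in F_j(V_0), and it remains to write the boundary point v
    with F_j(v) = x as F_a of a boundary point, where a is the rest of the word. *)
Lemma cells_overlap m (w w' : word m) x : w != w' ->
  (Fword w @` K D) x -> (Fword w' @` K D) x -> exists2 v, v \in V0 D & x = Fword w v.
Proof.
elim: m w w' x => [|m IH] w w' x; first by rewrite tuple0 [w']tuple0 eqxx.
case/tupleP: w => j a; case/tupleP: w' => j' b.
move=> ne [k Kk kx] [k' Kk' k'x].
have kx' : F j (Fword a k) = x by [].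
have k'x' : F j' (Fword b k') = x by [].
have [jj|jj] := eqVneq j j'.
  have ab : a != b by apply: contraNneq ne => ->; rewrite jj.
  have e : Fword a k = Fword b k' by apply: (@F_inj _ _ _ pcfD j); rewrite kx' jj k'x'.
  have [||v hv hx] := IH a b (Fword a k) ab.
  - by exists k.
  - by exists k'.
  by exists v => //; rewrite -kx' hx.
have [v hv vx] : exists2 v, v \in V0 D & F j v = x.
  case: (pcfD) => _ _ _ _ [_ _ h]; have [] := h j j' jj x.
    split; [exists (Fword a k) => //|exists (Fword b k') => //]; exact: K_Fword.
  by move=> [v hv vx] _; exists v.
have va : v = Fword a k by apply: (@F_inj _ _ _ pcfD j); rewrite vx.
have [i iv] := V0_fixed pcfD hv.
(* v is fixed by F_i and so lies in the cell of the constant word i...i. Either a is this word and v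
   is its own preimage, or v lies in two cells of level m and the induction hypothesis applies. *)
pose c : word m := [tuple of nseq m i].
have cv : Fword c v = v by rewrite /= /c /=; elim: (m) => //= n ->.
have [ac|ac] := eqVneq a c.
  exists k => //; suff <- : v = k by [].
  by apply: (@Fword_inj _ _ _ pcfD a); rewrite -va ac cv.
have [||v' hv' hv'v] := IH a c v ac.
- by exists k.
- by exists v => //; exact: V0_K.
by exists v' => //=; rewrite -hv'v vx.
Qed.

Lemma cell_small (e : R) : 0 < e -> exists m0, forall m (w : word m) x y,
  (m0 <= m)%N -> (Fword w @` K D) x -> (Fword w @` K D) y -> euclid (x - y) < e.
Proof.
move=> e0; have [M M0 hM] := K_bounded.
have [th0 th1] := andP (theta01 pcfD).
have [|n0 hn] := @geometric_small R M (theta D) e _ e0; first by rewrite ltW.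
exists n0 => m w x y /hn hm [a Ka <-] [b Kb <-].
rewrite (Fword_similar pcfD) size_tuple mulrC; apply: le_lt_trans hm.
by rewrite ler_wpM2r ?hM // exprn_ge0 // ltW.
Qed.

Lemma Vm_dense x (B : set 'rV[R]_d) : K D x -> nbhs x B -> exists m0, forall m (w : word m) y,
  (m0 <= m)%N -> (Fword w @` K D) x -> (Fword w @` K D) y -> B y.
Proof.
move=> Kx /nbhs_ballP[e e0 Be]; have [m0 hm] := cell_small e0.
exists m0 => m w y mm xw yw; apply: Be; rewrite -ball_normE /=.
exact: le_lt_trans (norm_le_euclid _) (hm _ _ _ _ mm xw yw).
Qed.

End FractalTopology.

(** * Oscillation of functions of finite energy *)

Section Oscillation.
Variables (R : realType) (d : nat) (D : fractal R d).
Implicit Types (x y : 'rV[R]_d) (u : 'rV[R]_d -> R[i]).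
Notation N := (nmaps D).
Notation word m := (m.-tuple 'I_N).
Hypothesis pcfD : pcf_fractal D.
Hypothesis graphsD : weighted_graphs D.
Hypothesis harmD : harmonic_functions D.

Lemma graph_energy_shift m u c :
  graph_energy D m (fun x => u x + c) = graph_energy D m u.
Proof.
by apply: eq_bigr => e _; rewrite opprD addrACA subrr addr0.
Qed.

Lemma graph_energy_cst m c : graph_energy D m (fun=> c) = 0.
Proof. by apply: big1 => e _; rewrite subrr cmod2_0 mulr0. Qed.

Lemma sqrt_edge m (w : word m) u a b : a \in V0 D -> b \in V0 D ->
  cmod (u (Fword w a) - u (Fword w b)) <=
  Num.sqrt (edge_resistance D * renorm D ^+ m) * Num.sqrt (graph_energy D m u).
Proof.
move=> aV bV; have r0 := renorm_gt0 graphsD.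
have rm0 : 0 <= renorm D ^+ m by rewrite exprn_ge0 // ltW.
have er0 := edge_resistance_ge0 graphsD.
have E0 := graph_energy_ge0 graphsD m u.
rewrite -sqrtrM ?mulr_ge0 // cmodE ler_sqrt ?mulr_ge0 //.
by rewrite -mulrA; exact: osc_cell.
Qed.

(* A 1-cell is good if it is connected to [v0] in G_1. An isolated union of
   1-cells either meets V_0, contradicting the compatibility of E_0 and E_1, or
   its indicator may be added to a 0-harmonic function, contradicting uniqueness. *)
Definition good (v0 : 'rV[R]_d) (j : 'I_N) : Prop := exists c : R, forall u x, x \in V0 D ->
  cmod (u (F j x) - u v0) <= c * Num.sqrt (graph_energy D 1 u).

Lemma good_fixed v0 j : v0 \in V0 D -> F j v0 = v0 -> good v0 j.
Proof.
move=> hv jv; exists (Num.sqrt (edge_resistance D * renorm D ^+ 1)) => u x hx.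
by have := @sqrt_edge 1 [tuple j] u x v0 hx hv; rewrite /= jv.
Qed.

Lemma good_neighbour v0 j j' x x' : good v0 j -> x \in V0 D -> x' \in V0 D ->
  F j x = F j' x' -> good v0 j'.
Proof.
move=> [c hc] hx hx' e.
exists (Num.sqrt (edge_resistance D * renorm D ^+ 1) + c) => u y hy.
apply: le_trans (cmod_triangle _ _ (u (F j' x'))) _; rewrite mulrDl lerD //.
  exact: (@sqrt_edge 1 [tuple j'] u y x' hy hx').
by rewrite -e; exact: hc.
Qed.

Lemma all_good v0 j : v0 \in V0 D -> good v0 j.
Proof.
move=> hv0; apply: contrapT => nj.
pose U x := exists2 i, ~ good v0 i & exists2 k, K D k & F i k = x.
pose f x : R[i] := if `[< U x >] then 1 else 0.
(* A point shared by a good and a bad cell would be a vertex of both and make the bad cell good. *)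
have UE i k : K D k -> U (F i k) <-> ~ good v0 i.
  move=> Kk; split=> [[i' ni' [k' Kk' e]] gi|ni]; last by exists i => //; exists k.
  have ii : i != i' by apply/eqP => ei; apply: ni'; rewrite -ei.
  case: (pcfD) => _ _ _ _ [_ _ h]; have [] := h i i' ii (F i k).
    by split; [exists k|exists k'].
  move=> [a ha ea] [b hb eb]; apply: ni'.
  by apply: (good_neighbour gi ha hb); rewrite ea eb.
have fE i k : K D k -> f (F i k) = if `[< good v0 i >] then 0 else 1.
  move=> Kk; rewrite /f; have := UE i k Kk.
  by case: asboolP => h1; case: asboolP => h2 // [h3 h4]; [case: (h3 h1)|case: h1; exact: h4].
(* f is constant on every 1-cell, and from level 1 on each edge lies inside a 1-cell. *)
have const_cell n u c : graph_energy D n.+1 (fun x => u x + c * f x) = graph_energy D n.+1 u.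
  rewrite -add1n !(graph_energy_cat pcfD graphsD 1 n); apply: eq_bigr => w _; congr (_ * _).
  case/tupleP: w => i w; rewrite tuple0 /=.
  rewrite -(@graph_energy_shift n (u \o F i) (c * if `[< good v0 i >] then 0 else 1)).
  apply: (eq_graph_energy pcfD) => x hx /=.
  by rewrite fE //; exact: Vm_K hx.
have Ef n : graph_energy D n.+1 f = 0.
  rewrite -[RHS](graph_energy_cst n.+1 0) -(const_cell n (fun=> 0) 1).
  by congr graph_energy; apply/funext => x; rewrite add0r mul1r.
(* Compatibility gives E_0(f) <= E_1(f) = 0, so f is constant on V_0; it vanishes at v0 because the
   cell whose map fixes v0 is good. *)
have f0 x : x \in V0 D -> f x = 0.
  move=> hx; have E0 : graph_energy D 0 f = 0.
    apply/eqP; rewrite eq_le graph_energy_ge0 // andbT -(Ef 0).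
    exact: graph_energy_mono.
  have fv0 : f v0 = 0.
    have [i iv] := V0_fixed pcfD hv0.
    rewrite -iv fE; last exact: V0_K.
    by case: asboolP => // -[]; exact: good_fixed.
  have := osc_V0 graphsD f hx hv0.
  rewrite E0 mulr0 fv0 subr0 => h; apply/cmod_eq0/eqP.
  by rewrite -sqrf_eq0 cmod_sqr eq_le h cmod2_ge0'.
have cf : {within K D, continuous (f : 'rV[R]_d -> R[i]^o)}.
  apply: (continuous_on_K pcfD) => e e0; exists 1%N => w x y.
  case/tupleP: w => i w; rewrite tuple0 /= => -[a Ka <-] [b Kb <-].
  by rewrite !fE // subrr cmod0.
have [p hp uniq_p] := @harmD 0%N v0 hv0.
(* Adding f changes neither the values on V_0 nor the energy, so p + f is a second 0-harmonic
   function for v0, yet it differs from p on the bad cell j. *)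
have hp' : m_harmonic D 0 v0 (fun x => p x + f x).
  case: hp => [[cp Ep] pV pmin].
  have lim_p : (fun n => graph_energy D n (fun x => p x + f x)) @ \oo --> energy D p.
    apply: cvg_trans Ep; apply: near_eq_cvg; exists 1%N => // -[//|n] _ /=.
    rewrite -(const_cell n p 1); congr graph_energy.
    by apply/funext => x; rewrite mul1r.
  split.
  - split; last by apply/cvg_ex; exists (energy D p).
    have -> : (fun x => p x + f x) = (fun x => 1 * p x + f x).
      by apply/funext => x; rewrite mul1r.
    exact: (within_continuousDZ (c := 1) cp cf).
  - by move=> v' hv'; rewrite f0 // addr0 pV.
  - move=> u du hu; rewrite [leLHS](_ : _ = energy D p); first exact: pmin.
    exact: (cvg_lim (@Rhausdorff R) lim_p).
have [x0 Kx0] : K D !=set0 by case: pcfD => _ [].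
have := uniq_p _ hp' (F j x0) (K_F pcfD j Kx0).
rewrite fE //; case: asboolP => // _ /eqP.
by rewrite -subr_eq0 addrAC subrr add0r oner_eq0.
Qed.

(** The sum of the constants over the finitely many 1-cells serves as a common constant. *)
Lemma osc_V1 v0 : v0 \in V0 D -> exists2 S : R, 0 <= S & forall u x, x \in Vm D 1 ->
  cmod (u x - u v0) <= S * Num.sqrt (graph_energy D 1 u).
Proof.
move=> hv0; have H j : good v0 j by exact: all_good.
have [c hc] := choice H.
exists (\sum_j `|c j|); first by apply: sumr_ge0.
move=> u x /VmP[w [v [hv ->]]]; case/tupleP: w => j w; rewrite tuple0 /=.
apply: le_trans (hc j u v hv) _; rewrite ler_wpM2r ?sqrtr_ge0 //.
by rewrite (bigD1 j) //= (le_trans (ler_norm _)) // lerDl sumr_ge0.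
Qed.

Lemma sqrt_renorm01 : 0 <= Num.sqrt (renorm D) < 1.
Proof.
have /andP[r0 r1] := renorm01 graphsD.
by rewrite sqrtr_ge0 /= -sqrtr1 ltr_sqrt.
Qed.

(** A vertex F_j(y) is compared first with F_j(v0), inside the cell, and then with v0, at level 1.
    Entering a cell costs only a factor sqrt(r) < 1 in the root of the energy, so the constant does
    not grow with m. *)
Lemma osc_Vm v0 : v0 \in V0 D -> exists2 B : R, 0 <= B & forall m u x, x \in Vm D m ->
  cmod (u x - u v0) <= B * Num.sqrt (graph_energy D m u).
Proof.
move=> hv0; have [S S0 hS] := osc_V1 hv0.
have /andP[s0 s1] := sqrt_renorm01; set s := Num.sqrt (renorm D) in s0 s1.
have s1' : 0 < 1 - s by rewrite subr_gt0.
(* S / (1 - s) is the fixed point of z = S + s z required by the induction; the other summand covers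
   level 0. *)
pose B := Num.sqrt (edge_resistance D) + S / (1 - s).
have B0 : 0 <= B by rewrite addr_ge0 ?sqrtr_ge0 // divr_ge0 // ltW.
have BS : S + s * B <= B.
  have : s * Num.sqrt (edge_resistance D) <= Num.sqrt (edge_resistance D).
    by rewrite ler_piMl ?sqrtr_ge0 // ltW.
  rewrite /B; have : S / (1 - s) = S + s * (S / (1 - s)) by field; exact: lt0r_neq0.
  by set z := S / (1 - s); lra.
exists B => //; elim=> [|m IH] u x hx.
  have := @sqrt_edge 0 [tuple] u x v0 hx hv0; rewrite expr0 mulr1 /=.
  by move/le_trans; apply; rewrite ler_wpM2r ?sqrtr_ge0 // lerDl divr_ge0 // ltW.
have /VmP[w [v [hv xE]]] := hx; case/tupleP: w xE => j w /= xE.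
have hy : Fword w v \in Vm D m by apply/VmP; exists w, v.
apply: le_trans (cmod_triangle _ _ (u (F j v0))) _.
have h1 := IH (u \o F j) _ hy; rewrite /= -xE in h1.
have h2 : cmod (u (F j v0) - u v0) <= S * Num.sqrt (graph_energy D 1 u).
  by apply: hS; exact: Vm_F.
have h3 : Num.sqrt (graph_energy D m (u \o F j)) <= s * Num.sqrt (graph_energy D m.+1 u).
  have r0 := renorm_gt0 graphsD.
  rewrite -sqrtrM ?(ltW r0) // ler_sqrt ?mulr_ge0 ?graph_energy_ge0 ?(ltW r0) //.
  by have := @graph_energy_word _ _ _ pcfD graphsD 1 m [tuple j] u; rewrite expr1.
have h4 : Num.sqrt (graph_energy D 1 u) <= Num.sqrt (graph_energy D m.+1 u).
  by rewrite ler_sqrt ?graph_energy_ge0 // (graph_energy_leq graphsD).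
apply: le_trans (lerD h1 h2) _.
apply: (@le_trans _ _ ((S + s * B) * Num.sqrt (graph_energy D m.+1 u))).
  rewrite [leRHS]mulrDl [leRHS]addrC; apply: lerD; last by rewrite ler_wpM2l.
  by rewrite (mulrC s) -mulrA ler_wpM2l.
by rewrite ler_wpM2r ?sqrtr_ge0.
Qed.

End Oscillation.

(** * Extension from the vertices to K *)

Section Extension.
Variables (R : realType) (d : nat) (D : fractal R d).
Implicit Types (x y : 'rV[R]_d) (u : 'rV[R]_d -> R[i]).
Notation N := (nmaps D).
Notation word m := (m.-tuple 'I_N).
Hypothesis pcfD : pcf_fractal D.
Hypothesis graphsD : weighted_graphs D.
Hypothesis harmD : harmonic_functions D.

Lemma graph_energy_cvg u (E : R) : (forall n, graph_energy D n u <= E) ->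
  cvgn (fun n => graph_energy D n u).
Proof.
move=> h; apply: nondecreasing_is_cvgn.
  by move=> m n; exact: (graph_energy_leq graphsD).
by exists E => _ [n _ <-].
Qed.

Lemma graph_energy_le_energy m u : dom_energy D u -> graph_energy D m u <= energy D u.
Proof.
move=> [_ h]; apply: nondecreasing_cvgn_le h m.
by move=> m n; exact: (graph_energy_leq graphsD).
Qed.

Lemma energy_ge0 u : dom_energy D u -> 0 <= energy D u.
Proof.
by move=> du; apply: le_trans (graph_energy_le_energy 0 du); exact: graph_energy_ge0.
Qed.

(* The value at [x] of the extension is the limit of [f (F_w v0)] over the cells
   [w] containing [x]; when [x] lies in two cells of the same level, it is a
   vertex and both values are close to [f x]. *)
Lemma continuous_extension (f : 'rV[R]_d -> R[i]) (E : R) :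
  (forall n, graph_energy D n f <= E) ->
  exists2 u, dom_energy D u & forall n, {in Vm D n, u =1 f}.
Proof.
move=> fE; have [v0 hv0] := V0_neq0 pcfD.
have [S S0 hS] := osc_V1 pcfD graphsD harmD hv0.
have s01 := sqrt_renorm01 graphsD; set s := Num.sqrt (renorm D) in s01.
have /andP[s0 s1] := s01.
have r0 := ltW (renorm_gt0 graphsD).
have sE n : Num.sqrt (renorm D ^+ n) = s ^+ n.
  apply/eqP; rewrite -(@eqrXn2 _ 2) ?sqrtr_ge0 ?exprn_ge0 //.
  by rewrite sqr_sqrtr ?exprn_ge0 // -exprM mulnC exprM sqr_sqrtr.
have E0 : 0 <= E by apply: le_trans (fE 0%N); exact: graph_energy_ge0.
have er0 := edge_resistance_ge0 graphsD.
pose C0 := Num.sqrt (edge_resistance D) * Num.sqrt E.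
pose C1 := S * Num.sqrt E.
have C00 : 0 <= C0 by rewrite mulr_ge0 ?sqrtr_ge0.
have C10 : 0 <= C1 by rewrite mulr_ge0 ?sqrtr_ge0.
have oscC n (w : word n) a b : a \in V0 D -> b \in V0 D ->
    cmod (f (Fword w a) - f (Fword w b)) <= C0 * s ^+ n.
  move=> ha hb; apply: le_trans (sqrt_edge pcfD graphsD w f ha hb) _.
  rewrite sqrtrM // sE /C0 mulrAC ler_wpM2r ?exprn_ge0 // ler_wpM2l ?sqrtr_ge0 //.
  by rewrite ler_sqrt.
have oscS n (w : word n) (j : 'I_N) :
    cmod (f (Fword w (F j v0)) - f (Fword w v0)) <= C1 * s ^+ n.
  have := hS (f \o Fword w) (F j v0) (@Vm_F _ _ D 0 j v0 hv0).
  move/le_trans; apply; rewrite /C1 -mulrA ler_wpM2l // -sE -sqrtrM //.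
  rewrite ler_sqrt ?mulr_ge0 ?exprn_ge0 // mulrC.
  apply: le_trans (graph_energy_word pcfD graphsD 1 w f) _.
  by rewrite ler_wpM2l ?exprn_ge0.
have overlap n (w w' : word n) x : (Fword w @` K D) x -> (Fword w' @` K D) x ->
    cmod (f (Fword w v0) - f (Fword w' v0)) <= 2 * C0 * s ^+ n.
  move=> xw xw'; have [->|ww'] := eqVneq w w'.
    by rewrite subrr cmod0 mulr_ge0 ?exprn_ge0 // mulr_ge0.
  have [v hv xv] := cells_overlap pcfD ww' xw xw'.
  have [v' hv' xv'] : exists2 v, v \in V0 D & x = Fword w' v.
    by apply: (cells_overlap pcfD _ xw' xw); rewrite eq_sym.
  apply: le_trans (cmod_triangle _ _ (f x)) _.
  rewrite -mulrA mulr2n mulrDl mul1r; apply: lerD; [rewrite xv|rewrite xv']; exact: oscC.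
(* A cell of level n containing x; the constant word is only a default for x outside K. *)
pose wn n x : word n := xget [tuple of nseq n (Ordinal (N_gt0 pcfD))]
  [set w : word n | (Fword w @` K D) x].
have wnP n x : K D x -> (Fword (wn n x) @` K D) x.
  move=> Kx; rewrite /wn; case: xgetP => [w _ //|].
  by have [w xw] := K_cover pcfD n Kx => /(_ w).
pose a x n := f (Fword (wn n x) v0).
pose M := C1 + 2 * C0.
have M0 : 0 <= M by rewrite addr_ge0 ?mulr_ge0.
(* The cell chosen at level n + 1 need not lie in the one chosen at level n. The comparison goes
   through its own parent p, which contains x as well. *)
have stepa x : K D x -> forall n, cmod (a x n.+1 - a x n) <= M * s ^+ n.
  move=> Kx n; have := wnP n.+1 x Kx; rewrite /a.
  move: (wn n.+1 x) => w'; case/tupleP: w' => j0 t0.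
  have [p [j pj]] : exists p : word n, exists j, Fword [tuple of j0 :: t0] =1 Fword (rcons p j).
    have sz : size (belast j0 t0) == n by rewrite size_belast size_tuple.
    by exists (Tuple sz), (last j0 t0) => y /=; rewrite -lastI.
  move=> [k Kk]; rewrite !pj Fword_rcons => xk.
  have xp : (Fword p @` K D) x by rewrite -xk; exists (F j k) => //; exact: K_F.
  rewrite Fword_rcons; apply: le_trans (cmod_triangle _ _ (f (Fword p v0))) _.
  by rewrite mulrDl; apply: lerD; [exact: oscS|apply: overlap xp _; exact: wnP].
pose u x := xget 0 [set l | ccvg (a x) l].
have hu x : K D x -> ccvg (a x) (u x) /\ forall n, cmod (u x - a x n) <= M / (1 - s) * s ^+ n.
  move=> Kx; have [l cl hl] := geometric_ccvg s01 M0 (stepa x Kx).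
  have -> : u x = l.
    rewrite /u; case: xgetP => [l' _ cl'|/(_ l)//]; exact: ccvg_unique cl' cl.
  by split.
pose C2 := M / (1 - s) + 2 * C0.
have C20 : 0 <= C2.
  by rewrite addr_ge0 ?mulr_ge0 // invr_ge0 subr_ge0 ltW.
have cell n (w : word n) x : (Fword w @` K D) x -> cmod (u x - f (Fword w v0)) <= C2 * s ^+ n.
  move=> xw; have Kx : K D x by case: xw => k Kk <-; exact: K_Fword.
  apply: le_trans (cmod_triangle _ _ (a x n)) _; rewrite mulrDl; apply: lerD.
    exact: (hu x Kx).2.
  by apply: (@overlap _ _ _ x) => //; exact: wnP.
have cu : {within K D, continuous (u : 'rV[R]_d -> R[i]^o)}.
  apply: (continuous_on_K pcfD) => e e0.
  have e2 : 0 < e / 2 by rewrite divr_gt0.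
  have [n0 hn] := geometric_small C2 s01 e2; exists n0 => w x y xw yw.
  apply: le_lt_trans (cmod_triangle _ _ (f (Fword w v0))) _.
  rewrite (splitr e) [X in _ + X]cmodB.
  by apply: ltrD; apply: le_lt_trans (cell _ _ _ _) (hn _ (leqnn _)).
(* f itself is not known to be continuous: u(x) and f(x) are both compared with f(F_w(v0)) for a
   word w of high level whose cell has x as a vertex. *)
have uf n : {in Vm D n, u =1 f}.
  move=> x hx; apply/eqP; rewrite -subr_eq0; apply/eqP/cmod_eq0/eqP.
  rewrite eq_le cmod_ge0 andbT; apply/ler_addgt0Pl => e e0; rewrite addr0.
  have [n0 hn] := geometric_small (C2 + C0) s01 e0.
  have /VmP[w [v [hv xE]]] := Vm_leq pcfD (leq_maxl n n0) hx.
  apply: le_trans (cmod_triangle _ _ (f (Fword w v0))) _.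
  apply: le_trans (ltW (hn _ (leq_maxr n n0))); rewrite mulrDl; apply: lerD.
    by apply: cell; exists v => //; exact: V0_K.
  by rewrite xE; exact: oscC.
exists u => //; split => //; apply: (@graph_energy_cvg u E) => n.
by rewrite (eq_graph_energy pcfD (uf n)).
Qed.

(** Compatibility provides a minimiser at each next level with the same energy. Iterating it defines
    a function on all V_n whose energies are bounded by E_m(phi), and this function extends
    continuously. *)
Lemma energy_minimal_extension m (phi : 'rV[R]_d -> R[i]) :
  exists u, [/\ dom_energy D u, {in Vm D m, u =1 phi} & energy D u = graph_energy D m phi].
Proof.
have [ext hext] : exists ext : nat -> ('rV[R]_d -> R[i]) -> 'rV[R]_d -> R[i],
    forall n g, {in Vm D n, ext n g =1 g} /\ graph_energy D n.+1 (ext n g) = graph_energy D n g.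
  have H (p : nat * ('rV[R]_d -> R[i])) : exists f : 'rV[R]_d -> R[i],
      {in Vm D p.1, f =1 p.2} /\ graph_energy D p.1.+1 f = graph_energy D p.1 p.2.
    by have [_ [f f1 f2]] := compatD graphsD p.1 p.2; exists f.
  have [e he] := choice H; exists (fun n g => e (n, g)) => n g; exact: (he (n, g)).
pose g := fix g k := if k is k'.+1 then ext (m + k')%N (g k') else phi.
have gE k : graph_energy D (m + k) (g k) = graph_energy D m phi.
  elim: k => [|k IH]; first by rewrite addn0.
  by rewrite addnS /= (hext _ _).2.
have gS k j : {in Vm D (m + k), g (k + j)%N =1 g k}.
  elim: j => [|j IH] x hx; first by rewrite addn0.
  rewrite addnS /= (hext _ _).1 ?IH //.
  by apply: (Vm_leq pcfD _ hx); rewrite leq_add2l leq_addr.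
(* The value is taken at the first level where x is a vertex; by [gS] later levels do not change
   it. *)
pose f x := if pselect (exists k, x \in Vm D (m + k)) is left h then g (ex_minn h) x else 0.
have fg k : {in Vm D (m + k), f =1 g k}.
  move=> x hx; rewrite /f; case: pselect => [h|[]]; last by exists k.
  case: ex_minnP => k0 h0 /(_ k hx) k0k.
  by rewrite -(subnKC k0k) gS.
have fE k : graph_energy D (m + k) f = graph_energy D m phi.
  by rewrite (eq_graph_energy pcfD (@fg k)).
have [|u du uf] := @continuous_extension f (graph_energy D m phi).
  move=> n; rewrite -(fE n); apply: (graph_energy_leq graphsD); exact: leq_addl.
exists u; split => //.
  by move=> x hx; rewrite (uf m) // -[phi x]/(g 0%N x) -(@fg 0%N) ?addn0.
apply: (cvg_lim (@Rhausdorff R)); apply: cvg_near_cst.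
exists m => // n /= /subnKC <-.
by rewrite (eq_graph_energy pcfD (@uf _)) fE.
Qed.

End Extension.

(** * The energy form on continuous functions *)

Section EnergyOnFunctions.
Variables (R : realType) (d : nat) (D : fractal R d).
Implicit Types (x y : 'rV[R]_d) (u : 'rV[R]_d -> R[i]).
Notation N := (nmaps D).
Notation word m := (m.-tuple 'I_N).
Hypothesis pcfD : pcf_fractal D.
Hypothesis graphsD : weighted_graphs D.

Lemma gform_hermitian m : hermitian_on setT (gform D m).
Proof.
split=> [c u v w _ _ _|u v _ _]; last exact: gformC.
by rewrite -gform_linear.
Qed.

Lemma hermitian_onB (V : lmodType R[i]) (A : set V) (B C : V -> V -> R[i]) :
  hermitian_on A B -> hermitian_on A C -> hermitian_on A (fun f g => B f g - C f g).
Proof.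
move=> [B1 B2] [C1 C2]; split=> [c f g h Af Ag Ah|f g Af Ag].
  by rewrite B1 // C1 //; ring.
by rewrite (B2 f g) // (C2 f g) // rmorphB.
Qed.

(** E_n - E_m is positive semidefinite by compatibility. Its Cauchy-Schwarz inequality turns
    convergence of the energies into convergence of the mixed forms. *)
Lemma gform_increment m n u v : (m <= n)%N ->
  cmod2 (gform D n u v - gform D m u v) <=
  (graph_energy D n u - graph_energy D m u) * (graph_energy D n v - graph_energy D m v).
Proof.
move=> mn.
have E w : Re (gform D n w w - gform D m w w) = graph_energy D n w - graph_energy D m w.
  by rewrite ReB !gform_energy.
rewrite -!E.
apply: (cauchy_schwarz_on (D := setT) (B := fun f g => gform D n f g - gform D m f g)) => //.
- exact: hermitian_onB (gform_hermitian _) (gform_hermitian _).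
- by move=> h _; rewrite E subr_ge0; exact: graph_energy_leq.
Qed.

(** The sesquilinear form of [energy], as the limit of the discrete forms; it is meaningful on
    [dom_energy] and has the default 0 where the limit does not exist. *)
Definition eform u (v : 'rV[R]_d -> R[i]) : R[i] :=
  xget 0 [set l | ccvg (fun m => gform D m u v) l].

Lemma energy_cauchy u : dom_energy D u -> forall e : R, 0 < e -> exists n0, forall m n,
  (n0 <= m)%N -> (m <= n)%N -> graph_energy D n u - graph_energy D m u < e.
Proof.
move=> du e e0; have [_ /cvgrPdist_lt /(_ e e0)[n0 _ hn]] := du.
exists n0 => m n hm mn; have := hn m hm; rewrite /= -/(energy D u).
have h := graph_energy_le_energy graphsD n du.
by rewrite ger0_norm ?subr_ge0 ?graph_energy_le_energy //; lra.
Qed.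

Lemma eformP u v : dom_energy D u -> dom_energy D v ->
  ccvg (fun m => gform D m u v) (eform u v).
Proof.
move=> du dv; rewrite /eform; case: xgetP => [l _ //|H].
have [l cl] : exists l, ccvg (fun m => gform D m u v) l; last by case: (H l).
apply: cauchy_ccvg => e e0.
have [n1 h1] := energy_cauchy du e0; have [n2 h2] := energy_cauchy dv e0.
have key m n : (maxn n1 n2 <= m)%N -> (m <= n)%N -> cmod (gform D n u v - gform D m u v) < e.
  rewrite geq_max => /andP[m1 m2] mn.
  rewrite -ltr_sqr ?nnegrE ?cmod_ge0 ?ltW // cmod_sqr.
  apply: le_lt_trans (gform_increment u v mn) _; rewrite expr2.
  by apply: ltr_pM; rewrite ?subr_ge0 ?graph_energy_leq ?h1 ?h2.
exists (maxn n1 n2) => m n hm hn; have [mn|nm] := leqP m n.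
  by rewrite cmodB; exact: key.
by apply: key => //; exact: ltnW.
Qed.

Lemma eform_lim u v l : dom_energy D u -> dom_energy D v ->
  ccvg (fun m => gform D m u v) l -> eform u v = l.
Proof. by move=> du dv; apply: ccvg_unique; exact: eformP. Qed.

Lemma ccvg_realC (u : nat -> R) (l : R) : u @ \oo --> l -> ccvg (fun n => (u n)%:C) l%:C.
Proof.
move=> /cvgrPdist_lt h e /h[n0 _ hn]; exists n0 => n /hn.
by rewrite -rmorphB cmod_real distrC.
Qed.

Lemma eform_energy u : dom_energy D u -> eform u u = (energy D u)%:C.
Proof.
move=> du; apply: eform_lim => //.
rewrite (_ : (fun m => _) = fun m => (graph_energy D m u)%:C).
  by apply: ccvg_realC; case: du.
by apply/funext => m; rewrite gform_energy.
Qed.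

Lemma dom_energy_subspace : linear_subspace (dom_energy D : set ('rV[R]_d -> R[i])).
Proof.
split.
  split; first exact: within_continuous_cst.
  apply: (@graph_energy_cvg _ _ D graphsD _ 0) => n.
  by rewrite (graph_energy_cst D n 0).
move=> c u v du dv; split; first by apply: within_continuousDZ; [case: du|case: dv].
have E n : graph_energy D n (c *: u + v) =
    cmod2 c * graph_energy D n u + 2 * Re (c * gform D n u v) + graph_energy D n v.
  apply: (@complexI R); rewrite -gform_energy addrC.
  rewrite (hermitian_expand (@subspaceT R _) (gform_hermitian n)) //.
  rewrite (gformC D n u v) !gform_energy; case: (gform D n u v) c => a b [a' b'].
  by rewrite ?conjCE /cmod2; simpc; rewrite /=; congr Complex; ring.
apply: (@graph_energy_cvg _ _ D graphsD _ (cmod2 c * energy D u +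
  2 * (cmod2 c * energy D u + energy D v) + energy D v)) => n; rewrite E.
have u0 := graph_energy_ge0 graphsD n u; have v0 := graph_energy_ge0 graphsD n v.
have hu := graph_energy_le_energy graphsD n du.
have hv := graph_energy_le_energy graphsD n dv.
have c0 := cmod2_ge0' c.
have cu : cmod2 c * graph_energy D n u <= cmod2 c * energy D u by rewrite ler_wpM2l.
apply: lerD => //; apply: lerD => //; rewrite ler_wpM2l //.
apply: le_trans (ler_norm _) _; apply: le_trans (normr_Re _) _.
apply: (@le_trans _ _ (cmod2 c * graph_energy D n u + graph_energy D n v)); last exact: lerD.
have cs : cmod2 (c * gform D n u v) <= (cmod2 c * graph_energy D n u) * graph_energy D n v.
  rewrite cmod2M -mulrA ler_wpM2l //.
  have := @cauchy_schwarz_on _ _ setT (gform D n) (@subspaceT R _) (gform_hermitian n) u v.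
  rewrite !gform_energy /=; apply => // w _.
  by rewrite gform_energy; exact: graph_energy_ge0.
have cu0 : 0 <= cmod2 c * graph_energy D n u by rewrite mulr_ge0.
rewrite -ler_sqr ?nnegrE ?cmod_ge0 ?addr_ge0 // cmod_sqr; apply: le_trans cs _.
set a := cmod2 c * _; set b := graph_energy _ _ _; have := sqr_ge0 (a - b).
have : 0 <= a * b by rewrite mulr_ge0.
by rewrite sqrrB sqrrD mulr2n; lra.
Qed.

Lemma eform_hermitian : hermitian_on (dom_energy D) eform.
Proof.
have sD := dom_energy_subspace.
split=> [c u v w du dv dw|u v du dv].
  apply: eform_lim => //; first exact: sD.2.
  rewrite (_ : (fun m => _) = fun m => c * gform D m u w + gform D m v w).
    by apply: ccvgDZ; exact: eformP.
  by apply/funext => m; rewrite -gform_linear.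
apply: eform_lim => // e e0; have [n0 hn] := eformP du dv e0.
by exists n0 => n /hn; rewrite (gformC D n u v) cmod_conjB.
Qed.

Lemma eform_gform_psd m u : dom_energy D u -> 0 <= Re (eform u u - gform D m u u).
Proof.
move=> du; rewrite ReB eform_energy // gform_energy subr_ge0.
exact: graph_energy_le_energy.
Qed.

Hypothesis harmD : harmonic_functions D.

Lemma psiP m v : v \in Vm D m -> m_harmonic D m v (psi D m v).
Proof.
move=> hv; have [p hp _] := harmD hv.
by rewrite /psi; case: xgetP => [q _ //|/(_ p)].
Qed.

Lemma dom_psi m v : v \in Vm D m -> dom_energy D (psi D m v).
Proof. by case/psiP. Qed.

(** [energy_minimal_extension] supplies a competitor with the same vertex values whose energy is
    already the discrete one. *)
Lemma energy_psi m v : v \in Vm D m -> energy D (psi D m v) = graph_energy D m (psi D m v).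
Proof.
move=> hv; have [dp pv pmin] := psiP hv.
apply/eqP; rewrite eq_le graph_energy_le_energy // andbT.
have [u [du uv <-]] := energy_minimal_extension pcfD graphsD harmD m (psi D m v).
by apply: pmin => // v' hv'; rewrite uv // pv.
Qed.

(** The form E_K - E_m is positive semidefinite and vanishes at psi, so by Cauchy-Schwarz psi lies
    in its kernel. *)
Lemma eform_psi m v u : v \in Vm D m -> dom_energy D u ->
  eform (psi D m v) u = gform D m (psi D m v) u.
Proof.
move=> hv du; have dp := dom_psi hv.
have hm : hermitian_on (dom_energy D) (fun f g => eform f g - gform D m f g).
  apply: hermitian_onB; first exact: eform_hermitian.
  by have [h1 h2] := gform_hermitian m; split=> *; [exact: h1|exact: h2].
have := cauchy_schwarz_on dom_energy_subspace hm (@eform_gform_psd m) dp du.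
rewrite eform_energy // energy_psi // gform_energy subrr mul0r => h.
apply/eqP; rewrite -subr_eq0; apply/eqP/cmod_eq0/eqP.
by rewrite -sqrf_eq0 cmod_sqr eq_le h cmod2_ge0'.
Qed.

(** Written in the basis of the psi_{m,v}, so that the extension is linear in phi and depends only
    on the values on V_m. *)
Definition mharmonic m (phi : 'rV[R]_d -> R[i]) (x : 'rV[R]_d) : R[i] :=
  \sum_(v <- Vm D m) phi v * psi D m v x.

Lemma big_vertices_subspace (s : seq 'rV[R]_d) m (phi : 'rV[R]_d -> R[i]) :
  {subset s <= Vm D m} ->
  dom_energy D (fun x => \sum_(v <- s) phi v * psi D m v x) /\
  forall u, dom_energy D u ->
    eform (fun x => \sum_(v <- s) phi v * psi D m v x) u =
    gform D m (fun x => \sum_(v <- s) phi v * psi D m v x) u.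
Proof.
have sD := dom_energy_subspace.
elim: s => [|v s IH] hs.
  under eq_fun do rewrite big_nil; split; first exact: sD.1.
  move=> u du.
  have := eform_hermitian.1 (-1) (fun=> 0) (fun=> 0) u sD.1 sD.1 du.
  rewrite mulN1r addNr => e0.
  have := (gform_hermitian m).1 (-1) (fun=> 0) (fun=> 0) u I I I.
  rewrite mulN1r addNr => g0.
  have z : (-1 *: (fun=> 0) + (fun=> 0) : 'rV[R]_d -> R[i]) = fun=> 0.
    by apply/funext => x; exact: (etrans (addr0 _) (mulr0 _)).
  by rewrite z in e0 g0; rewrite e0 g0.
have [|ds es] := IH; first by move=> x xs; apply: hs; rewrite inE xs orbT.
have hv : v \in Vm D m by apply: hs; rewrite inE eqxx.
have dp := dom_psi hv.
have -> : (fun x => \sum_(j <- v :: s) phi j * psi D m j x) =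
    phi v *: psi D m v + (fun x => \sum_(j <- s) phi j * psi D m j x).
  by apply/funext => x; rewrite big_cons.
split; first exact: sD.2.
move=> u du; rewrite eform_hermitian.1 // es // eform_psi //.
by rewrite (gform_hermitian m).1.
Qed.

Lemma dom_harmonic m phi : dom_energy D (mharmonic m phi).
Proof. by have [] := @big_vertices_subspace (Vm D m) m phi (fun _ h => h). Qed.

Lemma harmonic_val m phi : {in Vm D m, mharmonic m phi =1 phi}.
Proof.
move=> x hx; rewrite /mharmonic (bigD1_seq x) //= ?fset_uniq //.
have [_ pv _] := psiP hx; rewrite pv // eqxx mulr1 big_seq_cond big1 ?addr0 //.
move=> v /andP[hv vx]; have [_ pv' _] := psiP hv.
by rewrite pv' // eq_sym (negbTE vx) mulr0.
Qed.

Lemma eform_harmonic m phi u : dom_energy D u ->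
  eform (mharmonic m phi) u = gform D m phi u.
Proof.
move=> du; have [_ ->] // := @big_vertices_subspace (Vm D m) m phi (fun _ h => h).
by apply: eq_gform => // x hx; exact: harmonic_val.
Qed.

Lemma energy_harmonic m phi : energy D (mharmonic m phi) = graph_energy D m phi.
Proof.
apply: (@complexI R); rewrite -eform_energy ?eform_harmonic; try exact: dom_harmonic.
rewrite -gform_energy; apply: eq_gform => // x hx; exact: harmonic_val.
Qed.

Lemma harmonicDZ m c phi phi' :
  mharmonic m (fun x => c * phi x + phi' x) =
  (fun x => c * mharmonic m phi x + mharmonic m phi' x).
Proof.
apply/funext => x; rewrite /mharmonic mulr_sumr -big_split; apply: eq_bigr => v _ /=; ring.
Qed.

Lemma eq_harmonic m phi phi' : {in Vm D m, phi =1 phi'} -> mharmonic m phi = mharmonic m phi'.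
Proof. by move=> h; apply/funext => x; apply: eq_big_seq => v hv; rewrite h. Qed.

(** The vertices are dense in K and u is continuous there, so the bound of [osc_Vm], uniform in the
    level, passes to the limit. *)
Lemma osc_K v0 : v0 \in V0 D -> exists2 B : R, 0 <= B & forall u x, dom_energy D u -> K D x ->
  cmod (u x - u v0) <= B * Num.sqrt (energy D u).
Proof.
move=> hv0; have [B B0 hB] := osc_Vm pcfD graphsD harmD hv0; exists B => // u x du Kx.
apply/ler_addgt0Pl => e e0.
have /within_continuousP /(_ x Kx e e0) near_x := du.1.
have [m hm] := Vm_dense pcfD Kx near_x.
have [w xw] := K_cover pcfD m Kx.
have Kv0 := V0_K pcfD hv0.
have yw : (Fword w @` K D) (Fword w v0) by exists v0.
have h1 := hm m w _ (leqnn m) xw yw (K_Fword pcfD w Kv0).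
have hy : Fword w v0 \in Vm D m by apply/VmP; exists w, v0.
apply: le_trans (cmod_triangle _ _ (u (Fword w v0))) _; apply: lerD; first exact: ltW.
apply: le_trans (hB m u _ hy) _; rewrite ler_wpM2l // ler_sqrt ?energy_ge0 //.
exact: graph_energy_le_energy.
Qed.

Hypothesis selfsim : forall u, dom_energy D u ->
  (forall j, dom_energy D (u \o F (f := D) j)) /\
  energy D u = \sum_(j < N) (renorm D)^-1 * energy D (u \o F j).

Lemma dom_energy_Fword (w : seq 'I_N) u : dom_energy D u -> dom_energy D (u \o Fword w).
Proof.
elim: w u => [|j w IH] u du //.
by have [h _] := selfsim du; exact: (IH _ (h j)).
Qed.

Lemma energy_words m u : dom_energy D u ->
  energy D u = \sum_(w : word m) (renorm D ^+ m)^-1 * energy D (u \o Fword w).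
Proof.
elim: m u => [|m IH] u du.
  by rewrite (sum_word0 (fun w => (renorm D ^+ 0)^-1 * energy D (u \o Fword w))) expr0 invr1 mul1r.
have [h ->] := selfsim du.
rewrite (sum_word_cons m (fun w => (renorm D ^+ m.+1)^-1 * energy D (u \o Fword w))).
apply: eq_bigr => j _; rewrite (IH _ (h j)) mulr_sumr; apply: eq_bigr => w _.
by rewrite mulrA exprS invfM.
Qed.

(** Each cell energy is at least the corresponding E_0. Summed over the cells, with weight r^-m,
    both sides give E_m(phi), so equality holds in every cell. *)
Lemma energy_harmonic_cell m (w : word m) phi :
  energy D (mharmonic m phi \o Fword w) = graph_energy D 0 (phi \o Fword w).
Proof.
have r0 : 0 < (renorm D ^+ m)^-1 by rewrite invr_gt0 exprn_gt0 // renorm_gt0.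
have dh := dom_harmonic m phi.
have E : \sum_(w : word m) ((renorm D ^+ m)^-1 * energy D (mharmonic m phi \o Fword w) -
    (renorm D ^+ m)^-1 * graph_energy D 0 (mharmonic m phi \o Fword w)) = 0.
  rewrite sumrB -energy_words // -graph_energy_cat // addn0 energy_harmonic.
  rewrite (@eq_graph_energy _ _ D pcfD m _ phi) ?subrr //; exact: harmonic_val.
have ge w' : true -> 0 <= (renorm D ^+ m)^-1 * energy D (mharmonic m phi \o Fword (w' : word m)) -
    (renorm D ^+ m)^-1 * graph_energy D 0 (mharmonic m phi \o Fword w').
  move=> _; rewrite subr_ge0 ler_wpM2l ?(ltW r0) // graph_energy_le_energy //.
  exact: dom_energy_Fword.
move: E => /eqP; rewrite psumr_eq0 // => /allP /(_ w (mem_index_enum _)) /= /eqP.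
rewrite -mulrBr => /eqP; rewrite mulf_eq0 (gt_eqF r0) /= subr_eq0 => /eqP ->.
apply: (eq_graph_energy pcfD) => x hx /=; apply: harmonic_val.
by apply/VmP; exists w, x.
Qed.

Lemma cells_uniform (g : 'rV[R]_d -> R[i]) (e : R) :
  {within K D, continuous (g : 'rV[R]_d -> R[i]^o)} -> 0 < e ->
  exists m, forall (w : word m) x y, (Fword w @` K D) x -> (Fword w @` K D) y ->
    cmod (g x - g y) < e.
Proof.
move=> /within_continuousP cg e0.
have /compact_near_coveringP cK : compact (K D) by case: pcfD => _ [].
pose P (m : nat) x := forall (w : word m) y, (Fword w @` K D) x -> (Fword w @` K D) y ->
    cmod (g x - g y) < e.
have inK (w : seq 'I_N) x : (Fword w @` K D) x -> K D x.
  by move=> [k Kk <-]; exact: K_Fword.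
have [x Kx|m0 _ hm] := cK nat \oo P _.
  have e2 : 0 < e / 2 by rewrite divr_gt0.
  have /nbhs_ballP[r /= r0 hr] := cg x Kx _ e2.
  have r2 : 0 < r / 2 by rewrite divr_gt0.
  have [m0 hm] := cell_small pcfD r2.
  exists (ball x (r / 2), [set m | (m0 <= m)%N]) => /=.
    by split; [exact: nbhsx_ballx|exists m0].
  move=> [y m] /= [xy mm] w z yw zw.
  have xz : ball x r z.
    rewrite (splitr r); apply: ball_triangle xy _; rewrite -ball_normE /=.
    exact: le_lt_trans (norm_le_euclid _) (hm _ _ _ _ mm yw zw).
  have xy' : ball x r y by apply: le_ball xy; rewrite ler_pdivrMr // ler_peMr ?ler1n ?ltW.
  apply: le_lt_trans (cmod_triangle _ _ (g x)) _; rewrite cmodB (splitr e).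
  by apply: ltrD; apply: hr => //; exact: inK yw || exact: inK zw.
by exists m0 => w x y xw yw; apply: (hm m0 (leqnn m0) x (inK _ _ xw) w y).
Qed.

(** The m-harmonic function with the vertex values of g is close to g once g varies little on the
    cells: the oscillation bound applies in each cell, where the energy is E_0 of these values. *)
Lemma dom_energy_uniformly_dense (g : 'rV[R]_d -> R[i]) (e : R) :
  {within K D, continuous (g : 'rV[R]_d -> R[i]^o)} -> 0 < e ->
  exists2 u, dom_energy D u & forall x, K D x -> cmod (u x - g x) < e.
Proof.
move=> cg e0; have [v0 hv0] := V0_neq0 pcfD; have [B B0 hB] := osc_K hv0.
have Kv0 := V0_K pcfD hv0.
pose G := \sum_(e <- Em D 0) gamma D 0 e.
have G0 : 0 <= G.
  by rewrite /G big_seq_cond sumr_ge0 // => a /andP[ha _]; rewrite ltW // gamma_gt0.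
have c0 : 0 < B * Num.sqrt G + 1 by rewrite ltr_wpDl // mulr_ge0 ?sqrtr_ge0.
(* In a cell E_0 is at most G eta^2, so the harmonic function stays within B sqrt(G) eta of the
   vertex value and g within eta of it. *)
pose eta := e / (B * Num.sqrt G + 1).
have eta0 : 0 < eta by rewrite divr_gt0.
have [m hm] := cells_uniform cg eta0.
exists (mharmonic m g); first exact: dom_harmonic.
move=> x Kx; have [w [k Kk kx]] := K_cover pcfD m Kx.
have h1 : cmod (mharmonic m g x - g (Fword w v0)) <= B * Num.sqrt G * eta.
  have gv : g (Fword w v0) = mharmonic m g (Fword w v0).
    by rewrite harmonic_val //; apply/VmP; exists w, v0.
  have := hB (mharmonic m g \o Fword w) k (dom_energy_Fword _ (dom_harmonic _ _)) Kk.
  rewrite /= kx -gv energy_harmonic_cell => /le_trans; apply.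
  rewrite -mulrA ler_wpM2l // -(ger0_norm (ltW eta0)) -sqrtr_sqr -sqrtrM //.
  have Ge : 0 <= G * eta ^+ 2 by rewrite mulr_ge0 ?sqr_ge0.
  rewrite ler_sqrt // /graph_energy /G mulr_suml.
  rewrite big_seq [leRHS]big_seq; apply: ler_sum => a ha.
  rewrite ler_wpM2l ?(ltW (gamma_gt0 graphsD ha)) // -cmod_sqr.
  rewrite ler_sqr ?nnegrE ?cmod_ge0 ?(ltW eta0) //; apply/ltW/(hm w).
    by exists (src a) => //; have [s _] := edge_Vm pcfD ha; exact: Vm_K s.
  by exists (tgt a) => //; have [_ s] := edge_Vm pcfD ha; exact: Vm_K s.
apply: le_lt_trans (cmod_triangle _ _ (g (Fword w v0))) _.
rewrite (_ : e = B * Num.sqrt G * eta + eta); last by rewrite /eta; field; exact: lt0r_neq0.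
apply: ler_ltD => //; apply: (hm w); last by exists k.
by exists v0.
Qed.

End EnergyOnFunctions.

(** * Approximation by cell indicators *)

Section L2Bounds.
Context d (T : measurableType d) (R : realType).
Variable mu : {measure set T -> \bar R}.
Local Open Scope ereal_scope.

Lemma sqn_le_integral (f : T -> R[i]) (h : T -> R) : cmeasurable f ->
  measurable_fun setT h -> (forall x, 0 <= h x)%R ->
  {ae mu, forall x, (cmod2 (f x) <= h x)%R} -> sqn mu f <= \int[mu]_x (h x)%:E.
Proof.
move=> mf mh h0 fh; apply: ae_ge0_le_integral => //.
- by move=> x _; rewrite lee_fin cmod2_ge0.
- exact: measurable_cmod2E.
- by move=> x _; rewrite lee_fin.
- exact/measurable_EFinP.
- by apply: filterS fh => x hx _; rewrite lee_fin.
Qed.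

Lemma sqn_le_cst (f : T -> R[i]) (c : R) : (0 <= c)%R -> cmeasurable f ->
  {ae mu, forall x, (cmod2 (f x) <= c)%R} -> sqn mu f <= c%:E * mu setT.
Proof.
move=> c0 mf fc; apply: le_trans (sqn_le_integral mf (measurable_cst c) _ fc) _ => //.
by rewrite (_ : (fun x => (cst c x)%:E) = cst c%:E) // integral_cst.
Qed.

Lemma bounded_sq_integrable (f : T -> R[i]) (c : R) : mu setT < +oo -> (0 <= c)%R ->
  cmeasurable f -> {ae mu, forall x, (cmod2 (f x) <= c)%R} -> sq_integrable mu f.
Proof.
move=> muT c0 mf fc; split=> //; apply: le_lt_trans (sqn_le_cst c0 mf fc) _.
by rewrite lte_mul_pinfty.
Qed.

Lemma cintegral_indic (c : R) (B : set T) : measurable B -> mu B < +oo ->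
  cintegral mu setT (fun x => c%:C%C * cindic R B x)%R = (c * fine (mu B))%:C%C.
Proof.
move=> mB Bfin; rewrite /cintegral -[RHS]complexr0; congr Complex.
  transitivity (\int[mu]_x (c * \1_B x))%R.
    by apply: eq_Rintegral => x _; rewrite /cindic -rmorphM.
  rewrite RintegralZl //; first by rewrite /Rintegral integral_indic // setIT.
  apply/integrableP; split; first by apply/measurable_EFinP; exact: measurable_indic.
  rewrite (eq_integral (fun x => (\1_B x)%:E)); first by rewrite integral_indic // setIT.
  by move=> x _ /=; rewrite ger0_norm // indicE.
transitivity (\int[mu]_x (0 : R))%R.
  by apply: eq_Rintegral => x _; rewrite /cindic -rmorphM.
by rewrite /Rintegral integral0.
Qed.

Lemma approximable_ae (P : set (T -> R[i])) (f g : T -> R[i]) :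
  (forall h, P h -> cmeasurable h) -> cmeasurable g -> {ae mu, forall x, f x = g x} ->
  approximable mu P f -> approximable mu P g.
Proof.
move=> Pm mg fg [mf hf]; split=> // e e0; have [h Ph hh] := hf e e0; exists h => //.
rewrite -(sqn_ae (f := fun x => f x - h x)%R) //; try by apply: cmeasurableB => //; exact: Pm.
by apply: filterS fg => x /= ->.
Qed.

End L2Bounds.

Section CellPartition.
Context d (T : measurableType d) (R : realType).
Variable mu : {measure set T -> \bar R}.
Variables (I : finType) (A : I -> set T) (p : R).
Hypothesis p0 : 0 < p.
Hypothesis mA : forall i, measurable (A i).
Hypothesis muA : forall i, mu (A i) = p%:E.
Hypothesis Apart : {ae mu, forall x, exists i, A i x /\ forall j, A j x -> j = i}.

Let efun i (x : T) : R[i] := (Num.sqrt p)^-1%:C * cindic R (A i) x.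

Lemma cell_sq_integrable i : sq_integrable mu (efun i).
Proof.
apply: sq_integrableZ; split; first exact: cmeasurable_indic.
rewrite (eq_integral (fun x => (\1_(A i) x)%:E)).
  by rewrite integral_indic // setIT muA ltry.
move=> x _; rewrite cmod2_real indicE; case: (_ \in _); rewrite ?expr1n ?expr0n //.
Qed.

Definition cell_vector i : L2space mu := L2mk (cell_sq_integrable i).

(** Cells of K may share vertices, so products of different indicators vanish only almost
    everywhere, by [Apart]. *)
Lemma cell_vector_orthonormal i j : ip (cell_vector i) (cell_vector j) = (i == j)%:R.
Proof.
have me k : cmeasurable (efun k) by exact: (cell_sq_integrable k).1.
rewrite (ip_cintegral (me i) (me j) (L2mkE _) (L2mkE _)).
have sp : 0 < Num.sqrt p by rewrite sqrtr_gt0.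
have mc : cmeasurable (fun x => ((i == j)%:R * p^-1)%:C * cindic R (A i) x).
  by apply: cmeasurableM; [exact: cmeasurable_cst|exact: cmeasurable_indic].
rewrite (cintegral_ae (g := fun x => ((i == j)%:R * p^-1)%:C * cindic R (A i) x)) //.
- rewrite cintegral_indic ?muA ?ltry // mulfVK ?lt0r_neq0 //.
  by case: (i == j).
- by apply: cmeasurableM => //; exact: cmeasurableJ.
- apply: filterS Apart => x [k [Ak uk]].
  rewrite /efun /cindic !indicE.
  have Ein l : (x \in A l) = (l == k).
    by apply/idP/eqP => [/set_mem /uk //|->]; exact/mem_set.
  rewrite !Ein; have [<-|ij] := eqVneq i j.
    case: (i == k) => /=; rewrite ?mulr1 ?mul1r ?mulr0 ?mul0r //.
    rewrite conjCE conjc_real -rmorphM -invfM -expr2 sqr_sqrtr ?(ltW p0) //.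
  rewrite mul0r mul0r; case: (eqVneq i k) => [ik|_]; last by rewrite /= mulr0 mul0r.
  by rewrite -ik eq_sym (negbTE ij) /= !mulr0 rmorph0 mulr0.
Qed.

(** The factor sqrt(p) undoes the normalisation, so the combination equals c i almost everywhere on
    A i; integrating the pointwise bound cell by cell gives the estimate. *)
Lemma cell_approximation (F : L2space mu) (f : T -> R[i]) (c : I -> R[i]) (C : I -> R) :
  cmeasurable f -> {ae mu, forall x, (F : L2 mu) x = f x} -> (forall i, 0 <= C i) ->
  {ae mu, forall x i, A i x -> cmod2 (f x - c i) <= C i} ->
  hnorm (F - \sum_i ((Num.sqrt p)%:C * c i) *: cell_vector i) ^+ 2 <= \sum_i C i * p.
Proof.
move=> mf Ff C0 fc.
have sp : 0 < Num.sqrt p by rewrite sqrtr_gt0.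
pose g x := \sum_i c i * cindic R (A i) x.
have mg : cmeasurable g.
  rewrite /g; elim: (index_enum I) => [|i s IH].
    under [X in cmeasurable X]funext do rewrite big_nil; exact: cmeasurable_cst.
  under [X in cmeasurable X]funext do rewrite big_cons.
  apply: cmeasurableD => //; apply: cmeasurableM; [exact: cmeasurable_cst|exact: cmeasurable_indic].
have Gg : {ae mu, forall x,
    (\sum_i ((Num.sqrt p)%:C * c i) *: cell_vector i : L2 mu) x = g x}.
  have h := L2sumE (index_enum I) (fun i => (Num.sqrt p)%:C * c i) cell_vector.
  have h' : {ae mu, forall x i, (cell_vector i : L2 mu) x = efun i x}.
    by apply: filter_forall => i; exact: L2mkE.
  apply: filterS2 h h' => x -> hx; apply: eq_bigr => i _; rewrite hx /efun.
  rewrite mulrACA [X in X * _](_ : _ = 1) ?mul1r // -rmorphM.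
  by rewrite mulfV ?lt0r_neq0.
rewrite -lee_fin (hnormB_sqn mf mg Ff Gg).
have m1 i : measurable_fun setT (\1_(A i) : T -> R) by exact: measurable_indic.
apply: (@le_trans _ _ (\int[mu]_x (\sum_i (C i * \1_(A i) x)%:E)))%E.
  under eq_integral do rewrite sumEFin.
  apply: sqn_le_integral; first exact: cmeasurableB.
  - by apply: measurable_sum => i; apply: measurable_funM.
  - by move=> x; apply: sumr_ge0 => i _; rewrite mulr_ge0 // indicE.
  apply: filterS2 Apart fc => x [k [Ak uk]] /(_ k Ak) h.
  have Ein l : (x \in A l) = (l == k).
    by apply/idP/eqP => [/set_mem /uk //|->]; exact/mem_set.
  rewrite /g (bigD1 k) //= big1 ?addr0; last first.
    by move=> l lk; rewrite /cindic indicE Ein (negbTE lk) mulr0.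
  rewrite /cindic indicE Ein eqxx mulr1 (bigD1 k) //= indicE Ein eqxx mulr1.
  apply: le_trans h _; rewrite lerDl sumr_ge0 // => l _.
  by rewrite mulr_ge0 // indicE.
rewrite ge0_integral_sum //; last 2 first.
- by move=> i; apply/measurable_EFinP; exact: measurable_funM.
- by move=> i x _; rewrite lee_fin mulr_ge0 // indicE.
rewrite -sumEFin; apply: lee_sum => i _; rewrite (eq_integral (fun x => (C i)%:E * (\1_(A i) x)%:E)%E) //.
rewrite ge0_integralZl_EFin //; last by apply/measurable_EFinP.
by rewrite integral_indic // setIT muA.
Qed.

End CellPartition.

Section RealContinuity.
Variables (R : realType) (T : topologicalType) (A : set T).

Lemma within_continuous_Re (u : T -> R[i]) : {within A, continuous (u : T -> R[i]^o)} ->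
  {within A, continuous ((fun x => Re (u x)) : T -> R)}.
Proof.
move=> /within_continuousP h; apply/subspace_continuousP => x Ax; apply/cvgrPdist_lt => e e0.
apply: filterS (h x Ax e e0) => y hy Ay.
by rewrite -ReB; apply: le_lt_trans (normr_Re _) (hy Ay).
Qed.

Lemma within_continuous_Im (u : T -> R[i]) : {within A, continuous (u : T -> R[i]^o)} ->
  {within A, continuous ((fun x => Im (u x)) : T -> R)}.
Proof.
move=> /within_continuousP h; apply/subspace_continuousP => x Ax; apply/cvgrPdist_lt => e e0.
apply: filterS (h x Ax e e0) => y hy Ay.
by rewrite -ImB; apply: le_lt_trans (normr_Im _) (hy Ay).
Qed.

Lemma continuous_realC (h : T -> R) : continuous h ->
  {within A, continuous ((fun x => (h x)%:C) : T -> R[i]^o)}.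
Proof.
move=> ch; apply/within_continuousP => x _ e e0.
have /cvgrPdist_lt /(_ e e0) := ch x; apply: filterS => y hy _.
by rewrite -rmorphB cmod_real.
Qed.

End RealContinuity.

Section AlmostEverywhere.
Context d (T : measurableType d) (R : realType) (mu : {measure set T -> \bar R}).

Lemma ae_imply (P Q : T -> Prop) : {ae mu, forall x, P x} ->
  (forall x, P x -> Q x) -> {ae mu, forall x, Q x}.
Proof. by move=> hP PQ; apply: filterS hP. Qed.

Lemma ae_imply2 (P P' Q : T -> Prop) : {ae mu, forall x, P x} -> {ae mu, forall x, P' x} ->
  (forall x, P x -> P' x -> Q x) -> {ae mu, forall x, Q x}.
Proof. by move=> hP hP' PQ; apply: filterS2 hP hP'. Qed.

End AlmostEverywhere.

(** * The fractal energy form *)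

Section FractalL2.
Variables (R : realType) (d : nat) (D : fractal R d).
Implicit Types (x y : 'rV[R]_d) (u : 'rV[R]_d -> R[i]).
Notation N := (nmaps D).
Notation word m := (m.-tuple 'I_N).
Notation T := (borel R d).
Hypothesis pcfD : pcf_fractal D.
Hypothesis graphsD : weighted_graphs D.
Hypothesis muD : borel_measure_on_K D.
Hypothesis harmD : harmonic_functions D.
Hypothesis mu_cell : forall m (w : word m), mu D (Fword w @` K D) = ((N%:R ^+ m)^-1)%:E.

Lemma measurable_open (U : set 'rV[R]_d) : open U -> measurable (U : set T).
Proof. by move=> oU; exact: sub_sigma_algebra. Qed.

Lemma measurable_closed (U : set 'rV[R]_d) : closed U -> measurable (U : set T).
Proof.
move=> cU; rewrite -[U]setCK; apply: measurableC.
by apply: measurable_open; exact: closed_openC.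
Qed.

Lemma measurable_K : measurable (K D : set T).
Proof. by apply: measurable_closed; exact: closedK. Qed.

Lemma muT : mu D setT = 1%E.
Proof.
have [h0 h1] := muD.
have mK := measurable_K; have mC := measurableC mK.
have := measureU (mu D) mK mC; rewrite setICr setUv => /(_ erefl) ->.
by rewrite [X in (X + _)%E]h1 [X in (_ + X)%E]h0 adde0.
Qed.

Lemma ae_K : {ae mu D, forall x, K D x}.
Proof.
by exists (~` K D); split; [apply: measurableC; exact: measurable_K|case: muD|].
Qed.

Lemma measurable_within_continuous (h : 'rV[R]_d -> R) :
  {within K D, continuous h} -> measurable_fun (K D : set T) (h : T -> R).
Proof.
move=> /continuousP ch.
have mE : @measurable _ (measurableTypeR R) = <<s @RGenOpens.G R >> by exact: RGenOpens.measurableE.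
apply: (@measurability _ _ T (measurableTypeR R) _ _ _ mE).
move=> _ [_ [a [b ->]] <-]; rewrite setIC.
have oI : open (`]a, b[%classic : set R) by exact: interval_open.
have /open_subspaceP [V oV VE] := ch _ oI.
by rewrite -VE; apply: measurableI; [exact: measurable_open|exact: measurable_K].
Qed.

(** Functions of finite energy are arbitrary outside K; cutting them off there makes them Borel
    functions on the whole space. *)
Definition restrictK (u : 'rV[R]_d -> R[i]) (x : T) : R[i] :=
  if `[< K D x >] then u x else 0.

Lemma restrictKE u x : K D x -> restrictK u x = u x.
Proof. by move=> Kx; rewrite /restrictK asboolT. Qed.

Lemma restrictK_ae u : {ae mu D, forall x, restrictK u x = u x}.
Proof. by apply: ae_imply ae_K _ => x; exact: restrictKE. Qed.

Lemma cmeasurable_restrictK u : {within K D, continuous (u : 'rV[R]_d -> R[i]^o)} ->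
  cmeasurable (restrictK u).
Proof.
move=> cu; split.
- rewrite (_ : (fun x => _) = ((fun x => Re (u x)) : T -> R) \_ (K D)).
    apply/(measurable_restrictT _ measurable_K); apply: measurable_within_continuous.
    exact: within_continuous_Re.
  by apply/funext => x; rewrite /restrictK patchE; case: asboolP => Kx;
    [rewrite mem_set|rewrite memNset].
- rewrite (_ : (fun x => _) = ((fun x => Im (u x)) : T -> R) \_ (K D)).
    apply/(measurable_restrictT _ measurable_K); apply: measurable_within_continuous.
    exact: within_continuous_Im.
  by apply/funext => x; rewrite /restrictK patchE; case: asboolP => Kx;
    [rewrite mem_set|rewrite memNset].
Qed.

Lemma sqn_restrictK_le u (c : R) : {within K D, continuous (u : 'rV[R]_d -> R[i]^o)} ->
  0 <= c -> (forall x, K D x -> cmod2 (u x) <= c) -> (sqn (mu D) (restrictK u) <= c%:E)%E.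
Proof.
move=> cu c0 hc; rewrite -[leRHS]mule1 -muT; apply: sqn_le_cst => //.
  exact: cmeasurable_restrictK.
by apply: ae_imply ae_K _ => x Kx; rewrite restrictKE // hc.
Qed.

Lemma bounded_on_K u : dom_energy D u -> exists2 c : R, 0 <= c & forall x, K D x -> cmod2 (u x) <= c.
Proof.
move=> du; have [v0 hv0] := V0_neq0 pcfD; have [B B0 hB] := osc_K pcfD graphsD harmD hv0.
exists ((cmod (u v0) + B * Num.sqrt (energy D u)) ^+ 2); first exact: sqr_ge0.
move=> x Kx; rewrite -cmod_sqr ler_sqr ?nnegrE ?cmod_ge0 ?addr_ge0 ?cmod_ge0 ?mulr_ge0 ?sqrtr_ge0 //.
rewrite -{1}(subrK (u v0) (u x)) addrC; apply: le_trans (cmodD _ _) _.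
by rewrite lerD2l; exact: hB.
Qed.

Lemma sq_integrable_restrictK u : dom_energy D u -> sq_integrable (mu D) (restrictK u).
Proof.
move=> du; have [c c0 hc] := bounded_on_K du; split.
  by apply: cmeasurable_restrictK; case: du.
by apply: le_lt_trans (sqn_restrictK_le du.1 c0 hc) _; exact: ltry.
Qed.

Lemma fractal_class u : dom_energy D u -> exists f, fractal_repr (f : L2 (mu D)) u.
Proof.
move=> du; exists (L2mk (sq_integrable_restrictK du)); split => //.
by apply: ae_imply2 (L2mkE (sq_integrable_restrictK du)) (restrictK_ae u) _ => x -> ->.
Qed.

(* Cells have positive measure, so the measure has full support in K. *)
Lemma ae_eq_on_K u (v : 'rV[R]_d -> R[i]) :
  {within K D, continuous (u : 'rV[R]_d -> R[i]^o)} ->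
  {within K D, continuous (v : 'rV[R]_d -> R[i]^o)} ->
  {ae mu D, forall x, u x = v x} -> forall x, K D x -> u x = v x.
Proof.
move=> /within_continuousP cu /within_continuousP cv uv x Kx; apply: contrapT => ne.
have e0 : 0 < cmod (u x - v x) / 2.
  rewrite divr_gt0 // lt_neqAle cmod_ge0 andbT eq_sym; apply/eqP => h.
  by apply: ne; apply/eqP; rewrite -subr_eq0; apply/eqP/cmod_eq0.
have nb : \forall y \near x, K D y -> u y != v y.
  apply: filterS2 (cu x Kx _ e0) (cv x Kx _ e0) => y h1 h2 Ky; apply/eqP => uvy.
  have := cmod_triangle (u x) (v x) (u y); have := h1 Ky; have := h2 Ky.
  by rewrite uvy (cmodB (v y)); lra.
have [m hm] := Vm_dense pcfD Kx nb.
have [w xw] := K_cover pcfD m Kx.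
have mw : measurable (Fword w @` K D : set T) by apply: measurable_closed; exact: closed_cell.
have : mu D (Fword w @` K D) = 0%E.
  apply: measure_negligible => //; apply: negligibleS uv => y yw /= uvy.
  have Ky : K D y by case: yw => k Kk <-; exact: K_Fword.
  by have := hm m w y (leqnn m) xw yw Ky; rewrite uvy eqxx.
rewrite mu_cell => /eqP; rewrite eqe invr_eq0 expf_eq0 pnatr_eq0.
by rewrite gtn_eqF ?N_gt0 // andbF.
Qed.

Notation H := (L2space (mu D)).
Notation E := (fractal_form D).

Definition frep (f : H) : 'rV[R]_d -> R[i] := xget (fun=> 0) [set u | fractal_repr f u].

Lemma frepP (f : H) : qdom E f -> fractal_repr f (frep f).
Proof. by move=> [u hu]; rewrite /frep; case: xgetP => [v _ //|/(_ u)]. Qed.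

Lemma dom_frep (f : H) : qdom E f -> dom_energy D (frep f).
Proof. by case/frepP. Qed.

Lemma fractal_repr_unique (f : H) u v : fractal_repr f u -> fractal_repr f v ->
  forall x, K D x -> u x = v x.
Proof.
move=> [du fu] [dv fv]; apply: ae_eq_on_K; [by case: du|by case: dv|].
by apply: ae_imply2 fu fv _ => x -> ->.
Qed.

Lemma eq_on_K_graph_energy u u' m : (forall x, K D x -> u x = u' x) ->
  graph_energy D m u = graph_energy D m u'.
Proof.
by move=> h; apply: (eq_graph_energy pcfD) => x hx; apply: h; exact: Vm_K hx.
Qed.

Lemma eq_on_K_energy u u' : (forall x, K D x -> u x = u' x) -> energy D u = energy D u'.
Proof.
by move=> h; rewrite /energy; congr (limn _); apply/funext => m; exact: eq_on_K_graph_energy.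
Qed.

Lemma eq_on_K_eform u u' (v v' : 'rV[R]_d -> R[i]) : (forall x, K D x -> u x = u' x) ->
  (forall x, K D x -> v x = v' x) -> eform D u v = eform D u' v'.
Proof.
move=> hu hv; rewrite /eform; congr xget; apply/seteqP.
have hg m : gform D m u v = gform D m u' v'.
  by apply: (eq_gform pcfD) => x hx; [apply: hu|apply: hv]; exact: Vm_K hx.
by split=> l /= cl e /cl[n0 hn]; exists n0 => n /hn; rewrite hg.
Qed.

Lemma qval_repr (f : H) u : fractal_repr f u -> qval E f = energy D u.
Proof.
move=> hu; apply: eq_on_K_energy; apply: fractal_repr_unique (hu).
by apply: frepP; exists u.
Qed.

Lemma fractal_reprDZ c (f g : H) u (v : 'rV[R]_d -> R[i]) :
  fractal_repr f u -> fractal_repr g v ->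
  fractal_repr (c *: f + g : H) (fun x => c * u x + v x).
Proof.
move=> [du fu] [dv gv]; split.
  exact: (dom_energy_subspace graphsD).2 c u v du dv.
have h1 := L2DE (c *: f : H) g; have h2 := L2ZE c (f : L2 (mu D)).
apply: ae_imply2 (ae_imply2 h1 h2 (fun x => @conj _ _)) (ae_imply2 fu gv (fun x => @conj _ _)) _ => x [/= e1 e2] [e3 e4].
by rewrite e1 e2 e3 e4.
Qed.

Lemma fractal_dom_subspace : linear_subspace (qdom E).
Proof.
split.
  by exists (fun=> 0); split; [exact: (dom_energy_subspace graphsD).1|exact: L2zeroE].
by move=> c f g [u hu] [v hv]; exists (fun x => c * u x + v x); exact: fractal_reprDZ.
Qed.

Definition fractal_sesq (f g : H) : R[i] := eform D (frep f) (frep g).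

Lemma fractal_sesq_hermitian : hermitian_on (qdom E) fractal_sesq.
Proof.
have [h1 h2] := eform_hermitian graphsD.
split=> [c f g h Df Dg Dh|f g Df Dg]; last by rewrite /fractal_sesq h2 //; exact: dom_frep.
rewrite /fractal_sesq -h1; try exact: dom_frep.
apply: eq_on_K_eform => // ; apply: fractal_repr_unique (frepP _) _.
  exact: fractal_dom_subspace.2.
by apply: fractal_reprDZ; exact: frepP.
Qed.

Lemma fractal_sesq_qval (f : H) : qdom E f -> fractal_sesq f f = (qval E f)%:C.
Proof. by move=> Df; rewrite /fractal_sesq eform_energy //; exact: dom_frep. Qed.

Lemma polar_fractal (f g : H) : qdom E f -> qdom E g -> polar E f g = fractal_sesq f g.
Proof.
exact: (polarE fractal_dom_subspace fractal_sesq_hermitian fractal_sesq_qval).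
Qed.

Lemma fractal_qval_ge0 (f : H) : qdom E f -> 0 <= qval E f.
Proof. by move=> Df; exact: energy_ge0 (dom_frep Df). Qed.

Lemma frepB (f g : H) : qdom E f -> qdom E g ->
  forall x, K D x -> frep (f - g) x = frep f x - frep g x.
Proof.
move=> Df Dg x Kx.
have e : f - g = -1 *: g + f by rewrite scaleN1r addrC.
have h1 : fractal_repr (f - g) (frep (f - g)) by apply: frepP; exact: subspaceB fractal_dom_subspace Df Dg.
have h2 : fractal_repr (f - g) (fun x => -1 * frep g x + frep f x).
  by rewrite e; apply: fractal_reprDZ; exact: frepP.
by rewrite (fractal_repr_unique h1 h2 Kx) mulN1r addrC.
Qed.

(** By [osc_K], |u(x)| <= |u(y)| + 2 B sqrt(E(u)). Squaring gives the terms 2 |u(y)|^2 and 8 B^2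
    E(u), and integration over y costs nothing since mu(K) = 1. *)
Lemma sup_bound : exists2 C : R, 0 <= C & forall f : H, qdom E f -> forall x, K D x ->
  cmod2 (frep f x) <= C * (hnorm f ^+ 2 + qval E f).
Proof.
have [v0 hv0] := V0_neq0 pcfD; have [B B0 hB] := osc_K pcfD graphsD harmD hv0.
exists (2 + 8 * B ^+ 2); first by rewrite addr_ge0 // mulr_ge0 // sqr_ge0.
move=> f Df x Kx; have [du fu] := frepP Df; set u := frep f in du fu *.
have q0 := fractal_qval_ge0 Df; rewrite -/(energy D u) in q0 *.
have qE : qval E f = energy D u by exact: qval_repr (frepP Df).
rewrite qE; set e := energy D u in q0 *.
have e0 : 0 <= e by exact: energy_ge0.
have key y : K D y -> cmod2 (u x) <= 2 * cmod2 (u y) + 8 * B ^+ 2 * e.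
  move=> Ky; rewrite -!cmod_sqr.
  have h1 := hB u x du Kx; have h2 := hB u y du Ky.
  have h3 : cmod (u x) <= cmod (u y) + 2 * (B * Num.sqrt e).
    have := cmod_triangle (u x) 0 (u y); rewrite !subr0.
    have := cmod_triangle (u x) (u y) (u v0); rewrite (cmodB (u v0)) -/e in h1 h2 *; lra.
  have p1 := cmod_ge0 (u x); have p2 := cmod_ge0 (u y).
  have p3 : 0 <= B * Num.sqrt e by rewrite mulr_ge0 ?sqrtr_ge0.
  have -> : 8 * B ^+ 2 * e = 8 * (B * Num.sqrt e) ^+ 2.
    by rewrite -{1}(sqr_sqrtr e0); ring.
  move: h3 p1 p2 p3; set a := cmod (u x); set b := cmod (u y); set c := B * _.
  move=> h3 p1 p2 p3; apply: (@le_trans _ _ ((b + 2 * c) ^+ 2)).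
    by rewrite ler_sqr ?nnegrE ?addr_ge0 ?mulr_ge0.
  have := sqr_ge0 (b - 2 * c); rewrite !expr2; lra.
have I : ((cmod2 (u x))%:E <= 2%:E * sqn (mu D) (restrictK u) + (8 * B ^+ 2 * e)%:E)%E.
  have mru := measurable_cmod2E (cmeasurable_restrictK du.1).
  rewrite -[leLHS]mule1 -muT -integral_cst //.
  rewrite -[X in (_ + X)%E]mule1 -muT -integral_cst // -ge0_integralZl_EFin //; last first.
    by move=> y _; rewrite lee_fin cmod2_ge0.
  rewrite -ge0_integralD //; last 3 first.
  - by move=> y _; rewrite -EFinM lee_fin mulr_ge0 ?cmod2_ge0.
  - exact: measurable_funeM.
  - by move=> y _; rewrite lee_fin !mulr_ge0 ?sqr_ge0.
  apply: ae_ge0_le_integral => //.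
  - by move=> y _; rewrite lee_fin cmod2_ge0.
  - move=> y _; rewrite adde_ge0 // -?EFinM lee_fin ?mulr_ge0 ?cmod2_ge0 ?sqr_ge0 //.
  - by apply: emeasurable_funD => //; exact: measurable_funeM.
  - apply: ae_imply ae_K _ => y Ky _; rewrite -EFinM -EFinD lee_fin restrictKE //.
    exact: key.
have hn : ((hnorm f ^+ 2)%:E = sqn (mu D) (restrictK u))%E.
  apply: hnorm_sqn; first exact: cmeasurable_restrictK du.1.
  by apply: ae_imply2 fu (restrictK_ae u) _ => y -> ->.
rewrite -hn -EFinM -EFinD lee_fin in I; apply: le_trans I _.
have := sqr_ge0 (hnorm f); have := sqr_ge0 B.
have : 0 <= B ^+ 2 * hnorm f ^+ 2 by rewrite mulr_ge0 ?sqr_ge0.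
by rewrite !mulrDr !mulrDl; lra.
Qed.

End FractalL2.

(** * Indicators of open sets as limits of continuous functions *)

Section DistanceToComplement.
Variables (R : realType) (d : nat) (O : set 'rV[R]_d).
Hypothesis oO : open O.
Implicit Types x y z : 'rV[R]_d.

Let dists x : set R := [set r | exists2 z, ~ O z & r = `|x - z|].

(* The distance to the complement; [inf set0 = 0] is a junk value when [O] is full. *)
Let g x : R := inf (dists x).

Let dists_lb x : lbound (dists x) 0.
Proof. by move=> _ [z _ ->]. Qed.

Let g_ge0 x : 0 <= g x.
Proof.
have [z0 |h] := pselect (dists x !=set0); first by apply: lb_le_inf => //; exact: dists_lb.
rewrite /g (_ : dists x = set0) ?inf0 //.
by apply/seteqP; split=> // r hr; apply: h; exists r.
Qed.

Let g_lip x y : g x <= `|x - y| + g y.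
Proof.
have [[r [z nz rE]]|h] := pselect (dists y !=set0); last first.
  have eq0 t : dists t = set0.
    apply/seteqP; split=> // r [z nz _]; apply: h; by exists `|y - z|, z.
  by rewrite /g !eq0 inf0 addr0.
rewrite addrC -lerBlDr; apply: lb_le_inf; first by exists r, z.
move=> _ [t nt ->]; rewrite lerBlDr; apply: (@le_trans _ _ `|x - t|).
  by apply: ge_inf; [exists 0; exact: dists_lb|exists t].
have -> : x - t = (y - t) + (x - y) by rewrite [RHS]addrC addrA subrK.
exact: ler_normD.
Qed.

Let g_in x : O x -> (exists z, ~ O z) -> 0 < g x.
Proof.
move=> Ox [z nz]; have /nbhs_ballP [e /= e0 he] := open_nbhs_nbhs (conj oO Ox).
apply: lt_le_trans e0 _; apply: lb_le_inf; first by exists `|x - z|, z.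
move=> _ [t nt ->]; rewrite leNgt; apply/negP => lt; apply: nt.
by apply: he; rewrite -ball_normE.
Qed.

Let g_out x : ~ O x -> g x = 0.
Proof.
move=> nx; apply/eqP; rewrite eq_le g_ge0 andbT.
by apply: ge_inf; [exists 0; exact: dists_lb|exists x => //; rewrite subrr normr0].
Qed.

(** With g the distance to the complement, g / (1/(n+1) + g) is 0 off O and tends to 1 on O. The
    whole space is treated apart, since g is then the infimum of the empty set. *)
Lemma indicator_open_limit : exists h : nat -> 'rV[R]_d -> R,
  [/\ forall n, continuous (h n), forall n x, 0 <= h n x <= 1 &
      forall x, (fun n => h n x) @ \oo --> (\1_O x : R)].
Proof.
have [ne|full] := pselect (exists z, ~ O z); last first.
  exists (fun _ _ => 1); split=> [n|n x|x]; [exact: cst_continuous|by rewrite ler01 lexx|].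
  by rewrite indicE mem_set; [exact: cvg_cst|apply: contrapT => nx; apply: full; exists x].
have d0 n x : 0 < n.+1%:R^-1 + g x by rewrite ltr_pwDl ?invr_gt0.
exists (fun n x => g x / (n.+1%:R^-1 + g x)); split.
- move=> n x; have cg : {for x, continuous g}.
    move=> A /nbhs_ballP[e /= e0 he].
    apply: (@filterS _ _ (nbhs_filter x) _ _ _ (nbhsx_ballx x e e0)) => y.
    rewrite -ball_normE /= => xy; apply: he; rewrite -ball_normE /= ltr_norml.
    have := g_lip x y; have := g_lip y x; rewrite (distrC y); move: xy.
    by move=> h1 h2 h3; apply/andP; split; lra.
  apply: (@continuous_comp _ _ _ g (fun t => t / (n.+1%:R^-1 + t))) => //.
  apply: cvgM; first exact: cvg_id; apply: cvgV; first by rewrite lt0r_neq0.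
  by apply: cvgD; [exact: cvg_cst|exact: cvg_id].
- move=> n x; rewrite divr_ge0 ?(ltW (d0 _ _)) //= ler_pdivrMr // mul1r lerDr.
  by rewrite invr_ge0.
- move=> x; have [Ox|nOx] := pselect (O x); last first.
    by under eq_fun do rewrite g_out // mul0r; rewrite indicE memNset //; exact: cvg_cst.
  have gx := g_in Ox ne; rewrite indicE mem_set //.
  rewrite -[X in _ --> X](divff (lt0r_neq0 gx)); apply: cvgM; first exact: cvg_cst.
  apply: cvgV; first by rewrite lt0r_neq0.
  rewrite -[X in _ --> X]add0r; apply: cvgD; last exact: cvg_cst.
  exact: cvg_harmonic.
Unshelve. all: by end_near. Qed.

End DistanceToComplement.

(** * Closedness and density of the fractal form *)

Section FractalEnergyForm.
Variables (R : realType) (d : nat) (D : fractal R d).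
Implicit Types (x y : 'rV[R]_d) (u v w : 'rV[R]_d -> R[i]).
Notation N := (nmaps D).
Notation word m := (m.-tuple 'I_N).
Notation T := (borel R d).
Hypothesis pcfD : pcf_fractal D.
Hypothesis graphsD : weighted_graphs D.
Hypothesis muD : borel_measure_on_K D.
Hypothesis harmD : harmonic_functions D.
Hypothesis selfsim : forall u, dom_energy D u ->
  (forall j, dom_energy D (u \o F (f := D) j)) /\
  energy D u = \sum_(j < N) (renorm D)^-1 * energy D (u \o F j).
Hypothesis mu_cell : forall m (w : word m), mu D (Fword w @` K D) = ((N%:R ^+ m)^-1)%:E.
Notation H := (L2space (mu D)).
Notation E := (fractal_form D).

Let sD := fractal_dom_subspace graphsD.

Lemma fractal_repr_hnorm (f : H) u : fractal_repr f u ->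
  ((hnorm f ^+ 2)%:E = sqn (mu D) (restrictK D u))%E.
Proof.
move=> [du fu]; apply: hnorm_sqn; first exact: (cmeasurable_restrictK pcfD du.1).
by apply: ae_imply2 fu (restrictK_ae pcfD muD u) _ => y -> ->.
Qed.

Lemma fractal_hnorm_le (f : H) u (c : R) : fractal_repr f u -> 0 <= c ->
  (forall x, K D x -> cmod2 (u x) <= c) -> hnorm f ^+ 2 <= c.
Proof.
move=> fu c0 uc; rewrite -lee_fin (fractal_repr_hnorm fu).
by apply: sqn_restrictK_le => //; case: fu => -[].
Qed.

Lemma fractal_reprB (f g : H) u v : fractal_repr f u -> fractal_repr g v ->
  fractal_repr (f - g : H) (fun x => u x - v x).
Proof.
move=> fu gv; have := fractal_reprDZ graphsD (-1) gv fu.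
rewrite scaleN1r addrC (_ : (fun x => -1 * v x + u x) = (fun x => u x - v x)) //.
by apply/funext => x; rewrite mulN1r addrC.
Qed.

Lemma graph_energy_split m u v w : graph_energy D m (fun x => u x - w x) <=
  2 * graph_energy D m (fun x => u x - v x) + 2 * graph_energy D m (fun x => v x - w x).
Proof.
rewrite /graph_energy !mulr_sumr -big_split /= !big_seq; apply: ler_sum => e he.
rewrite mulrCA [2 * (_ * cmod2 (v _ - _ - _))]mulrCA -mulrDr.
apply: ler_wpM2l; first exact: (ltW (gamma_gt0 graphsD he)).
apply: le_trans (cmod2D_le _ _); rewrite le_eqVlt; apply/orP; left; apply/eqP; congr cmod2.
by ring.
Qed.

Lemma graph_energy_small m (e : R) : 0 < e -> exists2 c : R, 0 < c & forall u,
  {in Vm D m, forall x, cmod (u x) <= c} -> graph_energy D m u <= e.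
Proof.
move=> e0; pose G := \sum_(e <- Em D m) gamma D m e.
have g0 e' : e' \in Em D m -> 0 <= gamma D m e' by move=> h; exact: (ltW (gamma_gt0 graphsD h)).
have G0 : 0 <= G by rewrite /G big_seq sumr_ge0.
have ec : 0 < e / (4 * (G + 1)) by rewrite divr_gt0 // mulr_gt0 // ltr_wpDl.
exists (Num.sqrt (e / (4 * (G + 1)))); first by rewrite sqrtr_gt0.
move=> u hu; have bd x : x \in Vm D m -> cmod2 (u x) <= e / (4 * (G + 1)).
  move=> hx; rewrite -cmod_sqr -(sqr_sqrtr (ltW ec)) ler_sqr ?nnegrE ?sqrtr_ge0 ?cmod_ge0 //.
  exact: hu.
apply: (@le_trans _ _ (G * (e / (G + 1)))).
  rewrite /graph_energy {1}/G mulr_suml !big_seq; apply: ler_sum => f hf.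
  apply: ler_wpM2l; first exact: g0.
  have [hs ht] := edge_Vm pcfD hf.
  apply: le_trans (cmod2D_le _ _) _; rewrite cmod2N.
  have -> : e / (G + 1) = 2 * (e / (4 * (G + 1))) + 2 * (e / (4 * (G + 1))).
    by field; rewrite lt0r_neq0 // ltr_wpDl.
  by apply: lerD; apply: ler_wpM2l => //; exact: bd.
rewrite mulrA ler_pdivrMr ?ltr_wpDl // mulrC ler_wpM2l ?(ltW e0) //.
by rewrite lerDl.
Qed.

(** By [sup_bound] the representatives are uniformly Cauchy on K, hence have a continuous limit v.
    Its energy is controlled at each level separately, where finitely many vertices make E_m
    continuous under uniform convergence. *)
Lemma fractal_closed : closed_form E.
Proof.
move=> f Df C1 C2.
have [C C0 hC] := sup_bound pcfD graphsD muD harmD mu_cell.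
pose u n := frep (f n).
have du n : dom_energy D (u n) := dom_frep (Df n).
have Dfmn m n : qdom E (f m - f n) := subspaceB sD (Df m) (Df n).
have uB m n x : K D x -> frep (f m - f n) x = u m x - u n x.
  exact: (frepB pcfD graphsD mu_cell (Df m) (Df n)).
have eB m n : qval E (f m - f n) = energy D (fun x => u m x - u n x).
  by apply: eq_on_K_energy => // x; exact: uB.
have unif (e : R) : 0 < e -> exists n0, forall m n, (n0 <= m)%N -> (n0 <= n)%N ->
    forall x, K D x -> cmod (u m x - u n x) < e.
  move=> e0; pose a := e ^+ 2 / (2 * (C + 1)).
  have C1p : 0 < C + 1 by rewrite ltr_wpDl.
  have a0 : 0 < a by rewrite divr_gt0 ?exprn_gt0 ?mulr_gt0.
  have sa : 0 < Num.sqrt a by rewrite sqrtr_gt0.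
  have [n1 h1] := C1 _ sa; have [n2 h2] := C2 _ a0.
  exists (maxn n1 n2) => m n; rewrite !geq_max => /andP[m1 m2] /andP[k1 k2] x Kx.
  rewrite -uB // -ltr_sqr ?nnegrE ?cmod_ge0 ?(ltW e0) // cmod_sqr.
  apply: le_lt_trans (hC _ (Dfmn m n) x Kx) _.
  have hn : hnorm (f m - f n) ^+ 2 < a.
    rewrite -(sqr_sqrtr (ltW a0)) ltr_sqr ?nnegrE ?hnorm_ge0 ?sqrtr_ge0 //; exact: h1.
  have hq := h2 m n m2 k2.
  have aE : e ^+ 2 = (C + 1) * (2 * a) by rewrite /a; field; rewrite lt0r_neq0.
  rewrite aE; apply: (@le_lt_trans _ _ (C * (2 * a))).
    by apply: ler_wpM2l => //; lra.
  by rewrite [ltRHS]mulrDl mul1r ltrDl mulr_gt0.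
have [x|v hv] := @choice _ _ (fun (x : 'rV[R]_d) (l : R[i]) => K D x -> ccvg (fun n => u n x) l).
  have [Kx|nK] := pselect (K D x); last by exists 0.
  have [l hl] : exists l, ccvg (fun n => u n x) l.
    by apply: cauchy_ccvg => e /unif[n0 h]; exists n0 => m n hm hn; exact: h.
  by exists l.
have lim_v (e : R) : 0 < e -> exists n0, forall n, (n0 <= n)%N -> forall x, K D x ->
    cmod (u n x - v x) <= e.
  move=> /unif[n0 h]; exists n0 => n hn x Kx; rewrite cmodB.
  by apply: (ccvg_le (n0 := n0) (hv x Kx)) => k hk; exact: (ltW (h k n hk hn x Kx)).
have cv : {within K D, continuous (v : 'rV[R]_d -> R[i]^o)}.
  apply: (within_uniform_limit (u_ := u)) => [n|e e0]; first by case: (du n).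
  have [n0 h] := lim_v (e / 2) (divr_gt0 e0 (ltr0Sn _ 1)); exists n0 => x Kx.
  by apply: le_lt_trans (h n0 (leqnn _) x Kx) _; rewrite ltr_pdivrMr // ltr_pMr // ltr1n.
(* The threshold must not depend on m. An intermediate u_k is inserted: u_n - u_k is small in energy
   at all levels, and only k is chosen according to m. *)
have gE (e : R) : 0 < e -> exists n0, forall n, (n0 <= n)%N -> forall m,
    graph_energy D m (fun x => u n x - v x) <= e.
  move=> e0; have e4 : 0 < e / 4 by rewrite divr_gt0.
  have [n0 h] := C2 _ e4; exists n0 => n hn m.
  have [c c0 hc] := graph_energy_small m e4; have [k0 hk] := lim_v c c0.
  pose k := maxn n0 k0.
  apply: le_trans (graph_energy_split m _ (u k) _) _.
  have s1 : graph_energy D m (fun x => u n x - u k x) <= e / 4.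
    apply: le_trans (ltW (h n k hn (leq_maxl _ _))); rewrite eB.
    apply: (graph_energy_le_energy graphsD m).
    by have := (dom_energy_subspace graphsD).2 (-1) _ _ (du k) (du n);
       congr dom_energy; apply/funext => x /=; rewrite addrC fctE /= scaleN1r.
  have s2 : graph_energy D m (fun x => u k x - v x) <= e / 4.
    by apply: hc => x hx; apply: hk; [exact: leq_maxr|exact: Vm_K hx].
  lra.
have duv (e : R) : 0 < e -> exists n0, forall n, (n0 <= n)%N ->
    dom_energy D (fun x => u n x - v x) /\ energy D (fun x => u n x - v x) <= e.
  move=> /gE[n0 h]; exists n0 => n hn.
  have cg := graph_energy_cvg graphsD (h n hn).
  split; last by apply: limr_le => //; near=> m; exact: h.
  split; last exact: cg.
  have := within_continuousDZ (c := -1) cv (du n).1.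
  by rewrite (_ : (fun x => -1 * v x + u n x) = (fun x => u n x - v x)) //;
    apply/funext => x; rewrite mulN1r addrC.
have dv : dom_energy D v.
  have [n0 h] := duv 1 ltr01; have [h1 _] := h n0 (leqnn _).
  have := (dom_energy_subspace graphsD).2 (-1) _ _ h1 (du n0).
  congr dom_energy; apply/funext => x /=.
  by rewrite fctE /= scaleN1r opprB subrK.
have [F FP] := fractal_class pcfD graphsD muD harmD dv.
exists F; first by exists v.
move=> e e0.
have FB n : fractal_repr (f n - F) (fun x => u n x - v x).
  by apply: fractal_reprB => //; exact: (frepP (Df n)).
have e2 : 0 < e / 2 by rewrite divr_gt0.
have e2e : e / 2 < e by rewrite ltr_pdivrMr // ltr_pMr // ltr1n.
have [n1 h1] := duv _ e2; have [n2 h2] := lim_v _ e2.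
exists (maxn n1 n2) => n; rewrite geq_max => /andP[k1 k2]; split.
  apply: le_lt_trans e2e; rewrite -ler_sqr ?nnegrE ?hnorm_ge0 ?(ltW e2) //.
  apply: (fractal_hnorm_le (FB n)); first exact: sqr_ge0.
  by move=> x Kx; rewrite -cmod_sqr ler_sqr ?nnegrE ?cmod_ge0 ?(ltW e2) //; exact: h2.
by apply: le_lt_trans e2e; rewrite (qval_repr pcfD mu_cell (FB n)); case: (h1 n k1).
Unshelve. all: by end_near. Qed.

Let P : set (T -> R[i]) := [set g | exists2 u, dom_energy D u & g = restrictK D u].

Let Pm g : P g -> cmeasurable g.
Proof. by move=> [u [cu _] ->]; exact: cmeasurable_restrictK. Qed.

Let P0 : P (fun=> 0).
Proof.
exists (fun=> 0); first exact: (dom_energy_subspace graphsD).1.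
by apply/funext => x; rewrite /restrictK if_same.
Qed.

Let PDZ c f g : P f -> P g -> P (fun x => c * f x + g x).
Proof.
move=> [u du ->] [v dv ->]; exists (fun x => c * u x + v x).
  exact: (dom_energy_subspace graphsD).2 c u v du dv.
by apply/funext => x; rewrite /restrictK; case: asboolP => // _; rewrite mulr0 addr0.
Qed.

Lemma approximable_continuous u : {within K D, continuous (u : 'rV[R]_d -> R[i]^o)} ->
  approximable (mu D) P (restrictK D u).
Proof.
move=> cu; split; first exact: cmeasurable_restrictK.
move=> e e0; have e2 : 0 < e / 2 by rewrite divr_gt0.
have se : 0 < Num.sqrt (e / 2) by rewrite sqrtr_gt0.
have [v dv hv] := dom_energy_uniformly_dense pcfD graphsD harmD selfsim cu se.
exists (restrictK D v); first by exists v.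
have -> : (fun x => restrictK D u x - restrictK D v x) = restrictK D (fun x => -1 * v x + u x).
  apply/funext => x; rewrite /restrictK; case: asboolP => _; last by rewrite subrr.
  by rewrite mulN1r addrC.
apply: (@le_lt_trans _ _ (e / 2)%:E); last first.
  by rewrite lte_fin ltr_pdivrMr // ltr_pMr // ltr1n.
apply: (sqn_restrictK_le pcfD muD _ (ltW e2)).
  exact: (within_continuousDZ (c := -1) dv.1 cu).
move=> x Kx; rewrite -cmod_sqr -(sqr_sqrtr (ltW e2)).
rewrite ler_sqr ?nnegrE ?cmod_ge0 ?sqrtr_ge0 // mulN1r addrC cmodB.
exact: (ltW (hv x Kx)).
Qed.

Lemma approximable_open (O : set T) : open (O : set 'rV[R]_d) ->
  approximable (mu D) P (cindic R O).
Proof.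
move=> oO; have [h [ch h01 hlim]] := indicator_open_limit oO.
have mO := measurable_open oO.
have mK := measurable_K pcfD.
have mR : cmeasurable (restrictK D (cindic R O)).
  rewrite (_ : restrictK D (cindic R O) = cindic R (O `&` K D)).
    by apply: cmeasurable_indic; exact: measurableI.
  apply/funext => x; rewrite /restrictK /cindic indicI /=; case: asboolP => Kx.
    by rewrite [\1_(K D) x]indicE mem_set // mulr1.
  by rewrite [\1_(K D) x]indicE memNset // mulr0.
apply: (approximable_ae (f := restrictK D (cindic R O))) => //.
- exact: cmeasurable_indic.
- exact: restrictK_ae.
apply: (@approximable_dominated _ _ _ _ _ Pm _
  (fun n => restrictK D (fun x => (h n x)%:C)) (cst 1)) => //.
- by move=> n; apply: approximable_continuous; exact: continuous_realC.
- move=> x; rewrite /restrictK; case: asboolP => Kx; last by apply: ccvg_realC; exact: cvg_cst.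
  by apply: ccvg_realC; exact: hlim.
- move=> n x; rewrite /restrictK; case: asboolP => Kx; last by rewrite subrr cmod2_0.
  rewrite /cindic -rmorphB cmod2_real indicE; have /andP[h0 h1] := h01 n x.
  by case: (_ \in _) => /=; nra.
- by apply: integrable_cst1; rewrite (muT pcfD muD) ltry.
Qed.

(** Open sets generate the Borel sets and are closed under intersection, their indicators are limits
    of continuous functions, and on K these are uniform limits of functions of finite energy. *)
Lemma fractal_dense (f : H) (e : R) : 0 < e -> exists2 g, qdom E g & hnorm (f - g) < e.
Proof.
move=> e0.
have muT1 : (mu D setT < +oo)%E by rewrite (muT pcfD muD) ltry.
have ap A : measurable A -> approximable (mu D) P (cindic R A).
  apply: (@approximable_measurable _ _ _ _ _ muT1 Pm P0 PDZ (@open 'rV[R]_d : set (set T))).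
  - by [].
  - by move=> A' B oA oB; exact: openI.
  - by apply: approximable_open; exact: openT.
  - exact: approximable_open.
have [mf hf] := approximable_all Pm P0 PDZ ap (L2_sqint (f : L2 (mu D))).
have [g [u du gE] hg] := hf _ (exprn_gt0 2 e0).
have [G [_ GP]] := fractal_class pcfD graphsD muD harmD du.
exists G; first by exists u.
rewrite -hnorm_lt //; apply: le_lt_trans hg.
have GP' : {ae mu D, forall x, (G : L2 (mu D)) x = g x}.
  by apply: ae_imply2 GP (restrictK_ae pcfD muD u) _ => x -> hr; rewrite gE hr.
rewrite (hnormB_sqn mf (cmeasurable_restrictK pcfD du.1) _ _) -?gE //.
exact: ae_imply GP' _.
Qed.

Lemma fractal_energy_form : energy_form E.
Proof.
have q0 := fractal_qval_ge0 graphsD (D := D).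
split.
- exact: L2_complete.
- exact: (quadratic_of_hermitian sD (fractal_sesq_hermitian pcfD graphsD mu_cell)
    (fractal_sesq_qval graphsD (D := D))).
- exact: q0.
- exact: fractal_dense.
- by apply: complete_norm1 => //; exact: fractal_closed.
Qed.

End FractalEnergyForm.

(** * Cell vectors and harmonic extensions in the space of the fractal *)

Section FractalCells.
Variables (R : realType) (d : nat) (D : fractal R d).
Implicit Types (x y : 'rV[R]_d) (u v phi : 'rV[R]_d -> R[i]).
Notation N := (nmaps D).
Notation word m := (m.-tuple 'I_N).
Notation T := (borel R d).
Hypothesis pcfD : pcf_fractal D.
Hypothesis graphsD : weighted_graphs D.
Hypothesis muD : borel_measure_on_K D.
Hypothesis harmD : harmonic_functions D.
Hypothesis selfsim : forall u, dom_energy D u ->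
  (forall j, dom_energy D (u \o F (f := D) j)) /\
  energy D u = \sum_(j < N) (renorm D)^-1 * energy D (u \o F j).
Hypothesis mu_cell : forall m (w : word m), mu D (Fword w @` K D) = ((N%:R ^+ m)^-1)%:E.
Notation H := (L2space (mu D)).
Notation E := (fractal_form D).

Lemma measurable_cell (w : seq 'I_N) : measurable (Fword w @` K D : set T).
Proof. by apply: measurable_closed; exact: closed_cell. Qed.

(** The point lies in a cell of every level m, of measure N^-m with N >= 2. *)
Lemma point_null x : K D x -> (mu D).-negligible [set x].
Proof.
move=> Kx; have mx : measurable ([set x] : set T).
  by apply: measurable_closed; apply: compact_closed; [exact: norm_hausdorff|exact: compact_set1].
apply/negligibleP => //; apply/eqP; rewrite eq_le measure_ge0 andbT.
apply/lee_addgt0Pr => e e0; rewrite add0e.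
have N1 : (1 < N)%N by case: pcfD.
have q01 : 0 <= (N%:R^-1 : R) < 1.
  by rewrite invr_ge0 ler0n invf_lt1 ?ltr1n ?ltr0n // (ltn_trans _ N1).
have [n0 hn] := geometric_small 1 q01 e0; have [w xw] := K_cover pcfD n0 Kx.
apply: (@le_trans _ _ (mu D (Fword w @` K D))).
  by apply: le_measure; rewrite ?inE //; [exact: measurable_cell|move=> y ->].
by rewrite mu_cell lee_fin -exprVn; have := hn n0 (leqnn _); rewrite mul1r => /ltW.
Qed.

Lemma vertices_null m : (mu D).-negligible [set x | x \in Vm D m].
Proof.
have : {subset (Vm D m : seq _) <= K D} by move=> x /(Vm_K pcfD); rewrite inE.
rewrite [X in _ -> negligible _ X](_ : _ = [set x | x \in (Vm D m : seq _)]) //.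
elim: (Vm D m : seq _) => [|a s IH] hs.
  by rewrite (_ : [set x | x \in [::]] = set0); [exact: negligible_set0|apply/seteqP; split].
rewrite (_ : [set x | x \in a :: s] = [set a] `|` [set x | x \in s]).
  apply: negligibleU; first by apply: point_null; have := hs a (mem_head _ _); rewrite inE.
  by apply: IH => x xs; apply: hs; rewrite inE xs orbT.
apply/seteqP; split=> x /=; rewrite inE; first by case/orP => [/eqP|]; [left|right].
by case=> [->|->]; rewrite ?eqxx ?orbT.
Qed.

(** Two cells of level m meet only in V_m, a finite and hence null set. *)
Lemma ae_unique_cell m : {ae mu D, forall x, exists w : word m,
  (Fword w @` K D) x /\ forall w' : word m, (Fword w' @` K D) x -> w' = w}.
Proof.
have nv : {ae mu D, forall x, x \notin Vm D m}.
  by apply: negligibleS (vertices_null m) => x /= /negP; rewrite negbK.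
apply: ae_imply2 (ae_K pcfD muD) nv _ => x Kx nx.
have [w xw] := K_cover pcfD m Kx; exists w; split=> // w' xw'.
apply: contrapT => ne; have [|v hv xE] := cells_overlap pcfD (w := w') (w' := w) _ xw' xw.
  by apply/eqP.
by move/negP: nx; apply; rewrite xE -[m in Vm _ m]addn0 -[m in (m + 0)%N](size_tuple w'); exact: Vm_Fword.
Qed.

Let p0 m : 0 < (N%:R ^+ m)^-1 :> R.
Proof. by rewrite invr_gt0 exprn_gt0 // ltr0n N_gt0. Qed.

Let Acell m (w : word m) : set T := Fword w @` K D.
Let mA m (w : word m) : measurable (Acell w) := measurable_cell w.
Let muA m (w : word m) : mu D (Acell w) = ((N%:R ^+ m)^-1)%:E := mu_cell w.

Definition fractal_cell m : word m -> H := cell_vector (@mA m) (@muA m).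

Lemma fractal_cell_orthonormal m (w w' : word m) :
  ip (fractal_cell w) (fractal_cell w') = (w == w')%:R.
Proof. exact: (cell_vector_orthonormal (p0 m) _ _ (ae_unique_cell m)). Qed.

(** The value at the vertex F_w(v0), times the root of the measure of a cell because the cell
    vectors are normalised. *)
Definition fractal_coeff (v0 : 'rV[R]_d) m (f : H) (w : word m) : R[i] :=
  (Num.sqrt (N%:R ^+ m)^-1)%:C * frep f (Fword w v0).

(** In each cell the error is bounded by B^2 times the energy of u composed with F_w. These energies
    sum to r^m E(u), and the measure of a cell contributes N^-m. *)
Lemma fractal_approximation (v0 : 'rV[R]_d) : v0 \in V0 D -> exists2 B : R, 0 <= B &
  forall m (f : H), qdom E f ->
    hnorm (f - \sum_(w : word m) fractal_coeff v0 f w *: fractal_cell w) ^+ 2 <=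
    B ^+ 2 * (renorm D / N%:R) ^+ m * qval E f.
Proof.
move=> hv0; have [B B0 hB] := osc_K pcfD graphsD harmD hv0; exists B => // m f Df.
have [du fu] := frepP Df; have Kv0 := V0_K pcfD hv0.
have dw (w : word m) : dom_energy D (frep f \o Fword w) := dom_energy_Fword selfsim w du.
have e0 (w : word m) := energy_ge0 graphsD (dw w).
have fr : {ae mu D, forall x, (f : L2 (mu D)) x = restrictK D (frep f) x}.
  by apply: ae_imply2 fu (restrictK_ae pcfD muD (frep f)) _ => x -> ->.
have C0 (w : word m) : 0 <= B ^+ 2 * energy D (frep f \o Fword w) by rewrite mulr_ge0 ?sqr_ge0.
have hc : {ae mu D, forall x, forall w : word m, Acell w x ->
    cmod2 (restrictK D (frep f) x - frep f (Fword w v0)) <= B ^+ 2 * energy D (frep f \o Fword w)}.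
  apply: ae_imply (ae_K pcfD muD) _ => x Kx w [k Kk xE]; rewrite restrictKE //.
  have := hB (frep f \o Fword w) k (dw w) Kk; rewrite /= xE => h.
  rewrite -cmod_sqr -[energy _ _](sqr_sqrtr (e0 w)) -exprMn.
  by rewrite ler_sqr ?nnegrE ?cmod_ge0 ?mulr_ge0 ?sqrtr_ge0.
apply: le_trans (cell_approximation (p0 m) (@mA m) (@muA m) (ae_unique_cell m)
  (cmeasurable_restrictK pcfD du.1) fr C0 hc) _.
rewrite le_eqVlt; apply/orP; left; apply/eqP.
have r0 := renorm_gt0 graphsD.
rewrite (qval_repr pcfD mu_cell (frepP Df)) (energy_words selfsim m du) mulr_sumr.
apply: eq_bigr => w _; rewrite expr_div_n.
field; rewrite !expf_neq0 ?(lt0r_neq0 r0) //.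
by rewrite pnatr_eq0 -lt0n (N_gt0 pcfD).
Qed.

Definition harmonic_class m phi : H :=
  L2mk (sq_integrable_restrictK pcfD graphsD muD harmD (dom_harmonic pcfD graphsD harmD m phi)).

Lemma harmonic_classP m phi : fractal_repr (harmonic_class m phi) (mharmonic D m phi).
Proof.
split; first exact: dom_harmonic.
have h := L2mkE (sq_integrable_restrictK pcfD graphsD muD harmD (dom_harmonic pcfD graphsD harmD m phi)).
by apply: ae_imply2 h (restrictK_ae pcfD muD (mharmonic D m phi)) _ => x -> ->.
Qed.

Lemma dom_harmonic_class m phi : qdom E (harmonic_class m phi).
Proof. by exists (mharmonic D m phi); exact: harmonic_classP. Qed.

Lemma frep_harmonic_class m phi x : K D x -> frep (harmonic_class m phi) x = mharmonic D m phi x.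
Proof.
exact: (fractal_repr_unique pcfD mu_cell (frepP (dom_harmonic_class m phi)) (harmonic_classP m phi)).
Qed.

Lemma qval_harmonic_class m phi : qval E (harmonic_class m phi) = graph_energy D m phi.
Proof.
by rewrite (qval_repr pcfD mu_cell (harmonic_classP m phi)) energy_harmonic.
Qed.

Lemma polar_harmonic_class m phi (u : H) : qdom E u ->
  polar E (harmonic_class m phi) u = gform D m phi (frep u).
Proof.
move=> Du; rewrite (polar_fractal pcfD graphsD mu_cell (dom_harmonic_class m phi) Du).
rewrite -(eform_harmonic pcfD graphsD harmD m phi (dom_frep Du)).
by apply: (eq_on_K_eform pcfD) => // x; exact: frep_harmonic_class.
Qed.

(** Linearity is required at the vertices only: elsewhere the vertex values taken from the metric
    graph are arbitrary choices. *)
Lemma harmonic_class_linear m c phi (phi' : 'rV[R]_d -> R[i]) v :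
  {in Vm D m, forall x, v x = c * phi x + phi' x} ->
  harmonic_class m v = c *: harmonic_class m phi + harmonic_class m phi'.
Proof.
move=> h.
have [_ r1] := fractal_reprDZ graphsD c (harmonic_classP m phi) (harmonic_classP m phi').
have [_ r2] := harmonic_classP m v.
apply/L2P; apply: ae_imply2 r1 r2 _ => x -> ->.
by rewrite (eq_harmonic (phi' := fun x => c * phi x + phi' x) h) harmonicDZ.
Qed.

End FractalCells.

(** * Weak derivatives on an interval *)

Section SmoothStep.
Variable R : realType.
Implicit Types (x t a b h l : R) (f : R -> R).

Definition sqpos t : R := Num.max 0 t ^+ 2.

Lemma max0_cases t : (t <= 0 /\ Num.max 0 t = 0) \/ (0 <= t /\ Num.max 0 t = t).
Proof.
by case: (leP 0 t) => h; [right; rewrite ?max_r|left; split=> //; exact: ltW].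
Qed.

Lemma is_derive_sqpos x : is_derive x 1 sqpos (2 * Num.max 0 x).
Proof.
(* The remainder is quadratic even when x and x + h lie on different sides of 0. *)
have key h : `|sqpos (x + h) - sqpos x - 2 * Num.max 0 x * h| <= h ^+ 2.
  rewrite /sqpos ler_norml; case: (max0_cases (x + h)) => -[? ->];
    case: (max0_cases x) => -[? ->]; apply/andP; split; rewrite ?expr0n /= ?expr2; nra.
have lim : h^-1 *: (sqpos (h *: (1 : R) + x) - sqpos x) @[h --> 0^'] --> 2 * Num.max 0 x.
  apply/cvgrPdist_lt => e e0; near=> h.
  have h0 : h != 0 by near: h; exact: nbhs_dnbhs_neq.
  have he : `|h| < e by near: h; exact: dnbhs0_lt.
  apply: le_lt_trans he; rewrite distrC -(ler_pM2r (_ : 0 < `|h|)) ?normr_gt0 // -normrM.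
  rewrite -expr2 real_normK ?num_real //.
  have -> : (h^-1 *: (sqpos (h *: (1 : R) + x) - sqpos x) - 2 * Num.max 0 x) * h =
            sqpos (x + h) - sqpos x - 2 * Num.max 0 x * h.
    by rewrite -[h *: 1]/(h * 1) mulr1 (addrC h) -[_ *: (_ - _)]/(_ * _); field.
  exact: key.
by apply: DeriveDef; [apply/cvg_ex; exists (2 * Num.max 0 x)|exact: cvg_lim].
Unshelve. all: by end_near. Qed.

(** A quadratic spline rising from 0 to 1 on [0, 1]; test functions need to be C^1 only. Its
    derivative [tent] is the hat function on [0, 1] with integral 1. *)
Definition smooth_step t : R := 2 * sqpos t - 4 * sqpos (t - 2^-1) + 2 * sqpos (t - 1).
Definition tent t : R := 4 * Num.max 0 t - 8 * Num.max 0 (t - 2^-1) + 4 * Num.max 0 (t - 1).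

Lemma is_derive_lincomb (c c' : R) (f g : R -> R) x a b : is_derive x 1 f a ->
  is_derive x 1 g b -> is_derive x 1 (fun t => c * f t + c' * g t) (c * a + c' * b).
Proof.
move=> df dg.
have := is_deriveD (is_deriveM (is_derive_cst c x 1) df) (is_deriveM (is_derive_cst c' x 1) dg).
by rewrite !scaler0 !addr0.
Qed.

Lemma is_derive_smooth_step x : is_derive x 1 smooth_step (tent x).
Proof.
have sh c : is_derive x 1 (sqpos \o (fun t : R => t - c)) (2 * Num.max 0 (x - c)).
  have hs := is_derive_sqpos (x - c).
  have hc : is_derive x 1 (fun t : R => t - c) 1 by apply: is_derive_eq; rewrite subr0.
  by have := @is_derive1_comp _ sqpos (fun t : R => t - c) x _ _ hs hc; rewrite mulr1.
have h0 := is_derive_sqpos x; have h1 := sh 2^-1; have h2 := sh 1.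
have := is_derive_lincomb 1 2 (is_derive_lincomb 2 (- 4) h0 h1) h2.
have -> : (fun t => 1 * (2 * sqpos t + - 4 * (sqpos \o (fun t => t - 2^-1)) t) +
    2 * (sqpos \o (fun t => t - 1)) t) = smooth_step.
  by apply/funext => t; rewrite /smooth_step /=; ring.
have -> // : 1 * (2 * (2 * Num.max 0 x) + - 4 * (2 * Num.max 0 (x - 2^-1))) +
    2 * (2 * Num.max 0 (x - 1)) = tent x.
by rewrite /tent; ring.
Qed.

Lemma tent_ge0 t : 0 <= tent t.
Proof.
rewrite /tent; case: (max0_cases t) => -[? ->]; case: (max0_cases (t - 2^-1)) => -[? ->];
  case: (max0_cases (t - 1)) => -[? ->]; lra.
Qed.

Lemma tent_out t : t <= 0 \/ 1 <= t -> tent t = 0.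
Proof.
rewrite /tent; case: (max0_cases t) => -[? ->]; case: (max0_cases (t - 2^-1)) => -[? ->];
  case: (max0_cases (t - 1)) => -[? ->]; case; lra.
Qed.

Lemma smooth_step0 t : t <= 0 -> smooth_step t = 0.
Proof.
by move=> t0; rewrite /smooth_step /sqpos !max_l ?expr0n /= ?mulr0 ?subrr ?addr0 //; lra.
Qed.

Lemma smooth_step1 t : 1 <= t -> smooth_step t = 1.
Proof.
by move=> t1; rewrite /smooth_step /sqpos !max_r; [field|lra|lra|lra].
Qed.

Lemma smooth_step01 t : 0 <= smooth_step t <= 1.
Proof.
rewrite /smooth_step /sqpos; case: (max0_cases t) => -[? ->];
case: (max0_cases (t - 2^-1)) => -[? ->];
  case: (max0_cases (t - 1)) => -[? ->]; apply/andP; split; rewrite ?expr0n /= ?expr2; nra.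
Qed.

Definition C1 f (f' : R -> R) := (forall x, is_derive x 1 f (f' x)) /\ continuous f'.

Lemma C1_continuous f f' : C1 f f' -> continuous f.
Proof.
move=> [df _] x; apply: differentiable_continuous; apply/derivable1_diffP.
exact: (@ex_derive _ _ _ _ _ _ _ (df x)).
Qed.

Lemma C1_derive1 f f' : C1 f f' -> derive1 f = f'.
Proof. by move=> [df _]; apply/funext => x; rewrite derive1E; exact: (@derive_val _ _ _ _ _ _ _ (df x)). Qed.

Lemma C1_of_derivable f : (forall x, derivable f x 1) -> continuous (derive1 f) -> C1 f (derive1 f).
Proof. by move=> df cf; split=> // x; apply: DeriveDef => //; rewrite derive1E. Qed.

Lemma C1_lincomb c c' f f' g g' : C1 f f' -> C1 g g' ->
  C1 (fun t => c * f t + c' * g t) (fun t => c * f' t + c' * g' t).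
Proof.
move=> [df cf] [dg cg]; split=> x.
  exact: is_derive_lincomb (df x) (dg x).
by apply: cvgD; apply: cvgM => //; [exact: cvg_cst|exact: cf|exact: cvg_cst|exact: cg].
Qed.

Lemma tent_continuous : continuous tent.
Proof.
have sh c : continuous (fun t : R => Num.max 0 (t - c)).
  move=> x; apply: (@continuous_max _ _ (cst 0) (fun t : R => t - c)); first exact: cvg_cst.
  by apply: cvgB; [exact: cvg_id|exact: cvg_cst].
have c0 : continuous (fun t : R => Num.max 0 t).
  by move=> x; apply: (@continuous_max _ _ (cst 0) (fun t : R => t)); [exact: cvg_cst|exact: cvg_id].
move=> x; apply: cvgD; first apply: cvgB; (apply: cvgM; first exact: cvg_cst);
  [exact: c0|exact: sh|exact: sh].
Qed.

Lemma C1_step_affine a b : C1 (fun t => smooth_step (a * t + b)) (fun t => a * tent (a * t + b)).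
Proof.
split=> x.
  have hs := is_derive_smooth_step (a * x + b).
  have hc : is_derive x 1 (fun t : R => a * t + b) a.
    rewrite (_ : (fun t => _) = a *: (id : R -> R) + cst b) //.
    by apply: is_derive_eq; rewrite addr0 /GRing.scale /= mulr1.
  have := @is_derive1_comp _ smooth_step (fun t : R => a * t + b) x _ _ hs hc.
  by rewrite mulrC.
apply: cvgM; first exact: cvg_cst.
apply: (@continuous_comp _ _ _ (fun t : R => a * t + b) tent); last exact: tent_continuous.
by apply: cvgD; [apply: cvgM; [exact: cvg_cst|exact: cvg_id]|exact: cvg_cst].
Qed.

(* Rises from 0 to 1 on [x+h, x+2h] and falls back to 0 on [y-2h, y-h]. *)
Definition plateau x (y : R) h t := smooth_step (h^-1 * t + (- x / h - 1)) -
  smooth_step (h^-1 * t + (- y / h + 2)).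
Definition plateau' x (y : R) h t := h^-1 * tent (h^-1 * t + (- x / h - 1)) -
  h^-1 * tent (h^-1 * t + (- y / h + 2)).

Section Plateau.
Variables x y h : R.
Hypothesis h0 : 0 < h.

Lemma C1_plateau : C1 (plateau x y h) (plateau' x y h).
Proof.
have := C1_lincomb 1 (-1) (C1_step_affine h^-1 (- x / h - 1)) (C1_step_affine h^-1 (- y / h + 2)).
congr C1; apply/funext => t; rewrite ?/plateau ?/plateau' ; ring.
Qed.

Let arg1 t : h^-1 * t + (- x / h - 1) = (t - (x + h)) / h.
Proof. by field; rewrite lt0r_neq0. Qed.

Let arg2 t : h^-1 * t + (- y / h + 2) = (t - (y - 2 * h)) / h.
Proof. by field; rewrite lt0r_neq0. Qed.

Let div_le0 t : t <= 0 -> t / h <= 0.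
Proof. by move=> t0; rewrite ler_pdivrMr // mul0r. Qed.

Let div_ge1 t : h <= t -> 1 <= t / h.
Proof. by move=> t0; rewrite ler_pdivlMr // mul1r. Qed.

Lemma plateau_left t : x + 2 * h <= y - 2 * h -> t <= x + h -> plateau x y h t = 0.
Proof.
have hp := h0; move=> xy tx; rewrite /plateau arg1 arg2 !smooth_step0 ?subrr //; apply: div_le0; lra.
Qed.

Lemma plateau_right t : x + 2 * h <= y - 2 * h -> y - h <= t -> plateau x y h t = 0.
Proof.
have hp := h0; move=> xy tx; rewrite /plateau arg1 arg2 !smooth_step1 ?subrr //; apply: div_ge1; lra.
Qed.

Lemma plateau_mid t : x + 2 * h <= t <= y - 2 * h -> plateau x y h t = 1.
Proof.
move=> /andP[tx ty]; rewrite /plateau arg1 arg2 smooth_step1 ?smooth_step0 ?subr0 //.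
  by apply: div_le0; lra.
by apply: div_ge1; lra.
Qed.

Lemma plateau01 t : x + 2 * h <= y - 2 * h -> 0 <= plateau x y h t <= 1.
Proof.
move=> xy; rewrite /plateau arg1 arg2.
have /andP[p1 p2] := smooth_step01 ((t - (x + h)) / h).
have /andP[p3 p4] := smooth_step01 ((t - (y - 2 * h)) / h).
have [le|gt] := leP t (y - 2 * h).
  by rewrite [smooth_step ((t - (y - 2 * h)) / h)]smooth_step0 ?subr0 ?p1 //; apply: div_le0; lra.
rewrite [smooth_step ((t - (x + h)) / h)]smooth_step1 ?subr_ge0 ?p4 ?gerBl //.
by apply: div_ge1; lra.
Qed.

Lemma plateau_test l : 0 <= x -> y <= l -> x + 2 * h <= y - 2 * h ->
  test_function l (plateau x y h).
Proof.
move=> x0 yl xy; have c := C1_plateau; split.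
- by move=> t; exact: (@ex_derive _ _ _ _ _ _ _ (c.1 t)).
- by rewrite (C1_derive1 c); case: c.
have hp := h0; exists (x + h), (y - h); split; [by lra|by lra|].
move=> t; rewrite in_itv /= negb_and -!ltNge => /orP[/ltW|/ltW].
  exact: plateau_left.
exact: plateau_right.
Qed.

End Plateau.

Lemma test_function_bounds l phi : test_function l phi -> phi 0 = 0 /\ phi l = 0.
Proof.
move=> [_ _ [a [b [a0 bl out]]]]; split.
  by apply: out; rewrite in_itv /= negb_and -!ltNge a0.
by apply: out; rewrite in_itv /= negb_and -!ltNge bl orbT.
Qed.

Lemma test_function_C1 l phi : test_function l phi -> C1 phi (derive1 phi).
Proof. by move=> [h1 h2 _]; exact: (C1_of_derivable h1 h2). Qed.

Lemma C1_by_parts l f f' phi : 0 < l -> C1 f f' -> test_function l phi ->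
  (\int[@lebesgue_measure R]_(t in `[0%R, l]) (f t * derive1 phi t) =
   - \int[@lebesgue_measure R]_(t in `[0%R, l]) (f' t * phi t))%R.
Proof.
move=> l0 cf tphi; have [p0 pl] := test_function_bounds tphi; have cphi := test_function_C1 tphi.
have lr g g' : C1 g g' -> derivable_oo_LRcontinuous g 0 l.
  move=> cg; split=> [x _||]; first exact: (@ex_derive _ _ _ _ _ _ _ (cg.1 x)).
    by apply: cvg_at_right_filter; exact: C1_continuous cg _.
  by apply: cvg_at_left_filter; exact: C1_continuous cg _.
rewrite (@Rintegration_by_parts _ f phi f' (derive1 phi)) ?p0 ?pl ?mulr0 ?subrr ?sub0r //.
- exact/continuous_subspaceT/cf.2.
- exact: lr cf.
- by move=> x _; rewrite (C1_derive1 cf).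
- by apply/continuous_subspaceT; case: cphi.
- exact: lr cphi.
Qed.

End SmoothStep.

Section CauchySchwarz.
Context d (T : measurableType d) (R : realType) (mu : {measure set T -> \bar R}).
Implicit Types f g : T -> R[i].

Lemma sqn_fin f : sq_integrable mu f -> exists2 a : R, 0 <= a & sqn mu f = a%:E.
Proof.
move=> [_ fi]; exists (fine (sqn mu f)); first by rewrite fine_ge0 // sqn_ge0.
by rewrite fineK // ge0_fin_numE ?sqn_ge0.
Qed.

Lemma cintegral_cauchy_schwarz f g (a b : R) : sq_integrable mu f -> sq_integrable mu g ->
  sqn mu f = a%:E -> sqn mu g = b%:E ->
  cmod2 (cintegral mu setT (fun x => f x * (g x)^*)) <= a * b.
Proof.
move=> hf hg fa gb.
rewrite -(ip_cintegral (F := L2mk hf) (G := L2mk hg) hf.1 hg.1 (L2mkE hf) (L2mkE hg)).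
have nE (h : T -> R[i]) (hh : sq_integrable mu h) c : sqn mu h = c%:E ->
    Re (ip (L2mk hh : L2space mu) (L2mk hh)) = c.
  move=> hc; have := hnorm_sqn (F := L2mk hh) hh.1 (L2mkE hh); rewrite hc hnorm_sqr.
  by move=> [<-].
rewrite -(nE f hf a fa) -(nE g hg b gb).
apply: (cauchy_schwarz_on (@subspaceT R (L2space mu)) (@ip_hermitian _ _)) => // h _.
exact: Re_ip_ge0.
Qed.

Lemma cintegralB f g : cintegrable mu f -> cintegrable mu g ->
  cintegral mu setT (fun x => f x - g x) = cintegral mu setT f - cintegral mu setT g.
Proof.
move=> hf hg; rewrite addrC -mulN1r -cintegralDZ //; congr cintegral.
by apply/funext => x; rewrite mulN1r addrC.
Qed.

End CauchySchwarz.

(** * Square integrable functions on one edge *)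

Section Interval.
Variables (R : realType) (l : R).
Hypothesis l0 : 0 < l.
Notation T := (measurableTypeR R).
Notation io := (interval_measure l).
Implicit Types (f g v w : R -> R[i]) (x y t h : R).

(** Continuity is known on the edge only; the cutoff is measurable on the whole line. *)
Definition cutoff f (t : T) : R[i] := if 0 <= t <= l then f t else 0.

Lemma cutoffE f t : 0 <= t <= l -> cutoff f t = f t.
Proof. by rewrite /cutoff => ->. Qed.

Lemma interval_measureE (A : set T) : io A = @lebesgue_measure R (A `&` `[0, l]).
Proof. by []. Qed.

Lemma interval_measureT : io setT = l%:E.
Proof.
by rewrite interval_measureE setTI lebesgue_measure_itv /= lte_fin l0 sube0.
Qed.

Lemma interval_fin : (io setT < +oo)%E.
Proof. by rewrite interval_measureT ltry. Qed.

Lemma interval_ae : {ae io, forall t, 0 <= t <= l}.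
Proof.
exists (~` `[0, l]); split; first by apply: measurableC; exact: measurable_itv.
  by rewrite interval_measureE setICl measure0.
by move=> t /= h; rewrite in_itv.
Qed.

Lemma cutoff_ae f : {ae io, forall t, cutoff f t = f t}.
Proof. by apply: ae_imply interval_ae _ => t; exact: cutoffE. Qed.

(** Weak derivatives and the form are defined with Lebesgue integrals over the interval, the L2
    theory with the restricted measure; this passes between them for arbitrary integrands. *)
Lemma Rintegral_cutoff (f : R -> R) :
  (\int[@lebesgue_measure R]_(t in `[0%R, l]) f t)%R =
  (\int[io]_(t in setT) (if 0 <= t <= l then f t else 0))%R.
Proof.
rewrite /Rintegral; congr fine.
transitivity (\int[io]_(t in `[0%R, l]) (f t)%:E)%E.
  apply: eq_measure_integral => A mA Al; rewrite interval_measureE.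
  by congr (lebesgue_measure _); rewrite (setIidl Al).
rewrite [LHS]integral_mkcond; apply: eq_integral => t _; rewrite patchE.
by rewrite mem_setE in_itv /=; case: ifP.
Qed.

Lemma cintegral_cutoff f : cintegral (@lebesgue_measure R) `[0, l] f = cintegral io setT (cutoff f).
Proof.
rewrite /cintegral !Rintegral_cutoff; congr (_ +i* _); apply: eq_Rintegral => t _;
  by rewrite /cutoff; case: ifP.
Qed.

Lemma cmeasurable_cutoff f : {within `[0, l], continuous (f : R -> R[i]^o)} ->
  cmeasurable (cutoff f).
Proof.
move=> cf; have mI : measurable (`[0, l] : set T) := measurable_itv _.
split.
  rewrite (_ : (fun x => _) = ((fun t => Re (f t)) : T -> R) \_ `[0, l]).
    apply/(measurable_restrictT _ mI); apply: subspace_continuous_measurable_fun => //.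
    exact: within_continuous_Re.
  by apply/funext => t; rewrite /cutoff patchE mem_setE in_itv /=; case: ifP.
rewrite (_ : (fun x => _) = ((fun t => Im (f t)) : T -> R) \_ `[0, l]).
  apply/(measurable_restrictT _ mI); apply: subspace_continuous_measurable_fun => //.
  exact: within_continuous_Im.
by apply/funext => t; rewrite /cutoff patchE mem_setE in_itv /=; case: ifP.
Qed.

Lemma sqn_interval_le f (c : R) : cmeasurable (f : T -> R[i]) -> 0 <= c ->
  (forall t, 0 <= t <= l -> cmod2 (f t) <= c) -> (sqn io f <= (c * l)%:E)%E.
Proof.
move=> mf c0 hc; rewrite EFinM -interval_measureT; apply: sqn_le_cst => //.
exact: ae_imply interval_ae _.
Qed.

Lemma sq_integrable_interval f (c : R) : cmeasurable (f : T -> R[i]) ->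
  (forall t, 0 <= t <= l -> cmod2 (f t) <= c) -> sq_integrable io f.
Proof.
move=> mf hc; have c0 : 0 <= c by apply: le_trans (cmod2_ge0 (f 0)) (hc 0 _); rewrite lexx ltW.
apply: (bounded_sq_integrable interval_fin c0 mf); exact: ae_imply interval_ae _.
Qed.

Lemma continuous_interval_bounded f : {within `[0, l], continuous (f : R -> R[i]^o)} ->
  exists c, forall t, 0 <= t <= l -> cmod2 (f t) <= c.
Proof.
move=> cf.
have bd (u : R -> R) : {within `[0, l], continuous u} ->
    exists c, forall t, 0 <= t <= l -> `|u t| <= c.
  move=> cu; have cabs : {within `[0, l], continuous (fun t => `|u t|)}.
    by move=> t; apply: continuous_comp (cu t) _; exact: norm_continuous.
  have [c _ hc] := EVT_max (ltW l0) cabs.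
  by exists `|u c| => t ht; apply: hc; rewrite in_itv.
have [c hc] := bd _ (within_continuous_Re cf); have [c' hc'] := bd _ (within_continuous_Im cf).
exists (c ^+ 2 + c' ^+ 2) => t ht; apply: lerD; rewrite -real_normK ?num_real //.
  by rewrite ler_sqr ?nnegrE ?hc // (le_trans _ (hc t ht)).
by rewrite ler_sqr ?nnegrE ?hc' // (le_trans _ (hc' t ht)).
Qed.

Lemma sq_integrable_cutoff f : {within `[0, l], continuous (f : R -> R[i]^o)} ->
  sq_integrable io (cutoff f).
Proof.
move=> cf; have [c hc] := continuous_interval_bounded cf.
apply: (@sq_integrable_interval _ c); first exact: cmeasurable_cutoff.
by move=> t ht; rewrite cutoffE // hc.
Qed.

Lemma cmeasurable_realC (p : R -> R) : continuous p -> cmeasurable ((fun t => (p t)%:C) : T -> R[i]).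
Proof. by move=> cp; split => /=; [exact: continuous_measurable_fun|exact: measurable_cst]. Qed.

Lemma sq_integrable_realC (p : R -> R) : continuous p ->
  sq_integrable io ((fun t => (p t)%:C) : T -> R[i]).
Proof.
move=> cp; have [c hc] := continuous_interval_bounded (continuous_realC (A := `[0, l]) cp).
exact: sq_integrable_interval (cmeasurable_realC cp) hc.
Qed.

(** Both integrals take the shape of inner products with a test function; the conjugations act on
    real numbers and only match this shape. *)
Lemma weak_derivativeP v g : {within `[0, l], continuous (v : R -> R[i]^o)} ->
  weak_derivative l v g <-> sq_integrable io g /\
  forall phi, test_function l phi ->
    cintegral io setT (fun t => cutoff v t * ((derive1 phi t)%:C)^*) =
    - cintegral io setT (fun t => g t * ((phi t)%:C)^*).
Proof.
move=> cv; have realJ (a : R) : Num.conj (a%:C : R[i]) = a%:C by apply/eqP; rewrite eq_complex /= oppr0 !eqxx.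
have key phi : sq_integrable io g -> test_function l phi ->
    cintegral (@lebesgue_measure R) `[0, l] (fun t => v t * (derive1 phi t)%:C) =
      cintegral io setT (fun t => cutoff v t * ((derive1 phi t)%:C)^*) /\
    cintegral (@lebesgue_measure R) `[0, l] (fun t => g t * (phi t)%:C) =
      cintegral io setT (fun t => g t * ((phi t)%:C)^*).
  move=> hg tphi; rewrite !cintegral_cutoff; split.
    congr cintegral; apply/funext => t; rewrite realJ /cutoff; case: ifP => // _.
    by rewrite mul0r.
  have cp := C1_continuous (test_function_C1 tphi).
  have mg : cmeasurable (fun t : T => g t * ((phi t)%:C)^*).
    by apply: cmeasurableM hg.1 _; apply: cmeasurableJ; exact: cmeasurable_realC.
  rewrite (_ : cutoff _ = fun t : T => cindic R `[0, l] t * (g t * ((phi t)%:C)^*)).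
    apply: cintegral_ae => //.
      by apply: cmeasurableM mg; apply: cmeasurable_indic; exact: measurable_itv.
    apply: ae_imply interval_ae _ => t ht.
    by rewrite /cindic indicE mem_set ?mul1r //= in_itv.
  apply/funext => t; rewrite /cutoff /cindic indicE mem_setE in_itv /= realJ.
  by case: ifP => _; rewrite ?mul1r ?mul0r.
split=> -[hg h]; split=> // phi tphi; have [k1 k2] := key phi hg tphi; have := h phi tphi.
  by rewrite k1 k2.
by rewrite -k1 -k2.
Qed.

End Interval.

Section IntegralBound.
Context d (T : measurableType d) (R : realType) (mu : {measure set T -> \bar R}).

(** The factor 2 comes from bounding the real and imaginary parts separately. *)
Lemma cmod_cintegral_le (f : T -> R[i]) (b : T -> R) : cintegrable mu f ->
  mu.-integrable setT (EFin \o b) -> (forall x, cmod (f x) <= b x) ->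
  cmod (cintegral mu setT f) <= 2 * (\int[mu]_(x in setT) b x)%R.
Proof.
move=> [fr fi] bi fb.
have bd (u : T -> R) : mu.-integrable setT (EFin \o u) -> (forall x, `|u x| <= b x) ->
    `|(\int[mu]_(x in setT) u x)%R| <= (\int[mu]_(x in setT) b x)%R.
  move=> ui ub; rewrite ler_norml; apply/andP; split.
    rewrite -mulN1r -RintegralZl //; apply: le_Rintegral => // [|x _].
      exact: (integrableZl measurableT (-1) bi).
    by have := ub x; rewrite ler_norml mulN1r => /andP[].
  by apply: le_Rintegral => // x _; exact: le_trans (ler_norm _) (ub x).
apply: le_trans (cmod_le_Re_Im _) _; rewrite mulrDl !mul1r; apply: lerD.
  by apply: bd => // x; exact: le_trans (normr_Re _) (fb x).
by apply: bd => // x; exact: le_trans (normr_Im _) (fb x).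
Qed.

End IntegralBound.

(** * Test functions: density, uniqueness of weak derivatives and limits *)

Section WeakDerivative.
Variables (R : realType) (l : R).
Hypothesis l0 : 0 < l.
Notation T := (measurableTypeR R).
Notation io := (interval_measure l).
Implicit Types (f g v w : R -> R[i]) (x y t h c : R).

Lemma conj_realC (a : R) : Num.conj (a%:C : R[i]) = a%:C.
Proof. by apply/eqP; rewrite eq_complex /= oppr0 !eqxx. Qed.

Lemma integrable_continuous (p : R -> R) : continuous p -> io.-integrable setT (EFin \o p).
Proof.
move=> cp; have [cr _] := cintegrableM (sq_integrable_realC l0 cp)
  (sq_integrable_realC l0 (fun x => cvg_cst (1 : R))).
rewrite (_ : EFin \o p = EFin \o (fun t => Re ((p t)%:C * Num.conj 1%:C))) //.
by apply/funext => t /=; rewrite mulr1 mul0r subr0.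
Qed.

Lemma weak_derivative_lincomb (c : R[i]) v g w k : {within `[0, l], continuous (v : R -> R[i]^o)} ->
  {within `[0, l], continuous (w : R -> R[i]^o)} ->
  weak_derivative l v g -> weak_derivative l w k ->
  weak_derivative l (fun t => c * v t + w t) (fun t => c * g t + k t).
Proof.
move=> cv cw /(weak_derivativeP _ cv) [hg ig] /(weak_derivativeP _ cw) [hk ik].
have cvw : {within `[0, l], continuous ((fun t => c * v t + w t) : R -> R[i]^o)}.
  exact: (within_continuousDZ (c := c) cv cw).
apply/(weak_derivativeP _ cvw); split.
  by apply: sq_integrableD => //; exact: sq_integrableZ.
move=> phi tphi; have cphi := test_function_C1 tphi.
have cp := C1_continuous cphi.
have key (u u' : T -> R[i]) (p : R -> R) : continuous p -> sq_integrable io u -> sq_integrable io u' ->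
    cintegral io setT (fun t => (c * u t + u' t) * Num.conj (p t)%:C) =
    c * cintegral io setT (fun t => u t * Num.conj (p t)%:C) +
    cintegral io setT (fun t => u' t * Num.conj (p t)%:C).
  move=> cq hu hu'; rewrite -cintegralDZ.
  - by congr cintegral; apply/funext => t; rewrite mulrDl mulrA.
  - exact: cintegrableM hu (sq_integrable_realC l0 cq).
  - exact: cintegrableM hu' (sq_integrable_realC l0 cq).
have cutDZ : cutoff l (fun t => c * v t + w t) = fun t => c * cutoff l v t + cutoff l w t.
  by apply/funext => t; rewrite /cutoff; case: ifP; rewrite ?mulr0 ?addr0.
rewrite cutDZ !key //; try exact: sq_integrable_cutoff; last by case: cphi.
by rewrite ig // ik // opprD mulrN.
Qed.

(** The two functions differ by at most 1, and only in two bands of width 2 h at the ends. J may be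
    an interval with or without its end points. *)
Lemma plateau_indic x y h (J : set T) : 0 < h -> x + 2 * h <= y - 2 * h -> measurable J ->
  (forall t, 0 <= t <= l -> (x < t < y -> J t) /\ (J t -> x <= t <= y)) ->
  (sqn io (fun t => cindic R J t - (plateau x y h t)%:C)%R <= (4 * h)%:E)%E.
Proof.
move=> h0 xy mJ hJ; have mp := cmeasurable_realC (C1_continuous (C1_plateau x y h)).
have mb (a b : R) : measurable (`[a, b] : set T) by exact: measurable_itv.
have ib (a : R) : (\int[io]_t (\1_(`[a, a + 2 * h] : set T) t)%:E <= (2 * h)%:E)%E.
  rewrite integral_indic // setIT interval_measureE.
  apply: (@le_trans _ _ (@lebesgue_measure R `[a, a + 2 * h])).
    by apply: le_measure; rewrite ?inE //; exact: measurableI.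
  by rewrite lebesgue_measure_itv /= lte_fin ltrDl mulr_gt0 // -EFinB addrAC subrr add0r.
pose b t := \1_(`[x, x + 2 * h] : set T) t + \1_(`[y - 2 * h, y - 2 * h + 2 * h] : set T) t : R.
apply: (@le_trans _ _ (\int[io]_t (b t)%:E)%E).
  apply: sqn_le_integral.
  - by apply: cmeasurableB => //; exact: cmeasurable_indic.
  - by apply: measurable_funD; exact: measurable_indic.
  - by move=> t; rewrite addr_ge0.
  apply: ae_imply (interval_ae l) _ => t ht; rewrite /cindic -rmorphB cmod2_real.
  have [h1 h2] := hJ t ht; rewrite /b subrK.
  have /andP[p0 p1] := plateau01 h0 t xy.
  have bin a c : a <= t <= c -> \1_(`[a, c] : set T) t = 1 :> R.
    by move=> ac; rewrite indicE mem_set //= in_itv.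
  have J01 : 0 <= (\1_J t : R) <= 1 by rewrite indicE; case: (_ \in _); rewrite ?ler01 ?lexx.
  have sq1 : (\1_J t - plateau x y h t) ^+ 2 <= 1.
    by move/andP: J01 => [j0 j1]; rewrite expr2; nra.
  have n0 (A : set T) : 0 <= \1_A t :> R by [].
  have [tx|tx] := leP t (x + 2 * h); have [xt|xt] := leP x t.
  - by rewrite bin ?xt ?tx //; apply: le_trans sq1 _; rewrite lerDl.
  - have nJ : ~ J t by move=> /h2; rewrite leNgt xt.
    by rewrite [\1_J t]indicE memNset // plateau_left ?subrr ?expr0n ?addr_ge0 //; lra.
  - have [ty|ty] := leP t y; have [yt|yt] := leP (y - 2 * h) t.
    + by rewrite [X in _ <= _ + X]bin ?ty ?yt //; apply: le_trans sq1 _; rewrite lerDr.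
    + have Jt : J t by apply: h1; apply/andP; split; lra.
      rewrite [\1_J t]indicE mem_set // plateau_mid ?subrr ?expr0n ?addr_ge0 //.
      by rewrite (ltW tx) (ltW yt).
    + have nJ : ~ J t by move=> /h2; rewrite [t <= y]leNgt ty andbF.
      by rewrite [\1_J t]indicE memNset // plateau_right ?subrr ?expr0n ?addr_ge0 //; lra.
    + by exfalso; lra.
  - by exfalso; lra.
rewrite /b; under eq_integral do rewrite EFinD.
rewrite ge0_integralD //; last 2 first.
- by apply/measurable_EFinP; exact: measurable_indic.
- by apply/measurable_EFinP; exact: measurable_indic.
by rewrite (_ : 4 * h = 2 * h + 2 * h) ?EFinD ?leeD //; ring.
Qed.

Let P : set (T -> R[i]) := [set f | test_function l (fun t => Re (f t)) /\
  test_function l (fun t => Im (f t))].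

Lemma test_function_lincomb c c' (p q : R -> R) : test_function l p -> test_function l q ->
  test_function l (fun t => c * p t + c' * q t).
Proof.
move=> tp tq; have k := C1_lincomb c c' (test_function_C1 tp) (test_function_C1 tq).
split; first by move=> x; exact: (@ex_derive _ _ _ _ _ _ _ (k.1 x)).
  by rewrite (C1_derive1 k); case: k.
have [_ _ [a [b [a0 bl out]]]] := tp; have [_ _ [a' [b' [a0' bl' out']]]] := tq.
exists (Num.min a a'), (Num.max b b'); split.
- by rewrite lt_min a0.
- by rewrite gt_max bl.
- move=> x; rewrite in_itv /= negb_and -!ltNge lt_min gt_max => h.
  rewrite out ?out' ?mulr0 ?addr0 // in_itv /= negb_and -!ltNge.
    by move/orP: h => [/andP[_ ->]|/andP[_ ->]]; rewrite ?orbT.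
  by move/orP: h => [/andP[-> _]|/andP[-> _]]; rewrite ?orbT.
Qed.

Lemma test_function0 : test_function l (fun=> 0).
Proof.
have c0 : C1 (fun=> 0 : R) (fun=> 0).
  by split=> x; [exact: is_derive_cst|exact: cvg_cst].
split; first by move=> x; exact: (@ex_derive _ _ _ _ _ _ _ (c0.1 x)).
  by rewrite (C1_derive1 c0); case: c0.
by exists (l / 2), (l / 2); split=> //; [rewrite divr_gt0|rewrite ltr_pdivrMr // ltr_pMr // ltr1n].
Qed.

Lemma test_function_real (p : R -> R) : test_function l p -> P (fun t => (p t)%:C).
Proof. by move=> tp; split => //=; exact: test_function0. Qed.

Lemma test_function_measurable f : P f -> cmeasurable (f : T -> R[i]).
Proof.
by move=> [tr ti]; split; apply: continuous_measurable_fun;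
  [exact: C1_continuous (test_function_C1 tr)|exact: C1_continuous (test_function_C1 ti)].
Qed.

Lemma complex_test_function0 : P (fun=> 0).
Proof. by split; exact: test_function0. Qed.

Lemma complex_test_functionDZ (c : R[i]) f g : P f -> P g -> P (fun t => c * f t + g t).
Proof.
move=> [fr fi] [gr gi]; split.
  have := test_function_lincomb 1 1 (test_function_lincomb (Re c) (- Im c) fr fi) gr.
  congr test_function; apply/funext => t; rewrite !mul1r; case: c (f t) (g t) => ? ? [? ?] [? ?] /=.
  by rewrite mulNr.
have := test_function_lincomb 1 1 (test_function_lincomb (Im c) (Re c) fr fi) gi.
congr test_function; apply/funext => t; rewrite !mul1r; case: c (f t) (g t) => ? ? [? ?] [? ?] /=.
by ring.
Qed.

Let Pm := test_function_measurable.
Let P0 := complex_test_function0.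
Let PDZ := complex_test_functionDZ.

Let approximable_interval x y (J : set T) : 0 <= x -> x < y -> y <= l -> measurable J ->
  (forall t, 0 <= t <= l -> (x < t < y -> J t) /\ (J t -> x <= t <= y)) ->
  approximable io P (cindic R J).
Proof.
move=> x0 xy yl mJ hJ; split=> [|e e0]; first exact: cmeasurable_indic.
pose h := Num.min (e / 8) ((y - x) / 4).
have h0 : 0 < h by rewrite lt_min !divr_gt0 ?subr_gt0.
have he : h <= e / 8 by rewrite ge_min lexx.
have hxy : h <= (y - x) / 4 by rewrite ge_min lexx orbT.
have hh : x + 2 * h <= y - 2 * h by lra.
exists (fun t => (plateau x y h t)%:C).
  by apply: test_function_real; exact: plateau_test.
by apply: le_lt_trans (plateau_indic h0 hh mJ hJ) _; rewrite lte_fin; lra.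
Qed.

(** Open intervals are a generating family closed under intersection; clipped to the edge, their
    indicators are approximated by plateaus. *)
Lemma test_functions_dense f : sq_integrable io (f : T -> R[i]) -> approximable io P f.
Proof.
suff ap (A : set T) : measurable A -> approximable io P (cindic R A).
  by move=> hf; exact: (@approximable_all _ T R io P Pm P0 PDZ ap f hf).
move: A; have GE : @measurable _ T = <<s @RGenOpens.G R >> by exact: RGenOpens.measurableE.
apply: (approximable_measurable (interval_fin l0) Pm P0 PDZ GE).
- move=> A B [a [b ->]] [a' [b' ->]]; exists (Num.max a a'), (Num.min b b').
  apply/seteqP; split=> t /=; rewrite !in_itv /= gt_max lt_min.
    by move=> [/andP[-> ->] /andP[-> ->]].
  by move=> /andP[/andP[-> ->] /andP[-> ->]].
- exact: (@approximable_interval 0 l).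
move=> _ [a [b ->]]; have mI : measurable (`]a, b[ : set T) by exact: measurable_itv.
have [xy|yx] := ltP (Num.max a 0) (Num.min b l).
  apply: (@approximable_interval (Num.max a 0) (Num.min b l)) => //.
  - by rewrite le_max lexx orbT.
  - by rewrite ge_min lexx orbT.
  move=> t /andP[t0 tl] /=; rewrite in_itv /= gt_max lt_min ge_max le_min t0 tl.
  split; first by move=> /andP[/andP[-> _] /andP[-> _]].
  by move=> /andP[at_ tb]; rewrite (ltW at_) (ltW tb).
apply: (approximable_ae (f := fun=> 0)) => //.
- exact: cmeasurable_indic.
- apply: ae_imply (interval_ae l) _ => t /andP[t0 tl]; rewrite /cindic indicE memNset //.
  rewrite /= in_itv /= => /andP[at_ tb]; have ll := l0; move: yx; rewrite le_max !ge_min; lra.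
- exact: approximable0.
Qed.

(** The difference of the derivatives is orthogonal to all test functions, which are dense. *)
Lemma weak_derivative_unique v w g k : {within `[0, l], continuous (v : R -> R[i]^o)} ->
  {within `[0, l], continuous (w : R -> R[i]^o)} ->
  {ae io, forall t, v t = w t} ->
  weak_derivative l v g -> weak_derivative l w k -> {ae io, forall t, g t = k t}.
Proof.
move=> cv cw vw /(weak_derivativeP _ cv) [hg ig] /(weak_derivativeP _ cw) [hk ik].
have cut phi : test_function l phi ->
    cintegral io setT (fun t => cutoff l v t * Num.conj (derive1 phi t)%:C) =
    cintegral io setT (fun t => cutoff l w t * Num.conj (derive1 phi t)%:C).
  move=> tphi; have mp : cmeasurable (fun t : T => Num.conj (derive1 phi t)%:C).
    by apply: cmeasurableJ; apply: cmeasurable_realC; case: (test_function_C1 tphi).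
  apply: cintegral_ae; try by apply: cmeasurableM mp; exact: cmeasurable_cutoff.
  by apply: ae_imply vw _ => t e; rewrite /cutoff e.
have orth phi : test_function l phi ->
    cintegral io setT (fun t => (g t - k t) * Num.conj (phi t)%:C) = 0.
  move=> tphi; have cp := C1_continuous (test_function_C1 tphi).
  rewrite (_ : (fun t => _) = fun t => g t * Num.conj (phi t)%:C - k t * Num.conj (phi t)%:C).
    rewrite cintegralB.
    - by have := ig phi tphi; rewrite cut // ik // => /oppr_inj ->; rewrite subrr.
    - exact: cintegrableM hg (sq_integrable_realC l0 cp).
    - exact: cintegrableM hk (sq_integrable_realC l0 cp).
  by apply/funext => t; rewrite mulrBl.
have hd := sq_integrableB hg hk; set q := (fun t => g t - k t) in hd orth.
pose Q : L2space io := L2mk hd.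
(* The defining identity concerns real test functions; complex ones are split, and the conjugate
   yields the factor -i. *)
have orthP f : P f -> sq_integrable io f -> cintegral io setT (fun t => q t * Num.conj (f t)) = 0.
  move=> [tr ti] hf.
  have cr := C1_continuous (test_function_C1 tr); have ci := C1_continuous (test_function_C1 ti).
  have hr := cintegrableM hd (sq_integrable_realC l0 cr).
  have hi := cintegrableM hd (sq_integrable_realC l0 ci).
  rewrite (_ : (fun t => _) = fun t => (- 'i%C) * (q t * Num.conj (Im (f t))%:C) +
      q t * Num.conj (Re (f t))%:C).
    by rewrite cintegralDZ // !orth // mulr0 addr0.
  apply/funext => t; rewrite !conj_realC; case: (f t) (q t) => a b [a' b'].
  rewrite -[Num.conj (a +i* b)]/(a +i* - b).
  by apply/eqP; rewrite eq_complex /=; apply/andP; split; apply/eqP; ring.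
suff Q0 : Q = 0.
  have : {ae io, forall t, q t = 0}.
    have e1 := L2mkE hd; have e2 := L2zeroE io; rewrite -/(L2mk hd) in e1.
    move: (L2P (Q : L2 io) 0) => [h _]; have e3 := h Q0.
    apply: ae_imply2 (ae_imply2 e1 e2 (fun t => @conj _ _)) e3 _ => t [/= <- z0] ->.
    exact: z0.
  by move=> h; apply: ae_imply h _ => t /eqP; rewrite subr_eq0 => /eqP.
(* For F orthogonal to Q the square of the norm of Q is at most that of Q - F, which density makes
   arbitrarily small. *)
have n0 : hnorm Q = 0.
  apply/eqP; rewrite eq_le hnorm_ge0 andbT; apply/ler_addgt0Pr => e e0; rewrite add0r.
  have [_ ap] := test_functions_dense hd; have [f Pf hf] := ap _ (exprn_gt0 2 e0).
  have sf : sq_integrable io f.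
    have [tr ti] := Pf; have cf : {within `[0, l], continuous (f : R -> R[i]^o)}.
      rewrite (_ : f = fun t => 'i%C * (Im (f t))%:C + (Re (f t))%:C).
        by apply: within_continuousDZ; apply: continuous_realC;
          [exact: C1_continuous (test_function_C1 ti)|exact: C1_continuous (test_function_C1 tr)].
      by apply/funext => t; case: (f t) => a b; simpc.
    apply: cintegrable_ae (sq_integrable_cutoff l0 cf) (Pm Pf) (cutoff_ae l f).
  pose F : L2space io := L2mk sf.
  have QF : ip Q F = 0 by rewrite (ip_cintegral hd.1 sf.1 (L2mkE hd) (L2mkE sf)) orthP.
  have FQ : ip F Q = 0 by rewrite (ipC Q F) QF conjc0.
  have lt : hnorm (Q - F) < e.
    by rewrite -hnorm_lt // (hnormB_sqn hd.1 sf.1 (L2mkE hd) (L2mkE sf)).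
  apply: le_trans (ltW lt); rewrite -ler_sqr ?nnegrE ?hnorm_ge0 // !hnorm_sqr.
  have -> : ip (Q - F) (Q - F) = ip Q Q + ip F F.
    rewrite ipBl -scaleN1r !ipDr !ipZr QF FQ rmorphN1; ring.
  by rewrite ReD lerDl Re_ip_ge0.
apply: ip_eq0; have h1 := hnorm_sqr Q; rewrite n0 expr2 mul0r in h1.
have := ip_ge0 Q; rewrite lecE => /andP[/eqP h2 _].
by apply/eqP; rewrite eq_complex -h1 h2 !eqxx.
Qed.

Lemma weak_derivative_C1 (p p' q q' : R -> R) : C1 p p' -> C1 q q' ->
  weak_derivative l (fun t => p t +i* q t) (fun t => p' t +i* q' t).
Proof.
move=> cp cq; split.
  rewrite (_ : (fun t => _) = fun t => 'i%C * (q' t)%:C + (p' t)%:C).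
    apply: sq_integrableD; last exact: (sq_integrable_realC l0 cp.2).
    by apply: sq_integrableZ; exact: (sq_integrable_realC l0 cq.2).
  by apply/funext => t; simpc.
move=> phi tphi; rewrite /cintegral.
transitivity ((\int[@lebesgue_measure R]_(t in `[0%R, l]) (p t * derive1 phi t))%R +i*
   (\int[@lebesgue_measure R]_(t in `[0%R, l]) (q t * derive1 phi t))%R).
  congr (_ +i* _); apply: eq_Rintegral => t _ /=; ring.
rewrite (C1_by_parts l0 cp tphi) (C1_by_parts l0 cq tphi) -[- (_ +i* _)]/(- _ +i* - _).
congr (- _ +i* - _); apply: eq_Rintegral => t _ /=; ring.
Qed.

(** Against a fixed test function both sides of the defining identity are continuous in v and g, by
    Cauchy-Schwarz. *)
Lemma weak_derivative_limit (v_ g_ : nat -> R -> R[i]) v g :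
  (forall n, {within `[0, l], continuous (v_ n : R -> R[i]^o)}) ->
  {within `[0, l], continuous (v : R -> R[i]^o)} ->
  (forall n, weak_derivative l (v_ n) (g_ n)) -> sq_integrable io g ->
  (forall e : R, 0 < e -> exists n, (forall t, 0 <= t <= l -> cmod2 (v_ n t - v t) <= e) /\
     (sqn io (fun t => g_ n t - g t)%R <= e%:E)%E) ->
  weak_derivative l v g.
Proof.
move=> cv_ cv wd hg lim; apply/(weak_derivativeP _ cv); split=> // phi tphi.
have cphi := test_function_C1 tphi.
have cp := C1_continuous cphi; have cp' := cphi.2.
have hp := sq_integrable_realC l0 cp; have hp' := sq_integrable_realC l0 cp'.
have [a a0 aE] := sqn_fin hp; have [b b0 bE] := sqn_fin hp'.
set X := cintegral _ _ _; set Y := cintegral _ _ _.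
apply/eqP; rewrite -subr_eq0 opprK; apply/eqP/cmod_eq0/eqP.
rewrite -sqrf_eq0 cmod_sqr eq_le cmod2_ge0 andbT.
apply/ler_addgt0Pr => e e0; rewrite add0r.
have M0 : 0 < 2 * (l * b + a) + 1 by rewrite ltr_wpDl // mulr_ge0 // addr_ge0 // mulr_ge0 // ltW.
have [n [hv hgn]] := lim _ (divr_gt0 e0 M0); set e' := e / _ in hv hgn.
have e'0 : 0 < e' by exact: divr_gt0.
have /(weak_derivativeP _ (cv_ n)) [hgn' /(_ phi tphi) idn] := wd n.
have hcv := sq_integrable_cutoff l0 cv; have hcvn := sq_integrable_cutoff l0 (cv_ n).
have Xn : cintegral io setT (fun t => (cutoff l (v_ n) t - cutoff l v t) * Num.conj (derive1 phi t)%:C)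
    = cintegral io setT (fun t => cutoff l (v_ n) t * Num.conj (derive1 phi t)%:C) - X.
  rewrite -cintegralB; try exact: cintegrableM.
  by congr cintegral; apply/funext => t; rewrite mulrBl.
have Yn : cintegral io setT (fun t => (g_ n t - g t) * Num.conj (phi t)%:C)
    = cintegral io setT (fun t => g_ n t * Num.conj (phi t)%:C) - Y.
  rewrite -cintegralB; try exact: cintegrableM.
  by congr cintegral; apply/funext => t; rewrite mulrBl.
rewrite idn in Xn.
have -> : X + Y = (-1) * cintegral io setT (fun t => (cutoff l (v_ n) t - cutoff l v t) * Num.conj (derive1 phi t)%:C)
   + (-1) * cintegral io setT (fun t => (g_ n t - g t) * Num.conj (phi t)%:C).
  by rewrite Xn Yn; ring.
apply: le_trans (cmod2D_le _ _) _; rewrite !cmod2M.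
have m1 : cmod2 (-1 : R[i]) = 1 by rewrite /cmod2 /= oppr0 expr0n addr0 sqrrN expr1n.
rewrite m1 !mul1r.
have h1 := sq_integrableB hcvn hcv; have h2 := sq_integrableB hgn' hg.
have [c1 c10 c1E] := sqn_fin h1; have [c2 c20 c2E] := sqn_fin h2.
have k1 : c1 <= e' * l.
  rewrite -lee_fin -c1E; apply: sqn_interval_le => //; first exact: h1.1.
    exact: ltW.
  by move=> t ht; rewrite !cutoffE //; exact: hv.
have k2 : c2 <= e' by rewrite -lee_fin -c2E.
have b1 := cintegral_cauchy_schwarz h1 hp' c1E bE.
have b2 := cintegral_cauchy_schwarz h2 hp c2E aE.
have b1' : c1 * b <= e' * l * b by rewrite ler_wpM2r.
have b2' : c2 * a <= e' * a by rewrite ler_wpM2r.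
have eE : e = e' * (2 * (l * b + a) + 1) by rewrite /e' mulfVK // lt0r_neq0.
have : 2 * (e' * l * b) + 2 * (e' * a) + e' = e by rewrite eE; ring.
lra.
Qed.

Lemma integral_slope x h : 0 < h -> 0 <= x -> x + h <= l ->
  (\int[io]_(t in setT) (h^-1 * tent ((t - x) / h)))%R = 1.
Proof.
move=> h0 x0 xl.
have ar t : h^-1 * t + - x / h = (t - x) / h by field; rewrite lt0r_neq0.
have c := C1_step_affine h^-1 (- x / h).
have := @continuous_FTC2 R (fun t => h^-1 * tent (h^-1 * t + - x / h))
  (fun t => smooth_step (h^-1 * t + - x / h)) 0 l l0.
have lr : derivable_oo_LRcontinuous (fun t => smooth_step (h^-1 * t + - x / h)) 0 l.
  split=> [y _||]; first exact: (@ex_derive _ _ _ _ _ _ _ (c.1 y)).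
    by apply: cvg_at_right_filter; exact: C1_continuous c _.
  by apply: cvg_at_left_filter; exact: C1_continuous c _.
have c1 : {within `[0, l], continuous (fun t => h^-1 * tent (h^-1 * t + - x / h))}.
  exact/continuous_subspaceT/c.2.
have dE : {in `]0, l[, (fun t => smooth_step (h^-1 * t + - x / h))^`()%classic =1
    (fun t => h^-1 * tent (h^-1 * t + - x / h))}.
  by move=> y _; rewrite (C1_derive1 c).
move=> /(_ c1 lr dE); rewrite !ar smooth_step1; last by rewrite ler_pdivlMr // mul1r; lra.
rewrite smooth_step0; last by rewrite ler_pdivrMr // mul0r; lra.
rewrite sube0 => I1.
have : (\int[@lebesgue_measure R]_(t in `[0%R, l]) (h^-1 * tent (h^-1 * t + - x / h)))%R = 1.
  by rewrite /Rintegral I1.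
rewrite Rintegral_cutoff => <-; congr fine; apply: ae_eq_integral => //.
- by apply/measurable_EFinP; under eq_fun do rewrite -ar; exact: continuous_measurable_fun c.2.
- have mc : measurable_fun setT (fun t : T => h^-1 * tent (h^-1 * t + - x / h)).
    exact: continuous_measurable_fun c.2.
  rewrite (_ : (fun t : T => _) = EFin \o ((fun t => h^-1 * tent (h^-1 * t + - x / h)) \_ `[0, l])).
    apply/measurable_EFinP/(measurable_restrictT _ (measurable_itv _)).
    exact: measurable_funS mc.
  by apply/funext => t; rewrite /= patchE mem_setE in_itv.
- by apply: ae_imply (interval_ae l) _ => t ht _; rewrite ht ar.
Qed.

End WeakDerivative.

(** * The fundamental theorem of calculus for weak derivatives *)

Section FundamentalTheorem.
Variables (R : realType) (l : R).
Hypothesis l0 : 0 < l.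
Notation T := (measurableTypeR R).
Notation io := (interval_measure l).
Implicit Types (f g v w : R -> R[i]) (x y t h : R).

(** The rescaled tent is a mollifier of mass 1 supported in [x, x + h], so its average of v is as
    close to z as v is there, up to the factor 2 of [cmod_cintegral_le]. *)
Lemma slope_average v x h (z : R[i]) (w : R) : {within `[0, l], continuous (v : R -> R[i]^o)} ->
  0 < h -> 0 <= x -> x + h <= l -> 0 <= w ->
  (forall t, x <= t <= x + h -> cmod (v t - z) <= w) ->
  cmod (cintegral io setT (fun t => cutoff l v t * Num.conj (h^-1 * tent ((t - x) / h))%:C) - z)
    <= 2 * w.
Proof.
move=> cv h0 x0 xl w0 vz; set p := fun t => h^-1 * tent ((t - x) / h).
have cp : continuous p.
  rewrite /p (_ : (fun t => _) = fun t => h^-1 * tent (h^-1 * t + - x / h)).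
    by case: (C1_step_affine h^-1 (- x / h)).
  by apply/funext => t; congr (_ * tent _); field; rewrite lt0r_neq0.
have p0 t : 0 <= p t by rewrite mulr_ge0 ?invr_ge0 ?(ltW h0) ?tent_ge0.
have hp := sq_integrable_realC l0 cp; have hcv := sq_integrable_cutoff l0 cv.
have h1 := sq_integrable_realC l0 (@cst_continuous _ _ (1 : R)).
have ip1 : (\int[io]_(t in setT) p t)%R = 1 by exact: integral_slope.
have cp1 : cintegral io setT (fun t => 1%:C * Num.conj (p t)%:C) = 1.
  rewrite /cintegral; apply/eqP; rewrite eq_complex /=; apply/andP; split; apply/eqP.
    by rewrite -[RHS]ip1; apply: eq_Rintegral => t _ /=; rewrite mul1r mul0r subr0.
  transitivity (\int[io]_(t in setT) (0 : R))%R; last by rewrite Rintegral_cst // mul0r.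
  by apply: eq_Rintegral => t _ /=; rewrite mul0r oppr0 mulr0 addr0.
have -> : cintegral io setT (fun t => cutoff l v t * Num.conj (p t)%:C) - z =
    cintegral io setT (fun t => (cutoff l v t - z) * Num.conj (p t)%:C).
  rewrite (_ : (fun t => (cutoff l v t - z) * _) = fun t =>
    (- z) * (1%:C * Num.conj (p t)%:C) + cutoff l v t * Num.conj (p t)%:C).
    rewrite cintegralDZ; [by rewrite cp1 mulr1 addrC|exact: cintegrableM|exact: cintegrableM].
  by apply/funext => t; rewrite mulrBl mul1r mulNr addrC.
have ip_ := integrable_continuous l0 cp.
have bd := @cmod_cintegral_le _ T R io (fun t => (cutoff l v t - z) * Num.conj (p t)%:C)
  (fun t => w * p t).
apply: le_trans (bd _ _ _) _.
- apply: cintegrableM hp; apply: sq_integrableB => //.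
  have := sq_integrableZ z h1; congr sq_integrable; apply/funext => t.
  by rewrite mulr1.
- exact: (integrableZl measurableT w ip_).
- move=> t; rewrite conj_realC cmodM cmod_real ger0_norm ?p0 //.
  have [ht|nt] := boolP (x <= t <= x + h).
    rewrite ler_wpM2r // cutoffE ?vz //; move: ht; lra.
  rewrite /p tent_out ?mulr0 // ler_pdivrMr // ler_pdivlMr // mul0r mul1r.
  by move: nt; rewrite negb_and -!ltNge => /orP[]; [left|right]; lra.
by rewrite RintegralZl // ip1 mulr1.
Qed.

(** The identity is tested with a plateau on [x, y]. Its derivative is a mollifier near x minus one
    near y, which evaluates v at the end points, and the plateau itself is close to the indicator in
    L2. *)
Lemma weak_derivative_ftc v g x y : {within `[0, l], continuous (v : R -> R[i]^o)} ->
  weak_derivative l v g -> 0 <= x -> x < y -> y <= l ->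
  v y - v x = cintegral io setT (fun t => g t * Num.conj (cindic R (`[x, y] : set T) t)).
Proof.
move=> cv wd x0 xy yl; have /(weak_derivativeP _ cv) [hg idg] := wd.
have mJ : measurable (`[x, y] : set T) by exact: measurable_itv.
have hJ : sq_integrable io (cindic R (`[x, y] : set T)).
  apply: (@sq_integrable_interval _ _ l0 _ 1); first exact: cmeasurable_indic.
  by move=> t _; rewrite cmod2_real indicE; case: (_ \in _); rewrite ?expr1n ?expr0n.
have [a a0 aE] := sqn_fin hg.
set I := cintegral _ _ _.
suff small (e : R) : 0 < e -> cmod (v y - v x - I) <= e.
  apply/eqP; rewrite -subr_eq0; apply/eqP/cmod_eq0/eqP.
  by rewrite eq_le cmod_ge0 andbT; apply/ler_addgt0Pr => e e0; rewrite add0r small.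
move=> e0.
have e8 : 0 < e / 8 by rewrite divr_gt0.
have /within_continuousP cv' := cv.
have Ix : `[0, l]%classic x by rewrite /= in_itv /= x0 (le_trans (ltW xy)).
have Iy : `[0, l]%classic y by rewrite /= in_itv /= yl (le_trans x0 (ltW xy)).
have /nbhs_ballP [d1 /= d10 hd1] := cv' x Ix _ e8.
have /nbhs_ballP [d2 /= d20 hd2] := cv' y Iy _ e8.
(* The first two bounds keep the supports of the mollifiers where v is within e / 8 of its end
   values, the third leaves room for the plateau, and the last makes a * (4 h) <= (e / 4)^2 in
   Cauchy-Schwarz. *)
pose h := Num.min (Num.min (d1 / 4) (d2 / 4)) (Num.min ((y - x) / 4) ((e / 4) ^+ 2 / (4 * (a + 1)))).
have a1 : 0 < a + 1 by rewrite ltr_wpDl.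
have h0 : 0 < h by rewrite !lt_min !divr_gt0 ?subr_gt0 ?exprn_gt0 ?mulr_gt0 ?divr_gt0.
have hh1 : h <= d1 / 4 by rewrite !ge_min lexx.
have hh2 : h <= d2 / 4 by rewrite !ge_min lexx ?orbT.
have hh3 : h <= (y - x) / 4 by rewrite !ge_min lexx ?orbT.
have hh4 : h <= (e / 4) ^+ 2 / (4 * (a + 1)) by rewrite !ge_min lexx ?orbT.
have xyh : x + 2 * h <= y - 2 * h by lra.
have tphi := plateau_test h0 x0 yl xyh.
have cpl := C1_plateau x y h.
have hp := sq_integrable_realC l0 (C1_continuous cpl).
have hcv := sq_integrable_cutoff l0 cv.
have B1 := @slope_average v (x + h) h (v x) (e / 8) cv h0 _ _ (ltW e8) _.
have B2 := @slope_average v (y - 2 * h) h (v y) (e / 8) cv h0 _ _ (ltW e8) _.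
have {}B1 : cmod (cintegral io setT (fun t => cutoff l v t *
    Num.conj (h^-1 * tent ((t - (x + h)) / h))%:C) - v x) <= 2 * (e / 8).
  apply: B1; [lra|lra|move=> t /andP[t1 t2]; rewrite cmodB; apply/ltW/hd1].
    by rewrite -ball_normE /= ler0_norm; lra.
  by rewrite /= in_itv /=; apply/andP; split; lra.
have {}B2 : cmod (cintegral io setT (fun t => cutoff l v t *
    Num.conj (h^-1 * tent ((t - (y - 2 * h)) / h))%:C) - v y) <= 2 * (e / 8).
  apply: B2; [lra|lra|move=> t /andP[t1 t2]; rewrite cmodB; apply/ltW/hd2].
    by rewrite -ball_normE /= ger0_norm; lra.
  by rewrite /= in_itv /=; apply/andP; split; lra.
have dE t : derive1 (plateau x y h) t = h^-1 * tent ((t - (x + h)) / h) - h^-1 * tent ((t - (y - 2 * h)) / h).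
  rewrite (C1_derive1 cpl) /plateau'; congr (_ * tent _ - _ * tent _); field; exact: lt0r_neq0.
have cp1 c : continuous (fun t => h^-1 * tent ((t - c) / h)).
  rewrite (_ : (fun t => _) = fun t => h^-1 * tent (h^-1 * t + - c / h)).
    by case: (C1_step_affine h^-1 (- c / h)).
  by apply/funext => t; congr (_ * tent _); field; rewrite lt0r_neq0.
have := idg _ tphi.
set G := cintegral io setT (fun t => g t * Num.conj (plateau x y h t)%:C) => idG.
move: B1 B2; set A1 := cintegral _ _ _; set A2 := cintegral _ _ _ => B1 B2.
have A12 : A1 - A2 = - G.
  rewrite -idG -cintegralB; try exact: (cintegrableM hcv (sq_integrable_realC l0 (cp1 _))).
  by congr cintegral; apply/funext => t; rewrite dE rmorphB /= rmorphB mulrBr.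
have GI : cmod (I - G) <= e / 4.
  have -> : I - G = cintegral io setT (fun t => g t *
      Num.conj (cindic R (`[x, y] : set T) t - (plateau x y h t)%:C)).
    rewrite -cintegralB; try exact: cintegrableM.
    by congr cintegral; apply/funext => t; rewrite -mulrBr -rmorphB.
  have hd := sq_integrableB hJ hp; have [b b0 bE] := sqn_fin hd.
  have bh : b <= 4 * h.
    rewrite -lee_fin -bE; apply: plateau_indic => // t _; rewrite /= in_itv /=; split=> //.
    by move=> /andP[/ltW -> /ltW ->].
  have e4 : 0 < e / 4 by rewrite divr_gt0.
  rewrite -ler_sqr ?nnegrE ?cmod_ge0 ?(ltW e4) // cmod_sqr.
  apply: le_trans (cintegral_cauchy_schwarz hg hd aE bE) _.
  have k : h * (4 * (a + 1)) <= (e / 4) ^+ 2.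
    by move: hh4; rewrite ler_pdivlMr // mulr_gt0.
  have k1 : a * b <= a * (4 * h) by rewrite ler_wpM2l.
  have : h * (4 * (a + 1)) = a * (4 * h) + 4 * h by ring.
  lra.
have -> : v y - v x - I = (v y - A2) + ((A1 - v x) + (G - I)).
  have -> : G = A2 - A1 by rewrite -[A2 - A1]opprB A12 opprK.
  ring.
apply: le_trans (cmodD _ _) _; rewrite (cmodB (v y)).
have := cmodD (A1 - v x) (G - I); rewrite (cmodB G); lra.
Qed.

(** Cauchy-Schwarz for g against the indicator of [x, y], whose squared norm is at most l. *)
Lemma weak_derivative_osc v g (a : R) x y : {within `[0, l], continuous (v : R -> R[i]^o)} ->
  weak_derivative l v g -> sqn io (g : T -> R[i]) = a%:E -> 0 <= x <= l -> 0 <= y <= l ->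
  cmod2 (v y - v x) <= l * a.
Proof.
move=> cv wd aE; have [hg _] := wd; have [b b0 bE] := sqn_fin hg.
have a0 : 0 <= a by have := sqn_ge0 io (g : T -> R[i]); rewrite aE lee_fin.
wlog xy : x y / x <= y.
  move=> W hx hy; have [xy|/ltW yx] := leP x y; first exact: W.
  by rewrite -cmod_sqr cmodB cmod_sqr; exact: W.
move=> /andP[x0 xl] /andP[y0 yl]; move: xy; rewrite le_eqVlt => /orP[/eqP ->|xy].
  by rewrite subrr cmod2_0 mulr_ge0 // ltW.
rewrite (weak_derivative_ftc cv wd x0 xy yl).
have mJ : measurable (`[x, y] : set T) by exact: measurable_itv.
have J1 t : cmod2 (cindic R (`[x, y] : set T) t) <= 1.
  by rewrite cmod2_real indicE; case: (_ \in _); rewrite ?expr1n ?expr0n.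
have hJ : sq_integrable io (cindic R (`[x, y] : set T)).
  by apply: (@sq_integrable_interval _ _ l0 _ 1); first exact: cmeasurable_indic.
have [c c0 cE] := sqn_fin hJ; rewrite mulrC.
apply: le_trans (cintegral_cauchy_schwarz hg hJ aE cE) _.
rewrite ler_wpM2l // -lee_fin -cE -[l in leRHS]mul1r; apply: sqn_interval_le => //.
exact: cmeasurable_indic.
Qed.

Lemma weak_derivative_integral v g : {within `[0, l], continuous (v : R -> R[i]^o)} ->
  weak_derivative l v g -> cintegral io setT (g : T -> R[i]) = v l - v 0.
Proof.
move=> cv wd; have [hg _] := wd; rewrite (weak_derivative_ftc cv wd (lexx 0) l0 (lexx l)).
apply: cintegral_ae; first exact: hg.1.
  apply: cmeasurableM hg.1 _; apply: cmeasurableJ; apply: cmeasurable_indic; exact: measurable_itv.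
apply: ae_imply (interval_ae l) _ => t ht.
by rewrite /cindic conj_realC indicE mem_set /= ?in_itv // mulr1.
Qed.

(* The bound by the average over y in [0, l] of |v x|^2 <= 2 |v y|^2 + 2 |v x - v y|^2. *)
Lemma weak_derivative_sup v g (a b : R) x : {within `[0, l], continuous (v : R -> R[i]^o)} ->
  weak_derivative l v g -> sqn io (g : T -> R[i]) = a%:E -> sqn io (cutoff l v) = b%:E ->
  0 <= x <= l -> cmod2 (v x) <= 2 / l * b + 2 * l * a.
Proof.
move=> cv wd aE bE hx.
have hv := sq_integrable_cutoff l0 cv; have mv := measurable_cmod2E hv.1.
have a0 : 0 <= a by have := sqn_ge0 io (g : T -> R[i]); rewrite aE lee_fin.
have b0 : 0 <= b by have := sqn_ge0 io (cutoff l v); rewrite bE lee_fin.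
have la : 0 <= 2 * l * a by rewrite !mulr_ge0 // ltW.
have I : ((cmod2 (v x) * l)%:E <= (2 * b + 2 * l * a * l)%:E)%E.
  rewrite EFinM -(interval_measureT l0) -integral_cst //.
  rewrite [in leRHS]EFinD [X in (_ <= _ + X)%E]EFinM -(interval_measureT l0) -[X in (_ <= _ + X)%E]integral_cst //.
  rewrite EFinM -bE /sqn -ge0_integralZl_EFin //; last by move=> t _; rewrite lee_fin cmod2_ge0.
  rewrite -ge0_integralD //; last 2 first.
  - by move=> t _; rewrite -EFinM lee_fin mulr_ge0 ?cmod2_ge0.
  - exact: measurable_funeM.
  apply: ae_ge0_le_integral => //.
  - by move=> t _; rewrite lee_fin cmod2_ge0.
  - by move=> t _; rewrite adde_ge0 // -?EFinM lee_fin ?mulr_ge0 ?cmod2_ge0.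
  - by apply: emeasurable_funD => //; exact: measurable_funeM.
  apply: ae_imply (interval_ae l) _ => t ht _; rewrite -EFinM -EFinD lee_fin cutoffE //.
  rewrite -{1}(subrK (v t) (v x)) addrC; apply: le_trans (cmod2D_le _ _) _.
  by rewrite lerD2l -mulrA ler_wpM2l //; exact: weak_derivative_osc aE ht hx.
move: I; rewrite lee_fin -ler_pdivlMr // mulrDl mulfK ?lt0r_neq0 //.
by rewrite mulrAC.
Qed.

End FundamentalTheorem.

(** * The energy form of a metric graph *)

Section GraphMeasure.
Variables (R : realType) (V : Type) (M : metric_graph R V).
Notation T := (measurableTypeR R).
Notation T2 := (nat * T)%type.
Notation mm := (mg_measure M).
Notation len := (mg_len M).
Notation size := (mg_size M).
Notation io i := (interval_measure (len i)).
Implicit Types (f g : T2 -> R[i]) (i : nat).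

(** The edge index is discrete, so A is a countable union of measurable rectangles. *)
Lemma measurable_sections (A : set T2) :
  (forall i, measurable [set t : T | A (i, t)]) -> measurable A.
Proof.
move=> h; rewrite (_ : A = \bigcup_i ([set i] `*` [set t | A (i, t)])).
  by apply: bigcupT_measurable => i; exact: measurableX.
by apply/seteqP; split=> [[i t] At|[j t] [i _ [/= -> //]]]; exists i.
Qed.

Lemma measurable_pairl i : measurable_fun setT (fun t : T => (i, t)).
Proof. exact: measurable_fun_pair. Qed.

Lemma measurable_fun_sections (f : T2 -> R) :
  (forall i, measurable_fun setT (fun t : T => f (i, t))) -> measurable_fun setT f.
Proof.
move=> h _ B mB; rewrite setTI; apply: measurable_sections => i.
by have := h i measurableT B mB; rewrite setTI.
Qed.

Lemma cmeasurable_sections f : (forall i, cmeasurable (fun t : T => f (i, t))) -> cmeasurable f.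
Proof. by move=> h; split; apply: measurable_fun_sections => i; case: (h i). Qed.

Lemma cmeasurable_section f i : cmeasurable f -> cmeasurable (fun t : T => f (i, t)).
Proof. move=> [mr mi]; split; first exact: (measurableT_comp mr (measurable_pairl i)).
exact: (measurableT_comp mi (measurable_pairl i)). Qed.

Lemma ge0_integral_mg (f : T2 -> \bar R) : measurable_fun setT f -> (forall p, 0 <= f p)%E ->
  (\int[mm]_p f p = \sum_(i < size) \int[io i]_t f (nat_of_ord i, t))%E.
Proof.
move=> mf f0; rewrite /mg_measure ge0_integral_measure_sum //; apply: eq_bigr => i _.
have -> : (\int[edge_measure (len i) i]_p f p = \int[pushforward (io i) (fun t : T => (nat_of_ord i, t))]_p f p)%E.
  by [].
rewrite (@ge0_integral_pushforward _ _ _ _ _ _ (measurable_pairl i)) //.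
Qed.

Lemma mg_measureE (A : set T2) :
  mm A = (\sum_(i < size) io i [set t : T | A (nat_of_ord i, t)])%E.
Proof. by []. Qed.

Lemma mg_sqn f : cmeasurable f ->
  sqn mm f = (\sum_(i < size) sqn (io i) (fun t => f (nat_of_ord i, t)))%E.
Proof.
move=> mf; rewrite /sqn ge0_integral_mg //; first exact: measurable_cmod2E.
by move=> p; rewrite lee_fin cmod2_ge0.
Qed.

Lemma mg_ae (Q : T2 -> Prop) : (forall i, (i < size)%N -> {ae io i, forall t, Q (i, t)}) ->
  {ae mm, forall p, Q p}.
Proof.
move=> h.
have h' i : exists N : set T, (i < size)%N -> [/\ measurable N, io i N = 0%E & [set t | ~ Q (i, t)] `<=` N].
  have [lt|_] := boolP (i < size)%N; last by exists set0.
  by have [N [mN N0 hN]] := h i lt; exists N.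
have [N hN] := choice h'.
exists [set p | (p.1 < size)%N -> N p.1 p.2]; split.
- apply: measurable_sections => i /=; have [lt|ge] := boolP (i < size)%N.
    rewrite (_ : [set _ | _] = N i); first by case: (hN i lt).
    by apply/seteqP; split=> t /=; [exact|].
  by rewrite (_ : [set _ | _] = setT) //; apply/seteqP; split.
- rewrite mg_measureE big1 // => i _; have [_ N0 _] := hN i (ltn_ord i).
  rewrite (_ : [set t | _] = N i) //.
  by apply/seteqP; split=> t /=; [apply; exact: ltn_ord|].
- by move=> [i t] /= nQ lt; have [_ _] := hN i lt; exact.
Qed.

Lemma mg_ae_section (Q : T2 -> Prop) i : (i < size)%N -> {ae mm, forall p, Q p} ->
  {ae io i, forall t, Q (i, t)}.
Proof.
move=> lt [N [mN N0 hN]]; exists [set t | N (i, t)]; split.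
- by have := measurable_pairl i measurableT mN; rewrite setTI.
- apply/eqP; rewrite eq_le measure_ge0 andbT -[leRHS]N0 mg_measureE.
  rewrite (bigD1 (Ordinal lt)) //= leeDl // sume_ge0 // => j _; exact: measure_ge0.
- by move=> t /= nQ; exact: hN.
Qed.

(** Indices from [size] on carry no mass; the value 0 there secures measurability whatever v is. *)
Definition edge_glue (v : nat -> R -> R[i]) (p : T2) : R[i] :=
  if (p.1 < size)%N then v p.1 p.2 else 0.

Lemma cmeasurable_glue v : (forall i, (i < size)%N -> cmeasurable (v i : T -> R[i])) ->
  cmeasurable (edge_glue v).
Proof.
move=> h; apply: cmeasurable_sections => i; rewrite /edge_glue /=.
by have [lt|_] := boolP (i < size)%N; [exact: h|exact: cmeasurable_cst].
Qed.

Lemma sqn_glue v : (forall i, (i < size)%N -> cmeasurable (v i : T -> R[i])) ->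
  sqn mm (edge_glue v) = (\sum_(i < size) sqn (io i) (v i : T -> R[i]))%E.
Proof.
move=> h; rewrite mg_sqn; last exact: cmeasurable_glue.
by apply: eq_bigr => i _; rewrite /sqn; apply: eq_integral => t _; rewrite /edge_glue /= ltn_ord.
Qed.

Lemma sq_integrable_glue v : (forall i, (i < size)%N -> sq_integrable (io i) (v i : T -> R[i])) ->
  sq_integrable mm (edge_glue v).
Proof.
move=> h; split; first by apply: cmeasurable_glue => i /h[].
rewrite -/(sqn _ _) sqn_glue; last by move=> i /h[].
apply: lte_sum_pinfty => i _; exact: (h i (ltn_ord i)).2.
Qed.

Lemma sq_integrable_section f i : (i < size)%N -> sq_integrable mm f ->
  sq_integrable (io i) (fun t => f (i, t)).
Proof.
move=> lt [mf fi]; split; first exact: cmeasurable_section.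
apply: le_lt_trans fi; rewrite -/(sqn _ _) -/(sqn _ f) mg_sqn // (bigD1 (Ordinal lt)) //=.
by rewrite leeDl // sume_ge0 // => j _; exact: sqn_ge0.
Qed.

End GraphMeasure.

(** * Representatives and derivatives on a metric graph *)

Section MetricForm.
Variables (R : realType) (V : Type) (M : metric_graph R V).
Notation T := (measurableTypeR R).
Notation mm := (mg_measure M).
Notation len := (mg_len M).
Notation size := (mg_size M).
Notation io i := (interval_measure (len i)).
Hypothesis len_gt0 : forall i, (i < size)%N -> 0 < len i.
Notation H := (L2space mm).
Notation E := (mg_form M).
Implicit Types (F G : H) (v w : nat -> R -> R[i]) (i : nat).

Let cut v i : T -> R[i] := cutoff (len i) (v i).

Lemma Rintegral_cmod2 (l : R) (g : R -> R[i]) : 0 < l -> sq_integrable (interval_measure l) (g : T -> R[i]) ->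
  ((\int[@lebesgue_measure R]_(x in `[0%R, l]) cmod2 (g x))%R)%:E = sqn (interval_measure l) (g : T -> R[i]).
Proof.
move=> l0 hg; have [a a0 aE] := sqn_fin hg; rewrite Rintegral_cutoff aE; congr EFin.
rewrite -[RHS]/(fine a%:E) -aE; congr fine; rewrite /sqn.
have mg := cmeasurable_cmod2 hg.1.
apply: ae_eq_integral => //; last first.
- by apply: ae_imply (interval_ae l) _ => t ht _; rewrite ht.
- by apply/measurable_EFinP.
rewrite (_ : (fun t : T => _) = EFin \o ((fun t => cmod2 (g t)) \_ `[0, l])).
  apply/measurable_EFinP/(measurable_restrictT _ (measurable_itv _)).
  exact: measurable_funS mg.
by apply/funext => t; rewrite /= patchE mem_setE in_itv.
Qed.

Lemma H1_section F v v' i : mg_H1 F v v' -> (i < size)%N ->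
  {ae io i, forall t, (F : L2 mm) (i, t) = v i t}.
Proof. by move=> [fv _ _ _] lt; have := mg_ae_section lt fv. Qed.

Lemma H1_ae F v v' : mg_H1 F v v' -> {ae mm, forall p, (F : L2 mm) p = edge_glue M (cut v) p}.
Proof.
move=> h; apply: mg_ae => i lt.
apply: ae_imply2 (H1_section h lt) (interval_ae (len i)) _ => t -> ht.
by rewrite /edge_glue /= lt /cut cutoffE.
Qed.

Lemma H1_sq_integrable F v v' i : mg_H1 F v v' -> (i < size)%N -> sq_integrable (io i) (cut v i).
Proof. by move=> [_ cv _ _] lt; apply: sq_integrable_cutoff; [exact: len_gt0|exact: cv]. Qed.

Lemma H1_hnorm F v v' : mg_H1 F v v' ->
  ((hnorm F ^+ 2)%:E = \sum_(i < size) sqn (io i) (cut v i))%E.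
Proof.
move=> h; have mc i : (i < size)%N -> cmeasurable (cut v i).
  by move=> lt; exact: (H1_sq_integrable h lt).1.
by rewrite (hnorm_sqn (cmeasurable_glue mc) (H1_ae h)) sqn_glue.
Qed.

Lemma H1_sections_ae F v v' w w' i : mg_H1 F v v' -> mg_H1 F w w' -> (i < size)%N ->
  {ae io i, forall t, v i t = w i t}.
Proof.
by move=> hv hw lt; apply: ae_imply2 (H1_section hv lt) (H1_section hw lt) _ => t <- <-.
Qed.

Lemma H1_derivative_unique F v v' w w' i : mg_H1 F v v' -> mg_H1 F w w' -> (i < size)%N ->
  {ae io i, forall t, v' i t = w' i t}.
Proof.
move=> hv hw lt; have vw := H1_sections_ae hv hw lt.
have [_ cv _ wv] := hv; have [_ cw _ ww] := hw.
exact: (weak_derivative_unique (len_gt0 lt) (cv i lt) (cw i lt) vw (wv i lt) (ww i lt)).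
Qed.

Lemma H1_lincomb c F G v v' w w' : mg_H1 F v v' -> mg_H1 G w w' ->
  mg_H1 (c *: F + G : H) (fun i t => c * v i t + w i t) (fun i t => c * v' i t + w' i t).
Proof.
move=> [fv cv [phi hphi] wv] [gw cw [phi' hphi'] ww]; split.
- have h1 := L2DE (c *: F : H) G; have h2 := L2ZE c (F : L2 mm).
  apply: ae_imply2 (ae_imply2 h1 h2 (fun x => @conj _ _)) (ae_imply2 fv gw (fun x => @conj _ _)) _.
  by move=> p [/= e1 e2] [e3 e4]; rewrite e1 e2 e3 e4.
- by move=> i lt; apply: within_continuousDZ; [exact: cv|exact: cw].
- exists (fun x => c * phi x + phi' x) => i lt.
  by have [-> ->] := hphi i lt; have [-> ->] := hphi' i lt.
- move=> i lt; apply: (weak_derivative_lincomb (len_gt0 lt)).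
  + exact: cv.
  + exact: cw.
  + exact: wv.
  + exact: ww.
Qed.

(** The difference of two representatives and its weak derivative both have norm zero, so the sup
    bound forces equality at every point, end points included. Vertex values are thus well
    defined. *)
Lemma H1_unique F v v' w w' i t : mg_H1 F v v' -> mg_H1 F w w' -> (i < size)%N ->
  0 <= t <= len i -> v i t = w i t.
Proof.
move=> hv hw lt ht; have l0 := len_gt0 lt.
have vw := H1_sections_ae hv hw lt; have vw' := H1_derivative_unique hv hw lt.
have [_ cv _ wv] := hv; have [_ cw _ ww] := hw.
have cvw : {within `[0, len i], continuous ((fun t => -1 * v i t + w i t) : R -> R[i]^o)}.
  by apply: within_continuousDZ; [exact: cv|exact: cw].
have wd := weak_derivative_lincomb l0 (-1) (cv i lt) (cw i lt) (wv i lt) (ww i lt).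
have zero (h : T -> R[i]) : cmeasurable h -> {ae io i, forall t, h t = 0} -> sqn (io i) h = 0%:E.
  move=> mh h0; rewrite (sqn_ae mh (cmeasurable_cst _ (0 : R[i])) h0) /sqn.
  by under eq_integral do rewrite cmod2_0; rewrite integral0.
have s1 : sqn (io i) ((fun t => -1 * v' i t + w' i t) : T -> R[i]) = 0%:E.
  by apply: zero; [exact: wd.1.1|apply: ae_imply vw' _ => s ->; rewrite mulN1r addNr].
have s2 : sqn (io i) (cutoff (len i) (fun t => -1 * v i t + w i t)) = 0%:E.
  apply: zero; first exact: cmeasurable_cutoff.
  by apply: ae_imply vw _ => s e; rewrite /cutoff e mulN1r addNr if_same.
have := weak_derivative_sup l0 cvw wd s1 s2 ht; rewrite !mulr0 addr0 => h.
have : cmod (-1 * v i t + w i t) = 0.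
  apply/eqP; rewrite -sqrf_eq0 cmod_sqr eq_le cmod2_ge0 andbT; exact: h.
by move/cmod_eq0/eqP; rewrite mulN1r addrC subr_eq0 => /eqP.
Qed.

Definition mg_rep F : nat -> R -> R[i] :=
  xget (fun _ _ => 0) [set v | mg_H1 F v (mg_derivative F)].

Lemma mg_repP F : qdom E F -> mg_H1 F (mg_rep F) (mg_derivative F).
Proof.
move=> [v [v' h]].
have [w hw] : exists w, mg_H1 F w (mg_derivative F).
  by rewrite /mg_derivative; case: xgetP => [u _ //|/(_ v')]; case; exists v.
by rewrite /mg_rep; case: xgetP => [u _ //|/(_ w)].
Qed.

Lemma H1_dom F v v' : mg_H1 F v v' -> qdom E F.
Proof. by move=> h; exists v, v'. Qed.

Lemma qval_H1 F v v' : mg_H1 F v v' ->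
  ((qval E F)%:E = \sum_(i < size) sqn (io i) (v' i : T -> R[i]))%E.
Proof.
move=> h; have hr := mg_repP (H1_dom h); rewrite -sumEFin; apply: eq_bigr => i _.
have [_ _ _ wr] := hr; have [_ _ _ wv] := h; have lt := ltn_ord i.
rewrite Rintegral_cmod2 ?len_gt0 //; last exact: (wr i lt).1.
apply: sqn_ae; [exact: (wr i lt).1.1|exact: (wv i lt).1.1|].
exact: H1_derivative_unique hr h lt.
Qed.

Lemma H1_derivative_sq_integrable F v v' : mg_H1 F v v' -> sq_integrable mm (edge_glue M v').
Proof. by move=> [_ _ _ wv]; apply: sq_integrable_glue => i lt; exact: (wv i lt).1. Qed.

(** The chosen derivative is linear in F only up to null sets. As an L2 class it is linear on the
    domain, and the form becomes its squared norm. *)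
Definition dclass F : H :=
  if pselect (sq_integrable mm (edge_glue M (mg_derivative F))) is left h then L2mk h else 0.

Lemma dclassE F v v' : mg_H1 F v v' -> {ae mm, forall p, (dclass F : L2 mm) p = edge_glue M v' p}.
Proof.
move=> h; have hr := mg_repP (H1_dom h); rewrite /dclass.
case: pselect => [hs|]; last by have := H1_derivative_sq_integrable hr.
have e : {ae mm, forall p, edge_glue M (mg_derivative F) p = edge_glue M v' p}.
  apply: mg_ae => i lt; rewrite /edge_glue /= lt; exact: H1_derivative_unique hr h lt.
by apply: ae_imply2 (L2mkE hs) e _ => p -> ->.
Qed.

Lemma mg_dom_subspace : linear_subspace (qdom E).
Proof.
split.
  exists (fun _ _ => 0), (fun _ _ => 0); split.
  - exact: L2zeroE.
  - by move=> i _; exact: within_continuous_cst.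
  - by exists (fun=> 0).
  - move=> i lt; have c0 : C1 (fun=> 0 : R) (fun=> 0).
      by split=> x; [exact: is_derive_cst|exact: cvg_cst].
    exact: (weak_derivative_C1 (len_gt0 lt) c0 c0).
by move=> c F G [v [v' hv]] [w [w' hw]]; apply: H1_dom; exact: H1_lincomb hv hw.
Qed.

Lemma dclassDZ c F G : qdom E F -> qdom E G -> dclass (c *: F + G) = c *: dclass F + dclass G.
Proof.
move=> /mg_repP hF /mg_repP hG; have hFG := H1_lincomb c hF hG; apply/L2P.
have h1 := L2DE (c *: dclass F : H) (dclass G); have h2 := L2ZE c (dclass F : L2 mm).
apply: ae_imply2 (dclassE hFG) (ae_imply2 (ae_imply2 h1 h2 (fun x => @conj _ _))
  (ae_imply2 (dclassE hF) (dclassE hG) (fun x => @conj _ _)) (fun x => @conj _ _)) _.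
move=> p e0 [[e1 e2] [e3 e4]]; apply: (etrans e0); apply/esym/(etrans e1).
transitivity (c * edge_glue M (mg_derivative F) p + edge_glue M (mg_derivative G) p).
  by congr (_ + _); [apply: (etrans e2); congr (_ * _)|].
by rewrite /edge_glue; case: ifP; rewrite ?mulr0 ?addr0.
Qed.

Lemma qval_dclass F : qdom E F -> qval E F = hnorm (dclass F) ^+ 2.
Proof.
move=> /mg_repP h; apply: EFin_inj; rewrite (qval_H1 h).
rewrite (hnorm_sqn (H1_derivative_sq_integrable h).1 (dclassE h)) sqn_glue //.
by move=> i lt; have [_ _ _ wv] := h; exact: (wv i lt).1.1.
Qed.

Definition mg_sesq F G : R[i] := ip (dclass F) (dclass G).

Lemma mg_sesq_hermitian : hermitian_on (qdom E) mg_sesq.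
Proof.
split=> [c F G K DF DG DK|F G DF DG]; last exact: ipC.
by rewrite /mg_sesq dclassDZ // ipDZ.
Qed.

Lemma mg_sesq_qval F : qdom E F -> mg_sesq F F = (qval E F)%:C.
Proof.
move=> DF; rewrite qval_dclass // hnorm_sqr /mg_sesq.
have := ip_ge0 (dclass F); rewrite lecE => /andP[/eqP h _].
by apply/eqP; rewrite eq_complex h !eqxx.
Qed.

Lemma polar_mg F G : qdom E F -> qdom E G -> polar E F G = mg_sesq F G.
Proof. exact: (polarE mg_dom_subspace mg_sesq_hermitian mg_sesq_qval). Qed.

Lemma mg_qval_ge0 F : qdom E F -> 0 <= qval E F.
Proof. by move=> DF; rewrite qval_dclass // sqr_ge0. Qed.

Lemma mg_sup_bound F v v' i t : mg_H1 F v v' -> (i < size)%N -> 0 <= t <= len i ->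
  cmod2 (v i t) <= 2 / len i * hnorm F ^+ 2 + 2 * len i * qval E F.
Proof.
move=> h lt ht; have l0 := len_gt0 lt; have [_ cv _ wv] := h.
have [a a0 aE] := sqn_fin (wv i lt).1; have [b b0 bE] := sqn_fin (H1_sq_integrable h lt).
apply: le_trans (weak_derivative_sup l0 (cv i lt) (wv i lt) aE bE ht) _.
apply: lerD; apply: ler_wpM2l; rewrite ?mulr_ge0 ?invr_ge0 ?(ltW l0) //; rewrite -lee_fin.
  rewrite -bE (H1_hnorm h) (bigD1 (Ordinal lt)) //= leeDl // sume_ge0 // => j _.
  exact: sqn_ge0.
rewrite -aE (qval_H1 h) (bigD1 (Ordinal lt)) //= leeDl // sume_ge0 // => j _.
exact: sqn_ge0.
Qed.

End MetricForm.

(** * Closedness and density of the metric graph form *)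

Section MetricEnergyForm.
Variables (R : realType) (V : Type) (M : metric_graph R V).
Notation T := (measurableTypeR R).
Notation mm := (mg_measure M).
Notation len := (mg_len M).
Notation size := (mg_size M).
Notation io i := (interval_measure (len i)).
Hypothesis len_gt0 : forall i, (i < size)%N -> 0 < len i.
Notation H := (L2space mm).
Notation E := (mg_form M).
Implicit Types (F G : H) (v w : nat -> R -> R[i]) (i : nat).

Lemma H1_sub F G v v' w w' : mg_H1 F v v' -> mg_H1 G w w' ->
  mg_H1 (F - G : H) (fun i t => v i t - w i t) (fun i t => v' i t - w' i t).
Proof.
move=> hv hw; have := H1_lincomb len_gt0 (-1) hw hv; rewrite scaleN1r addrC.
rewrite (_ : (fun i t => -1 * w i t + v i t) = (fun i t => v i t - w i t)).
  rewrite (_ : (fun i t => -1 * w' i t + v' i t) = (fun i t => v' i t - w' i t)) //.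
  by apply/funext => i; apply/funext => t; rewrite mulN1r addrC.
by apply/funext => i; apply/funext => t; rewrite mulN1r addrC.
Qed.

Lemma H1_class v g (phi : V -> R[i]) :
  (forall i, (i < size)%N -> {within `[0, len i], continuous (v i : R -> R[i]^o)}) ->
  (forall i, (i < size)%N -> v i 0 = phi (mg_src M i) /\ v i (len i) = phi (mg_tgt M i)) ->
  (forall i, (i < size)%N -> weak_derivative (len i) (v i) (g i)) ->
  exists F, mg_H1 F v g.
Proof.
move=> cv hphi wd.
have hs : sq_integrable mm (edge_glue M (fun i => cutoff (len i) (v i))).
  by apply: sq_integrable_glue => i lt; apply: sq_integrable_cutoff; [exact: len_gt0|exact: cv].
exists (L2mk hs); split=> //; last by exists phi.
have e : {ae mm, forall p, edge_glue M (fun i => cutoff (len i) (v i)) p = v p.1 p.2}.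
  apply: mg_ae => i lt; apply: ae_imply (interval_ae (len i)) _ => t ht.
  by rewrite /edge_glue /= lt cutoffE.
by apply: ae_imply2 (L2mkE hs) e _ => p -> ->.
Qed.

Lemma hnorm_dclassB F G v v' : mg_H1 F v v' -> ((hnorm (dclass F - G) ^+ 2)%:E =
  \sum_(i < size) sqn (io i) (fun t => v' i t - (G : L2 mm) (nat_of_ord i, t))%R)%E.
Proof.
move=> h; have mv := (H1_derivative_sq_integrable h).1; have mG := (L2_sqint (G : L2 mm)).1.
have Gae : {ae mm, forall p, (G : L2 mm) p = (G : L2 mm) p} by exact: ae_imply (dclassE len_gt0 h) _.
rewrite (hnormB_sqn mv mG (dclassE len_gt0 h) Gae) mg_sqn; last exact: cmeasurableB.
by apply: eq_bigr => i _; congr sqn; apply/funext => t; rewrite /edge_glue /= ltn_ord.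
Qed.

Let C := \sum_(i < size) (2 / len i + 2 * len i).

Let C_ge0 : 0 <= C.
Proof.
by apply: sumr_ge0 => i _; rewrite addr_ge0 ?divr_ge0 ?mulr_ge0 // ltW // len_gt0.
Qed.

Lemma mg_uniform_bound F v v' i t : mg_H1 F v v' -> (i < size)%N -> 0 <= t <= len i ->
  cmod2 (v i t) <= C * (hnorm F ^+ 2 + qval E F).
Proof.
move=> h lt ht; apply: le_trans (mg_sup_bound len_gt0 h lt ht) _.
have q0 := mg_qval_ge0 len_gt0 (H1_dom h); have n0 := sqr_ge0 (hnorm F).
have le : 2 / len i + 2 * len i <= C.
  rewrite /C (bigD1 (Ordinal lt)) //= lerDl sumr_ge0 // => j _.
  by rewrite addr_ge0 ?divr_ge0 ?mulr_ge0 // ltW // len_gt0.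
have l1 : 0 <= 2 / len i by rewrite divr_ge0 // ltW // len_gt0.
have l2 : 0 <= 2 * len i by rewrite mulr_ge0 // ltW // len_gt0.
rewrite mulrDr; apply: lerD; apply: ler_wpM2r => //; lra.
Qed.

(** The representatives converge uniformly and the derivatives converge in L2 by completeness;
    [weak_derivative_limit] joins the two limits on each edge. *)
Lemma mg_closed : closed_form E.
Proof.
move=> F DF C1 C2.
pose u n := mg_rep (F n); pose u' n := mg_derivative (F n).
have h n : mg_H1 (F n) (u n) (u' n) := mg_repP (DF n).
have unif (e : R) : 0 < e -> exists n0, forall m n, (n0 <= m)%N -> (n0 <= n)%N ->
    forall i t, (i < size)%N -> 0 <= t <= len i -> cmod (u m i t - u n i t) < e.
  move=> e0; pose a := e ^+ 2 / (2 * (C + 1)).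
  have C1p : 0 < C + 1 by rewrite ltr_wpDl.
  have a0 : 0 < a by rewrite divr_gt0 ?exprn_gt0 ?mulr_gt0.
  have sa : 0 < Num.sqrt a by rewrite sqrtr_gt0.
  have [n1 h1] := C1 _ sa; have [n2 h2] := C2 _ a0.
  exists (maxn n1 n2) => m n; rewrite !geq_max => /andP[m1 m2] /andP[k1 k2] i t lt ht.
  rewrite -ltr_sqr ?nnegrE ?cmod_ge0 ?(ltW e0) // cmod_sqr.
  apply: le_lt_trans (mg_uniform_bound (H1_sub (h m) (h n)) lt ht) _.
  have hn : hnorm (F m - F n) ^+ 2 < a.
    rewrite -(sqr_sqrtr (ltW a0)) ltr_sqr ?nnegrE ?hnorm_ge0 ?sqrtr_ge0 //; exact: h1.
  have hq := h2 m n m2 k2.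
  have aE : e ^+ 2 = (C + 1) * (2 * a) by rewrite /a; field; rewrite lt0r_neq0.
  rewrite aE; apply: (@le_lt_trans _ _ (C * (2 * a))).
    by apply: ler_wpM2l => //; lra.
  by rewrite [ltRHS]mulrDl mul1r ltrDl mulr_gt0.
have [[i t]|vv hvv] := @choice _ _ (fun (p : nat * R) (z : R[i]) =>
    (p.1 < size)%N -> 0 <= p.2 <= len p.1 -> ccvg (fun n => u n p.1 p.2) z).
  have [[lt ht]|nK] := pselect ((i < size)%N /\ 0 <= t <= len i); last first.
    by exists 0 => /= lt ht; case: nK.
  have [z hz] : exists z, ccvg (fun n => u n i t) z.
    by apply: cauchy_ccvg => e /unif[n0 hn]; exists n0 => m n hm hn'; exact: hn.
  by exists z.
pose v i t := vv (i, t).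
have hv i t : (i < size)%N -> 0 <= t <= len i -> ccvg (fun n => u n i t) (v i t).
  by move=> lt ht; exact: (hvv (i, t)).
have lim_v (e : R) : 0 < e -> exists n0, forall n, (n0 <= n)%N -> forall i t,
    (i < size)%N -> 0 <= t <= len i -> cmod (u n i t - v i t) <= e.
  move=> /unif[n0 hn]; exists n0 => n hn0 i t lt ht; rewrite cmodB.
  by apply: (ccvg_le (n0 := n0) (hv i t lt ht)) => k hk; exact: (ltW (hn k n hk hn0 i t lt ht)).
have cv i : (i < size)%N -> {within `[0, len i], continuous (v i : R -> R[i]^o)}.
  move=> lt; apply: (within_uniform_limit (u_ := fun n => u n i)) => [n|e e0].
    by have [_ ch _ _] := h n; exact: ch.
  have [n0 hn] := lim_v (e / 2) (divr_gt0 e0 (ltr0Sn _ 1)); exists n0 => t; rewrite /= in_itv => ht.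
  by apply: le_lt_trans (hn n0 (leqnn _) i t lt ht) _; rewrite ltr_pdivrMr // ltr_pMr // ltr1n.
have [|phis hphis] := @choice _ _ (fun n (phi : V -> R[i]) => forall i, (i < size)%N ->
    u n i 0 = phi (mg_src M i) /\ u n i (len i) = phi (mg_tgt M i)).
  by move=> n; have [_ _ [phi hp] _] := h n; exists phi.
(* The vertex values of the limit are the limits of the vertex values, which exist at every end
   point of an edge; elsewhere the value is arbitrary. *)
have [x|phi hphi] := @choice _ _ (fun (x : V) (z : R[i]) =>
    forall z', ccvg (fun n => phis n x) z' -> z = z').
  have [[z hz]|no] := pselect (exists z, ccvg (fun n => phis n x) z).
    by exists z => z'; exact: ccvg_unique.
  by exists 0 => z' hz'; case: no; exists z'.
have vphi i : (i < size)%N -> v i 0 = phi (mg_src M i) /\ v i (len i) = phi (mg_tgt M i).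
  move=> lt; have l0 := ltW (len_gt0 lt); split; apply/esym/hphi.
    have := hv i 0 lt _; rewrite lexx l0 => /(_ isT).
    by congr ccvg; apply/funext => n; have [] := hphis n i lt.
  have := hv i (len i) lt _; rewrite lexx l0 => /(_ isT).
  by congr ccvg; apply/funext => n; have [] := hphis n i lt.
have DFmn m n : qdom E (F m - F n) by exact: subspaceB (mg_dom_subspace len_gt0) (DF m) (DF n).
have dB m n : qval E (F m - F n) = hnorm (dclass (F m) - dclass (F n)) ^+ 2.
  rewrite (qval_dclass len_gt0 (DFmn m n)); congr (hnorm _ ^+ 2).
  by rewrite addrC -[- F n]scaleN1r (dclassDZ len_gt0 _ (DF n) (DF m)) scaleN1r addrC.
have [e e0|G _ /cvgrPdist_lt limG] := L2_complete (u := fun n => dclass (F n)) (fun _ => I).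
  have [n0 hn] := C2 _ (exprn_gt0 2 e0); exists n0 => m n hm hn0.
  by rewrite -ltr_sqr ?nnegrE ?hnorm_ge0 ?(ltW e0) // -dB; exact: hn.
have limG' (e : R) : 0 < e -> exists n0, forall n, (n0 <= n)%N -> hnorm (dclass (F n) - G) < e.
  move=> /limG [n0 _ hn]; exists n0 => n /hn /=.
  by rewrite sub0r normrN ger0_norm ?hnorm_ge0.
pose g i t := (G : L2 mm) (i, t).
have hg i : (i < size)%N -> sq_integrable (io i) (g i).
  by move=> lt; exact: sq_integrable_section lt (L2_sqint (G : L2 mm)).
have wd i : (i < size)%N -> weak_derivative (len i) (v i) (g i).
  move=> lt; apply: (@weak_derivative_limit R _ (len_gt0 lt) (fun n => u n i) (fun n => u' n i)).
  - by move=> n; have [_ ch _ _] := h n; exact: ch.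
  - exact: cv.
  - by move=> n; have [_ _ _ ch] := h n; exact: ch.
  - exact: hg.
  move=> e e0; have se : 0 < Num.sqrt e by rewrite sqrtr_gt0.
  have [n1 h1] := lim_v _ se; have [n2 h2] := limG' _ se; exists (maxn n1 n2); split.
    move=> t ht; rewrite -cmod_sqr -[leRHS](sqr_sqrtr (ltW e0)) ler_sqr ?nnegrE ?cmod_ge0 ?sqrtr_ge0 //.
    by apply: h1 => //; exact: leq_maxl.
  have := h2 _ (leq_maxr n1 n2); rewrite -hnorm_lt // [Num.sqrt e ^+ 2]sqr_sqrtr ?(ltW e0) //.
  rewrite (hnorm_dclassB G (h _)) => /ltW; apply: le_trans.
  by rewrite (bigD1 (Ordinal lt)) //= leeDl // sume_ge0 // => j _; exact: sqn_ge0.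
have [Finf hF] := H1_class cv vphi wd.
exists Finf; first exact: H1_dom hF.
move=> e e0; pose L := \sum_(i < size) len i.
have L0 : 0 <= L by apply: sumr_ge0 => i _; exact: (ltW (len_gt0 (ltn_ord i))).
have L1 : 0 < L + 1 by rewrite ltr_wpDl.
pose d := e ^+ 2 / (L + 1); have d0 : 0 < d by rewrite divr_gt0 ?exprn_gt0.
have sd : 0 < Num.sqrt d by rewrite sqrtr_gt0.
have se : 0 < Num.sqrt e by rewrite sqrtr_gt0.
have [n1 h1] := lim_v _ sd; have [n2 h2] := limG' _ se.
exists (maxn n1 n2) => n; rewrite geq_max => /andP[k1 k2]; have hd := H1_sub (h n) hF; split.
  rewrite -hnorm_lt // (H1_hnorm len_gt0 hd).
  apply: (@le_lt_trans _ _ (\sum_(i < size) (d * len i)%:E)%E).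
    apply: lee_sum => i _; apply: sqn_interval_le.
    - exact: len_gt0.
    - exact: (H1_sq_integrable len_gt0 hd (ltn_ord i)).1.
    - exact: ltW.
    - move=> t ht; rewrite cutoffE // -cmod_sqr -[leRHS](sqr_sqrtr (ltW d0)).
      by rewrite ler_sqr ?nnegrE ?cmod_ge0 ?sqrtr_ge0 //; exact: h1.
  rewrite sumEFin lte_fin -mulr_sumr -/L /d mulrAC ltr_pdivrMr // ltr_pM2l ?exprn_gt0 //.
  by rewrite ltrDl.
have := h2 n k2; rewrite -hnorm_lt // [Num.sqrt e ^+ 2]sqr_sqrtr ?(ltW e0) //.
by rewrite (hnorm_dclassB G (h n)) -(qval_H1 len_gt0 hd) lte_fin.
Qed.

(** Test functions vanish at the end points, so separate approximations on the edges glue to a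
    continuous function with vertex values 0. *)
Lemma mg_dense F (e : R) : 0 < e -> exists2 G, qdom E G & hnorm (F - G) < e.
Proof.
move=> e0; pose b := e ^+ 2 / (size%:R + 1).
have s1 : 0 < size%:R + 1 :> R by rewrite ltr_wpDl.
have b0 : 0 < b by rewrite divr_gt0 ?exprn_gt0.
have [i|p hp] := @choice _ _ (fun i (f : R -> R[i]) => (i < size)%N ->
   [/\ test_function (len i) (fun t => Re (f t)), test_function (len i) (fun t => Im (f t)) &
    (sqn (io i) (fun t : T => (F : L2 mm) (i, t) - f t)%R < b%:E)%E]).
  have [lt|_] := boolP (i < size)%N; last by exists (fun=> 0).
  have := test_functions_dense (len_gt0 lt) (sq_integrable_section lt (L2_sqint (F : L2 mm))).
  by move=> [_ /(_ b b0) [f [fr fi] hf]]; exists f.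
pose g i (t : R) : R[i] := derive1 (fun t => Re (p i t)) t +i* derive1 (fun t => Im (p i t)) t.
have [|||G hG] := @H1_class p g (fun=> 0).
- move=> i lt; have [tr ti _] := hp i lt.
  rewrite (_ : p i = fun t => 'i%C * (Im (p i t))%:C + (Re (p i t))%:C).
    by apply: within_continuousDZ; apply: continuous_realC;
      [exact: C1_continuous (test_function_C1 ti)|exact: C1_continuous (test_function_C1 tr)].
  by apply/funext => t; case: (p i t) => x y; simpc.
- move=> i lt; have [tr ti _] := hp i lt.
  have [r0 rl] := test_function_bounds tr; have [i0 il] := test_function_bounds ti.
  by split; apply/eqP; rewrite eq_complex ?r0 ?rl ?i0 ?il !eqxx.
- move=> i lt; have [tr ti _] := hp i lt.
  rewrite (_ : p i = fun t => Re (p i t) +i* Im (p i t)).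
    exact: (weak_derivative_C1 (len_gt0 lt) (test_function_C1 tr) (test_function_C1 ti)).
  by apply/funext => t; case: (p i t).
exists G; first exact: H1_dom hG.
have mF := (L2_sqint (F : L2 mm)).1.
have Fae : {ae mm, forall p, (F : L2 mm) p = (F : L2 mm) p} by exact: ae_imply (H1_ae hG) _.
have mp : cmeasurable (edge_glue M (fun i => cutoff (len i) (p i))).
  by apply: cmeasurable_glue => i lt; exact: (H1_sq_integrable len_gt0 hG lt).1.
rewrite -hnorm_lt // (hnormB_sqn mF mp Fae (H1_ae hG)) mg_sqn; last exact: cmeasurableB.
apply: (@le_lt_trans _ _ (\sum_(i < size) b%:E)%E).
  apply: lee_sum => i _; have lt := ltn_ord i; have [tr ti hlt] := hp i lt.
  apply: le_trans (ltW hlt); rewrite le_eqVlt; apply/orP; left; apply/eqP.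
  have mp' : cmeasurable (p i : T -> R[i]).
    by split; apply: continuous_measurable_fun; [exact: C1_continuous (test_function_C1 tr)|
      exact: C1_continuous (test_function_C1 ti)].
  have mFi := cmeasurable_section i mF.
  apply: sqn_ae.
  - by apply: cmeasurableB => //; exact: (cmeasurable_section i mp).
  - exact: cmeasurableB.
  - apply: ae_imply (interval_ae (len i)) _ => t ht.
    by rewrite /edge_glue /= lt cutoffE.
rewrite sumEFin lte_fin sumr_const card_ord -mulr_natl /b mulrA ltr_pdivrMr //.
by rewrite mulrC ltr_pM2l ?exprn_gt0 // ltrDl.
Qed.

Lemma mg_energy_form (t : R) : 0 < t -> energy_form (scale_form t E).
Proof.
move=> t0; have sD := mg_dom_subspace len_gt0.
have q0 F : qdom E F -> 0 <= qval (scale_form t E) F.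
  by move=> DF; rewrite mulr_ge0 ?(ltW t0) //; exact: mg_qval_ge0.
split.
- exact: L2_complete.
- apply: quadratic_scale.
  exact: (quadratic_of_hermitian sD (mg_sesq_hermitian len_gt0) (mg_sesq_qval len_gt0)).
- exact: q0.
- exact: mg_dense.
- apply: complete_norm1 => //; exact: (closed_form_scale t0 mg_closed).
Qed.

End MetricEnergyForm.

(** * Complex integrals as sums over the edges *)

Section IntegralOverEdges.
Variables (R : realType) (V : Type) (M : metric_graph R V).
Notation T := (measurableTypeR R).
Notation mm := (mg_measure M).
Notation io i := (interval_measure (mg_len M i)).

Lemma Rintegral_mg (h : nat * T -> R) : mm.-integrable setT (EFin \o h) ->
  (\int[mm]_(p in setT) h p)%R =
  \sum_(i < mg_size M) (\int[io i]_(t in setT) h (nat_of_ord i, t))%R.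
Proof.
move=> hi; have mh := measurable_int _ hi.
have mpos := measurable_funepos mh; have mneg := measurable_funeneg mh.
have Ep : (\int[mm]_p ((EFin \o h)^\+ p) =
    \sum_(i < mg_size M) \int[io i]_t ((EFin \o h)^\+ (nat_of_ord i, t)))%E.
  by apply: ge0_integral_mg => // p; exact: funepos_ge0.
have En : (\int[mm]_p ((EFin \o h)^\- p) =
    \sum_(i < mg_size M) \int[io i]_t ((EFin \o h)^\- (nat_of_ord i, t)))%E.
  by apply: ge0_integral_mg => // p; exact: funeneg_ge0.
have fp := integral_funepos_lt_pinfty measurableT hi; have fn := integral_funeneg_lt_pinfty measurableT hi.
have fin (f : nat * T -> \bar R) : (forall p, 0 <= f p)%E ->
    (\int[mm]_p f p = \sum_(i < mg_size M) \int[io i]_t f (nat_of_ord i, t))%E ->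
    (\int[mm]_p f p < +oo)%E -> forall i : 'I_(mg_size M),
    (\int[io i]_t f (nat_of_ord i, t))%E \is a fin_num.
  move=> f0 fE flt i; rewrite ge0_fin_numE ?integral_ge0 //; apply: le_lt_trans flt.
  by rewrite fE (bigD1 i) //= leeDl // sume_ge0 // => j _; exact: integral_ge0.
have finp := fin _ (funepos_ge0 _) Ep fp; have finn := fin _ (funeneg_ge0 _) En fn.
rewrite /Rintegral [in LHS]integralE Ep En fineB; last 2 first.
- by apply/sum_fin_numP => i _ _; exact: finp.
- by apply/sum_fin_numP => i _ _; exact: finn.
rewrite -!sum_fine // -sumrB; apply: eq_bigr => i _.
rewrite -fineB; [|exact: finp|exact: finn].
rewrite [X in _ = fine X]integralE; congr (fine (_ - _)); apply: eq_integral => t _.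
  by rewrite !funeposE.
by rewrite !funenegE.
Qed.

Lemma cintegral_mg (f : nat * T -> R[i]) : cintegrable mm f ->
  cintegral mm setT f = \sum_(i < mg_size M) cintegral (io i) setT (fun t => f (nat_of_ord i, t)).
Proof.
move=> [fr fi]; apply/eqP; rewrite eq_complex Re_sum Im_sum.
by rewrite /cintegral /= (Rintegral_mg fr) (Rintegral_mg fi) !eqxx.
Qed.

End IntegralOverEdges.

(** * Metric graphs approximating the fractal *)

Section ApproximatingGraph.
Variables (R : realType) (d : nat) (D : fractal R d) (C0 l00 Lambda : R) (m : nat).
Implicit Types (phi : 'rV[R]_d -> R[i]).
Notation N := (nmaps D).
Notation word := (m.-tuple 'I_N).
Hypothesis pcfD : pcf_fractal D.
Hypothesis graphsD : weighted_graphs D.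
Hypothesis C0_gt0 : 0 < C0.
Hypothesis symC0 : forall v, v \in V0 D -> \sum_(e <- Em D 0 | v \in e) (gamma0 D e)^-1 = C0.
Hypothesis l00_gt0 : 0 < l00.
Hypothesis Lambda_gt0 : 0 < Lambda.
Notation T := (measurableTypeR R).
Notation M := (graph_Mm D l00 Lambda m).
Notation mm := (mg_measure M).
Notation len := (mg_len M).
Notation size := (mg_size M).
Notation io i := (interval_measure (len i)).
Notation H := (L2space mm).
Notation E := (mg_form M).
Notation edge i := (Em_nth D m i).

Lemma edge_mem i : (i < size)%N -> edge i \in Em D m.
Proof. exact: mem_nth. Qed.

Lemma edge_index e : e \in Em D m -> (index e (Em D m) < size)%N /\ edge (index e (Em D m)) = e.
Proof. by move=> he; rewrite /= index_mem he /Em_nth nth_index. Qed.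

Lemma index_edge i : (i < size)%N -> index (edge i) (Em D m) = i.
Proof. by move=> lt; rewrite /Em_nth index_uniq // fset_uniq. Qed.

Lemma sum_edges (W : nmodType) (f : {fset 'rV[R]_d} -> W) :
  \sum_(i < size) f (edge i) = \sum_(e <- Em D m) f e.
Proof. by rewrite (big_nth fset0) big_mkord. Qed.

Lemma len_gt0 i : (i < size)%N -> 0 < len i.
Proof.
move=> lt; rewrite /= mulr_gt0 ?exprn_gt0 // divr_gt0 //.
by apply: (gamma0_gt0 graphsD); exact: base_edge_Em0 (edge_mem lt).
Qed.

(** Weight times length is the same for all edges of a level. An affine function on an edge has
    energy |increment|^2 / length, so the two energies are proportional with one common factor. *)
Lemma gamma_len i : (i < size)%N -> gamma D m (edge i) = l00 * (Lambda / renorm D) ^+ m / len i.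
Proof.
move=> lt; have g0 : gamma0 D (base_edge D m (edge i)) != 0.
  by apply/lt0r_neq0/(gamma0_gt0 graphsD); exact: base_edge_Em0 (edge_mem lt).
have r0 := lt0r_neq0 (renorm_gt0 graphsD); have L0 := lt0r_neq0 Lambda_gt0.
rewrite /gamma /= expr_div_n; field.
by rewrite g0 !expf_neq0 // lt0r_neq0.
Qed.

(** A vertex without edges would make the sum defining C_0 empty, against C_0 > 0. *)
Lemma vertex_neighbour v0 : v0 \in V0 D -> exists2 v1, v1 \in V0 D & v0 != v1.
Proof.
move=> hv0; have [[e /andP[he ve]]|no] := pselect (exists e, (e \in Em D 0) && (v0 \in e)).
  have [hs ht st eE] := src_tgt_V0 he; move: ve; rewrite {1}eE !inE => /orP[/eqP vE|/eqP vE].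
    by exists (tgt e); rewrite ?vE.
  by exists (src e); rewrite ?vE // eq_sym.
have := symC0 hv0; rewrite big_seq_cond big1 => [h|e h]; first by move: C0_gt0; rewrite -h ltxx.
by case: no; exists e.
Qed.

Lemma Vm_endpoint x : x \in Vm D m -> exists2 i, (i < size)%N & x = src (edge i) \/ x = tgt (edge i).
Proof.
move=> /VmP [w [v [hv ->]]]; have [v1 hv1 ne] := vertex_neighbour hv.
have he := edge_V0 hv hv1 ne.
have /edge_index [lt eE] : (Fword w @` [fset v; v1])%fset \in Em D m by apply/EmP; exists w, [fset v; v1]%fset.
exists (index (Fword w @` [fset v; v1])%fset (Em D m)) => //.
have ne' : Fword w v != Fword w v1 by rewrite (inj_eq (@Fword_inj _ _ _ pcfD w)).
have imE : (Fword w @` [fset v; v1])%fset = [fset Fword w v; Fword w v1]%fset.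
  apply/fsetP => z; apply/imfsetP/idP => /=.
    by move=> [y]; rewrite !inE => /orP[] /eqP -> ->; rewrite eqxx ?orbT.
  by rewrite !inE => /orP[] /eqP ->; [exists v|exists v1]; rewrite // !inE eqxx ?orbT.
rewrite eE imE; case: (src_tgt ne') => -[-> ->]; by [left|right].
Qed.

Definition vertex_values (v : nat -> R -> R[i]) phi :=
  forall i, (i < size)%N -> v i 0 = phi (src (edge i)) /\ v i (len i) = phi (tgt (edge i)).

Definition vval (F : H) : 'rV[R]_d -> R[i] :=
  xget (fun=> 0) [set phi | vertex_values (mg_rep F) phi].

Lemma vvalP (F : H) : qdom E F -> vertex_values (mg_rep F) (vval F).
Proof.
move=> /mg_repP [_ _ [phi hphi] _]; rewrite /vval; case: xgetP => [? _ //|/(_ phi)].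
by [].
Qed.

(** Every vertex is an end point of some edge, and representatives agree up to the end points. *)
Lemma vval_unique (F : H) v v' phi : mg_H1 F v v' -> vertex_values v phi ->
  {in Vm D m, vval F =1 phi}.
Proof.
move=> hF hphi x /Vm_endpoint[i lt xE].
have hr := mg_repP (H1_dom hF); have [s t] := vvalP (H1_dom hF) lt; have [s' t'] := hphi i lt.
have l0 := ltW (len_gt0 lt).
case: xE => ->.
  by rewrite -s -s'; apply: (H1_unique len_gt0 hr hF lt); rewrite lexx.
by rewrite -t -t'; apply: (H1_unique len_gt0 hr hF lt); rewrite l0 lexx.
Qed.

Lemma vval_linear c (F G : H) : qdom E F -> qdom E G ->
  {in Vm D m, forall x, vval (c *: F + G) x = c * vval F x + vval G x}.
Proof.
move=> DF DG; apply: (vval_unique (H1_lincomb len_gt0 c (mg_repP DF) (mg_repP DG))).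
by move=> i lt; have [-> ->] := vvalP DF lt; have [-> ->] := vvalP DG lt.
Qed.

Notation resistance := (edge_resistance D).

(** Summing the symmetry condition over V_0 counts each edge at both of its end points; this is the
    origin of C_0 N_0 / 2 in tau_m. *)
Lemma edge_resistanceE : resistance = C0 * #|` V0 D|%:R / 2.
Proof.
have two : \sum_(v <- V0 D) \sum_(e <- Em D 0 | v \in e) (gamma0 D e)^-1 = 2 * resistance.
  rewrite (exchange_big_dep xpredT) //= /edge_resistance mulr_sumr big_seq [RHS]big_seq.
  apply: eq_bigr => e he; have [hs ht st eE] := src_tgt_V0 he.
  rewrite -big_filter (perm_big [:: src e; tgt e]); last first.
    apply: uniq_perm; first by rewrite filter_uniq // fset_uniq.
      by rewrite /= inE st.
    move=> x; rewrite mem_filter {1}eE !inE; case: eqP => [->|_] /=; first by rewrite hs.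
    by case: eqP => [->|]//=; rewrite ht.
  by rewrite !big_cons big_nil /= addr0 mulrDl mul1r.
have : \sum_(v <- V0 D) \sum_(e <- Em D 0 | v \in e) (gamma0 D e)^-1 = \sum_(v <- V0 D) C0.
  by rewrite big_seq [RHS]big_seq; apply: eq_bigr => v; exact: symC0.
rewrite two big_const_seq count_predT iter_addr_0 => h.
have -> : C0 * #|` V0 D|%:R = 2 * resistance by rewrite h mulr_natr.
by rewrite mulrAC divff ?mul1r // pnatr_eq0.
Qed.

Lemma edge_resistance_gt0 : 0 < resistance.
Proof.
rewrite edge_resistanceE divr_gt0 // mulr_gt0 // ltr0n cardfs_gt0.
by case: pcfD => _ _ _ _ [].
Qed.

Definition cell_mass : R := l00 * Lambda ^+ m * resistance.

Lemma cell_mass_gt0 : 0 < cell_mass.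
Proof. by rewrite !mulr_gt0 ?exprn_gt0 ?edge_resistance_gt0. Qed.

Definition in_cell (w : word) (e : {fset 'rV[R]_d}) : bool :=
  has (fun e0 : {fset 'rV[R]_d} => e == (Fword w @` e0)%fset) (Em D 0).

Lemma in_cell_word (w w' : word) e0 : e0 \in Em D 0 -> in_cell w (Fword w' @` e0)%fset = (w' == w).
Proof.
move=> he0; rewrite /in_cell; apply/hasP/eqP => [[e1 he1 /eqP E_]|->]; last by exists e0.
by have [] := simpleD graphsD he0 he1 E_.
Qed.

Definition Acell (w : word) : set (nat * T) := [set p | (p.1 < size)%N && in_cell w (edge p.1)].

Lemma measurable_Acell w : measurable (Acell w).
Proof.
apply: measurable_sections => i; rewrite /Acell /=.
by case: (_ && _); [rewrite (_ : [set _ | _] = setT)|rewrite (_ : [set _ | _] = set0)] => //;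
  apply/seteqP; split.
Qed.

Lemma mu_Acell w : mm (Acell w) = cell_mass%:E.
Proof.
rewrite mg_measureE; transitivity (\sum_(i < size) ((in_cell w (edge i))%:R * len i)%:E)%E.
  apply: eq_bigr => i _; rewrite /Acell /= ltn_ord /=; case: (in_cell w _).
    rewrite mul1r -[RHS](interval_measureT (len_gt0 (ltn_ord i))); congr (interval_measure _ _).
    by apply/seteqP; split.
  rewrite mul0r -[RHS](measure0 (io i)); congr (interval_measure _ _).
  by apply/seteqP; split.
rewrite sumEFin; congr EFin.
rewrite (sum_edges (fun e => (in_cell w e)%:R * (l00 / gamma0 D (base_edge D m e) * Lambda ^+ m))).
rewrite (sum_Em graphsD) (bigD1 w) //= [X in _ + X]big1 ?addr0; last first.
  move=> w' ne; rewrite big_seq big1 // => e0 he0.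
  by rewrite in_cell_word // (negbTE ne) mul0r.
rewrite /cell_mass /edge_resistance mulr_sumr big_seq [RHS]big_seq; apply: eq_bigr => e0 he0.
by rewrite in_cell_word // eqxx mul1r base_edgeE // mulrAC.
Qed.

Lemma Acell_partition : {ae mm, forall p, exists w, Acell w p /\ forall w', Acell w' p -> w' = w}.
Proof.
apply: mg_ae => i lt; apply: ae_imply (interval_ae (len i)) _ => t _.
have /EmP[w [e0 [he0 eE]]] := edge_mem lt.
exists w; rewrite /Acell /= lt eE in_cell_word // eqxx; split=> // w'.
by rewrite in_cell_word // => /eqP.
Qed.

Definition mg_cell (w : word) : H := cell_vector measurable_Acell mu_Acell w.

Lemma mg_cell_orthonormal w w' : ip (mg_cell w) (mg_cell w') = (w == w')%:R.
Proof. exact: (cell_vector_orthonormal cell_mass_gt0 _ _ Acell_partition). Qed.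

Definition mg_coeff (v0 : 'rV[R]_d) (F : H) (w : word) : R[i] :=
  (Num.sqrt cell_mass)%:C * vval F (Fword w v0).

End ApproximatingGraph.

Lemma C1_affine (R : realType) (a b : R) : C1 (fun t => b + a * t) (fun=> a).
Proof.
split=> x; last exact: cvg_cst.
have := is_derive_lincomb b a (is_derive_cst (1 : R) x 1) (is_derive_id x 1).
by rewrite mulr0 add0r mulr1 (_ : (fun t => _) = fun t => b + a * t) //;
  apply/funext => t; rewrite mulr1.
Qed.

Section ConstantIntegrals.
Context d (T : measurableType d) (R : realType) (mu : {measure set T -> \bar R}).

Lemma cintegralZr (f : T -> R[i]) (z : R[i]) : cintegrable mu f ->
  cintegral mu setT (fun x => f x * z) = cintegral mu setT f * z.
Proof.
move=> hf; have h0 : cintegrable mu (fun=> 0 : R[i]).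
  by split; rewrite (_ : EFin \o _ = cst 0%E) //; exact: integrable0.
have := cintegralDZ z hf h0.
have -> : cintegral mu setT (fun=> 0 : R[i]) = 0.
  rewrite -[RHS](addNr (cintegral mu setT (fun=> 0 : R[i]))) -mulN1r -(cintegralDZ (-1) h0 h0).
  congr cintegral; by apply/funext => x; rewrite mulr0 addr0.
by rewrite addr0 mulrC => <-; congr cintegral; apply/funext => x; rewrite addr0 mulrC.
Qed.

End ConstantIntegrals.

(** * Approximation by vertex values and affine interpolation *)

Section Interpolation.
Variables (R : realType) (d : nat) (D : fractal R d) (C0 l00 Lambda : R) (m : nat).
Implicit Types (phi : 'rV[R]_d -> R[i]).
Notation N := (nmaps D).
Notation word := (m.-tuple 'I_N).
Hypothesis pcfD : pcf_fractal D.
Hypothesis graphsD : weighted_graphs D.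
Hypothesis C0_gt0 : 0 < C0.
Hypothesis symC0 : forall v, v \in V0 D -> \sum_(e <- Em D 0 | v \in e) (gamma0 D e)^-1 = C0.
Hypothesis l00_gt0 : 0 < l00.
Hypothesis Lambda_gt0 : 0 < Lambda.
Notation T := (measurableTypeR R).
Notation M := (graph_Mm D l00 Lambda m).
Notation mm := (mg_measure M).
Notation len := (mg_len M).
Notation size := (mg_size M).
Notation io i := (interval_measure (len i)).
Notation H := (L2space mm).
Notation E := (mg_form M).
Notation edge i := (Em_nth D m i).
Notation resistance := (edge_resistance D).
Notation mass := (cell_mass D l00 Lambda m).
Notation scaling := (l00 * (Lambda / renorm D) ^+ m).

Let lenp : forall i, (i < size)%N -> 0 < len i := @len_gt0 _ _ _ _ _ m graphsD l00_gt0 Lambda_gt0.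

Definition edge_energy (F : H) i : R := fine (sqn (io i) (mg_derivative F i : T -> R[i])).

Lemma edge_energyE (F : H) i : qdom E F -> (i < size)%N ->
  sqn (io i) (mg_derivative F i : T -> R[i]) = (edge_energy F i)%:E.
Proof.
move=> /mg_repP [_ _ _ wd] lt; rewrite /edge_energy fineK //.
by have [a _ ->] := sqn_fin (wd i lt).1.
Qed.

Lemma edge_energy_ge0 (F : H) i : 0 <= edge_energy F i.
Proof. by rewrite fine_ge0 // sqn_ge0. Qed.

Lemma qval_edges (F : H) : qdom E F -> qval E F = \sum_(i < size) edge_energy F i.
Proof.
move=> DF; apply: EFin_inj; rewrite (qval_H1 lenp (mg_repP DF)) -sumEFin.
by apply: eq_bigr => i _; exact: edge_energyE.
Qed.

Lemma edge_osc (F : H) i x y : qdom E F -> (i < size)%N -> 0 <= x <= len i -> 0 <= y <= len i ->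
  cmod2 (mg_rep F i y - mg_rep F i x) <= len i * edge_energy F i.
Proof.
move=> DF lt hx hy; have [_ cv _ wd] := mg_repP DF.
exact: (weak_derivative_osc (lenp lt) (cv i lt) (wd i lt) (edge_energyE DF lt) hx hy).
Qed.

Lemma vval_osc (F : H) i : qdom E F -> (i < size)%N ->
  cmod2 (vval F (src (edge i)) - vval F (tgt (edge i))) <= len i * edge_energy F i.
Proof.
move=> DF lt; have [<- <-] := vvalP DF lt; have l0 := ltW (lenp lt).
by apply: edge_osc => //; rewrite lexx l0.
Qed.

Lemma graph_energy_le_mg (F : H) : qdom E F ->
  graph_energy D m (vval F) <= scaling * qval E F.
Proof.
move=> DF; rewrite /graph_energy -(@sum_edges _ _ D l00 Lambda m _
  (fun e => gamma D m e * cmod2 (vval F (src e) - vval F (tgt e)))).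
rewrite qval_edges // mulr_sumr; apply: ler_sum => i _; have lt := ltn_ord i.
have l0 := lenp lt; have s0 : 0 <= scaling.
  by rewrite mulr_ge0 ?exprn_ge0 ?divr_ge0 ?(ltW l00_gt0) ?(ltW Lambda_gt0) // ltW // renorm_gt0.
rewrite (gamma_len graphsD l00_gt0 Lambda_gt0 lt) -mulrA ler_wpM2l //.
by rewrite mulrC ler_pdivrMr // mulrC; exact: vval_osc.
Qed.

Definition cell_energy (F : H) (w : word) : R :=
  \sum_(e <- Em D 0) edge_energy F (index (Fword w @` e)%fset (Em D m)).

Lemma cell_energy_ge0 (F : H) w : 0 <= cell_energy F w.
Proof. by apply: sumr_ge0 => e _; exact: edge_energy_ge0. Qed.

Lemma sum_cell_energy (F : H) : qdom E F -> \sum_(w : word) cell_energy F w = qval E F.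
Proof.
move=> DF; rewrite qval_edges //.
transitivity (\sum_(e <- Em D m) edge_energy F (index e (Em D m))); first by rewrite (sum_Em graphsD).
rewrite -(@sum_edges _ _ D l00 Lambda m _ (fun e => edge_energy F (index e (Em D m)))).
by apply: eq_bigr => i _; rewrite (index_edge (ltn_ord i)).
Qed.

Lemma edge_le_cell (F : H) (w : word) e0 : e0 \in Em D 0 ->
  edge_energy F (index (Fword w @` e0)%fset (Em D m)) <= cell_energy F w.
Proof.
move=> he0; rewrite /cell_energy (big_rem e0) //= lerDl; apply: sumr_ge0 => e _.
exact: edge_energy_ge0.
Qed.

Lemma gamma0E e : e \in Em D 0 -> gamma D 0 e = gamma0 D e.
Proof.
move=> he; have := @gammaE _ _ _ graphsD 0 [tuple] e he.
by rewrite (_ : Fword _ = id) ?imfset_id // expr0 invr1 mul1r.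
Qed.

Let edge_cell (w : word) e0 : e0 \in Em D 0 ->
  exists i, [/\ (i < size)%N, edge i = (Fword w @` e0)%fset, i = index (Fword w @` e0)%fset (Em D m) &
    len i = l00 / gamma0 D e0 * Lambda ^+ m].
Proof.
move=> he0; have he : (Fword w @` e0)%fset \in Em D m by apply/EmP; exists w, e0.
have [lt eE] := edge_index l00 Lambda he.
exists (index (Fword w @` e0)%fset (Em D m)); split=> //.
by rewrite /= eE base_edgeE.
Qed.

Lemma graph_energy_cell (F : H) (w : word) : qdom E F ->
  graph_energy D 0 (vval F \o Fword w) <= l00 * Lambda ^+ m * cell_energy F w.
Proof.
move=> DF; rewrite /graph_energy /cell_energy mulr_sumr !big_seq; apply: ler_sum => e0 he0.
have [i [lt eE <- lE]] := edge_cell w he0; rewrite gamma0E //.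
have g0 : 0 < gamma0 D e0 := gamma0_gt0 graphsD he0.
have -> : cmod2 ((vval F \o Fword w) (src e0) - (vval F \o Fword w) (tgt e0)) =
    cmod2 (vval F (src (edge i)) - vval F (tgt (edge i))).
  rewrite eE (@src_tgt_sym _ _ D _ (fun x y => cmod2 (vval F x - vval F y)) _ _ (@Fword_inj _ _ _ pcfD w)) //.
  by move=> x y; rewrite cmod2B.
rewrite mulrC -ler_pdivlMr //; apply: le_trans (vval_osc DF lt) _.
by rewrite lE le_eqVlt; apply/orP; left; apply/eqP; field; rewrite lt0r_neq0.
Qed.

(** The step along an edge to its source and the step from there to F_w(v0) each have squared size
    at most the mass times the energy of the cell. The square of the sum gives the factor 4, and the
    measure of the cell the second power of the mass. *)
Lemma mg_approximation v0 (F : H) : v0 \in V0 D -> qdom E F ->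
  hnorm (F - \sum_(w : word) mg_coeff v0 F w *: mg_cell graphsD l00_gt0 Lambda_gt0 w) ^+ 2 <=
  4 * mass ^+ 2 * qval E F.
Proof.
move=> hv0 DF; have hF := mg_repP DF; have r0 := edge_resistance_gt0 pcfD C0_gt0 symC0.
have m0 := cell_mass_gt0 m pcfD C0_gt0 symC0 l00_gt0 Lambda_gt0.
have lL : 0 < l00 * Lambda ^+ m by rewrite mulr_gt0 ?exprn_gt0.
have mf : cmeasurable (edge_glue M (fun i => cutoff (len i) (mg_rep F i))).
  by apply: cmeasurable_glue => i lt; exact: (H1_sq_integrable lenp hF lt).1.
pose C w := 4 * mass * cell_energy F w.
have Cge0 w : 0 <= C w by rewrite /C mulr_ge0 ?cell_energy_ge0 // mulr_ge0 ?(ltW m0).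
apply: (@le_trans _ _ (\sum_(w : word) C w * mass)); last first.
  have -> : \sum_(w : word) C w * mass = 4 * mass ^+ 2 * qval E F.
    by rewrite -mulr_suml -mulr_sumr sum_cell_energy //; ring.
  exact: lexx.
have approx := cell_approximation (c := fun w : word => vval F (Fword w v0)) m0
  (@measurable_Acell _ _ D l00 Lambda m) (mu_Acell graphsD l00_gt0 Lambda_gt0)
  (Acell_partition l00 Lambda m graphsD) mf (H1_ae hF) Cge0.
apply: approx.
apply: mg_ae => i lt; apply: ae_imply (interval_ae (len i)) _ => t ht w.
rewrite /Acell /= => /andP[_ /hasP[e0 he0 /eqP eE]].
have [i' [lt' eE' iE lE]] := edge_cell w he0.
have ii' : i = i' by rewrite iE -eE (index_edge lt).
rewrite -{}ii' {lt' i'} in eE' iE lE; rewrite /edge_glue lt /= cutoffE //.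
have [hs ht' _ _] := src_tgt_V0 he0.
have cell x : x \in V0 D -> cmod2 (vval F (Fword w x) - vval F (Fword w v0)) <= mass * cell_energy F w.
  move=> hx; apply: le_trans (osc_V0 graphsD (vval F \o Fword w) hx hv0) _.
  apply: (@le_trans _ _ (resistance * (l00 * Lambda ^+ m * cell_energy F w))).
    by apply: ler_wpM2l; [exact: ltW|exact: graph_energy_cell].
  by rewrite mulrA [resistance * _]mulrC.
have srcE : cmod2 (vval F (src (edge i)) - vval F (Fword w v0)) <= mass * cell_energy F w.
  (* The source may be the image of either end of e0, so the bound is proved for both ends at
     once. *)
  pose S x y := (cmod2 (vval F x - vval F (Fword w v0)) <= mass * cell_energy F w) &&
    (cmod2 (vval F y - vval F (Fword w v0)) <= mass * cell_energy F w).
  have : S (src (edge i)) (tgt (edge i)).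
    rewrite eE (@src_tgt_sym _ _ D _ S _ _ (@Fword_inj _ _ _ pcfD w)) //; last by move=> x y; rewrite /S andbC.
    by rewrite /S !cell.
  by case/andP.
have [v0E _] := vvalP DF lt; rewrite -v0E in srcE.
have l0 := ltW (lenp lt).
have zero : 0 <= (0 : R) <= len i by rewrite lexx l0.
have tE : cmod2 (mg_rep F i t - mg_rep F i 0) <= mass * cell_energy F w.
  apply: le_trans (edge_osc DF lt zero ht) _.
  apply: (@le_trans _ _ (len i * cell_energy F w)).
    by apply: ler_wpM2l => //; rewrite iE; exact: edge_le_cell.
  apply: ler_wpM2r; first exact: cell_energy_ge0.
  rewrite lE /cell_mass mulrAC; apply: ler_wpM2l; first exact: ltW.
  exact: le_edge_resistance.
have -> : mg_rep F i t - vval F (Fword w v0) =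
    (mg_rep F i t - mg_rep F i 0) + (mg_rep F i 0 - vval F (Fword w v0)) by rewrite addrA subrK.
apply: le_trans (cmod2D_le _ _) _; rewrite /C; lra.
Qed.

Definition affine_values phi i (t : R) : R[i] :=
  phi (src (edge i)) + ((len i)^-1 * t)%:C * (phi (tgt (edge i)) - phi (src (edge i))).
Definition affine_slope phi i (t : R) : R[i] :=
  (len i)^-1%:C * (phi (tgt (edge i)) - phi (src (edge i))).

Lemma interp_exists phi : exists F : H, mg_H1 F (affine_values phi) (affine_slope phi).
Proof.
have E_ i : affine_values phi i = fun t =>
    (Re (phi (src (edge i))) + (len i)^-1 * Re (phi (tgt (edge i)) - phi (src (edge i))) * t) +i*
    (Im (phi (src (edge i))) + (len i)^-1 * Im (phi (tgt (edge i)) - phi (src (edge i))) * t).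
  apply/funext => t; rewrite /affine_values; set z := _ - _; case: (phi (src (edge i))) z => a b [a' b'].
  by apply/eqP; rewrite eq_complex /=; apply/andP; split; apply/eqP; ring.
apply: (H1_class (phi := phi) lenp).
- move=> i lt; rewrite E_ (_ : (fun t => _) = fun t => 'i%C *
     (Im (phi (src (edge i))) + (len i)^-1 * Im (phi (tgt (edge i)) - phi (src (edge i))) * t)%:C +
     (Re (phi (src (edge i))) + (len i)^-1 * Re (phi (tgt (edge i)) - phi (src (edge i))) * t)%:C).
    by apply: within_continuousDZ; apply: continuous_realC; exact: C1_continuous (C1_affine _ _).
  by apply/funext => t; simpc.
- move=> i lt; rewrite /affine_values mulr0 mul0r addr0 mulVf ?lt0r_neq0 ?lenp // mul1r.
  by rewrite addrC subrK.
- move=> i lt; rewrite E_.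
  have := weak_derivative_C1 (lenp lt)
    (C1_affine ((len i)^-1 * Re (phi (tgt (edge i)) - phi (src (edge i)))) (Re (phi (src (edge i)))))
    (C1_affine ((len i)^-1 * Im (phi (tgt (edge i)) - phi (src (edge i)))) (Im (phi (src (edge i))))).
  congr weak_derivative; apply/funext => t; rewrite /affine_slope; set z := _ - _; case: z => a b.
  by simpc.
Qed.

Definition interp phi : H := xget 0 [set F | mg_H1 F (affine_values phi) (affine_slope phi)].

Lemma interpP phi : mg_H1 (interp phi) (affine_values phi) (affine_slope phi).
Proof.
by have [F hF] := interp_exists phi; rewrite /interp; case: xgetP => [? _ //|/(_ F)].
Qed.

Lemma dom_interp phi : qdom E (interp phi).
Proof. exact: H1_dom (interpP phi). Qed.

Lemma vval_interp phi : {in Vm D m, vval (interp phi) =1 phi}.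
Proof.
apply: (vval_unique pcfD graphsD C0_gt0 symC0 l00_gt0 Lambda_gt0 (interpP phi)) => i lt.
rewrite /affine_values mulr0 mul0r addr0 mulVf ?lt0r_neq0 ?lenp // mul1r.
by rewrite addrC subrK.
Qed.

Lemma interp_linear c phi (phi' v : 'rV[R]_d -> R[i]) :
  {in Vm D m, forall x, v x = c * phi x + phi' x} ->
  interp v = c *: interp phi + interp phi'.
Proof.
move=> h; have [e1 _ _ _] := interpP v.
have [e2 _ _ _] := H1_lincomb lenp c (interpP phi) (interpP phi').
apply/L2P; have e3 : {ae mm, forall p, affine_values v p.1 p.2 =
    c * affine_values phi p.1 p.2 + affine_values phi' p.1 p.2}.
  apply: mg_ae => i lt; apply: ae_imply (interval_ae (len i)) _ => t _.
  have [hs ht] := edge_Vm pcfD (edge_mem lt).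
  by rewrite /affine_values /= !h //; ring.
by apply: ae_imply2 (ae_imply2 e1 e2 (fun x => @conj _ _)) e3 _ => p [-> ->].
Qed.

(** The interpolation has constant derivative on each edge, so the edge integral involves F only
    through its increment. *)
Lemma gform_interp (F : H) phi : qdom E F ->
  gform D m (vval F) phi = scaling%:C * polar E F (interp phi).
Proof.
move=> DF; have hF := mg_repP DF; have hI := interpP phi.
rewrite (polar_mg lenp DF (dom_interp phi)) /mg_sesq.
have s1 := H1_derivative_sq_integrable hF; have s2 := H1_derivative_sq_integrable hI.
rewrite (ip_cintegral s1.1 s2.1 (dclassE lenp hF) (dclassE lenp hI)).
rewrite cintegral_mg; last exact: cintegrableM.
rewrite /gform -(@sum_edges _ _ D l00 Lambda m _ (fun e => (gamma D m e)%:C *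
  ((vval F (src e) - vval F (tgt e)) * Num.conj (phi (src e) - phi (tgt e))))).
rewrite mulr_sumr; apply: eq_bigr => i _; have lt := ltn_ord i; have l0 := lenp lt.
have [_ cv _ wd] := hF.
rewrite (_ : (fun t => _) = fun t : T => mg_derivative F i t *
    Num.conj ((len i)^-1%:C * (phi (tgt (edge i)) - phi (src (edge i))))); last first.
  by apply/funext => t; rewrite /edge_glue /= lt.
have h1 := cintegrableM (wd i lt).1 (sq_integrable_realC l0 (@cst_continuous _ _ (1 : R))).
rewrite cintegralZr; last first.
  move: h1; congr cintegrable; apply/funext => t; by rewrite conj_realC mulr1.
rewrite (weak_derivative_integral l0 (cv i lt) (wd i lt)).
have [-> ->] := vvalP DF lt.
rewrite (gamma_len graphsD l00_gt0 Lambda_gt0 lt); set L := len i; set c := scaling.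
set A := vval F _; set B := vval F _; set A' := phi _; set B' := phi _.
have -> : (c / L)%:C = c%:C * L^-1%:C by rewrite rmorphM.
have -> : Num.conj (L^-1%:C * (B' - A')) = L^-1%:C * Num.conj (B' - A').
  by case: (B' - A') => a b; apply/eqP; rewrite eq_complex /=; apply/andP; split; apply/eqP; ring.
have -> : Num.conj (A' - B') = - Num.conj (B' - A') by rewrite -rmorphN opprB.
ring.
Qed.

Lemma qval_interp phi : graph_energy D m phi = scaling * qval E (interp phi).
Proof.
apply: (@complexI R); rewrite rmorphM /= -(mg_sesq_qval lenp (dom_interp phi)).
rewrite -(polar_mg lenp (dom_interp phi) (dom_interp phi)) -gform_interp; last exact: dom_interp.
rewrite -gform_energy; apply: (eq_gform pcfD) => // x hx.
by rewrite vval_interp.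
Qed.

End Interpolation.

Lemma qval_scale (R : realType) (H : ipSpace R) (t : R) (a : qform H) f :
  qval (scale_form t a) f = t * qval a f.
Proof. by []. Qed.

Section GraphForms.
Variables (R : realType) (d : nat) (D : fractal R d).
Implicit Types u v : 'rV[R]_d -> R[i].

Lemma graph_energyZ m (c : R) u :
  graph_energy D m (fun x => c%:C * u x) = c ^+ 2 * graph_energy D m u.
Proof.
rewrite /graph_energy mulr_sumr; apply: eq_bigr => e _.
by rewrite -mulrBr cmod2Z mulrCA.
Qed.

Lemma gformZl m (c : R) u v : gform D m (fun x => c%:C * u x) v = c%:C * gform D m u v.
Proof. rewrite /gform mulr_sumr; apply: eq_bigr => e _; ring. Qed.

Lemma gformZr m (c : R) u v : gform D m u (fun x => c%:C * v x) = c%:C * gform D m u v.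
Proof.
rewrite /gform mulr_sumr; apply: eq_bigr => e _.
have -> : Num.conj (c%:C * v (src e) - c%:C * v (tgt e)) = c%:C * Num.conj (v (src e) - v (tgt e)).
  rewrite -mulrBr; case: (v (src e) - v (tgt e)) => a b.
  by apply/eqP; rewrite eq_complex /=; apply/andP; split; apply/eqP; ring.
ring.
Qed.

End GraphForms.

(** * Rate of the quasi-unitary equivalence *)

Section QuasiUnitaryEquivalence.
Variables (R : realType) (d : nat) (D : fractal R d) (C0 Lambda l00 : R).
Hypothesis pcfD : pcf_fractal D.
Hypothesis graphsD : weighted_graphs D.
Hypothesis muD : borel_measure_on_K D.
Hypothesis harmD : harmonic_functions D.
Hypothesis symD : symmetric_fractal D C0.
Hypothesis Lambda01 : 0 < Lambda < 1.
Hypothesis l00_gt0 : 0 < l00.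
Notation N := (nmaps D).
Notation resistance := (edge_resistance D).
Notation mass m := (cell_mass D l00 Lambda m).
Notation scaling m := (l00 * (Lambda / renorm D) ^+ m).

Let selfsim : forall u, dom_energy D u ->
  (forall j, dom_energy D (u \o F (f := D) j)) /\
  energy D u = \sum_(j < N) (renorm D)^-1 * energy D (u \o F j).
Proof. by case: symD. Qed.

Let mu_cell : forall m (w : m.-tuple 'I_N), mu D (Fword w @` K D) = ((N%:R ^+ m)^-1)%:E.
Proof. by case: symD. Qed.

Let C0_gt0 : 0 < C0.
Proof. by case: symD => _ _ _ []. Qed.

Let symC0 : forall v, v \in V0 D -> \sum_(e <- Em D 0 | v \in e) (gamma0 D e)^-1 = C0.
Proof. by case: symD => _ _ _ []. Qed.

Let Lambda_gt0 : 0 < Lambda.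
Proof. by case/andP: Lambda01. Qed.

Let N0 : 0 < N%:R :> R.
Proof. by rewrite ltr0n N_gt0. Qed.

Let r0 := renorm_gt0 graphsD.
Let mass0 m := cell_mass_gt0 m pcfD C0_gt0 symC0 l00_gt0 Lambda_gt0.

(** The first two factors form the ratio of the cell measures on the graph and on the fractal, the
    third converts the metric energy into E_m. *)
Lemma tauE m : tau D C0 l00 Lambda m = N%:R ^+ m * mass m * scaling m.
Proof.
rewrite /tau /cell_mass (edge_resistanceE symC0) !expr_div_n !exprMn.
by field; rewrite expf_neq0 ?lt0r_neq0.
Qed.

Lemma tau_gt0 m : 0 < tau D C0 l00 Lambda m.
Proof. have h := mass0 m; rewrite tauE; apply: mulr_gt0; first by rewrite mulr_gt0 ?exprn_gt0.
by rewrite mulr_gt0 ?exprn_gt0 ?divr_gt0. Qed.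

Lemma quasi_unitary_equivalence_rate : exists2 c : R, 0 <= c & forall m,
  quasi_unitarily_equivalent (2 * Num.sqrt (c * (renorm D / N%:R) ^+ m))
    (scale_form (tau D C0 l00 Lambda m) (mg_form (graph_Mm D l00 Lambda m)))
    (fractal_form D).
Proof.
have [v0 hv0] := V0_neq0 pcfD.
have [B B0 hB] := fractal_approximation pcfD graphsD muD harmD selfsim mu_cell hv0.
have res0 := edge_resistance_gt0 pcfD C0_gt0 symC0.
(* The first summand serves the approximation on the graph, the second the one on the fractal. *)
have c0 : 0 <= 4 * resistance + B ^+ 2 by rewrite addr_ge0 ?sqr_ge0 // mulr_ge0 // ltW.
exists (4 * resistance + B ^+ 2) => // m.
have lenp : forall i, (i < mg_size (graph_Mm D l00 Lambda m))%N -> 0 < mg_len (graph_Mm D l00 Lambda m) i.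
  exact: len_gt0 graphsD l00_gt0 Lambda_gt0.
have t0 := tau_gt0 m; have m0 := mass0 m; have s0 : 0 < scaling m.
  by rewrite mulr_gt0 ?exprn_gt0 ?divr_gt0.
have Nm0 : 0 < N%:R ^+ m :> R by rewrite exprn_gt0.
(* The coefficients carry the roots of different cell measures; lam is their quotient, so harmonic
   extension of lam times the vertex values preserves the coefficients. *)
pose lam : R := Num.sqrt (N%:R ^+ m * mass m).
have lam2 : lam ^+ 2 = N%:R ^+ m * mass m by rewrite sqr_sqrtr // ltW // mulr_gt0.
have lam0 : 0 < lam by rewrite sqrtr_gt0 mulr_gt0.
have lamC : lam%:C != 0 :> R[i] by rewrite eq_complex /= negb_and lt0r_neq0.
have Vv (w : m.-tuple 'I_N) : Fword w v0 \in Vm D m by apply/VmP; exists w, v0.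
have VvK (w : m.-tuple 'I_N) : K D (Fword w v0) := Vm_K pcfD (Vv w).
have rate0 : 0 <= (renorm D / N%:R) ^+ m by rewrite exprn_ge0 // divr_ge0 // ltW.
have eta0 := sqrtr_ge0 ((4 * resistance + B ^+ 2) * (renorm D / N%:R) ^+ m).
have etaE : Num.sqrt ((4 * resistance + B ^+ 2) * (renorm D / N%:R) ^+ m) ^+ 2 =
    (4 * resistance + B ^+ 2) * (renorm D / N%:R) ^+ m by rewrite sqr_sqrtr // mulr_ge0.
have sqrt_bound (H : ipSpace R) (x : H) (q : R) : 0 <= q ->
    hnorm x ^+ 2 <= (4 * resistance + B ^+ 2) * (renorm D / N%:R) ^+ m * q ->
    hnorm x <= Num.sqrt ((4 * resistance + B ^+ 2) * (renorm D / N%:R) ^+ m) * Num.sqrt q.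
  move=> q0 h; rewrite -ler_sqr ?nnegrE ?hnorm_ge0 ?mulr_ge0 ?sqrtr_ge0 // exprMn etaE.
  by rewrite (sqr_sqrtr q0).
have sqrtM : Num.sqrt (N%:R ^+ m)^-1 * lam = Num.sqrt (mass m).
  by rewrite /lam -sqrtrM ?invr_ge0 ?(ltW Nm0) // mulKf // lt0r_neq0.
refine (@quasi_unitary_of_cells R (L2space (mg_measure (graph_Mm D l00 Lambda m))) (L2space (mu D))
  (m.-tuple 'I_N) (mg_cell graphsD l00_gt0 Lambda_gt0) (@fractal_cell _ _ _ pcfD mu_cell m)
  (scale_form (tau D C0 l00 Lambda m) (mg_form (graph_Mm D l00 Lambda m))) (fractal_form D)
  (Num.sqrt ((4 * resistance + B ^+ 2) * (renorm D / N%:R) ^+ m))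
  (mg_coeff v0) (@fractal_coeff _ _ _ v0 m)
  (fun F => harmonic_class pcfD graphsD muD harmD m (fun x => lam%:C * vval F x))
  (fun u => interp D l00 Lambda m (fun x => lam^-1%:C * frep u x)) _ _ _ _ _ _ _ _ _ _ _ _).
- exact: mg_cell_orthonormal pcfD graphsD C0_gt0 symC0 l00_gt0 Lambda_gt0.
- exact: fractal_cell_orthonormal.
- exact: mg_energy_form.
- exact: fractal_energy_form.
- exact: eta0.
- move=> F DF; have q0 := mg_qval_ge0 lenp DF.
  have q1 : 0 <= qval (scale_form (tau D C0 l00 Lambda m) (mg_form (graph_Mm D l00 Lambda m))) F.
    by rewrite mulr_ge0 ?(ltW t0).
  apply: sqrt_bound => //.
  (* Here 4 mass^2 = 4 resistance (r / N)^m tau_m, so Lambda and l_{0,0} enter only through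
     tau_m. *)
  apply: le_trans (mg_approximation pcfD graphsD C0_gt0 symC0 l00_gt0 Lambda_gt0 hv0 DF) _.
  rewrite [in leRHS]mulrDl [in leRHS]mulrDl; apply: ler_wpDr; first by rewrite mulr_ge0 // mulr_ge0 ?sqr_ge0.
  rewrite [in leRHS]/scale_form /= tauE le_eqVlt; apply/orP; left; apply/eqP.
  rewrite /cell_mass !expr_div_n; field.
  by rewrite !expf_neq0 ?lt0r_neq0.
- move=> u Du; have q0 := fractal_qval_ge0 graphsD Du; apply: sqrt_bound => //.
  apply: le_trans (hB m u Du) _; rewrite [in leRHS]mulrDl [in leRHS]mulrDl.
  by apply: ler_wpDl => //; rewrite !mulr_ge0 // ltW.
- move=> F DF; split; first exact: dom_harmonic_class.
    rewrite qval_harmonic_class // graph_energyZ lam2 /= tauE -[leRHS]mulrA.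
    apply: ler_wpM2l; first by rewrite ltW // mulr_gt0.
    exact: graph_energy_le_mg.
  move=> w; rewrite /fractal_coeff /mg_coeff frep_harmonic_class // (harmonic_val harmD) //.
  by rewrite mulrA -rmorphM sqrtM.
- move=> c F G DF DG; apply: harmonic_class_linear => x hx.
  rewrite (vval_linear pcfD graphsD C0_gt0 symC0 l00_gt0 Lambda_gt0 c DF DG hx).
  by rewrite mulrDr mulrCA.
- move=> u Du; split; first exact: dom_interp.
    rewrite qval_scale tauE -mulrA.
    rewrite -(qval_interp m pcfD graphsD C0_gt0 symC0 l00_gt0 Lambda_gt0) -lam2.
    rewrite graph_energyZ mulrA -exprMn mulfV ?lt0r_neq0 // expr1n mul1r.
    rewrite (qval_repr pcfD mu_cell (frepP Du)).
    exact: (graph_energy_le_energy graphsD m (dom_frep Du)).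
  move=> w; rewrite /fractal_coeff /mg_coeff.
  rewrite (vval_interp pcfD graphsD C0_gt0 symC0 l00_gt0 Lambda_gt0) // mulrA -rmorphM.
  by rewrite -sqrtM mulfK // lt0r_neq0.
- move=> c u v Du Dv; apply: (interp_linear pcfD graphsD l00_gt0 Lambda_gt0) => x hx.
  have Duv := (fractal_dom_subspace graphsD).2 c u v Du Dv.
  rewrite (fractal_repr_unique pcfD mu_cell (frepP Duv)
    (fractal_reprDZ graphsD c (frepP Du) (frepP Dv)) (Vm_K pcfD hx)); ring.
(* Both sides equal lam times the discrete form of the vertex values: on the right lam^2, contained
   in tau_m, meets the factor 1 / lam of the interpolation. *)
- move=> F u DF Du; rewrite polar_harmonic_class // polar_scale tauE -lam2.
  rewrite rmorphM /= -mulrA -(gform_interp graphsD l00_gt0 Lambda_gt0) // gformZl gformZr.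
  rewrite rmorphXn /= mulrA; congr (_ * _).
  by rewrite expr2 -mulrA -rmorphM mulfV ?lt0r_neq0 // mulr1.
Qed.

End QuasiUnitaryEquivalence.

Theorem theorem1p3 (R : realType) (d : nat) (D : fractal R d)
    (C0 Lambda l00 : R)
    (pcfD : pcf_fractal D) (graphsD : weighted_graphs D)
    (muD : borel_measure_on_K D) (harmD : harmonic_functions D)
    (symD : symmetric_fractal D C0)
    (Lambda01 : 0 < Lambda < 1) (l00_gt0 : 0 < l00) :
  exists delta : nat -> R,
    [/\ forall m, 0 <= delta m,
        delta @ \oo --> (0 : R) &
        forall m, quasi_unitarily_equivalent (delta m)
          (scale_form (tau D C0 l00 Lambda m)
             (mg_form (graph_Mm D l00 Lambda m)))
          (fractal_form D)].
Proof.
have [c c0 h] := quasi_unitary_equivalence_rate pcfD graphsD muD harmD symD Lambda01 l00_gt0.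
exists (fun m => 2 * Num.sqrt (c * (renorm D / (nmaps D)%:R) ^+ m)); split=> //.
have N1 : 1 < (nmaps D)%:R :> R by rewrite ltr1n; case: pcfD.
have /andP[r0 r1] := renorm01 graphsD.
have q01 : 0 <= renorm D / (nmaps D)%:R < 1.
  rewrite divr_ge0 ?(ltW r0) //= ltr_pdivrMr ?ltr0n ?(N_gt0 pcfD) // mul1r.
  exact: lt_trans r1 N1.
apply/cvgrPdist_lt => e e0; have e2 : 0 < e / 2 by rewrite divr_gt0.
have [n0 hn] := geometric_small c q01 (exprn_gt0 2 e2).
exists n0 => // n /= hn0; rewrite sub0r normrN ger0_norm ?mulr_ge0 ?sqrtr_ge0 //.
rewrite mulrC -ltr_pdivlMr // -[ltRHS](ger0_norm (ltW e2)) -sqrtr_sqr ltr_sqrt ?exprn_gt0 //.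
exact: hn.
Qed.
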